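(* Let $T$ be a finite-dimensional $\mathbb F_p$-vector space with a continuous action of $G_K$ which is tamely ramified (the wild inertia subgroup acts trivially). Then there exist a crystalline $p$-adic representation $V$ of $G_K$ with Hodge–Tate weights in $\{0,\dots,p-1\}$ and $G_K$-stable $\mathbb Z_p$-lattices $L'\subset L$ in $V$ such that $T\simeq L/L'$ as $G_K$-representations.
   Context: $p$ is an odd prime, $k$ a perfect field of characteristic $p$, $K$ a finite totally ramified extension of $W(k)[1/p]$, and $G_K$ the absolute Galois group of $K$. *)

(* Defs.v *)
From HB Require Import structures.
From mathcomp Require Import all_boot all_order all_algebra fieldext.

Set Implicit Arguments.
Unset Strict Implicit.
Unset Printing Implicit Defensive.

Import GRing.Theory.
Local Open Scope ring_scope.

Section PadicRings.

Variable p : nat.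

Definition in_pX (A : comNzRingType) (n : nat) (x : A) : Prop :=
  exists y : A, x = p%:R ^+ n * y.

(* The canonical map from A to the inverse limit of the A / p^n A is
   bijective. *)
Definition padically_complete (A : comNzRingType) : Prop :=
  (forall x : A, (forall n, in_pX n x) -> x = 0) /\
  (forall u : nat -> A, (forall n, in_pX n (u n.+1 - u n)) ->
     exists l : A, forall n, in_pX n (l - u n)).

(* For R perfect of characteristic p, the ring W(R) is characterised, up to a
   unique isomorphism over R, as the strict p-ring with residue ring R (Serre,
   Local Fields, II.5-6).  In particular W('F_p) is the ring of p-adic
   integers. *)
Record witt_vectors (R : comNzRingType) := WittVectors {
  witt_ring :> idomainType;
  witt_residue : {rmorphism witt_ring -> R};
  witt_p_neq0 : p%:R != 0 :> witt_ring;
  witt_complete : padically_complete witt_ring;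
  witt_residue_surj : forall y : R, exists x, witt_residue x = y;
  witt_residue_ker : forall x, witt_residue x = 0 <-> in_pX 1 x
}.

End PadicRings.

(* A divided power structure on the ideal J of A; the values of gam n outside
   J are irrelevant. *)
Definition pd_structure (A : comNzRingType) (J : A -> Prop)
    (gam : nat -> A -> A) : Prop :=
  [/\ forall x, J x -> gam 0%N x = 1 /\ gam 1%N x = x,
      forall n x, J x -> (0 < n)%N -> J (gam n x),
      forall n x y, J x -> J y ->
        gam n (x + y) = \sum_(i < n.+1) gam i x * gam (n - i)%N y,
      forall n a x, J x -> gam n (a * x) = a ^+ n * gam n x
    & (forall m n x, J x ->
        gam m x * gam n x = 'C(m + n, m)%:R * gam (m + n)%N x) /\
      (forall m n x, J x -> (0 < n)%N ->
        gam m (gam n x) =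
        ((m * n)`! %/ (m`! * n`! ^ m))%N%:R * gam (m * n)%N x)].

Record alg_closure (K : fieldType) := AlgClosure {
  closure_field :> closedFieldType;
  closure_emb : {rmorphism K -> closure_field};
  closure_alg : forall x, algebraicOver closure_emb x
}.

Section AbsoluteGalois.

Variables (K : fieldType) (Kb : alg_closure K).

Record abs_galois := AbsGalois {
  gal_mor :> {rmorphism Kb -> Kb};
  gal_bij : bijective gal_mor;
  gal_fix : forall x : K, gal_mor (closure_emb Kb x) = closure_emb Kb x
}.

Fact gal_id_bij : bijective (idfun : {rmorphism Kb -> Kb}).
Proof. by exists id. Qed.

Definition gal_id : abs_galois :=
  @AbsGalois (idfun : {rmorphism Kb -> Kb}) gal_id_bij (fun=> erefl).

Fact gal_comp_bij (g h : abs_galois) :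
  bijective ((gal_mor g \o gal_mor h) : {rmorphism Kb -> Kb}).
Proof. exact: bij_comp (gal_bij g) (gal_bij h). Qed.

Fact gal_comp_fix (g h : abs_galois) (x : K) :
  ((gal_mor g \o gal_mor h) : {rmorphism Kb -> Kb}) (closure_emb Kb x)
  = closure_emb Kb x.
Proof. by rewrite /= !gal_fix. Qed.

Definition gal_comp (g h : abs_galois) : abs_galois :=
  @AbsGalois ((gal_mor g \o gal_mor h) : {rmorphism Kb -> Kb})
    (@gal_comp_bij g h) (@gal_comp_fix g h).

(* The automorphisms that agree with g0 on a finite list form a basis of
   neighbourhoods of g0 for the Krull topology. *)
Definition gal_agree (s : seq Kb) (g0 g : abs_galois) : Prop :=
  forall x, x \in s -> g x = g0 x.

Definition linear_rep (F : fieldType) (T : vectType F)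
    (tau : abs_galois -> 'End(T)) : Prop :=
  tau gal_id = \1%VF /\
  (forall g h, tau (gal_comp g h) = (tau g \o tau h)%VF).

(* Continuity of abs_galois * T -> T for the discrete topology on T. *)
Definition discrete_continuous (F : fieldType) (T : vectType F)
    (tau : abs_galois -> 'End(T)) : Prop :=
  forall (g0 : abs_galois) (t : T),
    exists s, forall g, gal_agree s g0 g -> tau g t = tau g0 t.

Definition matrix_rep (F : fieldType) (d : nat) (rho : abs_galois -> 'M[F]_d)
    : Prop :=
  rho gal_id = 1%:M /\ (forall g h, rho (gal_comp g h) = rho g *m rho h).

End AbsoluteGalois.

Section LocalField.

Variables (p : nat) (k : fieldType) (W : witt_vectors p k).
Variable K : fieldExtType {fraction W}.

Definition witt_to_K (w : W) : K := (tofrac w)%:A.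

(* As W(k) is a complete discrete valuation ring, its integral closure in an
   algebraic extension L of its fraction field is the valuation ring of L, and
   the maximal ideal of this ring consists of its non-invertible elements. *)
Definition val_ring (L : fieldType) (f : W -> L) (x : L) : Prop :=
  integralOver f x.

Definition max_ideal (L : fieldType) (f : W -> L) (x : L) : Prop :=
  val_ring f x /\ (x = 0 \/ ~ val_ring f x^-1).

(* The residue field extension of K over the fraction field of W is trivial. *)
Definition totally_ramified : Prop :=
  forall x : K, val_ring witt_to_K x ->
    exists w : W, max_ideal witt_to_K (x - witt_to_K w).

Variable Kb : alg_closure K.

Definition witt_to_Kb (w : W) : Kb := closure_emb Kb (witt_to_K w).

Definition inertia (g : abs_galois Kb) : Prop :=
  forall x : Kb, val_ring witt_to_Kb x -> max_ideal witt_to_Kb (g x - x).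

(* The kernel of the map sending g in the inertia group to the homomorphism
   x |-> (g x / x modulo the maximal ideal); its fixed field is the maximal
   tamely ramified extension of K. *)
Definition wild_inertia (g : abs_galois Kb) : Prop :=
  inertia g /\
  (forall x : Kb, x != 0 -> max_ideal witt_to_Kb (g x / x - 1)).

Definition tamely_ramified (F : fieldType) (T : vectType F)
    (tau : abs_galois Kb -> 'End(T)) : Prop :=
  forall g, wild_inertia g -> tau g = \1%VF.

Definition in_pXOC (C : fieldType) (OC : C -> Prop) (n : nat) (x : C) : Prop :=
  exists2 y : C, OC y & x = p%:R ^+ n * y.

(* The completion C of Kb, where the OC-submodules p^n OC form a basis of
   neighbourhoods of 0, with valuation ring OC = comp_int and the extension by
   continuity of the action of the Galois group; this is unique up to a unique
   isomorphism. *)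
Record completion := Completion {
  comp_field :> fieldType;
  comp_emb : {rmorphism Kb -> comp_field};
  comp_int : comp_field -> Prop;
  comp_int1 : comp_int 1;
  comp_intB : forall x y, comp_int x -> comp_int y -> comp_int (x - y);
  comp_intM : forall x y, comp_int x -> comp_int y -> comp_int (x * y);
  comp_int_frac : forall x, exists n, comp_int (p%:R ^+ n * x);
  comp_int_emb : forall x, comp_int (comp_emb x) <-> val_ring witt_to_Kb x;
  comp_dense : forall x n, exists y, in_pXOC comp_int n (x - comp_emb y);
  comp_separated : forall x, (forall n, in_pXOC comp_int n x) -> x = 0;
  comp_complete : forall u : nat -> comp_field,
    (forall n, in_pXOC comp_int n (u n.+1 - u n)) ->
    exists l, forall n, in_pXOC comp_int n (l - u n);
  comp_act : abs_galois Kb -> {rmorphism comp_field -> comp_field};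
  comp_act_emb : forall g x, comp_act g (comp_emb x) = comp_emb (g x);
  comp_act_int : forall g x, comp_int x -> comp_int (comp_act g x)
}.

Variable C : completion.

(* p-adically complete divided power thickenings of OC; the map to OC is
   written as a map to C with image OC.  Compatibility with the canonical
   divided powers on pD is automatic because OC has no p-torsion. *)
Definition pd_thickening (D : comNzRingType) (th : {rmorphism D -> C})
    (gam : nat -> D -> D) : Prop :=
  [/\ padically_complete p D,
      forall c : C, comp_int c <-> exists x, th x = c
    & pd_structure (fun x => th x = 0) gam].

Definition pd_morphism (A D : comNzRingType)
    (thA : {rmorphism A -> C}) (gamA : nat -> A -> A)
    (thD : {rmorphism D -> C}) (gamD : nat -> D -> D)
    (f : {rmorphism A -> D}) : Prop :=
  (forall x, thD (f x) = thA x) /\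
  (forall n x, thA x = 0 -> f (gamA n x) = gamD n (f x)).

(* A_cris is the universal p-adically complete divided power thickening of OC
   (Fontaine); the Galois group acts on it by transport of structure. *)
Record Acris := MkAcris {
  acris :> comNzRingType;
  acris_theta : {rmorphism acris -> C};
  acris_gam : nat -> acris -> acris;
  acris_thickening : pd_thickening acris_theta acris_gam;
  acris_universal : forall (D : comNzRingType) (th : {rmorphism D -> C})
      (gam : nat -> D -> D),
    pd_thickening th gam ->
    (exists f : {rmorphism acris -> D},
       pd_morphism acris_theta acris_gam th gam f) /\
    (forall f1 f2 : {rmorphism acris -> D},
       pd_morphism acris_theta acris_gam th gam f1 ->
       pd_morphism acris_theta acris_gam th gam f2 -> f1 =1 f2);
  acris_act : abs_galois Kb -> {rmorphism acris -> acris};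
  acris_act_theta : forall g x,
    acris_theta (acris_act g x) = comp_act C g (acris_theta x);
  acris_act_gam : forall g n x, acris_theta x = 0 ->
    acris_act g (acris_gam n x) = acris_gam n (acris_act g x)
}.

Variable A : Acris.

Definition compatible_roots (zeta : nat -> Kb) : Prop :=
  [/\ zeta 0%N = 1, zeta 1%N != 1 & forall n, zeta n.+1 ^+ p = zeta n].

(* e is the element [eps] of A_cris for eps = (1, zeta_1, zeta_2, ...).  If a
   lifts zeta_n, then a = [eps^(1/p^n)] + y with theta(y) = 0, and since
   y^i = i! gam_i(y), the power a^(p^n) is congruent to [eps] modulo p^n. *)
Definition teichmuller_eps (zeta : nat -> Kb) (e : A) : Prop :=
  forall n (a : A), acris_theta A a = comp_emb C (zeta n) ->
    in_pX p n (e - a ^+ (p ^ n)).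

(* t = log [eps], the sum over n >= 1 of (-1)^(n-1) (n-1)! gam_n([eps] - 1),
   for some choice of eps; another choice multiplies t by a p-adic unit. *)
Definition is_period_t (t : A) : Prop :=
  exists zeta e, [/\ compatible_roots zeta, teichmuller_eps zeta e &
    forall N, exists M0, forall M, (M0 <= M)%N ->
      in_pX p N (t - \sum_(1 <= n < M.+1)
        (-1) ^+ n.-1 * n.-1`!%:R * acris_gam n (e - 1))].

Variable Zp : witt_vectors p 'F_p.

(* B_cris = A_cris[1/p, 1/t], with its Galois action and its Q_p-algebra
   structure, where Q_p is the fraction field of Zp. *)
Record Bcris := MkBcris {
  bcris :> comUnitRingType;
  bcris_t : A;
  bcris_tP : is_period_t bcris_t;
  bcris_loc : {rmorphism A -> bcris};
  bcris_unit : bcris_loc (p%:R * bcris_t) \is a GRing.unit;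
  bcris_frac : forall b, exists (a : A) (n : nat),
    b * bcris_loc (p%:R * bcris_t) ^+ n = bcris_loc a;
  bcris_ker : forall a, bcris_loc a = 0 ->
    exists n : nat, (p%:R * bcris_t) ^+ n * a = 0;
  bcris_act : abs_galois Kb -> {rmorphism bcris -> bcris};
  bcris_act_loc : forall g a,
    bcris_act g (bcris_loc a) = bcris_loc (acris_act A g a);
  bcris_Zp : {rmorphism Zp -> A};
  bcris_Qp : {rmorphism {fraction Zp} -> bcris};
  bcris_QpP : forall z : Zp, bcris_Qp (tofrac z) = bcris_loc (bcris_Zp z);
  comp_Qp : {rmorphism {fraction Zp} -> C};
  comp_QpP : forall z : Zp, comp_Qp (tofrac z) = acris_theta A (bcris_Zp z)
}.

Variable B : Bcris.

Section Representation.

Variables (d : nat) (rho : abs_galois Kb -> 'M[{fraction Zp}]_d).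

(* Continuity of the entries of rho for the p-adic topology of Q_p. *)
Definition padic_continuous : Prop :=
  forall (g0 : abs_galois Kb) (n : nat), exists s, forall g, gal_agree s g0 g ->
    forall i j, exists z : Zp, rho g i j - rho g0 i j = tofrac (p%:R ^+ n * z).

Definition bcris_invariant (b : B) : Prop := forall g, bcris_act B g b = b.

(* D_cris(V), the invariants of the tensor product of B_cris and V for the
   diagonal action, where V is Q_p^d with the action given by rho. *)
Definition dcris (v : 'cV[B]_d) : Prop :=
  forall g, map_mx (bcris_Qp B) (rho g) *m map_mx (bcris_act B g) v = v.

(* D_cris(V) has dimension d over the field of invariants of B_cris (which is
   the fraction field of W(k)). *)
Definition crystalline : Prop :=
  exists M : 'M[B]_d,
    (forall j, dcris (col j M)) /\
    (forall v, dcris v -> exists! c : 'cV[B]_d,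
       (forall i, bcris_invariant (c i ord0)) /\ v = M *m c).

(* chi is the value at g of the p-adic cyclotomic character. *)
Definition cyclotomic_value (g : abs_galois Kb) (chi : Zp) : Prop :=
  forall n m : nat, in_pX p n (chi - m%:R) ->
    forall z : Kb, z ^+ (p ^ n) = 1 -> g z = z ^+ m.

(* The invariants of the tensor product of C(-i) and V are nonzero; the
   cyclotomic character has weight 1. *)
Definition hodge_tate_weight (i : int) : Prop :=
  exists2 v : 'cV[C]_d, v != 0 &
    forall g chi, cyclotomic_value g chi ->
      comp_Qp B (tofrac chi) ^ (- i) *:
        (map_mx (comp_Qp B) (rho g) *m map_mx (comp_act C g) v) = v.

(* Z_p-lattices in Q_p^d: the Z_p-spans of the bases of Q_p^d. *)
Definition lattice (L : 'cV[{fraction Zp}]_d -> Prop) : Prop :=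
  exists2 P : 'M[{fraction Zp}]_d, P \in unitmx &
    forall v, L v <->
      exists z : 'cV[Zp]_d, v = P *m map_mx (@tofrac Zp) z.

Definition gal_stable (L : 'cV[{fraction Zp}]_d -> Prop) : Prop :=
  forall g v, L v -> L (rho g *m v).

(* A Galois-equivariant isomorphism of L / L' with T, given as a
   Z_p-semilinear surjection f from L onto T with kernel L'; the values of f
   outside L are irrelevant. *)
Definition quotient_iso (T : vectType 'F_p) (tau : abs_galois Kb -> 'End(T))
    (L L' : 'cV[{fraction Zp}]_d -> Prop) : Prop :=
  exists f : 'cV[{fraction Zp}]_d -> T,
    [/\ forall u v, L u -> L v -> f (u + v) = f u + f v,
        forall (z : Zp) v, L v -> f (tofrac z *: v) = witt_residue Zp z *: f v,
        forall g v, L v -> f (rho g *m v) = tau g (f v),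
        forall t, exists2 v, L v & f v = t
      & forall v, L v -> (f v = 0 <-> L' v)].

End Representation.

End LocalField.

(* Main.v *)
(* The representation V is constructed together with its matrix of periods.
   A_inf is replaced by the ring E of sequences (f_m) in C, m an integer, that
   are limits of combinations of compatible systems x_(m+1)^p = x_m: the
   sequence of f lists the values theta (phi^-m f), so Frobenius is a shift,
   and ev maps E to A_cris.  Let xi = 1 + [eps] + ... + [eps]^(p-1) and q = p^n.
   The equation phi^n y = xi y has a solution y in E congruent to a Teichmuller
   element; g y = X_g b_g y, where b_g accounts for the action on xi and X_g is
   a character of Lubin-Tate type with values in Z_q^*, the ring Z_q being the
   sequences in E of period n.  Its reduction is the fundamental character of
   level n on tame inertia.  The conjugates of y, corrected by infinite products
   of phi^m(xi)/p, are elements of A_cris with product c p t, c a unit; hence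
   they are units of B_cris and are periods of the conjugates of X.  Their
   values in C do not vanish, except for one of them, so the characters
   X^(c_0) phi(X)^(c_1) ..., c = sum of c_l p^l with 0 <= c_l < p, are
   crystalline with Hodge-Tate weights the digits of c by Tate's theorem on the
   invariants of C(j).
   By continuity, inertia acts on T through a finite cyclic quotient of order
   prime to p, that is through X mod p for suitable n, and there is a finite
   unramified G_K-set with a point whose stabiliser H acts on T through X mod p.
   The sum over c of the induced representations, with periods in E obtained
   from Vandermonde matrices of Teichmuller elements, surjects onto T modulo p
   by averaging over G_K modulo the kernel of X mod p on H. *)
Require Import Defs.
From HB Require Import structures.
From mathcomp Require Import all_boot all_order all_algebra fieldext falgebra.
From mathcomp Require Import boolp classical_sets filter ring lra zify.
From mathcomp Require finfield fingroup perm separable cyclic cyclotomic.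

Set Implicit Arguments.
Unset Strict Implicit.
Unset Printing Implicit Defensive.

Import Order.TTheory GRing.Theory Num.Theory.
Local Open Scope ring_scope.

(** The ring [A] is known only through its universal property. Hence [p] is never cancelled in it:
    an identity is proved for sequences with values in the field [C] and carried over by [ev], or
    obtained as a congruence modulo every [p^N]. Sequences in [E] are determined by their values at
    large indices, where [mu] and [xi] are invertible in [C] and quotients such as [g(mu) / mu] make
    sense. The condition [n > 1] comes from the zero of [xi] at index 1: it makes [y] vanish at
    index [1 - n], while [y 0] stays nonzero and can be used to read off the character [X]. All
    exponents [c] from 0 to [q - 2] are taken together because the powers [X^c] modulo [p] make up
    the regular representation of the multiplicative group of the field with [q] elements. Base [p]
    digits turn these powers into characters with weights at most [p - 1]. Tate's theorem is proved
    over the fraction field of [W], where the cyclotomic tower is totally ramified, and transferred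
    to [K] by a norm. The field [k] is only perfect, so the residue action of the Galois group has
    to be trivialised separately; this is the role of the finite unramified sets. *)

Module Valuations.
(** Up to a power, every nonzero element is a power of [p] times a unit; this yields a valuation
    with rational values and value 1 at [p]. The axioms can be checked both for the integral closure
    of [W] in [Kb] and for its completion; comparability of two elements is a consequence, see
    [vge_total]. *)
Record valued (p : nat) (L : fieldType) (O : L -> Prop) : Prop := Valued {
  valued_prime : prime p;
  valued_1 : O 1;
  valued_B : forall x y, O x -> O y -> O (x - y);
  valued_M : forall x y, O x -> O y -> O (x * y);
  valued_p0 : p%:R != 0 :> L;
  valued_pV : ~ O (p%:R^-1);
  valued_root : forall x n, (0 < n)%N -> O (x ^+ n) -> O x;
  valued_pow : forall x, x != 0 -> exists N (z : int) u,
     [/\ (0 < N)%N, O u /\ O u^-1, u != 0 & x ^+ N = p%:R ^ z * u] }.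

(** * Rational valuations attached to a subring of a field *)

Section Valued.
Variables (p : nat) (L : fieldType) (O : L -> Prop).
Hypothesis V : valued p O.

Let pP := valued_prime V.
Let pL0 : p%:R != 0 :> L := valued_p0 V.

Definition hasval (x : L) (r : rat) := exists N (z : int) u,
  [/\ (0 < N)%N, O u /\ O u^-1, u != 0, x ^+ N = p%:R ^ z * u
    & r = z%:~R / N%:R].

(** At 0 the value is the default 0 ([vl0]), so [vge] and [vgt] treat 0 apart and make every bound
    hold for it. *)
Definition vl (x : L) : rat :=
  if pselect (exists r, hasval x r) is left e then projT1 (cid e) else 0.

Lemma O0 : O 0.
Proof. by rewrite -(subrr 1); apply: valued_B V _ _ _ _; apply: valued_1 V. Qed.

Lemma ON x : O x -> O (- x).
Proof. by move=> Ox; rewrite -sub0r; apply: (valued_B V) => //; apply: O0. Qed.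

Lemma OD x y : O x -> O y -> O (x + y).
Proof. by move=> Ox Oy; rewrite -[y]opprK; apply: (valued_B V) => //; apply: ON. Qed.

Lemma OX x n : O x -> O (x ^+ n).
Proof.
by move=> Ox; elim: n => [|n IH]; rewrite ?expr0 ?exprS; [apply: valued_1 V|apply: valued_M V _ _ _ _].
Qed.

Lemma Onat n : O n%:R.
Proof. by elim: n => [|n IH]; rewrite ?mulrS; [apply: O0|apply: OD => //; apply: valued_1 V]. Qed.

Lemma O_pXz (z : int) : O (p%:R ^ z) <-> (0 <= z)%R.
Proof.
split; last by case: z => // n _; apply: OX; apply: Onat.
case: z => // n; rewrite NegzE => Op; exfalso; apply: (valued_pV V).
apply: (@valued_root _ _ _ V _ n.+1) => //.
by rewrite exprVn.
Qed.

(** Closure under roots reduces membership of [x] to that of a power of [p], which [valued_pV]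
    decides. *)
Lemma hasval_O x r : hasval x r -> O x <-> 0 <= r.
Proof.
case=> N [z [u [N0 [Ou OuV] u0 xN ->]]].
rewrite pmulr_lge0 ?invr_gt0 ?ltr0n // ler0z -O_pXz; split=> [Ox|Oz].
  have -> : p%:R ^ z = x ^+ N * u^-1 by rewrite xN mulfK.
  by apply: (valued_M V) => //; apply: OX.
by apply: (valued_root V N0); rewrite xN; apply: (valued_M V).
Qed.

Lemma hasvalM x y r s : x != 0 -> y != 0 -> hasval x r -> hasval y s -> hasval (x * y) (r + s).
Proof.
move=> x0 y0 [N [z [u [N0 [Ou OuV] u0 xN ->]]]] [M [t [w [M0 [Ow OwV] w0 yM ->]]]].
exists (N * M)%N, (z * M%:Z + t * N%:Z), (u ^+ M * w ^+ N); split.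
- by rewrite muln_gt0 N0.
- by rewrite invfM -!exprVn; split; apply: (valued_M V); apply: OX.
- by rewrite mulf_neq0 // expf_neq0.
- rewrite exprMn exprM xN [(N * M)%N]mulnC exprM yM !exprMn expfzDr //.
  by rewrite !exprnP !exprz_exp mulrACA.
- have N1 : N%:R != 0 :> rat by rewrite pnatr_eq0 -lt0n.
  have M1 : M%:R != 0 :> rat by rewrite pnatr_eq0 -lt0n.
  by rewrite intrD !intrM natrM; field; rewrite N1 M1.
Qed.

Lemma hasvalV x r : x != 0 -> hasval x r -> hasval x^-1 (- r).
Proof.
move=> x0 [N [z [u [N0 [Ou OuV] u0 xN ->]]]].
exists N, (- z), u^-1; split; rewrite ?invrK ?invr_eq0 //.
- by rewrite exprVn xN invfM invr_expz.
- by rewrite rmorphN mulNr.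
Qed.

Lemma hasval_uniq x r s : x != 0 -> hasval x r -> hasval x s -> r = s.
Proof.
have aux t : hasval 1 t -> 0 <= t by move/hasval_O => [H _]; apply: H; apply: valued_1 V.
move=> x0.
have le r1 r2 : hasval x r1 -> hasval x r2 -> r1 <= r2.
  move=> h1 h2; rewrite -subr_ge0; apply: aux; rewrite -(divff x0).
  by apply: hasvalM; rewrite ?invr_eq0 //; apply: hasvalV.
by move=> xr xs; apply/eqP; rewrite eq_le !le.
Qed.

Lemma vlP x : x != 0 -> hasval x (vl x).
Proof.
move=> x0; rewrite /vl; case: pselect => [e|]; first by case: cid.
by case: (valued_pow V x0) => N [z [u [N0 Ou u0 xN]]] []; exists (z%:~R / N%:R), N, z, u.
Qed.

Lemma vlE x r : x != 0 -> hasval x r -> vl x = r.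
Proof. by move=> x0 h; apply: hasval_uniq h => //; apply: vlP. Qed.

Lemma vl0 : vl 0 = 0.
Proof.
rewrite /vl; case: pselect => // -[r [N [z [u [N0 h u0 xN e]]]]]; exfalso.
move/eqP: xN; rewrite expr0n gtn_eqF //= eq_sym mulf_eq0 (negPf u0) orbF.
by rewrite expfz_eq0 (negPf pL0) andbF.
Qed.

Lemma vlM x y : x != 0 -> y != 0 -> vl (x * y) = vl x + vl y.
Proof. by move=> x0 y0; apply: vlE; rewrite ?mulf_neq0 //; apply: hasvalM => //; apply: vlP. Qed.

Lemma vlV x : x != 0 -> vl x^-1 = - vl x.
Proof. by move=> x0; apply: vlE; rewrite ?invr_eq0 //; apply: hasvalV => //; apply: vlP. Qed.

Lemma vl_p : vl p%:R = 1.
Proof.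
by apply: vlE => //; exists 1%N, 1, 1; rewrite invr1 mulr1 expr1 oner_eq0 divr1; split => //; split; apply: valued_1 V.
Qed.

Lemma vl_unit u : u != 0 -> O u -> O u^-1 -> vl u = 0.
Proof.
by move=> u0 Ou OuV; apply: vlE => //; exists 1%N, 0, u; rewrite expr0z mul1r mul0r.
Qed.

Lemma vl1 : vl 1 = 0.
Proof. by apply: vl_unit; rewrite ?invr1 ?oner_eq0 //; apply: valued_1 V. Qed.

Lemma vlN x : vl (- x) = vl x.
Proof.
have [->|x0] := eqVneq x 0; first by rewrite oppr0.
rewrite -mulN1r vlM ?oppr_eq0 ?oner_eq0 // vl_unit ?add0r ?oppr_eq0 ?oner_eq0 //.
  exact/ON/(valued_1 V).
by rewrite invrN1; apply/ON/(valued_1 V).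
Qed.

Lemma vlX x n : x != 0 -> vl (x ^+ n) = vl x *+ n.
Proof.
move=> x0; elim: n => [|n IH]; first by rewrite expr0 vl1.
by rewrite exprS vlM ?expf_neq0 // IH mulrS.
Qed.

Definition vge (r : rat) (x : L) := (x == 0) || (r <= vl x).
Definition vgt (r : rat) (x : L) := (x == 0) || (r < vl x).

Lemma vge0P x : vge 0 x <-> O x.
Proof.
rewrite /vge; have [->|x0] := eqVneq x 0; first by split=> // _; apply: O0.
by rewrite (hasval_O (vlP x0)).
Qed.

Lemma vge_0 r : vge r 0. Proof. by rewrite /vge eqxx. Qed.
Lemma vgt_0 r : vgt r 0. Proof. by rewrite /vgt eqxx. Qed.
Hint Resolve vge_0 vgt_0 : core.

Lemma vgeM r s x y : vge r x -> vge s y -> vge (r + s) (x * y).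
Proof.
rewrite /vge mulf_eq0; have [//|x0] := eqVneq x 0; have [//|y0] := eqVneq y 0.
by rewrite vlM //=; apply: lerD.
Qed.

Lemma vge_mull x y r : O x -> vge r y -> vge r (x * y).
Proof. by move/vge0P => h /(vgeM h); rewrite add0r. Qed.

Lemma vge_mulr x y r : O y -> vge r x -> vge r (x * y).
Proof. by rewrite mulrC; apply: vge_mull. Qed.

Lemma vgtM r s x y : vgt r x -> vge s y -> vgt (r + s) (x * y).
Proof.
rewrite /vgt /vge mulf_eq0; have [//|x0] := eqVneq x 0; have [//|y0] := eqVneq y 0.
by rewrite vlM //=; apply: ltr_leD.
Qed.

Lemma vge_mulIr r x y : y != 0 -> vge (r + vl y) (x * y) = vge r x.
Proof.
move=> y0; rewrite /vge mulf_eq0 (negPf y0) orbF; have [//|x0] := eqVneq x 0.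
by rewrite vlM //= lerD2r.
Qed.

Lemma vge_divr r x y : y != 0 -> vge r (x / y) = vge (r + vl y) x.
Proof. by move=> y0; rewrite -(vge_mulIr r _ y0) divfK. Qed.

Lemma vge_total x y : x != 0 -> y != 0 -> vl x <= vl y -> O (y / x).
Proof. by move=> x0 y0 xy; apply/vge0P; rewrite vge_divr // add0r /vge xy orbT. Qed.

(** Factoring out the element of least valuation leaves [1 + y / x] with [y / x] in [O], where
    closure under addition applies. *)
Lemma vgeD r x y : vge r x -> vge r y -> vge r (x + y).
Proof.
rewrite /vge; have [->|x0] := eqVneq x 0; first by rewrite add0r.
have [->|y0] := eqVneq y 0; first by rewrite addr0 (negPf x0).
move=> /=; wlog xy : x y x0 y0 / vl x <= vl y => [hw|] rx ry.
  by case: (leP (vl x) (vl y)) => [|/ltW] xy; [|rewrite addrC]; apply: hw.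
rewrite -/(vge r (x + y)); have -> : x + y = (1 + y / x) * x by rewrite mulrDl mul1r divfK.
rewrite -[r](add0r).
apply: vgeM; last by rewrite /vge rx orbT.
by apply/vge0P/OD; [apply: valued_1 V|apply: vge_total].
Qed.

Lemma vgeN r x : vge r (- x) = vge r x.
Proof. by rewrite /vge vlN oppr_eq0. Qed.

Lemma vgtN r x : vgt r (- x) = vgt r x.
Proof. by rewrite /vgt vlN oppr_eq0. Qed.

Lemma vgeB r x y : vge r x -> vge r y -> vge r (x - y).
Proof. by move=> hx hy; apply: vgeD => //; rewrite vgeN. Qed.

Lemma vge_subC r x y : vge r (x - y) = vge r (y - x).
Proof. by rewrite -vgeN opprB. Qed.

Lemma vgt_subC r x y : vgt r (x - y) = vgt r (y - x).
Proof. by rewrite -vgtN opprB. Qed.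

Lemma vge_trans r y x z : vge r (x - y) -> vge r (y - z) -> vge r (x - z).
Proof. by move=> h1 h2; rewrite -(subrKA y); apply: vgeD. Qed.

Lemma vge_le r s x : s <= r -> vge r x -> vge s x.
Proof. by rewrite /vge; case: eqP => //= _ sr; apply: le_trans. Qed.

Lemma vgtW r x : vgt r x -> vge r x.
Proof. by rewrite /vgt /vge; case: eqP => //= _ /ltW. Qed.

Lemma vge_vgt r s x : r < s -> vge s x -> vgt r x.
Proof. by rewrite /vge /vgt; case: eqP => //= _ rs; apply: lt_le_trans. Qed.

Lemma vgt_vge r x : vgt r x -> exists2 s, r < s & vge s x.
Proof.
rewrite /vgt /vge; have [->|x0] /= := eqVneq x 0; last by exists (vl x).
by exists (r + 1); rewrite ?ltrDl.
Qed.

Lemma vgtD r x y : vgt r x -> vgt r y -> vgt r (x + y).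
Proof.
move=> /vgt_vge[s rs hx] /vgt_vge[t rt hy].
apply: (@vge_vgt _ (Num.min s t)); first by rewrite lt_min rs.
by apply: vgeD; [apply: vge_le hx|apply: vge_le hy]; rewrite ge_min lexx ?orbT.
Qed.

Lemma vgtB r x y : vgt r x -> vgt r y -> vgt r (x - y).
Proof. by move=> hx hy; apply: vgtD => //; rewrite vgtN. Qed.

Lemma vge_sum r (I : Type) (s : seq I) (P : pred I) (F : I -> L) :
  (forall i, P i -> vge r (F i)) -> vge r (\sum_(i <- s | P i) F i).
Proof. by move=> h; elim/big_rec: _ => // i x Pi hx; apply: vgeD => //; apply: h. Qed.

Lemma vgt_sum r (I : Type) (s : seq I) (P : pred I) (F : I -> L) :
  (forall i, P i -> vgt r (F i)) -> vgt r (\sum_(i <- s | P i) F i).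
Proof. by move=> h; elim/big_rec: _ => // i x Pi hx; apply: vgtD => //; apply: h. Qed.

Lemma O_sum (I : Type) (s : seq I) (P : pred I) (F : I -> L) :
  (forall i, P i -> O (F i)) -> O (\sum_(i <- s | P i) F i).
Proof. by move=> h; apply/vge0P/vge_sum => i /h /vge0P. Qed.

Lemma O_prod (I : Type) (s : seq I) (P : pred I) (F : I -> L) :
  (forall i, P i -> O (F i)) -> O (\prod_(i <- s | P i) F i).
Proof. by move=> h; elim/big_rec: _ => [|i x Pi hx]; [apply: valued_1 V|apply: (valued_M V) => //; apply: h]. Qed.

Lemma vl_prod (I : Type) (s : seq I) (P : pred I) (F : I -> L) :
  (forall i, P i -> F i != 0) -> vl (\prod_(i <- s | P i) F i) = \sum_(i <- s | P i) vl (F i).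
Proof.
move=> h; suff [//] : vl (\prod_(i <- s | P i) F i) = \sum_(i <- s | P i) vl (F i) /\ \prod_(i <- s | P i) F i != 0.
elim/big_rec2: _ => [|i x y Pi [<- y0]]; first by rewrite vl1 oner_eq0.
by rewrite mulf_neq0 ?h // vlM ?h.
Qed.

Lemma vgeX r x n : vge r x -> vge (r *+ n) (x ^+ n).
Proof.
by move=> h; elim: n => [|n IH]; rewrite ?mulr0n ?expr0 ?mulrS ?exprS; [apply/vge0P; apply: valued_1 V|apply: vgeM].
Qed.

Lemma vge_pX n : vge n%:R (p%:R ^+ n).
Proof. by rewrite /vge vlX // vl_p lexx orbT. Qed.

Lemma vl_pX n : vl (p%:R ^+ n) = n%:R.
Proof. by rewrite vlX // vl_p. Qed.

Lemma vge_nP n x : vge n%:R x <-> exists2 y, O y & x = p%:R ^+ n * y.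
Proof.
split=> [h|[y Oy ->]]; last by apply: vge_mulr => //; apply: vge_pX.
exists (x / p%:R ^+ n); last by rewrite mulrC divfK // expf_neq0.
by apply/vge0P; rewrite vge_divr ?expf_neq0 // vl_pX add0r.
Qed.

Lemma vge_pM r x : vge (1 + r) (p%:R * x) = vge r x.
Proof. by rewrite mulrC addrC -vl_p vge_mulIr. Qed.

Lemma vl_add_lt x y : x != 0 -> vgt (vl x) y -> vl (x + y) = vl x /\ x + y != 0.
Proof.
move=> x0 h.
have le1 : vge (vl x) (x + y) by apply: vgeD; [rewrite /vge lexx orbT|apply: vgtW].
have n1 : ~~ vgt (vl x) (x + y).
  apply/negP => h'; have := vgtB h' h; rewrite addrK /vgt ltxx (negPf x0); done.
move: n1 le1; rewrite /vgt /vge negb_or -leNgt => /andP[xy0 le2].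
by rewrite (negPf xy0) /= => le1; split=> //; apply/eqP; rewrite eq_le le2.
Qed.

Lemma vl_sub_lt x y : x != 0 -> vgt (vl x) (y - x) -> vl y = vl x /\ y != 0.
Proof. by move=> x0 h; have := vl_add_lt x0 h; rewrite subrKC. Qed.

(** By a Bezout relation [a n - b p = 1], a positive valuation of [n] would force one on 1. *)
Lemma vl_natcoprime n : coprime p n -> n%:R != 0 :> L /\ vl n%:R = 0.
Proof.
move=> cop; have p1 := prime_gt1 pP; have n0 : (0 < n)%N.
  by rewrite lt0n; apply: contraL cop => /eqP->; rewrite /coprime gcdn0 neq_ltn p1 orbT.
case: (egcdnP p n0) => a b e _; rewrite gcdnC (eqP cop) in e.
have e2 : a%:R * n%:R - b%:R * p%:R = 1 :> L by rewrite -!natrM e natrD addrAC subrr add0r.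
have nz : n%:R != 0 :> L.
  apply/eqP => nz; move: e2; rewrite nz mulr0 sub0r => e2.
  apply: (valued_pV V); have -> : p%:R^-1 = - b%:R :> L by rewrite -[- b%:R](mulfK pL0) mulNr e2 mul1r.
  exact/ON/Onat.
split=> //.
have : 0 <= vl n%:R by have /vge0P := Onat n; rewrite /vge (negPf nz).
rewrite le_eqVlt => /predU1P[<- //|h].
have : vgt 0 (1 : L).
  rewrite -e2 -[0]addr0; apply: vgtB.
    by rewrite mulrC; apply: vgtM; [rewrite /vgt h orbT|apply/vge0P/Onat].
  by rewrite mulrC; apply: vgtM; [rewrite /vgt vl_p ltr01 orbT|apply/vge0P/Onat].
by rewrite /vgt oner_eq0 vl1 ltxx.
Qed.

Lemma valued_nat0 n : (0 < n)%N -> n%:R != 0 :> L.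
Proof.
move=> n0; have [m cop ->] := pfactor_coprime pP n0.
by rewrite natrM mulf_neq0 ?natrX ?expf_neq0 //; case: (vl_natcoprime cop).
Qed.

Lemma vl_nat n : (0 < n)%N -> vl n%:R = (logn p n)%:R.
Proof.
move=> n0; have [m cop e] := pfactor_coprime pP n0; rewrite {1}e.
have [m0 vm] := vl_natcoprime cop.
by rewrite natrM natrX vlM ?expf_neq0 // vm add0r vl_pX.
Qed.

Lemma O_intr (z : int) : O z%:~R.
Proof. by case: z => n; [apply: Onat|rewrite NegzE rmorphN; apply/ON/Onat]. Qed.

Lemma vge_exprB r x y n : 0 <= r -> O x -> O y -> vge r (x - y) -> vge r (x ^+ n - y ^+ n).
Proof.
move=> r0 Ox Oy h; rewrite subrXX; apply: vge_mulr => //.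
by apply: O_sum => i _; apply: (valued_M V); apply: OX.
Qed.

(* Raising to the p-th power contracts: (y + d)^p - y^p = d^p + p d (...). *)
Lemma vge_exprpB r x y : 0 <= r -> O x -> O y -> vge r (x - y) ->
  vge (Num.min (r *+ p) (1 + r)) (x ^+ p - y ^+ p).
Proof.
move=> r0 Ox Oy; rewrite -[x](subrK y); set d := x - y; rewrite addrK => hd.
rewrite [d + y]addrC exprDn big_ord_recl /= subn0 expr0 mulr1 bin0 mulr1n addrAC subrr add0r.
apply: vge_sum => -[i ip] _ /=; rewrite /bump /= add1n.
have [->|np] := eqVneq i.+1 p.
  by rewrite subnn binn mul1r; apply: vge_le (vgeX p hd); rewrite ge_min lexx.
apply: (@vge_le (1 + r)); first by rewrite ge_min lexx orbT.
have /dvdnP[k ->] : (p %| 'C(p, i.+1))%N by apply: prime_dvd_bin => //; rewrite /= ltn_neqAle np.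
rewrite -mulr_natl natrM -mulrA mulrCA vge_pM; apply: vge_mull; first exact: Onat.
apply: vge_mull; first exact: OX.
rewrite exprS; apply: vge_mulr => //; apply: OX; rewrite /d; exact: valued_B V _ _ _ _.
Qed.

End Valued.
#[export] Hint Resolve vge_0 vgt_0 : core.

End Valuations.

(** * Witt vectors as a complete discrete valuation ring, and integral closures over them *)

Module WittRings.
Import Valuations.

Section InpX.
Variables (p : nat) (A : comNzRingType).
Implicit Types x y : A.

Lemma in_pX0 n : in_pX p n (0 : A). Proof. by exists 0; rewrite mulr0. Qed.
Lemma in_pX_all x : in_pX p 0 x. Proof. by exists x; rewrite expr0 mul1r. Qed.
Lemma in_pXD n x y : in_pX p n x -> in_pX p n y -> in_pX p n (x + y).
Proof. by move=> [a ->] [b ->]; exists (a + b); rewrite mulrDr. Qed.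
Lemma in_pXN n x : in_pX p n x -> in_pX p n (- x).
Proof. by move=> [a ->]; exists (- a); rewrite mulrN. Qed.
Lemma in_pXB n x y : in_pX p n x -> in_pX p n y -> in_pX p n (x - y).
Proof. by move=> h1 h2; apply: in_pXD => //; apply: in_pXN. Qed.
Lemma in_pXMl n x y : in_pX p n x -> in_pX p n (x * y).
Proof. by move=> [a ->]; exists (a * y); rewrite mulrA. Qed.
Lemma in_pXMr n x y : in_pX p n y -> in_pX p n (x * y).
Proof. by rewrite mulrC; apply: in_pXMl. Qed.
Lemma in_pX_le n m x : (m <= n)%N -> in_pX p n x -> in_pX p m x.
Proof. by move=> /subnK<- [a ->]; exists (p%:R ^+ (n - m) * a); rewrite addnC exprD mulrA. Qed.
Lemma in_pX_sym n x y : in_pX p n (x - y) -> in_pX p n (y - x).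
Proof. by move/in_pXN; rewrite opprB. Qed.
Lemma in_pX_trans n y x z : in_pX p n (x - y) -> in_pX p n (y - z) -> in_pX p n (x - z).
Proof. by move=> h1 h2; rewrite -(subrKA y); apply: in_pXD. Qed.
Lemma in_pX_pX n : in_pX p n (p%:R ^+ n : A). Proof. by exists 1; rewrite mulr1. Qed.
Lemma in_pX_sum n (I : Type) (s : seq I) (P : pred I) (F : I -> A) :
  (forall i, P i -> in_pX p n (F i)) -> in_pX p n (\sum_(i <- s | P i) F i).
Proof. by move=> h; elim/big_rec: _ => [|i x Pi hx]; [apply: in_pX0|apply: in_pXD => //; apply: h]. Qed.
Lemma in_pXMB n x x' y y' : in_pX p n (x - x') -> in_pX p n (y - y') -> in_pX p n (x * y - x' * y').
Proof.
move=> h1 h2; have -> : x * y - x' * y' = (x - x') * y + x' * (y - y') by ring.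
by apply: in_pXD; [apply: in_pXMl|apply: in_pXMr].
Qed.
Lemma in_pXXB n x y k : in_pX p n (x - y) -> in_pX p n (x ^+ k - y ^+ k).
Proof. by move=> h; elim: k => [|k IH]; rewrite ?subrr ?exprS; [apply: in_pX0|apply: in_pXMB]. Qed.

Definition padic_lim (u : nat -> A) (l : A) :=
  forall n, exists m0, forall m, (m0 <= m)%N -> in_pX p n (l - u m).

Definition padic_cauchy (u : nat -> A) :=
  forall n, exists m0, forall m, (m0 <= m)%N -> in_pX p n (u m - u m0).

Hypothesis cA : padically_complete p A.

Lemma padic_sep x y : (forall n, in_pX p n (x - y)) -> x = y.
Proof. by case: cA => h _ /h /eqP; rewrite subr_eq0 => /eqP. Qed.

(** [padically_complete] speaks of sequences with [u n.+1 - u n] in [p^n]; the running maximum [g]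
    of the moduli extracts such a subsequence from any Cauchy sequence. *)
Lemma cauchy_lim u : padic_cauchy u -> exists l, padic_lim u l.
Proof.
move=> /choice [f hf]; pose g n := \max_(i < n.+1) f i.
have fg n : (f n <= g n)%N by apply: (@leq_bigmax _ (fun i : 'I_n.+1 => f i) ord_max).
have gS n : (g n <= g n.+1)%N by rewrite /g [X in (_ <= X)%N]big_ord_recr /=; apply: leq_maxl.
have [n|l hl] := (cA.2 (fun n => u (g n))).
  apply: (@in_pX_trans _ (u (f n))); first by apply: hf; apply: leq_trans (fg n) (gS n).
  by apply/in_pX_sym/hf.
exists l => n; exists (f n) => m fm; apply: in_pX_trans (hl n) _.
by apply: (@in_pX_trans _ (u (f n))); [apply: hf|apply/in_pX_sym/hf].
Qed.

Lemma one_sub_unit x : (forall n, exists m, in_pX p n (x ^+ m)) -> exists y, (1 - x) * y = 1.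
Proof.
move=> h; have [|l hl] := @cauchy_lim (fun m => \sum_(i < m) x ^+ i).
  move=> n; have [m0 hm0] := h n; exists m0 => m /subnKC<-.
  rewrite big_split_ord /= addrAC subrr add0r; apply: in_pX_sum => i _.
  by rewrite exprD; apply: in_pXMl.
exists l; apply: padic_sep => n; have [m hm] := h n; have [m' hm'] := hl n.
have e : in_pX p n (x ^+ (m + m')) by rewrite exprD; apply: in_pXMl.
have -> : (1 - x) * l - 1 = (1 - x) * (l - \sum_(i < m + m') x ^+ i) - x ^+ (m + m').
  rewrite mulrBr -opprB -(opprB x) !mulNr -subrX1; ring.
by apply: in_pXB => //; apply/in_pXMr/hm'; rewrite leq_addl.
Qed.

End InpX.

Section WittRing.
Variables (p : nat) (k : fieldType) (W : witt_vectors p k).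
Hypothesis pP : prime p.

Let cW := witt_complete W.

Lemma res_p : witt_residue W p%:R = 0.
Proof. by apply/witt_residue_ker; exists 1; rewrite expr1 mulr1. Qed.

Lemma witt_unitP (w : W) : witt_residue W w != 0 <-> w \is a GRing.unit.
Proof.
split=> [nz|u]; last first.
  have : witt_residue W w * witt_residue W w^-1 = 1 by rewrite -rmorphM mulrV ?rmorph1.
  by apply: contra_eq_neq => ->; rewrite mul0r eq_sym oner_eq0.
have [w' hw'] := witt_residue_surj W (witt_residue W w)^-1.
have [z] : in_pX p 1 (1 - w * w').
  by apply/witt_residue_ker; rewrite rmorphB rmorph1 rmorphM hw' divff // subrr.
rewrite expr1 => hz.
have [|y] := @one_sub_unit p W cW (1 - w * w').
  by move=> n; exists n; rewrite hz exprMn; apply/in_pXMl/in_pX_pX.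
rewrite opprB subrKC -mulrA => e.
by apply/unitrP; exists (w' * y); rewrite mulrC.
Qed.

Lemma witt_decomp (w : W) : w != 0 -> exists n u, u \is a GRing.unit /\ w = p%:R ^+ n * u.
Proof.
move=> w0; have [n hn] : exists n, ~ in_pX p n w.
  by apply/existsNP => h; move/eqP: w0; apply; apply: cW.1.
elim: n hn => [|n IH] hn; first by case: hn; apply: in_pX_all.
case: (pselect (in_pX p n w)) => [[u e]|/IH //]; exists n, u; split => //.
apply/witt_unitP/eqP => /witt_residue_ker [v]; rewrite expr1 => ev.
by apply: hn; exists v; rewrite exprSr e ev mulrA.
Qed.

Lemma in_pX_poly n (f : {poly W}) : in_pX p n f <-> forall i, in_pX p n f`_i.
Proof.
split=> [[s ->] i|/choice [g hg]].
  by exists s`_i; rewrite -natrX mulr_natl coefMn -natrX mulr_natl.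
exists (\poly_(i < size f) g i); apply/polyP => i.
rewrite -natrX mulr_natl coefMn coef_poly; case: ltnP => h.
  by rewrite hg -natrX mulr_natl.
by rewrite nth_default // mul0rn.
Qed.

Lemma rmodp_in_pX n (f g : {poly W}) : g \is monic -> in_pX p n f ->
  in_pX p n (Pdiv.Ring.rmodp f g).
Proof.
move=> mg [s ->]; exists (Pdiv.Ring.rmodp s g).
by rewrite -natrX !mulr_natl -!scaler_nat Pdiv.RingMonic.rmodpZ.
Qed.

(** Hensel lifting in the case where the cofactor reduces to the constant [c], so that each
    correction comes from one division by the monic factor. Only the monic factor is passed to the
    limit; the cofactor is then defined as a quotient. *)
Lemma hensel_factor (f : {poly W}) (d : nat) : f`_d \is a GRing.unit ->
  (forall i, (d < i)%N -> in_pX p 1 f`_i) ->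
  exists g h : {poly W}, [/\ f = g * h, g \is monic, size g = d.+1,
    h`_0 \is a GRing.unit & forall i, (0 < i)%N -> in_pX p 1 h`_i].
Proof.
set c := f`_d => uc hf.
pose step (m : nat) (gh : {poly W} * {poly W}) := [/\ in_pX p m.+1 (f - gh.1 * gh.2),
  gh.1 \is monic, size gh.1 = d.+1 & in_pX p 1 (gh.2 - c%:P)].
have cc : c%:P * c^-1%:P = 1 :> {poly W} by rewrite -polyCM divrr.
have monD (a g : {poly W}) : g \is monic -> (size a < size g)%N ->
    size g = d.+1 -> (g + a \is monic) /\ size (g + a) = d.+1.
  move=> mg sa sg; rewrite size_polyDl // sg; split => //.
  by rewrite monicE lead_coefDl.
have [gh0 h0] : exists gh, step 0%N gh.
  pose a := \poly_(i < d) (c^-1 * f`_i).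
  have [||m0 s0] := @monD a 'X^d (monicXn _ _); rewrite ?size_polyXn ?ltnS ?size_poly //.
  exists ('X^d + a, c%:P); split => //; last by rewrite subrr; apply: in_pX0.
  apply/in_pX_poly => i; rewrite coefB coefMC coefD coefXn coef_poly.
  case: (ltngtP i d) => hi.
  - by rewrite add0r mulrAC mulVr // mul1r subrr; apply: in_pX0.
  - by rewrite addr0 mul0r subr0; apply: hf.
  - by rewrite hi addr0 mul1r subrr; apply: in_pX0.
have nxt m gh : step m gh -> exists gh', step m.+1 gh' /\ in_pX p m.+1 (gh'.1 - gh.1).
  case: gh => g h [/= [r hr] mg sg [e he]].
  (* Corrections [a] of [g] and [c b] of [h] must satisfy [r = c a + g (c b)] modulo [p]. Dividing
     [c^-1 r] by [g] gives them with [a] of degree below that of [g], which keeps [g] monic. *)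
  pose b := Pdiv.Ring.rdivp (c^-1%:P * r) g; pose a := Pdiv.Ring.rmodp (c^-1%:P * r) g.
  have E : c^-1%:P * r = b * g + a := Pdiv.RingMonic.rdivp_eq mg _.
  have sa : (size a < size g)%N by apply: Pdiv.CommonRing.ltn_rmodpN0 => //; apply: monic_neq0.
  have sa' : (size (p%:R ^+ m.+1 * a)%R < size g)%N.
    by rewrite -natrX mulr_natl -scaler_nat; apply: leq_ltn_trans (size_scale_leq _ _) sa.
  have [mg' sg'] := monD _ _ mg sa' sg.
  exists (g + p%:R ^+ m.+1 * a, h + p%:R ^+ m.+1 * (c%:P * b)); split; last first.
    by exists a; rewrite /= addrAC subrr add0r.
  split => //=.
    exists (- (a * e) - p%:R ^+ m * (a * (c%:P * b))).
    have r' : r = c%:P * b * g + c%:P * a.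
      by rewrite -mulrA -mulrDr -E mulrA cc mul1r.
    have h' : h = c%:P + p%:R * e by rewrite -[h](subrK c%:P) he expr1 addrC.
    have f' : f = g * h + p%:R ^+ m.+1 * r by rewrite -hr addrC subrK.
    by rewrite f' r' h' !exprS; ring.
  rewrite addrAC; apply: in_pXD; first by exists e.
  by exists (p%:R ^+ m * (c%:P * b)); rewrite exprS expr1; ring.
have [s [s0 hs]] : exists s, s 0%N = gh0 /\ forall m, step m (s m) -> 
    step m.+1 (s m.+1) /\ in_pX p m.+1 ((s m.+1).1 - (s m).1).
  have H m gh : exists gh', step m gh -> step m.+1 gh' /\ in_pX p m.+1 (gh'.1 - gh.1).
    by case: (pselect (step m gh)) => [/nxt[gh' h']|]; [exists gh'|exists gh].
  have [F hF] := choice (fun x : nat * ({poly W} * {poly W}) => H x.1 x.2).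
  exists (fix s m := if m is m'.+1 then F (m', s m') else gh0); split => // m.
  exact: (hF (m, _)).
have st m : step m (s m) by elim: m => [|m IH]; [rewrite s0|case: (hs m IH)].
have gc m : in_pX p m.+1 ((s m.+1).1 - (s m).1) by case: (hs m (st m)).
have /choice[G hG] : forall i, exists l : W, forall n, in_pX p n (l - (s n).1`_i).
  move=> i; have [n|l hl] := cW.2 (fun n => (s n).1`_i); last by exists l.
  by rewrite -coefB; move/in_pX_poly: (gc n) => /(_ i); apply: in_pX_le.
have sz m i : (d < i)%N -> (s m).1`_i = 0 by move=> di; case: (st m) => _ _ sg _; rewrite nth_default ?sg.
have lead m : (s m).1`_d = 1 by case: (st m) => _ /monicP; rewrite lead_coefE => + sg _; rewrite sg.
have Gd : G d = 1 by apply: padic_sep cW _ _ _ => n; rewrite -(lead n); apply: hG.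
pose g := \poly_(i < d.+1) G i.
have sg : size g = d.+1 by rewrite size_poly_eq // Gd oner_eq0.
have mg : g \is monic by rewrite monicE lead_coefE sg coef_poly ltnSn Gd.
have gE m : in_pX p m (g - (s m).1).
  apply/in_pX_poly => i; rewrite coefB coef_poly; case: ltnP => hi; first exact: hG.
  by rewrite sz // subrr; apply: in_pX0.
(* The remainder is divisible by every power of [p], because [f] is a multiple of [g] modulo each
   [p^m]. *)
have r0 : Pdiv.Ring.rmodp f g = 0.
  apply/polyP => i; rewrite coef0; apply: cW.1 => m.
  suff /in_pX_poly : in_pX p m (Pdiv.Ring.rmodp f g) by apply.
  have -> : f = (f - g * (s m).2) + (s m).2 * g by rewrite [X in _ + X]mulrC subrK.
  rewrite Pdiv.RingMonic.rmodpD // Pdiv.RingMonic.rmodp_mull // addr0.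
  apply: rmodp_in_pX => //; case: (st m) => hm _ _ _.
  apply: (in_pX_trans (in_pX_le (leqnSn m) hm)).
  by rewrite -mulrBl; apply/in_pXMl/in_pX_sym.
exists g, (Pdiv.Ring.rdivp f g).
have e : f = g * Pdiv.Ring.rdivp f g.
  by rewrite {1}(Pdiv.RingMonic.rdivp_eq mg f) r0 addr0 mulrC.
set h := Pdiv.Ring.rdivp f g in e *.
pose rs := map_poly (witt_residue W).
have szg : size (rs g) = d.+1 by rewrite size_map_poly_id0 // (monicP mg) rmorph1 oner_eq0.
have rf : rs f = rs g * rs h by rewrite {1}e /rs rmorphM.
have rfd : (rs f)`_d != 0 by rewrite coef_map; apply/witt_unitP.
have szf : size (rs f) = d.+1.
  apply/eqP; rewrite eqn_leq; apply/andP; split; last first.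
    by rewrite ltnNge; apply: contra rfd => h'; rewrite nth_default.
  by apply/leq_sizeP => j dj; rewrite coef_map; apply/witt_residue_ker/hf.
have szh : size (rs h) = 1%N.
  have g0 : rs g != 0 by rewrite -size_poly_gt0 szg.
  have h0' : rs h != 0.
    by apply: contraNneq rfd => h0'; rewrite rf h0' mulr0 coef0.
  move: szf; rewrite rf size_mul // szg addSn /= => e2; by apply/eqP; rewrite -(eqn_add2l d) e2 addn1.
split => //.
  apply/witt_unitP; rewrite -coef_map -/rs; apply: contraTneq (eqxx (size (rs h))) => h'.
  rewrite {1}szh; have := size1_polyC (eq_leq szh) => e'.
  by rewrite e' h' polyC0 size_poly0.
by move=> i i0; apply/witt_residue_ker; rewrite -coef_map nth_default // -/rs szh.
Qed.

Section IntegralClosure.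
Variables (L : fieldType) (iota : {rmorphism W -> L}).
Hypothesis iotaI : injective iota.
Hypothesis iota_alg : forall x : L, exists2 f : {poly W}, f != 0 & root (map_poly iota f) x.

Let O := integralOver iota.

Lemma iota_p_neq0 : p%:R != 0 :> L.
Proof. by rewrite -(rmorph_nat iota) (raddf_eq0 _ iotaI); apply: witt_p_neq0. Qed.

(** The reversed polynomial, divided by the constant coefficient of [h], is monic and kills
    [x^-1]. *)
Lemma O_unit_const (h : {poly W}) (x : L) : x != 0 -> root (map_poly iota h) x ->
  h`_0 \is a GRing.unit -> O x^-1.
Proof.
move=> x0 rx u0; set e := size h.
have h0 : h != 0 by apply: contraTneq u0 => ->; rewrite coef0 unitr0.
have e0 : (0 < e)%N by rewrite size_poly_gt0.
pose P := \poly_(i < e) ((h`_0)^-1 * h`_(e.-1 - i)); exists P.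
  have cE : (h`_0)^-1 * h`_(e.-1 - e.-1) = 1 by rewrite subnn mulVr.
  by rewrite monicE lead_coefE size_poly_eq ?cE ?oner_eq0 // coef_poly prednK // leqnn cE.
have ue : (iota h`_0) != 0 by rewrite (raddf_eq0 _ iotaI); apply: contraTneq u0 => ->; rewrite unitr0.
rewrite /root -(mulIr_eq0 _ (mulIf (expf_neq0 e.-1 x0))) -(mulrI_eq0 _ (mulfI ue)).
move: rx; rewrite /root; congr (_ == _).
have szP : (size (map_poly iota P) <= e)%N.
  by rewrite size_map_inj_poly ?rmorph0 // size_poly.
rewrite (horner_coef_wide _ szP) horner_coef size_map_inj_poly ?rmorph0 // -/e mulr_suml mulr_sumr.
rewrite (reindex_inj rev_ord_inj) /=; apply: eq_bigr => i _.
rewrite !coef_map /= coef_poly ltn_ord rmorphM rmorphV // !mulrA divff // mul1r -mulrA; congr (_ * _).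
  by congr (iota _`_ _); have := ltn_ord i; lia.
have -> : e.-1 = ((e - i.+1) + i)%N by have := ltn_ord i; lia.
by rewrite exprVn exprD mulrCA mulVf ?mulr1 ?expf_neq0.
Qed.

(** A primitive polynomial killing [x] splits by [hensel_factor] into a monic factor and a factor
    with unit constant term; a root of the first is integral, and for a root of the second
    [O_unit_const] applies. *)
Lemma integral_total (x : L) : O x \/ O x^-1.
Proof.
have [->|x0] := eqVneq x 0; first by left; exists 'X; rewrite ?monicX // map_polyX rootX.
have [f f0 rf] := iota_alg x.
have {f f0 rf}[f [rf nf]] : exists f, root (map_poly iota f) x /\ ~ in_pX p 1 f.
  have [i fi] : exists i, f`_i != 0 by exists (size f).-1; rewrite -lead_coefE lead_coef_eq0.
  have [n hn] : exists n, ~ in_pX p n f.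
    have [n hn] : exists n, ~ in_pX p n f`_i.
      by apply/existsNP => h; move/eqP: fi; apply; apply: cW.1.
    by exists n => /in_pX_poly /(_ i).
  elim: n f rf hn {f0 fi} => [|n IH] f rf hn; first by case: hn; apply: in_pX_all.
  case: (pselect (in_pX p 1 f)) => [[g]|]; last by exists f.
  rewrite expr1 => e; apply: (IH g) => [|[s es]]; last first.
    by apply: hn; exists s; rewrite e es exprS mulrA.
  move: rf; rewrite e rmorphM rootM rmorph_nat => /orP[|//].
  by rewrite -[p%:R]polyC_natr rootC (negPf iota_p_neq0).
have [d [ud hd]] : exists d, f`_d \is a GRing.unit /\ forall i, (d < i)%N -> in_pX p 1 f`_i.
  pose P i := `[< ~ in_pX p 1 f`_i >].
  have ex : exists i, P i.
    by apply/not_existsP => h; apply: nf; apply/in_pX_poly => i; apply: contrapT => /asboolP; apply: h.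
  have bd i : P i -> (i <= size f)%N.
    move=> /asboolP Pi; rewrite leqNgt; apply/negP => h; apply: Pi.
    by rewrite nth_default ?(ltnW h) //; apply: in_pX0.
  case: (ex_maxnP ex bd) => d /asboolP Pd md; exists d; split.
    by apply/witt_unitP/eqP => /witt_residue_ker.
  by move=> i di; apply: contrapT => /asboolP /md; rewrite leqNgt di.
have [g [h [e mg _ uh _]]] := hensel_factor ud hd.
move: rf; rewrite e rmorphM rootM => /orP[rg|rh]; first by left; exists g.
by right; apply: O_unit_const rh uh.
Qed.

(** The axiom [valued_pow] is a Newton polygon argument: among the terms of a polynomial equation of
    [x] the least valuation occurs at least twice, and the quotient of two such terms is a unit that
    expresses a power of [x] by a power of [p]. *)
Lemma integral_valued : valued p O.
Proof.
have O1 : O 1 by exact: integral1.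
have OM x y : O x -> O y -> O (x * y) by exact: integral_mul.
have OB x y : O x -> O y -> O (x - y) by exact: integral_sub.
have OD x y : O x -> O y -> O (x + y) by move=> Ox Oy; rewrite -[y]opprK -[X in - X]add0r; do 2 apply: (OB _ _) => //; exact: integral0.
have Ow w : O (iota w) by exact: integral_id.
have OwV w : w \is a GRing.unit -> O (iota w)^-1 by move=> uw; rewrite -rmorphV.
(* Multiplying a monic equation of [p^-1] by [p^n] gives [p s + 1 = 0] with [s] in [W], which is
   impossible in the residue field. *)
have pN : ~ O p%:R^-1.
  case=> g mg; have p0 := iota_p_neq0.
  have [n sgn] : exists n, size g = n.+1.
    by exists (size g).-1; rewrite prednK // size_poly_gt0 monic_neq0.
  have gn : g`_n = 1 by move/monicP: mg; rewrite lead_coefE sgn.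
  rewrite /root -(mulIr_eq0 _ (mulIf (expf_neq0 n p0))).
  rewrite horner_coef size_map_inj_poly ?rmorph0 // sgn big_ord_recr /= mulrDl.
  rewrite coef_map /= gn rmorph1 mul1r exprVn mulVf ?expf_neq0 //.
  have -> : (\sum_(i < n) (map_poly iota g)`_i * p%:R^-1 ^+ i) * p%:R ^+ n
     = iota (p%:R * \sum_(i < n) g`_i * p%:R ^+ (n - i.+1)).
    rewrite mulr_suml mulr_sumr rmorph_sum; apply: eq_bigr => i _ /=.
    rewrite coef_map /= rmorphM rmorphM rmorphXn rmorph_nat.
    have -> : p%:R ^+ n = p%:R ^+ i * (p%:R * p%:R ^+ (n - i.+1)) :> L.
      by rewrite -exprS -exprD; congr (_ ^+ _); have := ltn_ord i; lia.
    by rewrite exprVn; field; rewrite !expf_neq0.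
  rewrite -(rmorph1 iota) -rmorphD (raddf_eq0 _ iotaI) => /eqP e.
  have /eqP := congr1 (witt_residue W) e.
  by rewrite rmorphD rmorphM rmorph1 res_p mul0r add0r rmorph0 oner_eq0.
split => //; first exact: iota_p_neq0.
  move=> x n n0 [g mg rg]; exists (g \Po 'X^n).
    by rewrite monicE lead_coef_comp ?size_polyXn ?ltnS // (monicP mg) lead_coefXn expr1n mul1r.
  by rewrite /root map_comp_poly map_polyXn horner_comp hornerXn.
move=> x x0; have [f f0 rf] := iota_alg x.
(* [T i] is a term of the equation; [nu] expresses membership in the maximal ideal for nonzero
   elements. *)
pose T i := iota f`_i * x ^+ i; pose nu (y : L) := O y /\ ~ O y^-1.
have nuD y z : nu y \/ y = 0 -> nu z \/ z = 0 -> nu (y + z) \/ y + z = 0.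
  case=> [nuy|->]; last by rewrite add0r.
  case=> [nuz|->]; last by rewrite addr0; left.
  have [yz0|yz0] := eqVneq (y + z) 0; [by right|left]; split; first by apply: OD; [case: nuy|case: nuz].
  wlog yz : y z nuy nuz yz0 / O (y / z).
    move=> hw; have [/hw h|] := integral_total (y / z); first exact: h.
    by rewrite invf_div addrC => /hw; apply; rewrite // addrC.
  move=> h; have [_ nz] := nuz; apply: nz.
  have z0 : z != 0 by apply/eqP => z0; case: nuz; rewrite z0 invr0.
  have -> : z^-1 = (y / z + 1) * (y + z)^-1 by field; rewrite z0 yz0.
  by apply: OM => //; apply: OD.
have [i [fi mini]] : exists i, f`_i != 0 /\ forall j, (j < size f)%N -> O (T j / T i).
  have : exists i, f`_i != 0 by exists (size f).-1; rewrite -lead_coefE lead_coef_eq0.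
  elim: (size f) => [[i fi]|n IH /IH [i [fi hi]]]; first by exists i.
  have T0 l : f`_l != 0 -> T l != 0 by move=> fl; rewrite mulf_neq0 ?expf_neq0 // (raddf_eq0 _ iotaI).
  have [fn|fn] := eqVneq f`_n 0.
    exists i; split => // j; rewrite ltnS leq_eqVlt => /predU1P[->|/hi //].
    by rewrite /T fn rmorph0 !mul0r; exact: integral0.
  case: (integral_total (T n / T i)) => h.
    by exists i; split => // j; rewrite ltnS leq_eqVlt => /predU1P[->|/hi].
  exists n; split => // j; rewrite ltnS leq_eqVlt => /predU1P[->|/hi hj]; first by rewrite divff ?T0.
  by have -> : T j / T n = T j / T i * (T n / T i)^-1; [rewrite invf_div mulrA divfK ?T0|apply: OM].
have Ti0 : T i != 0 by rewrite mulf_neq0 ?expf_neq0 // (raddf_eq0 _ iotaI).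
(* Otherwise all other quotients [T j / T i] lie in the maximal ideal, and so does their sum, which
   is [-1]. *)
have [j [ji fj lj OTj]] : exists j, [/\ j != i, f`_j != 0, (j < size f)%N & O (T j / T i)^-1].
  apply: contrapT => hn.
  have li : (i < size f)%N by rewrite ltnNge; apply: contra fi => h; rewrite nth_default.
  have : nu (- 1) \/ - 1 = 0 :> L.
    have e : \sum_(j < size f) T j / T i = 0.
      rewrite -mulr_suml; move: rf; rewrite /root horner_coef size_map_inj_poly ?rmorph0 //.
      under eq_bigr do rewrite coef_map /=.
      by rewrite -/T => /eqP->; rewrite mul0r.
    move: e; rewrite (bigD1 (Ordinal li)) //= divff // addrC => /eqP.
    rewrite addr_eq0 => /eqP <-.
    elim/big_rec: _ => [|j y ji hy]; first by right.
    apply: nuD => //; have [->|Tj0] := eqVneq (T j / T i) 0; [by right|left; split; first exact: mini].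
    move=> h; apply: hn; exists (nat_of_ord j); split => //.
    by apply: contra Tj0 => /eqP fj; rewrite /T fj rmorph0 !mul0r.
  case=> [[_]|/eqP]; rewrite ?invrN1 ?oppr_eq0 ?oner_eq0 // => h; apply: h.
  by rewrite -sub0r; apply: OB => //; exact: integral0.
suff key a b : (a < b)%N -> f`_a != 0 -> f`_b != 0 -> O (T b / T a) -> O (T b / T a)^-1 ->
    exists N (z : int) u, [/\ (0 < N)%N, O u /\ O u^-1, u != 0 & x ^+ N = p%:R ^ z * u].
  case: (ltngtP i j) ji => // h _; first by apply: (key i j) => //; apply: mini.
  by apply: (key j i) => //; rewrite -invf_div // invrK; apply: mini.
move=> ab fa fb Oab OabV.
have [n [u [uu eu]]] := witt_decomp fa; have [m [w [uw ew]]] := witt_decomp fb.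
have u0 : iota u != 0 by rewrite (raddf_eq0 _ iotaI); apply: contraTneq uu => ->; rewrite unitr0.
have w0 : iota w != 0 by rewrite (raddf_eq0 _ iotaI); apply: contraTneq uw => ->; rewrite unitr0.
have p0 := iota_p_neq0.
have Ta0 : T a != 0 by rewrite mulf_neq0 ?expf_neq0 // (raddf_eq0 _ iotaI).
have Tb0 : T b != 0 by rewrite mulf_neq0 ?expf_neq0 // (raddf_eq0 _ iotaI).
exists (b - a)%N, (n%:Z - m%:Z), (T b / T a * iota (u * w^-1)); split.
- by rewrite subn_gt0.
- split; first by apply: OM.
  by rewrite invfM; apply: OM => //; rewrite -rmorphV ?unitrM ?unitrV ?uu // ; exact: Ow.
- have w0V : (iota w)^-1 != 0 by rewrite invr_eq0.
  have Ta0V : (T a)^-1 != 0 by rewrite invr_eq0.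
  by rewrite rmorphM rmorphV //; exact: mulf_neq0 (mulf_neq0 Tb0 Ta0V) (mulf_neq0 u0 w0V).
- rewrite /T ew eu !rmorphM !rmorphXn rmorphV // rmorph_nat expfzDr // -exprnN -!exprnP.
  have -> : x ^+ b = x ^+ (b - a) * x ^+ a by rewrite -exprD subnK // ltnW.
  by field; rewrite u0 w0 !expf_neq0.
Qed.

End IntegralClosure.
End WittRing.

End WittRings.

(** * The valuations of the algebraic closure and of its completion *)

Module ClosureAndCompletion.
Import Valuations WittRings.

Lemma frac_repr (R : idomainType) (x : {fraction R}) :
  exists a b : R, b != 0 /\ x * tofrac b = tofrac a.
Proof.
elim/quotW: x => x; exists (fraction.frac x).1, (fraction.frac x).2; split; first exact: denom_ratioP.
unlock FracField.tofrac; rewrite -[LHS]FracField.pi_mul.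
apply/eqmodP => /=; rewrite FracField.equivfE /FracField.mulf !numden_Ratio ?mulf_neq0 ?denom_ratioP ?oner_neq0 //.
by rewrite !mulr1 mulrC.
Qed.

Section Local.
Variables (p : nat) (k : fieldType) (W : witt_vectors p k).
Hypothesis pP : prime p.

Lemma frac_witt (x : {fraction W}) : exists n (w : W), p%:R ^+ n * x = tofrac w.
Proof.
have [a [b [b0 ex]]] := frac_repr x.
have [n [u [uu eb]]] := witt_decomp b0.
exists n, (a * u^-1).
have -> : tofrac (a * u^-1) = x * (p%:R ^+ n * tofrac u) * tofrac u^-1 :> {fraction W}.
  by rewrite rmorphM /= -ex eb rmorphM rmorphXn rmorph_nat.
have u0 : tofrac u != 0 :> {fraction W}.
  by rewrite tofrac_eq0; apply: contraTneq uu => ->; rewrite unitr0.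
have eV : tofrac u^-1 = (tofrac u)^-1 :> {fraction W} by rewrite rmorphV.
by rewrite eV mulrA mulfK // mulrC.
Qed.

Section KbVal.
Variable (K : fieldExtType {fraction W}).

Lemma algebraic_frac (L : fieldType) (f : {rmorphism {fraction W} -> L}) x : algebraicOver f x ->
  exists2 g : {poly W}, g != 0 & root (map_poly (f \o @tofrac W) g) x.
Proof.
move=> [q q0 rq].
have [n /choice[F hF]] : exists n, forall i, exists w : W, p%:R ^+ n * q`_i = tofrac w.
  have [n hn] : exists n, forall i, (i < size q)%N -> exists w : W, p%:R ^+ n * q`_i = tofrac w.
    elim: (size q) => [|m [n IH]]; first by exists 0%N.
    have [n' [w' hw']] := frac_witt q`_m; exists (n + n')%N => i.
    rewrite ltnS leq_eqVlt => /predU1P[->|/IH[w hw]].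
      by exists (p%:R ^+ n * w'); rewrite exprD -mulrA hw' rmorphM rmorphXn rmorph_nat.
    by exists (p%:R ^+ n' * w); rewrite addnC exprD -mulrA hw rmorphM rmorphXn rmorph_nat.
  exists n => i; case: (ltnP i (size q)) => [/hn //|h].
  by exists 0; rewrite nth_default // mulr0 rmorph0.
have p0 : p%:R != 0 :> {fraction W} by rewrite -(rmorph_nat (@tofrac W)) tofrac_eq0 witt_p_neq0.
have e : map_poly (@tofrac W) (\poly_(i < size q) F i) = p%:R ^+ n *: q.
  apply/polyP => i; rewrite coef_map coef_poly coefZ /=.
  case: ltnP => h; first by rewrite hF.
  by rewrite nth_default // mulr0 rmorph0.
exists (\poly_(i < size q) F i).
  apply/eqP => h; move: e; rewrite h rmorph0 => /esym/eqP.
  by rewrite scaler_eq0 expf_eq0 (negPf p0) andbF (negPf q0).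
rewrite map_poly_comp e linearZ /= rootE hornerZ.
by move: rq; rewrite rootE => /eqP->; rewrite mulr0.
Qed.

Variable (Kb : alg_closure K).

Definition fracKb : {rmorphism {fraction W} -> Kb} := closure_emb Kb \o in_alg K.
Definition iotaK : {rmorphism W -> Kb} := fracKb \o @tofrac W.

Lemma iotaK_inj : injective iotaK.
Proof. by move=> x y /fmorph_inj /eqP; rewrite tofrac_eq => /eqP. Qed.

Lemma algKb_frac (x : Kb) : algebraicOver fracKb x.
Proof.
have [q q0 rq] := closure_alg x; apply/integral_algebraic.
apply: (@integral_root _ _ fracKb (map_poly (closure_emb Kb) q)) => //.
  by rewrite map_poly_eq0.
move=> c /(nthP 0)[i _ <-]; rewrite coef_map; apply/integral_algebraic.
have [/polyOver1P[r er] mr] := (minPolyOver 1 q`_i, monic_minPoly 1 q`_i).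
exists r; first by rewrite -(map_poly_eq0 (in_alg K)) -er monic_neq0.
by rewrite map_poly_comp -er fmorph_root root_minPoly.
Qed.

Lemma iotaK_alg (x : Kb) : exists2 f : {poly W}, f != 0 & root (map_poly iotaK f) x.
Proof. exact: algebraic_frac (algKb_frac x). Qed.

Definition OK := val_ring (witt_to_Kb Kb).

Lemma valuedK : valued p OK.
Proof. exact: (integral_valued pP iotaK_inj iotaK_alg). Qed.

Lemma max_idealK x : max_ideal (witt_to_Kb Kb) x <-> vgt p OK 0 x.
Proof.
rewrite /max_ideal -/OK /vgt; have V := valuedK.
have [->|x0] /= := eqVneq x 0.
  by split=> // _; split; [apply: (O0 V)|left].
rewrite -(vge0P V) -(vge0P V) /vge invr_eq0 (negPf x0) (vlV V) // oppr_ge0.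
by split=> [[_ [/eqP|/negP]]|h]; rewrite ?(negPf x0) // -?ltNge //; split; [apply: ltW|right; apply/negP; rewrite -ltNge].
Qed.

Lemma gal_O (g : abs_galois Kb) x : OK x -> OK (g x).
Proof.
move=> [f mf rf]; exists f => //; rewrite -(fmorph_root (gal_mor g)) -map_poly_comp in rf.
congr (is_true (root _ _)): rf; apply: eq_map_poly => w /=; exact: gal_fix.
Qed.

End KbVal.
End Local.
Arguments OK {p k W K} Kb _.
Arguments fracKb : simpl never.
Arguments iotaK : simpl never.

Section ActVal.
Variables (p : nat) (L L' : fieldType) (O : L -> Prop) (O' : L' -> Prop).
Hypotheses (V : valued p O) (V' : valued p O') (f : {rmorphism L -> L'}).
Hypothesis fO : forall x, O x -> O' (f x).

Lemma vl_morph x : vl p O' (f x) = vl p O x.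
Proof.
have [->|x0] := eqVneq x 0; first by rewrite rmorph0 (vl0 V) (vl0 V').
apply: (vlE V'); first by rewrite fmorph_eq0.
have [N [z [u [N0 [Ou OuV] u0 xN ->]]]] := vlP V x0.
exists N, z, (f u); rewrite fmorph_eq0; split => //; last by rewrite -rmorphXn xN rmorphM fmorphXz rmorph_nat.
by split; rewrite -?fmorphV; apply: fO.
Qed.

Lemma vge_morph r x : vge p O' r (f x) = vge p O r x.
Proof. by rewrite /vge vl_morph fmorph_eq0. Qed.

Lemma vgt_morph r x : vgt p O' r (f x) = vgt p O r x.
Proof. by rewrite /vgt vl_morph fmorph_eq0. Qed.

End ActVal.

Section CompletionVal.
Variables (p : nat) (k : fieldType) (W : witt_vectors p k).
Hypothesis pP : prime p.
Variables (K : fieldExtType {fraction W}) (Kb : alg_closure K) (C : completion Kb).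

Local Notation OC := (@comp_int p k W K Kb C).
Local Notation emb := (comp_emb C).
Let VK := valuedK pP Kb.

Lemma OC0 : OC 0. Proof. by rewrite -(subrr 1); apply: comp_intB; exact: comp_int1. Qed.
Lemma OCD x y : OC x -> OC y -> OC (x + y).
Proof. by move=> hx hy; rewrite -[y]opprK -[X in - X]sub0r; apply: comp_intB => //; apply: comp_intB => //; exact: OC0. Qed.
Lemma OCX x n : OC x -> OC (x ^+ n).
Proof. by move=> hx; elim: n => [|n IH]; rewrite ?exprS; [exact: comp_int1|exact: comp_intM]. Qed.
Lemma OCp n : OC (p%:R ^+ n).
Proof.
apply: OCX; have h m : OC m%:R by elim: m => [|m IH]; rewrite ?mulrS; [exact: OC0|apply: OCD => //; exact: comp_int1].
exact: h.
Qed.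

Lemma comp_one_add x : OC x -> exists y, [/\ OC y & (1 + p%:R * x) * y = 1].
Proof.
move=> Ox; pose z := - (p%:R * x); pose u n := \sum_(i < n) z ^+ i.
have Oz : OC z by rewrite /z -sub0r; apply: comp_intB; [exact: OC0|apply: comp_intM => //; exact: (OCp 1)].
have zn n : in_pXOC p OC n (z ^+ n).
  by exists ((- x) ^+ n); [apply: OCX; rewrite -sub0r; apply: comp_intB => //; exact: OC0|rewrite /z -mulrN exprMn].
have [n|l hl] := comp_complete (u := u); first by rewrite /u big_ord_recr /= addrAC subrr add0r.
have Ou n : OC (u n).
  rewrite /u; elim: n => [|n IH]; first by rewrite big_ord0; exact: OC0.
  by rewrite big_ord_recr; apply: OCD => //; apply: OCX.
have Ol : OC l.
  have [y Oy e] := hl 0%N; rewrite -(subrK (u 0%N) l) e expr0 mul1r.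
  exact: OCD.
exists l; split => //; apply/eqP; rewrite -subr_eq0; apply/eqP/comp_separated => n.
have [y Oy e] := hl n; have [w Ow e'] := zn n.
exists ((1 - z) * y - w); first by apply: comp_intB => //; apply: comp_intM => //; apply: comp_intB => //; exact: comp_int1.
have -> : l = u n + p%:R ^+ n * y by rewrite -e addrC subrK.
have -> : 1 + p%:R * x = 1 - z by rewrite /z opprK.
have : (1 - z) * u n = 1 - z ^+ n by rewrite /u -opprB mulNr -subrX1 opprB.
rewrite e' !mulrDr => ->; ring.
Qed.

(** An approximation [y] of [x] that is one digit finer than the size of [x] satisfies
    [x = y (1 + p w)] with [w] integral. So completion does not enlarge the value group, and the
    axioms of [valued] pass from [Kb] to [C]. *)
Lemma comp_repr (x : C) : x != 0 -> exists y u, [/\ y != 0, OC u /\ OC u^-1, u != 0 & x = emb y * u].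
Proof.
move=> x0; have [n hn] : exists n, ~ in_pXOC p OC n x.
  by apply/existsNP => h; move/eqP: x0; apply; apply: comp_separated.
have [y [o Oo e]] := comp_dense x n.+1.
have p0 : p%:R != 0 :> Kb := valued_p0 VK.
have ny : ~ vge p (OK Kb) n%:R y.
  move=> /(vge_nP VK) [z Oz ey]; apply: hn.
  exists (emb z + p%:R * o); first by apply: OCD; [apply/comp_int_emb|apply: comp_intM => //; exact: (OCp 1)].
  by rewrite -[x](subrK (emb y)) e ey rmorphM rmorphXn rmorph_nat exprS; ring.
have y0 : y != 0 by apply/eqP => y0; apply: ny; rewrite y0.
have Oz : OK Kb (p%:R ^+ n / y).
  apply: (vge_total VK) => //; first by rewrite expf_neq0.
  by rewrite (vl_pX VK) ltW // ltNge; apply/negP => h; apply: ny; rewrite /vge h orbT.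
have Ox : OC (o * emb (p%:R ^+ n / y)) by apply: comp_intM => //; apply/comp_int_emb.
have [w [Ow ew]] := comp_one_add Ox.
have u0 : 1 + p%:R * (o * emb (p%:R ^+ n / y)) != 0.
  by apply: contra_eq_neq ew => ->; rewrite mul0r eq_sym oner_eq0.
exists y, (1 + p%:R * (o * emb (p%:R ^+ n / y))); split => //.
  split; last by rewrite (_ : _^-1 = w) //; apply: (mulfI u0); rewrite divff.
  by apply: OCD; [exact: comp_int1|apply: comp_intM => //; exact: (OCp 1)].
rewrite -[x](subrK (emb y)) e fmorph_div /= rmorphXn rmorph_nat exprS.
by field; rewrite fmorph_eq0.
Qed.

Lemma valuedC : valued p OC.
Proof.
split => //.
- exact: comp_int1.
- exact: comp_intB.
- exact: comp_intM.
- by rewrite -(rmorph_nat emb) fmorph_eq0 (valued_p0 VK).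
- by rewrite -(rmorph_nat emb) -fmorphV => /comp_int_emb; exact: (valued_pV VK).
- move=> x n n0 Oxn; have [->|x0] := eqVneq x 0; first exact: OC0.
  have [y [u [y0 [Ou OuV] u0 ex]]] := comp_repr x0.
  have h : OC (emb (y ^+ n)).
    have -> : emb (y ^+ n) = x ^+ n * u^-1 ^+ n by rewrite ex -exprMn mulfK // rmorphXn.
    by apply: comp_intM => //; apply: OCX.
  by rewrite ex; apply: comp_intM => //; apply/comp_int_emb/(valued_root VK n0)/comp_int_emb/h.
- move=> x x0; have [y [u [y0 [Ou OuV] u0 ex]]] := comp_repr x0.
  have [N [z [w [N0 [Ow OwV] w0 yN]]]] := valued_pow VK y0.
  exists N, z, (emb w * u ^+ N); split => //.
  + by rewrite invfM -fmorphV -exprVn; split; apply: comp_intM; solve [exact: OCX | exact/comp_int_emb].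
  + by rewrite mulf_neq0 ?fmorph_eq0 // expf_neq0.
  + by rewrite ex exprMn -rmorphXn yN rmorphM fmorphXz rmorph_nat mulrA.
Qed.

Let VC := valuedC.

Lemma vl_emb y : vl p OC (emb y) = vl p (OK Kb) y.
Proof. by apply: (vl_morph VK VC) => x Ox; apply/comp_int_emb. Qed.
Lemma vge_emb r y : vge p OC r (emb y) = vge p (OK Kb) r y.
Proof. by apply: (vge_morph VK VC) => x Ox; apply/comp_int_emb. Qed.
Lemma vgt_emb r y : vgt p OC r (emb y) = vgt p (OK Kb) r y.
Proof. by apply: (vgt_morph VK VC) => x Ox; apply/comp_int_emb. Qed.
Lemma vl_act (g : abs_galois Kb) x : vl p OC (comp_act C g x) = vl p OC x.
Proof. by apply: (vl_morph VC VC) => y Oy; apply: comp_act_int. Qed.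
Lemma vge_act (g : abs_galois Kb) r x : vge p OC r (comp_act C g x) = vge p OC r x.
Proof. by apply: (vge_morph VC VC) => y Oy; apply: comp_act_int. Qed.
Lemma vgt_act (g : abs_galois Kb) r x : vgt p OC r (comp_act C g x) = vgt p OC r x.
Proof. by apply: (vgt_morph VC VC) => y Oy; apply: comp_act_int. Qed.
Lemma vl_gal (g : abs_galois Kb) x : vl p (OK Kb) (g x) = vl p (OK Kb) x.
Proof. by apply: (vl_morph VK VK) => y Oy; apply: gal_O. Qed.
Lemma vgt_gal (g : abs_galois Kb) r x : vgt p (OK Kb) r (g x) = vgt p (OK Kb) r x.
Proof. by apply: (vgt_morph VK VK) => y Oy; apply: gal_O. Qed.

Lemma comp_approx (x : C) (n : nat) : exists y, vge p OC n%:R (x - emb y).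
Proof. by have [y h] := comp_dense x n; exists y; apply/(vge_nP VC). Qed.

Lemma vC_sep (x y : C) : (forall n : nat, vge p OC n%:R (x - y)) -> x = y.
Proof.
move=> h; apply/eqP; rewrite -subr_eq0; apply/eqP/comp_separated => n.
by have /(vge_nP VC) := h n.
Qed.

Lemma vC_lim (u : nat -> C) :
  (forall n : nat, exists m0, forall m, (m0 <= m)%N -> vge p OC n%:R (u m - u m0)) ->
  exists l, forall n : nat, exists m0, forall m, (m0 <= m)%N -> vge p OC n%:R (l - u m).
Proof.
move=> /choice [f hf]; pose g n := \max_(i < n.+1) f i.
have fg n : (f n <= g n)%N by apply: (@leq_bigmax _ (fun i : 'I_n.+1 => f i) ord_max).
have gS n : (g n <= g n.+1)%N by rewrite /g [X in (_ <= X)%N]big_ord_recr /=; apply: leq_maxl.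
have [n|l hl] := comp_complete (u := fun n => u (g n)).
  apply/(vge_nP VC); apply: (@vge_trans _ _ _ VC _ (u (f n))); first by apply: hf; apply: leq_trans (fg n) (gS n).
  by rewrite (vge_subC VC); apply: hf.
exists l => n; exists (f n) => m fm; apply: (vge_trans VC (y := u (g n))).
  by apply/(vge_nP VC); apply: hl.
apply: (vge_trans VC (y := u (f n))); first exact: hf.
by rewrite (vge_subC VC); apply: hf.
Qed.

(** A morphism preserving integrality is an isometry ([vge_morph]), hence determined on the dense
    image of [Kb]. *)
Lemma act_ext (f g : {rmorphism C -> C}) : (forall x, OC x -> OC (f x)) ->
  (forall x, OC x -> OC (g x)) -> (forall y, f (emb y) = g (emb y)) -> f =1 g.
Proof.
move=> fO gO e x; apply: vC_sep => n; have [y hy] := comp_approx x n.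
have -> : f x - g x = f (x - emb y) - g (x - emb y) by rewrite !rmorphB e; ring.
by apply: (vgeB VC); rewrite ?(vge_morph VC VC fO) ?(vge_morph VC VC gO).
Qed.

Lemma comp_act_comp (g h : abs_galois Kb) x :
  comp_act C (gal_comp g h) x = comp_act C g (comp_act C h x).
Proof.
apply: (@act_ext (comp_act C (gal_comp g h)) (comp_act C g \o comp_act C h)).
- exact: comp_act_int.
- by move=> y Oy /=; do 2 apply: comp_act_int.
- by move=> y /=; rewrite !comp_act_emb.
Qed.

Lemma comp_act_id x : comp_act C (gal_id Kb) x = x.
Proof.
apply: (@act_ext (comp_act C (gal_id Kb)) idfun) => //; first exact: comp_act_int.
by move=> y /=; rewrite comp_act_emb.
Qed.

End CompletionVal.

End ClosureAndCompletion.

(** * Extension of isomorphisms between subfields by Zorn's lemma *)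

Module FieldIsomorphisms.
Import Valuations.

Record subfield (L : fieldType) (F : L -> Prop) : Prop := Subfield {
  sf1 : F 1;
  sfB : forall x y, F x -> F y -> F (x - y);
  sfM : forall x y, F x -> F y -> F (x * y);
  sfV : forall x, F x -> F x^-1 }.

Definition alg_over (L : fieldType) (F : L -> Prop) (x : L) :=
  exists f : {poly L}, [/\ f != 0, forall i, F f`_i & root f x].

Section Extension.
Variables (L : closedFieldType) (F : L -> Prop).
Hypothesis sF : subfield F.
Hypothesis algF : forall x, alg_over F x.

(* Graphs of field isomorphisms between subfields of L that fix F. *)
Record isog (G : set (L * L)) : Prop := Isog {
  isogF : forall c, F c -> G (c, c);
  isogB : forall x y x' y', G (x, y) -> G (x', y') -> G (x - x', y - y');
  isogM : forall x y x' y', G (x, y) -> G (x', y') -> G (x * x', y * y');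
  isog0 : forall x y, G (x, y) -> (x = 0 <-> y = 0);
  isogV : forall x y, G (x, y) -> G (x^-1, y^-1) }.

(** [Q] is the image of [P] under the isomorphism with graph [G], applied to the coefficients. *)
Definition pp (G : set (L * L)) (P Q : {poly L}) := forall i, G (P`_i, Q`_i).

Lemma sf0 : F 0. Proof. by rewrite -(subrr 1); apply: (sfB sF); apply: sf1. Qed.

(** An equation with nonzero constant term, solved for the inverse, gives one polynomial [S] over
    [F] that inverts all roots of [g] at once. In [isog_adj] the same [S] therefore inverts an
    element and its image. *)
Lemma alg_inv_poly (x : L) : x != 0 -> exists g S : {poly L}, [/\ forall i, F g`_i, forall i, F S`_i,
  root g x & forall z, root g z -> z^-1 = S.[z]].
Proof.
move=> x0.
have [f [f0 Ff rf]] := algF x.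
have [g [Fg g0 rg]] : exists g : {poly L}, [/\ forall i, F g`_i, g`_0 != 0 & root g x].
  have [n] := ubnP (size f); elim: n f f0 Ff rf => // n IH f f0 Ff rf sf.
  have [f00|] := eqVneq f`_0 0; last by exists f.
  have ef : f = (f %/ 'X) * 'X.
    by rewrite divpK // -['X]subr0 dvdp_XsubCl /root horner_coef0 f00.
  apply: (IH (f %/ 'X)).
  + by apply: contraNneq f0 => h0; rewrite ef h0 mul0r.
  + by move=> i; have := Ff i.+1; rewrite {1}ef coefMX.
  + by move: rf; rewrite {1}ef rootM rootX (negPf x0) orbF.
  + by move: sf; rewrite {1}ef size_mulX ?ltnS //; apply: contraNneq f0 => h0; rewrite ef h0 mul0r.
pose S := - (g`_0)^-1 *: (\poly_(i < (size g).-1) g`_i.+1).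
have FS : forall i, F S`_i.
  move=> i; rewrite coefZ coef_poly; apply: (sfM sF).
    by rewrite -[- _]sub0r; apply: (sfB sF); [exact: sf0|apply: (sfV sF)].
  by case: ifP => _; [|exact: sf0].
have gE : g = (g`_0)%:P * (1 - S * 'X).
  apply/polyP => i; rewrite coefCM coefB coefMX coef1; case: i => [|i]; first by rewrite subr0 mulr1.
  rewrite /= sub0r /S coefZ mulNr opprK mulrA divff // mul1r coef_poly.
  by case: ltnP => // h'; rewrite nth_default //; case: (size g) h'.
have SV z : root g z -> z^-1 = S.[z].
  rewrite gE rootM rootC (negPf g0) /= /root !hornerE subr_eq0 => /eqP e.
  have z0 : z != 0 by apply: contra_eq_neq e => ->; rewrite mulr0 oner_eq0.
  by rewrite -[RHS](mulfK z0) -e mul1r.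
by exists g, S.
Qed.

Section Iso.
Variable (G : set (L * L)).
Hypothesis iG : isog G.

Lemma isog00 : G (0, 0). Proof. exact: (isogF iG sf0). Qed.
Lemma isogN x y : G (x, y) -> G (- x, - y).
Proof. by move=> h; rewrite -[- x]sub0r -[- y]sub0r; apply: (isogB iG) => //; exact: isog00. Qed.
Lemma isogD x y x' y' : G (x, y) -> G (x', y') -> G (x + x', y + y').
Proof. by move=> h h'; rewrite -[x']opprK -[y']opprK; apply: (isogB iG) => //; exact: isogN. Qed.

Lemma ppB P Q P' Q' : pp G P Q -> pp G P' Q' -> pp G (P - P') (Q - Q').
Proof. by move=> h h' i; rewrite !coefB; apply: (isogB iG). Qed.
Lemma ppD P Q P' Q' : pp G P Q -> pp G P' Q' -> pp G (P + P') (Q + Q').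
Proof. by move=> h h' i; rewrite !coefD; apply: isogD. Qed.
Lemma ppM P Q P' Q' : pp G P Q -> pp G P' Q' -> pp G (P * P') (Q * Q').
Proof.
move=> h h' i; rewrite !coefM.
elim/big_rec2: _ => [|j x y _ hxy]; first exact: isog00.
by apply: isogD => //; apply: (isogM iG).
Qed.
Lemma ppC x y : G (x, y) -> pp G x%:P y%:P.
Proof. by move=> h i; rewrite !coefC; case: eqP => // _; exact: isog00. Qed.
Lemma ppXn n : pp G 'X^n 'X^n.
Proof. by move=> i; rewrite coefXn; apply: (isogF iG); case: eqP => _; [exact: sf1|exact: sf0]. Qed.
Lemma ppF (P : {poly L}) : (forall i, F P`_i) -> pp G P P.
Proof. by move=> h i; apply: (isogF iG). Qed.

Lemma pp_size P Q : pp G P Q -> size P = size Q.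
Proof.
move=> h; apply/eqP; rewrite eqn_leq; apply/andP; split; apply/leq_sizeP => j /leq_sizeP hj.
  by apply/(isog0 iG (h j)); apply: hj.
by apply/(isog0 iG (h j)); apply: hj.
Qed.

Lemma pp_div m m' : pp G m m' -> m \is monic -> forall P Q, pp G P Q ->
  exists D D' R R', [/\ pp G D D', pp G R R', P = D * m + R, Q = D' * m' + R' & (size R < size m)%N].
Proof.
move=> hm mm P; have [n] := ubnP (size P); elim: n P => // n IH P sP Q hPQ.
case: (ltnP (size P) (size m)) => sPm.
  exists 0, 0, P, Q; rewrite !mul0r !add0r; split => // i; rewrite coef0; exact: isog00.
have sm0 : (0 < size m)%N by rewrite size_poly_gt0 monic_neq0.
set d := (size P - size m)%N.
pose E := (lead_coef P)%:P * 'X^d; pose E' := (lead_coef Q)%:P * 'X^d.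
have hE : pp G E E' by apply: ppM; [apply: ppC; rewrite !lead_coefE -(pp_size hPQ)|exact: ppXn].
have sP' : (size (P - E * m)%R < n)%N.
  have P0 : P != 0 by rewrite -size_poly_gt0; apply: leq_trans sPm.
  apply: (@leq_trans (size P)); last by rewrite -ltnS.
  have sE : size (E * m) = size P.
    have lP : lead_coef P != 0 by rewrite lead_coef_eq0.
    have E1 : E * m = ((lead_coef P)%:P * m) * 'X^d by rewrite /E mulrAC.
    have m0 : (lead_coef P)%:P * m != 0 by rewrite mulf_neq0 ?polyC_eq0 ?monic_neq0.
    by rewrite E1 size_mulXn // mul_polyC size_scale // subnK.
  have lE : lead_coef (E * m) = lead_coef P.
    by rewrite !lead_coefM lead_coefC lead_coefXn (monicP mm) !mulr1.
  rewrite (polySpred P0) ltnS; apply/leq_sizeP => j; rewrite leq_eqVlt => /predU1P[<-|hj].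
    by rewrite coefB -lead_coefE -{1}sE -lead_coefE lE subrr.
  by rewrite coefB !nth_default ?subrr // ?sE (polySpred P0).
have [D [D' [R [R' [hD hR eP eQ sR]]]]] := IH _ sP' _ (ppB hPQ (ppM hE hm)).
exists (D + E), (D' + E'), R, R'; split => //; first exact: ppD.
  by rewrite mulrDl addrAC -eP subrK.
by rewrite mulrDl addrAC -eQ subrK.
Qed.

Lemma isog_adj x y : (forall P Q, pp G P Q -> (P.[x] = 0 <-> Q.[y] = 0)) ->
  isog [set z | exists P Q, pp G P Q /\ z = (P.[x], Q.[y])]%classic.
Proof.
move=> hxy; split.
- move=> c Fc; exists c%:P, c%:P; rewrite !hornerC; split => //; apply: ppC; exact: (isogF iG).
- move=> _ _ _ _ [P [Q [h [-> ->]]]] [P' [Q' [h' [-> ->]]]]; exists (P - P'), (Q - Q').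
  by rewrite !hornerE; split => //; exact: ppB.
- move=> _ _ _ _ [P [Q [h [-> ->]]]] [P' [Q' [h' [-> ->]]]]; exists (P * P'), (Q * Q').
  by rewrite !hornerE; split => //; exact: ppM.
- by move=> _ _ [P [Q [h [-> ->]]]]; apply: hxy.
- move=> _ _ [P [Q [h [-> ->]]]].
  have [Px0|Px0] := eqVneq P.[x] 0.
    have /(hxy _ _ h) -> := Px0; rewrite Px0 !invr0.
    by exists 0, 0; rewrite !horner0; split => // i; rewrite coef0; exact: isog00.
  have [g [S [Fg FS rg SV]]] := alg_inv_poly Px0.
  have hg : pp G (g \Po P) (g \Po Q).
    rewrite !comp_polyE; elim/big_rec2: _ => [i|i A B _ hAB]; first by rewrite coef0; exact: isog00.
    apply: ppD => //; rewrite -!mul_polyC; apply: ppM; first by apply/ppC/(isogF iG).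
    elim: (nat_of_ord i) => [|j IH]; last by rewrite !exprS; apply: ppM.
    by rewrite !expr0; exact: (ppXn 0).
  have rg' : root g Q.[y].
    by rewrite /root -horner_comp; apply/eqP/(hxy _ _ hg)/eqP; rewrite horner_comp.
  rewrite (SV _ rg) (SV _ rg') -!horner_comp.
  exists (S \Po P), (S \Po Q); split => //.
  rewrite !comp_polyE; elim/big_rec2: _ => [i|i A B _ hAB]; first by rewrite coef0; exact: isog00.
  apply: ppD => //; rewrite -!mul_polyC; apply: ppM; first by apply/ppC/(isogF iG).
  elim: (nat_of_ord i) => [|j IH]; last by rewrite !exprS; apply: ppM.
  by rewrite !expr0; exact: (ppXn 0).
Qed.

(** With [R] a condition on the first polynomial this gives minimal polynomials; with [R] a
    condition on the second, it serves in [isog_conj] to control the transported polynomial. *)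
Lemma pp_min (R : {poly L} -> {poly L} -> Prop) P0 Q0 : pp G P0 Q0 -> P0 != 0 -> R P0 Q0 ->
  (forall P Q c d, R P Q -> R (c *: P) (d *: Q)) ->
  exists m m', [/\ pp G m m', m \is monic, R m m', (size m <= size P0)%N
    & forall P Q, pp G P Q -> P != 0 -> R P Q -> (size m <= size P)%N].
Proof.
move=> h0 P00 R0 RZ.
pose S n := `[< exists P Q, [/\ pp G P Q, P != 0, R P Q & size P = n] >].
have exS : exists n, S n by exists (size P0); apply/asboolP; exists P0, Q0.
case: (ex_minnP exS) => n /asboolP[P [Q [h Pn0 RPQ sP]]] mn.
exists ((lead_coef P)^-1 *: P), ((lead_coef Q)^-1 *: Q).
have sz : size ((lead_coef P)^-1 *: P) = n by rewrite size_scale ?invr_eq0 ?lead_coef_eq0.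
split.
- rewrite -!mul_polyC; apply: ppM => //; apply/ppC/(isogV iG).
  by rewrite !lead_coefE -(pp_size h).
- by rewrite monicE lead_coefZ mulVf ?lead_coef_eq0.
- exact: RZ.
- by rewrite sz; apply: mn; apply/asboolP; exists P0, Q0.
- by move=> P' Q' h' n0' R'; rewrite sz; apply: mn; apply/asboolP; exists P', Q'.
Qed.

(** Division by [m] reduces to degrees below that of [m]. If a nonzero remainder were transported to
    a polynomial killing [y], a pair [(r, r')] of least degree with this property would have [r]
    dividing [m]; then [x] would be a root of [r] or of the cofactor, both of too small degree. *)
Lemma isog_conj x y m m' : pp G m m' -> m \is monic -> root m x -> root m' y ->
  (forall P Q, pp G P Q -> P != 0 -> root P x -> (size m <= size P)%N) ->
  forall P Q, pp G P Q -> (P.[x] = 0 <-> Q.[y] = 0).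
Proof.
move=> hm mm mx my minm P Q hPQ.
have [D [D' [R [R' [hD hR eP eQ sR]]]]] := pp_div hm mm hPQ.
rewrite eP eQ !hornerE; move: (mx) (my); rewrite /root => /eqP-> /eqP->; rewrite !mulr0 !add0r.
have RR' : R = 0 <-> R' = 0.
  split=> e; apply/eqP; rewrite -size_poly_eq0; first by rewrite -(pp_size hR) e size_poly0.
  by rewrite (pp_size hR) e size_poly0.
split=> [Rx|Ry].
  have [/RR'-> //|R0] := eqVneq R 0; first by rewrite horner0.
  by have := minm _ _ hR R0; rewrite /root Rx eqxx leqNgt sR => /(_ isT).
have [->|R0] := eqVneq R 0; first by rewrite horner0.
exfalso.
have [||r [r' [hr mr ry sr minr]]] := @pp_min (fun _ Q => root Q y) _ _ hR R0.
- by rewrite /root Ry.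
- by move=> P1 Q1 c d; rewrite /root hornerZ => /eqP->; rewrite mulr0.
have [E [E' [S [S' [hE hS em em' sS]]]]] := pp_div hr mr hm.
have S0 : S = 0.
  apply/eqP/negPn/negP => S0; have := minr _ _ hS S0; rewrite leqNgt sS => h; suff // : false by [].
  apply: h; move: my; rewrite em' /root !hornerE; move: ry; rewrite /root => /eqP->.
  by rewrite mulr0 add0r.
move: em; rewrite S0 addr0 => em.
have srm : (size r < size m)%N by apply: leq_ltn_trans sr sR.
have r0 : r != 0 by apply: monic_neq0.
have E0 : E != 0.
  by apply: contraTneq mm => E0; rewrite em E0 mul0r monicE lead_coef0 eq_sym oner_eq0.
move: mx; rewrite {1}em rootM => /orP[rx|rx]; last first.
  by have := minm _ _ hr r0 rx; rewrite leqNgt srm.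
have sr1 : (1 < size r)%N.
  rewrite ltn_neqAle size_poly_gt0 r0 andbT eq_sym; apply/eqP => sr1.
  have := pp_size hr; rewrite sr1 => /esym /eqP /size_poly1P[c c0 er'].
  by move: ry; rewrite er' rootC (negPf c0).
have := minm _ _ hE E0 rx; rewrite em size_mul // leqNgt; case/negP.
have : (0 < size E)%N by rewrite size_poly_gt0.
by move: sr1; case: (size r) => [|[|n]] // _ _; rewrite addnS addnS /= ltnS leq_addr.
Qed.

Lemma isog_min x : exists m m', [/\ pp G m m', m \is monic, root m x, (1 < size m')%N
  & forall P Q, pp G P Q -> P != 0 -> root P x -> (size m <= size P)%N].
Proof.
have [f [f0 Ff rf]] := algF x.
have [||m [m' [hm mm mx _ minm]]] := @pp_min (fun P _ => root P x) _ _ (ppF Ff) f0.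
- by [].
- by move=> P1 Q1 c d; rewrite /root hornerZ => /eqP->; rewrite mulr0.
exists m, m'; split => //; rewrite -(pp_size hm) ltn_neqAle size_poly_gt0 monic_neq0 // andbT eq_sym.
by apply/eqP => /eqP /size_poly1P[c c0 em]; move: mx; rewrite em rootC (negPf c0).
Qed.

End Iso.

Lemma isog_total_ext (G0 : set (L * L)) : isog G0 -> exists G, [/\ isog G, (G0 `<=` G)%classic
  & forall x, exists y, G (x, y)].
Proof.
(* Zorn's lemma is applied to the sets [X] whose union with [G0] is a graph, so that the empty chain
   needs no separate treatment. *)
move=> i0; have [Fam FP totF|A [iA maxA]] := @Zorn_bigcup _ [set X | isog (X `|` G0)]%classic.
  have both z z' : ((\bigcup_(X in Fam) X) `|` G0)%classic z -> ((\bigcup_(X in Fam) X) `|` G0)%classic z' ->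
      exists X, [/\ isog X, X z, X z' & (X `<=` (\bigcup_(X in Fam) X) `|` G0)%classic].
    have one X : Fam X -> [/\ isog (X `|` G0)%classic & ((X `|` G0) `<=` (\bigcup_(X in Fam) X) `|` G0)%classic].
      by move=> FX; split; [apply: FP|move=> t [Xt|]; [left; exists X|right]].
    case=> [[X FX Xz]|z0] [[X' FX' Xz']|z0'].
    - case: (totF _ _ FX FX') => le; last first.
        by have [i s] := one _ FX; exists (X `|` G0)%classic; split => //; left => //; apply: le.
      by have [i s] := one _ FX'; exists (X' `|` G0)%classic; split => //; left => //; apply: le.
    - by have [i s] := one _ FX; exists (X `|` G0)%classic; split => //; [left|right].
    - by have [i s] := one _ FX'; exists (X' `|` G0)%classic; split => //; [right|left].
    - by exists G0; split => // t; right.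
  split.
  - by move=> c Fc; right; apply: (isogF i0).
  - by move=> x y x' y' h h'; have [X [iX Xz Xz' s]] := both _ _ h h'; apply/s/(isogB iX).
  - by move=> x y x' y' h h'; have [X [iX Xz Xz' s]] := both _ _ h h'; apply/s/(isogM iX).
  - by move=> x y h; have [X [iX Xz _ s]] := both _ _ h h; apply: (isog0 iX).
  - by move=> x y h; have [X [iX Xz _ s]] := both _ _ h h; apply/s/(isogV iX).
exists (A `|` G0)%classic; split => //; try by move=> t; right.
move=> x; have [m [m' [hm mm mx sm minm]]] := isog_min iA x.
have /closed_rootP[y my] : size m' != 1%N by rewrite neq_ltn sm orbT.
have hxy := isog_conj iA hm mm mx my minm.
have iG := isog_adj iA hxy; set G := [set _ | _]%classic in iG.
have sG : (A `|` G0 `<=` G)%classic.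
  by move=> [u v] h; exists u%:P, v%:P; rewrite !hornerC; split => //; apply: ppC.
have Gxy : G (x, y).
  by exists 'X, 'X; rewrite !hornerX; split => //; exact: (ppXn iA 1).
exists y; apply: contrapT => nA; apply: (maxA G).
  split; first by move=> t h; apply: sG; left.
  by move=> h; apply: nA; left; apply: h.
rewrite /= setUidl //; apply: subset_trans sG; exact: subsetUr.
Qed.

(* An endomorphism over F permutes the roots of each polynomial over F. *)
Lemma alg_endo_surj (s : L -> L) : {morph s : x y / x - y} -> s 1 = 1 -> {morph s : x y / x * y} ->
  (forall c, F c -> s c = c) -> bijective s.
Proof.
move=> sB s1 sM sF'.
have s0 : s 0 = 0 by rewrite -(subrr 1) sB s1 subrr.
pose s1z : zmod_morphism s := sB.
pose s1m : monoid_morphism s := (s1, sM).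
pose M1 := GRing.isZmodMorphism.Build L L s s1z.
pose M2 := GRing.isMonoidMorphism.Build L L s s1m.
pose sr : {rmorphism L -> L} := HB.pack s M1 M2.
have injs : injective s := fmorph_inj sr.
have surj z : exists x, s x = z.
  have [f [f0 Ff rf]] := algF z.
  have [r er] := closed_field_poly_normal f.
  have rts x : root f x = (x \in undup r).
    by rewrite er rootZ ?lead_coef_eq0 // root_prod_XsubC mem_undup.
  have sub : {subset map s (undup r) <= undup r}.
    move=> _ /mapP[x hx ->]; rewrite -rts; rewrite -rts in hx.
    have -> : f = map_poly sr f by apply/polyP => i; rewrite coef_map /= sF'.
    by rewrite (fmorph_root sr).
  have us : uniq (map s (undup r)) by rewrite map_inj_uniq ?undup_uniq.
  have [_ e] := uniq_min_size us sub (eq_leq (esym (size_map s _))).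
  by move: rf; rewrite rts -e => /mapP[x _ ->]; exists x.
have [t ht] := choice surj.
exists t => x; last exact: ht.
by apply: injs; rewrite ht.
Qed.

(** The diagonal of [F] is enlarged by the pair [(a, b)] and then until it is total; a total graph
    is a function. *)
Lemma conj_aut_fun a b : (forall P : {poly L}, (forall i, F P`_i) -> root P a -> root P b) ->
  exists s : L -> L, [/\ {morph s : x y / x - y}, s 1 = 1, {morph s : x y / x * y},
    forall c, F c -> s c = c & s a = b].
Proof.
move=> hab; pose D := [set z | F z.1 /\ z.2 = z.1]%classic.
have iD : isog D.
  split => //=.
  - by move=> x y x' y' [/= Fx ->] [/= Fx' ->]; split => //; apply: (sfB sF).
  - by move=> x y x' y' [/= Fx ->] [/= Fx' ->]; split => //; apply: (sfM sF).
  - by move=> x y [/= Fx ->].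
  - by move=> x y [/= Fx ->]; split => //; apply: (sfV sF).
have [m [m' [hm mm mx sm minm]]] := isog_min iD a.
have Fm i : F m`_i by case: (hm i).
have em : m' = m by apply/polyP => i; case: (hm i).
have my : root m' b by rewrite em; apply: hab.
have hxy := isog_conj iD hm mm mx my minm.
have iG := isog_adj iD hxy; set G := [set _ | _]%classic in iG.
have [H [iH sGH totH]] := isog_total_ext iG.
have [s hs] := choice totH.
have fun_ x y y' : H (x, y) -> H (x, y') -> y = y'.
  move=> h h'; apply/eqP; rewrite -subr_eq0; apply/eqP/(isog0 iH (isogB iH h h')).
  exact: subrr.
exists s; split.
- by move=> x y; apply: (fun_ (x - y)) => //; apply: (isogB iH).
- by apply: (fun_ 1) => //; apply/(isogF iH)/(sf1 sF).
- by move=> x y; apply: (fun_ (x * y)) => //; apply: (isogM iH).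
- by move=> c Fc; apply: (fun_ c) => //; apply: (isogF iH).
- apply: (fun_ a) => //; apply: sGH; exists 'X, 'X; rewrite !hornerX; split => //.
  exact: (ppXn iD 1).
Qed.

End Extension.

End FieldIsomorphisms.

(** * Absolute Galois groups: conjugates, fixed fields, finite orbits, compactness *)

Module GaloisGroups.
Import Valuations FieldIsomorphisms.

Section GaloisTheory.
Variables (K : fieldType) (Kb : alg_closure K).
Local Notation emb := (closure_emb Kb).
Local Notation G := (abs_galois Kb).

Definition baseF (x : Kb) : Prop := exists c, x = emb c.

Lemma baseF_subfield : subfield baseF.
Proof.
split; first by exists 1; rewrite rmorph1.
- by move=> _ _ [a ->] [b ->]; exists (a - b); rewrite rmorphB.
- by move=> _ _ [a ->] [b ->]; exists (a * b); rewrite rmorphM.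
- by move=> _ [a ->]; exists a^-1; rewrite fmorphV.
Qed.

Lemma baseF_alg x : alg_over baseF x.
Proof.
have [q q0 rq] := closure_alg x; exists (map_poly emb q); split => //.
  by rewrite map_poly_eq0.
by move=> i; exists q`_i; rewrite coef_map.
Qed.

Lemma mkgal (s : Kb -> Kb) : {morph s : x y / x - y} -> s 1 = 1 -> {morph s : x y / x * y} ->
  (forall c, s (emb c) = emb c) -> exists g : G, g =1 s.
Proof.
move=> sB s1 sM sF.
have bs : bijective s.
  by apply: (alg_endo_surj baseF_alg) => // _ [c ->].
pose s1z : zmod_morphism s := sB.
pose s1m : monoid_morphism s := (s1, sM).
pose M1 := GRing.isZmodMorphism.Build Kb Kb s s1z.
pose M2 := GRing.isMonoidMorphism.Build Kb Kb s s1m.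
pose sr : {rmorphism Kb -> Kb} := HB.pack s M1 M2.
by exists (@AbsGalois K Kb sr bs sF).
Qed.

Lemma gal_inj (g : G) : injective g. Proof. exact: fmorph_inj. Qed.

Lemma gal_inv_ex (g : G) : exists h : G, (forall x, h (g x) = x) /\ (forall x, g (h x) = x).
Proof.
have [t gt tg] := gal_bij g.
have [] := @mkgal t.
- by move=> x y; apply: (gal_inj (g := g)); rewrite rmorphB !tg.
- by apply: (gal_inj (g := g)); rewrite tg rmorph1.
- by move=> x y; apply: (gal_inj (g := g)); rewrite rmorphM !tg.
- by move=> c; apply: (gal_inj (g := g)); rewrite tg gal_fix.
by move=> h hE; exists h; split => x; rewrite hE ?gt ?tg.
Qed.

Lemma gal_iter (g : G) n : exists h : G, forall x, h x = iter n g x.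
Proof.
elim: n => [|n [h hE]]; first by exists (gal_id Kb).
by exists (gal_comp g h) => x /=; rewrite hE.
Qed.

Section FixedField.
Variable F : Kb -> Prop.
Hypotheses (sF : subfield F) (bF : forall c, F (emb c)).

Lemma F_alg x : alg_over F x.
Proof. by have [f [f0 Ff rf]] := baseF_alg x; exists f; split => // i; have [c ->] := Ff i. Qed.

Lemma gal_conj (a b : Kb) : (forall P : {poly Kb}, (forall i, F P`_i) -> root P a -> root P b) ->
  exists g : G, (forall c, F c -> g c = c) /\ g a = b.
Proof.
move=> h; have [s [sB s1 sM sF' sab]] := conj_aut_fun sF F_alg h.
have [|g gE] := @mkgal s sB s1 sM; first by move=> c; apply: sF'.
by exists g; split => [c Fc|]; rewrite gE; [exact: sF'|exact: sab].
Qed.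

(** All roots of the minimal polynomial of [x] over [F] are conjugates of [x], so it is a power of
    [X - x]; in characteristic 0 its derivative excludes an exponent above 1. *)
Lemma gal_fixed_field (x : Kb) : (forall n, n.+1%:R != 0 :> Kb) ->
  (forall g : G, (forall c, F c -> g c = c) -> g x = x) -> F x.
Proof.
move=> ch0 hx; pose D := [set z : Kb * Kb | F z.1 /\ z.2 = z.1]%classic.
have iD : isog F D.
  split => //=.
  - by move=> a b a' b' [/= Fx ->] [/= Fx' ->]; split => //; apply: (sfB sF).
  - by move=> a b a' b' [/= Fx ->] [/= Fx' ->]; split => //; apply: (sfM sF).
  - by move=> a b [/= Fx ->].
  - by move=> a b [/= Fx ->]; split => //; apply: (sfV sF).
have [m [m' [hm mm mx sm minm]]] := isog_min sF F_alg iD x.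
have Fm i : F m`_i by case: (hm i).
have em : m' = m by apply/polyP => i; case: (hm i).
rewrite em in sm hm.
have [r er] := closed_field_poly_normal m; rewrite (monicP mm) scale1r in er.
have allx : all (pred1 x) r.
  apply/allP => b br /=.
  have mb : root m b by rewrite er root_prod_XsubC.
  have hxb := isog_conj sF iD hm mm mx mb minm.
  have [|g [gF <-]] := @gal_conj x b.
    by move=> P FP; rewrite /root => /eqP /(hxb P P (ppF iD FP)) /eqP.
  by rewrite hx.
have {allx}er : m = ('X - x%:P) ^+ (size r).
  rewrite er; elim: (r) allx => [|b s IH] /=; first by rewrite big_nil.
  by case/andP => /eqP -> /IH e; rewrite big_cons e exprS.
case: (size r) er => [|[|n]] er.
- by move: sm; rewrite er expr0 size_poly1.
- have := Fm 0%N; rewrite er expr1 coefB coefX coefC /= sub0r => Fx.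
  by rewrite -[x]opprK -sub0r; apply: (sfB sF) => //; apply: (sf0 sF).
exfalso; pose d := m^`().
have dE : d = ('X - x%:P) ^+ n.+1 *+ n.+2.
  by rewrite /d er deriv_exp derivXsubC mul1r.
have d0 : d != 0.
  rewrite dE -scaler_nat scaler_eq0 negb_or ch0.
  by rewrite expf_neq0 // polyXsubC_eq0.
have Fd i : F d`_i.
  have FD a b : F a -> F b -> F (a + b).
    by move=> Fa Fb; rewrite -[b]opprK -[X in - X]sub0r; do 2 apply: (sfB sF _ _) => //; apply: (sf0 sF).
  have FMn a j : F a -> F (a *+ j).
    by move=> Fa; elim: j => [|j IH]; rewrite ?mulr0n ?mulrS; [apply: (sf0 sF)|apply: FD].
  by rewrite /d coef_deriv; apply: FMn.
have rd : root d x by rewrite dE rootE hornerMn horner_exp !hornerE subrr exprS mul0r mul0rn.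
have := minm _ _ (ppF iD Fd) d0 rd.
by rewrite leqNgt lt_size_deriv // monic_neq0.
Qed.

End FixedField.

Lemma gal_fixed_base (x : Kb) : (forall n, n.+1%:R != 0 :> Kb) -> (forall g : G, g x = x) -> exists c, x = emb c.
Proof.
move=> ch0 hx; apply: (gal_fixed_field baseF_subfield) => //.
by move=> c; exists c.
Qed.

Lemma gal_finite (x : Kb) : exists s : seq Kb, forall g : G, g x \in s.
Proof.
have [q q0 rq] := closure_alg x.
have [r er] := closed_field_poly_normal (map_poly emb q).
exists r => g; rewrite -root_prod_XsubC -(rootZ _ _ (_ : lead_coef (map_poly emb q) != 0)); last first.
  by rewrite lead_coef_eq0 map_poly_eq0.
rewrite -er; have -> : map_poly emb q = map_poly g (map_poly emb q).
  by rewrite -map_poly_comp; apply: eq_map_poly => c /=; rewrite gal_fix.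
by rewrite fmorph_root.
Qed.

Lemma gal_orbit (S : G -> Prop) (x : Kb) :
  exists2 s : seq Kb, uniq s & forall y, y \in s <-> exists2 g, S g & g x = y.
Proof.
have [r hr] := gal_finite x.
exists (undup [seq y <- r | `[< exists2 g, S g & g x = y >]]); first exact: undup_uniq.
move=> y; rewrite mem_undup mem_filter; split=> [/andP[/asboolP //]|[g Sg e]].
by rewrite -{2}e hr andbT; apply/asboolP; exists g.
Qed.

Section Ultra.
Variables (I : Type) (U : set_system I).
Hypothesis UU : UltraFilter U.

Lemma ultra_seq (T : eqType) (s : seq T) (f : I -> T) :
  U [set i | f i \in s]%classic -> exists2 y, y \in s & U [set i | f i = y]%classic.
Proof.
elim: s => [|a s IH].
  move=> h; exfalso; have [i] := filter_ex h; done.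
move=> h; have [h1|h1] := @in_ultra_setVsetC _ U [set i | f i = a]%classic UU.
  by exists a; rewrite // mem_head.
have [|y ys hy] := IH; last by exists y; rewrite // in_cons ys orbT.
apply: filterS (filterI h h1) => i [/=]; rewrite in_cons => /orP[/eqP|] //.
Qed.

Lemma gal_ultralimit (g : I -> G) : exists h : G, forall x, U [set i | g i x = h x]%classic.
Proof.
have ex x : exists y, U [set i | g i x = y]%classic.
  have [s hs] := gal_finite x; have [|y _ hy] := @ultra_seq _ s (fun i => g i x); last by exists y.
  by apply: filterS filterT => i _ /=.
have [s hs] := choice ex.
have uniq_ x y : U [set i | g i x = y]%classic -> s x = y.
  by move=> h; have [i [/= -> ->]] := filter_ex (filterI (hs x) h).
have [] := @mkgal s.
- by move=> x y; apply: uniq_; apply: filterS (filterI (hs x) (hs y)) => i [/= <- <-]; rewrite rmorphB.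
- by apply: uniq_; apply: filterS filterT => i _ /=; rewrite rmorph1.
- by move=> x y; apply: uniq_; apply: filterS (filterI (hs x) (hs y)) => i [/= <- <-]; rewrite rmorphM.
- by move=> c; apply: uniq_; apply: filterS filterT => i _ /=; rewrite gal_fix.
by move=> h hE; exists h => x; rewrite hE.
Qed.

Lemma ultra_all (T : eqType) (s : seq T) (P : T -> I -> Prop) :
  (forall x, x \in s -> U (P x)) -> U [set i | forall x, x \in s -> P x i]%classic.
Proof.
elim: s => [|a s IH] h; first by apply: filterS filterT.
have h1 : U (P a) by apply: h; rewrite mem_head.
have {IH}h2 : U [set i | forall x, x \in s -> P x i]%classic.
  by apply: IH => x xs; apply: h; rewrite in_cons xs orbT.
by apply: filterS (filterI h1 h2) => i [/= Pa Ps] x; rewrite in_cons => /predU1P[->|/Ps].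
Qed.

End Ultra.

End GaloisTheory.

End GaloisGroups.

(** * Ax's approximation of almost fixed elements by fixed ones *)

Module AxApproximation.
Import Valuations ClosureAndCompletion GaloisGroups.

Section BinomialValuation.
Variable p : nat.
Hypothesis pP : prime p.

Lemma logn_sub_small n k i : (p ^ k %| n)%N -> (0 < i)%N -> (i < p ^ k)%N -> (i < n)%N ->
  logn p (n - i) = logn p i.
Proof.
move=> dn i0 ik lin; have ni0 : (0 < n - i)%N by rewrite subn_gt0.
have dvdE e : (e <= k)%N -> (p ^ e %| n - i)%N = (p ^ e %| i)%N.
  move=> ek; have de : (p ^ e %| n)%N by apply: dvdn_trans dn; apply: dvdn_exp2l.
  by rewrite dvdn_subr // ltnW.
have nk : ~~ (p ^ k %| i)%N by apply: contraL ik => /(dvdn_leq i0); rewrite -leqNgt.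
have li : (logn p i < k)%N by rewrite ltnNge -pfactor_dvdn.
have lni : (logn p (n - i) < k)%N by rewrite ltnNge -pfactor_dvdn // dvdE.
apply/eqP; rewrite eqn_leq; apply/andP; split.
  by rewrite -pfactor_dvdn // -dvdE ?(ltnW lni) // pfactor_dvdn.
by rewrite -pfactor_dvdn // dvdE ?(ltnW li) // pfactor_dvdn.
Qed.

(** Each factor [n - j] with [0 < j < p^k] has the same [p]-valuation as [j], so numerator and
    denominator cancel. *)
Lemma logn_bin_pred n k : (p ^ k %| n)%N -> (0 < n)%N -> logn p 'C(n.-1, (p ^ k).-1) = 0%N.
Proof.
move=> dn n0; have pk0 : (0 < p ^ k)%N by rewrite expn_gt0 prime_gt0.
have le : (p ^ k <= n)%N := dvdn_leq n0 dn.
have key j : (j < p ^ k)%N -> logn p (n.-1 ^_ j) = logn p j`!.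
  elim: j => [|j IH] hj; first by rewrite ffactn0 fact0.
  have jn : (j.+1 < n)%N by apply: leq_trans hj le.
  have e : (n.-1 - j = n - j.+1)%N by lia.
  have f0 : (0 < n.-1 ^_ j)%N by rewrite ffact_gt0; lia.
  rewrite ffactnSr factS !lognM ?fact_gt0 // ?subn_gt0; last by lia.
  by rewrite IH ?(ltnW hj) // addnC e (logn_sub_small dn).
have hj0 : ((p ^ k).-1 < p ^ k)%N by rewrite prednK.
have := key _ hj0; rewrite -bin_ffact lognM ?bin_gt0 ?fact_gt0 //; last by lia.
lia.
Qed.

Lemma logn_bin_pk n k : (p ^ k %| n)%N -> (0 < n)%N ->
  logn p 'C(n, p ^ k) = (logn p n - k)%N.
Proof.
move=> dn n0; have pk0 : (0 < p ^ k)%N by rewrite expn_gt0 prime_gt0.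
have le : (p ^ k <= n)%N := dvdn_leq n0 dn.
have e := mul_bin_diag n (p ^ k).-1; rewrite prednK // in e.
have C0 : (0 < 'C(n.-1, (p ^ k).-1))%N by rewrite bin_gt0; lia.
have C1 : (0 < 'C(n, p ^ k))%N by rewrite bin_gt0.
have := congr1 (logn p) e; rewrite !lognM // logn_bin_pred // pfactorK //; lia.
Qed.

End BinomialValuation.

Lemma ltn_add_sub N q j : (q < N)%N -> (N - q < j)%N -> (N < q + j)%N.
Proof. lia. Qed.

Section Ax.
Variables (p : nat) (K : fieldType) (Kb : alg_closure K) (O : Kb -> Prop).
Hypothesis V : valued p O.
Local Notation G := (abs_galois Kb).
Hypothesis gO : forall (g : G) x, O x -> O (g x).
Variable S : G -> Prop.
Hypothesis S1 : S (gal_id Kb).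
Hypothesis SM : forall g h, S g -> S h -> S (gal_comp g h).
Local Notation vge := (vge p O).
Local Notation vl := (vl p O).

Lemma vge_galO (g : G) r x : vge r (g x) = vge r x.
Proof. by apply: (vge_morph V V) => y; apply: gO. Qed.

(** The [i]-th Taylor coefficient at [b] is a sum of products of [size s - i] differences
    [b - x]. *)
Lemma prod_nderivn_vge (s : seq Kb) (b : Kb) (u : rat) i :
  (forall x, x \in s -> vge u (b - x)) ->
  vge (((size s)%:R - i%:R) * u) ((\prod_(x <- s) ('X - x%:P))^`N(i)).[b].
Proof.
elim: s i => [|x s IH] i hs.
  rewrite big_nil; case: i => [|i]; first by rewrite nderivn0 hornerC subrr mul0r; apply/(vge0P V)/(valued_1 V).
  by rewrite nderivnC horner0; apply: vge_0.
have {}IH j : vge (((size s)%:R - j%:R) * u) ((\prod_(x <- s) ('X - x%:P))^`N(j)).[b].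
  by apply: IH => y ys; apply: hs; rewrite in_cons ys orbT.
have hx : vge u (b - x) by apply: hs; rewrite mem_head.
rewrite big_cons /=; set P := \prod_(_ <- _) _ in IH *.
have step j : vge (((size s).+1%:R - j%:R) * u) ((b - x) * (P^`N(j)).[b]).
  apply: vge_le (vgeM V hx (IH j)); rewrite mulrS; lra.
case: i => [|i]; first by have := step 0%N; rewrite !nderivn0 hornerM !hornerE.
have -> : ('X - x%:P) * P = (P * 'X + 0%:P) - x *: P.
  by rewrite mulrBl addr0 mul_polyC [P * 'X]mulrC.
rewrite nderivnB nderivnMXaddC nderivnZ !hornerE.
have := IH i; have := step i.+1; set A := (P^`N(i)).[b]; set B := (P^`N(i.+1)).[b] => hB hA.
have -> : A + B * b - x * B = A + (b - x) * B by ring.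
by apply: (vgeD V) => //; apply: vge_le hA; rewrite !mulrS; lra.
Qed.

Lemma prod_root_near (s : seq Kb) (b c : Kb) (w : rat) : c != 0 -> (0 < size s)%N ->
  vge ((size s)%:R * w + vl c) (c * \prod_(x <- s) (b - x)) ->
  exists2 x, x \in s & vge w (b - x).
Proof.
move=> c0 s0 h; apply: contrapT => hn.
have lt x : x \in s -> b - x != 0 /\ vl (b - x) < w.
  move=> xs; have : ~~ vge w (b - x) by apply/negP => h'; apply: hn; exists x.
  by rewrite /Valuations.vge negb_or -ltNge => /andP[].
rewrite [X in vge _ X]mulrC (vge_mulIr V) // /Valuations.vge in h.
suff [P0 lP] : \prod_(x <- s) (b - x) != 0 /\ vl (\prod_(x <- s) (b - x)) < (size s)%:R * w.
  by move: h; rewrite (negPf P0) /= leNgt lP.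
elim: s s0 lt {h hn} => [|x s IH] //= _ lt; rewrite big_cons.
have [x0 lx] := lt x (mem_head _ _); case: s IH lt => [|y s] IH lt.
  by rewrite big_nil mulr1 mul1r.
have [|z zs|P0 lP] := IH; rewrite //; first by apply: lt; rewrite in_cons zs orbT.
by rewrite mulf_neq0 // (vlM V) // mulrS mulrDl mul1r; split => //; apply: ltrD.
Qed.

Lemma stable_seq_prod (g : G) (s : seq Kb) : uniq s -> (forall x, x \in s -> g x \in s) ->
  map_poly g (\prod_(x <- s) ('X - x%:P)) = \prod_(x <- s) ('X - x%:P).
Proof.
move=> us hs; rewrite rmorph_prod.
under eq_bigr do rewrite rmorphB /= map_polyX map_polyC /=.
rewrite -(big_map g xpredT (fun y => 'X - y%:P)); apply: perm_big.
have usg : uniq (map g s) by rewrite map_inj_uniq //; exact: fmorph_inj.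
apply: uniq_perm => //; have sub : {subset map g s <= s} by move=> _ /mapP[x xs ->]; apply: hs.
by have [] := uniq_min_size usg sub (eq_leq (esym (size_map g s))).
Qed.

Variables (y : Kb) (r : rat).
Hypothesis hy : forall g, S g -> vge r (g y - y).

(** A root [c] of the divided derivative of order [q] of the orbit polynomial of [b] is close to [b]
    and has at most [N - q] conjugates, so induction applies. The allowed loss [p - p / N]
    telescopes: for [N = p q] it exceeds the loss allowed at [N - q] by exactly [1 / (N - q)], which
    is the loss of this step. *)
Lemma ax_step (b : Kb) (u : rat) (s : seq Kb) : u <= r -> vge u (b - y) -> uniq s ->
  (forall z, z \in s <-> exists2 g, S g & g b = z) ->
  exists a, (forall g, S g -> g a = a) /\ vge (u - (p%:R - p%:R / (size s)%:R)) (a - y).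
Proof.
have pP := valued_prime V; have p1 := prime_gt1 pP.
have [n] := ubnP (size s); elim: n b u s => // n IH b u s sn ur hb us sE.
have bs : b \in s by apply/sE; exists (gal_id Kb).
have s0 : (0 < size s)%N by case: (s) bs.
have sstab g x : S g -> x \in s -> g x \in s.
  by move=> Sg /sE[h Sh <-]; apply/sE; exists (gal_comp g h) => //; apply: SM.
have [s1|s1] := leqP (size s) 1.
  have e1 : size s = 1%N by apply/eqP; rewrite eqn_leq s1.
  exists b; split; last by rewrite e1 divr1 subrr subr0.
  move=> g Sg; have := sstab g b Sg bs; case: (s) e1 bs => [|c [|]] // _.
  by rewrite !inE => /eqP <- /eqP.
set N := size s in s0 s1 sn *.
(* If [N] is not a power of [p], its [p]-part [q] makes the leading coefficient ['C(N, q)] prime to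
   [p] and nothing is lost. If it is one, [q = N / p] gives a leading coefficient of valuation 1. *)
have [q [k [qE qN dN dq]]] : exists q k, [/\ q = (p ^ k)%N, (q < N)%N, (q %| N)%N &
   (logn p N - k = 0)%N \/ N = (p * q)%N /\ (logn p N - k = 1)%N].
  have [m cop e] := pfactor_coprime pP s0; set l := logn p N in e.
  have [m1|m1] := eqVneq m 1%N; last first.
    have m0 : (0 < m)%N by rewrite lt0n; apply: contraTneq s0 => m0; rewrite e m0.
    exists (p ^ l)%N, l; split => //; last by left; rewrite subnn.
      by rewrite [X in (_ < X)%N]e -[X in (X < _)%N]mul1n ltn_pmul2r ?expn_gt0 ?prime_gt0 // ltn_neqAle eq_sym m1.
    by rewrite [X in (_ %| X)%N]e dvdn_mull.
  have l0 : (0 < l)%N.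
    by rewrite lt0n; apply: contraTneq s1 => l0; rewrite e m1 l0.
  have eN : N = (p * p ^ l.-1)%N by rewrite e m1 mul1n -expnS prednK.
  exists (p ^ l.-1)%N, l.-1; split => //; last by right; split => //; rewrite -/l -{1}(prednK l0) subSnn.
    by rewrite [X in (_ < X)%N]eN -[X in (X < _)%N]mul1n ltn_pmul2r ?expn_gt0 ?prime_gt0.
  by rewrite [X in (_ %| X)%N]eN dvdn_mull.
pose f := \prod_(x <- s) ('X - x%:P).
have sf : size f = N.+1 by rewrite size_prod_XsubC.
have mf : f \is monic by apply: monic_prod_XsubC.
pose D := f^`N(q).
have q0 : (0 < q)%N by rewrite qE expn_gt0 prime_gt0.
have C0 : (0 < 'C(N, q))%N by rewrite bin_gt0 ltnW.
have DN : D`_(N - q) = 'C(N, q)%:R.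
  rewrite /D coef_nderivn subnKC ?(ltnW qN) //.
  by move/monicP: mf; rewrite lead_coefE sf /= => ->.
have CL0 : 'C(N, q)%:R != 0 :> Kb by apply: (valued_nat0 V).
have sD : size D = (N - q).+1.
  apply/eqP; rewrite eqn_leq; apply/andP; split; last first.
    by rewrite ltnNge; apply: contra CL0 => h; rewrite -DN nth_default.
  apply/leq_sizeP => j hj; rewrite coef_nderivn nth_default ?mul0rn // sf; exact: ltn_add_sub.
have D0 : D != 0 by rewrite -size_poly_gt0 sD.
have [rs ers] := closed_field_poly_normal D.
have lD : lead_coef D = 'C(N, q)%:R by rewrite lead_coefE sD.
have srs : size rs = (N - q)%N.
  by move: sD; rewrite ers size_scale ?lead_coef_eq0 // size_prod_XsubC => -[].
have near x : x \in s -> vge u (b - x).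
  move=> /sE[g Sg <-].
  have -> : b - g b = (b - y) - (g y - y) - g (b - y) by rewrite rmorphB; ring.
  apply: (vgeB V); last by rewrite vge_galO.
  by apply: (vgeB V) => //; apply: vge_le (hy Sg).
have hD := prod_nderivn_vge q near.
pose w := u - (logn p N - k)%:R / (N - q)%:R.
have Nq0 : (N - q)%:R != 0 :> rat by rewrite pnatr_eq0 -lt0n subn_gt0.
have [c crs hc] : exists2 c, c \in rs & vge w (b - c).
  apply: (@prod_root_near _ _ 'C(N, q)%:R) => //; first by rewrite srs subn_gt0.
  have -> : 'C(N, q)%:R * \prod_(x <- rs) (b - x) = D.[b].
    rewrite [in RHS]ers hornerZ lD horner_prod; congr (_ * _).
    by apply: eq_bigr => x _; rewrite !hornerE.
  apply: vge_le hD; rewrite srs (vl_nat V) // {2}qE logn_bin_pk -?qE // /w.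
  by rewrite -natrB ?(ltnW qN) // mulrBr [X in _ - X]mulrC divfK // subrK.
have [s' us' sE'] := gal_orbit S c.
have s'sub : {subset s' <= undup rs}.
  move=> z /sE'[g Sg <-]; rewrite mem_undup -root_prod_XsubC.
  have rD x : root D x = root (\prod_(z <- rs) ('X - z%:P)) x.
    by rewrite ers rootZ ?lead_coef_eq0.
  rewrite -rD; have -> : D = map_poly g D.
    apply/polyP => i; rewrite coef_map /= !coef_nderivn rmorphMn /=; congr (_ *+ _).
    have ef : map_poly g f = f := stable_seq_prod us (fun x => @sstab g x Sg).
    by rewrite -{1}ef coef_map.
  by rewrite fmorph_root rD root_prod_XsubC.
have ls' : (size s' <= N - q)%N.
  by rewrite -srs; apply: leq_trans (uniq_leq_size us' s'sub) (size_undup _).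
have w_u : w <= u by rewrite /w gerBl divr_ge0.
have hcy : vge w (c - y).
  by apply: (vge_trans V (y := b)); [rewrite (vge_subC V)|apply: vge_le hb].
have [||a [aS ha]] := IH c w s' _ _ hcy us' sE'; [|exact: le_trans ur|]; first by apply: leq_ltn_trans ls' _; apply: (@leq_trans N); [rewrite ltn_subrL q0 s0|rewrite -ltnS].
exists a; split => //; apply: vge_le ha.
have s'0 : (0 < size s')%N by have : c \in s' by [apply/sE'; exists (gal_id Kb)]; case: (s').
have h1 : p%:R / (N - q)%:R <= p%:R / (size s')%:R :> rat.
  by rewrite ler_pM2l ?ltr0n ?prime_gt0 // lef_pV2 ?posrE ?ltr0n ?ler_nat ?subn_gt0.
suff h2 : (logn p N - k)%:R / (N - q)%:R <= p%:R / (N - q)%:R - p%:R / N%:R :> rat by rewrite /w; lra.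
case: dq => [->|[eN ->]]; rewrite ?mul0r ?subr_ge0.
  by rewrite ler_pM2l ?ltr0n ?prime_gt0 // lef_pV2 ?posrE ?ltr0n ?ler_nat ?subn_gt0 ?leq_subr.
have Nr0 : N%:R != 0 :> rat by rewrite pnatr_eq0 -lt0n.
have -> : p%:R / (N - q)%:R - p%:R / N%:R = (p * q)%:R / N%:R / (N - q)%:R :> rat.
  by rewrite natrM; move: Nq0; rewrite natrB ?(ltnW qN) // => Nq0; field; rewrite Nq0 Nr0.
by rewrite -eN divff // mul1r div1r.
Qed.

Lemma ax_fixed_approx : exists a, (forall g, S g -> g a = a) /\ vge (r - p%:R) (a - y).
Proof.
have [s us sE] := gal_orbit S y.
have [||a [aS ha]] := @ax_step y r s _ _ us sE => //; first by rewrite subrr; apply: vge_0.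
exists a; split => //; apply: vge_le ha; have : 0 <= p%:R / (size s)%:R :> rat by rewrite divr_ge0.
by lra.
Qed.

End Ax.

End AxApproximation.

(** * Valuations in the cyclotomic tower *)

Module CyclotomicValuations.
Import Valuations WittRings ClosureAndCompletion.

Section DistinctValuations.
Variables (p : nat) (L : fieldType) (O : L -> Prop).
Hypothesis V : valued p O.

(** The unique term of least valuation determines the valuation of the sum, so a bound on the sum
    bounds this term and hence all of them. *)
Lemma vge_sum_distinct (I : finType) (t : I -> L) r :
  (forall i j, t i != 0 -> t j != 0 -> vl p O (t i) = vl p O (t j) -> i = j) ->
  vge p O r (\sum_i t i) -> forall i, vge p O r (t i).
Proof.
move=> inj hs i; apply: contrapT => /negP hi.
have ti0 : t i != 0 by apply: contraNneq hi => ->; apply: vge_0.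
case: (@Order.TotalTheory.arg_minP _ _ _ i (fun i => t i != 0) (fun i => vl p O (t i)) ti0) => j tj0 jmin.
have lt : vgt p O (vl p O (t j)) (\sum_(l | l != j) t l).
  apply: (vgt_sum V) => l lj; rewrite /vgt; have [//|tl0] /= := eqVneq (t l) 0.
  by rewrite lt_neqAle jmin // andbT; apply: contra lj => /eqP /(inj _ _ tj0 tl0) ->.
move: hs; rewrite (bigD1 j) //= /vge.
have [-> s0] := vl_add_lt V tj0 lt; rewrite (negPf s0) /= => rj.
by move: hi; rewrite /vge (negPf ti0) /= (le_trans rj (jmin _ ti0)).
Qed.
End DistinctValuations.

(* (1 + mu)^p = 1 + lam forces v(mu) = v(lam)/p, or v(mu) = 1/(p-1) when lam = 0. *)
Lemma binomial_tail_ring (R : comNzRingType) q (x : R) : prime q -> (2 < q)%N ->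
  (1 + x) ^+ q - 1 = x ^+ q + q%:R * x * (1 + x * \sum_(i < q.-2) ('C(q, i.+2) %/ q)%N%:R * x ^+ i).
Proof.
case: q => [|[|m]] // qP _; set q := m.+2 in qP *.
rewrite exprDn big_ord_recl big_ord_recl big_ord_recr /= /bump /= !add1n.
rewrite expr0 !expr1n bin0 !mul1r mulr1n bin1 binn expr1.
have -> : \sum_(i < m) 1 ^+ (m.+2 - i.+2) * x ^+ i.+2 *+ 'C(m.+2, i.+2) =
   q%:R * x * (x * \sum_(i < m) ('C(q, i.+2) %/ q)%N%:R * x ^+ i).
  rewrite !mulr_sumr; apply: eq_bigr => i _; rewrite expr1n mul1r -mulr_natl.
  have d : (q %| 'C(q, i.+2))%N by apply: prime_dvd_bin => //=; rewrite /q !ltnS ltn_ord.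
  by rewrite -{1}(divnK d) natrM !exprS; ring.
by rewrite -[x *+ _]mulr_natl -/q; ring.
Qed.

Section Cyclotomic.
Variables (p : nat) (k : fieldType) (W : witt_vectors p k).
Hypotheses (pP : prime p) (p_odd : odd p).
Variables (K : fieldExtType {fraction W}) (Kb : alg_closure K).
Let V := valuedK pP Kb.
Local Notation O := (OK Kb).
Local Notation vl := (vl p (OK Kb)).
Local Notation vge := (vge p (OK Kb)).
Local Notation vgt := (vgt p (OK Kb)).
Variable z : nat -> Kb.
Hypothesis hz : compatible_roots z.

Let z0 : z 0%N = 1. Proof. by case: hz. Qed.
Let z1 : z 1%N != 1. Proof. by case: hz. Qed.
Let zS n : z n.+1 ^+ p = z n. Proof. by case: hz. Qed.
Let p2 : (2 < p)%N. Proof. by move: (prime_gt1 pP); case: (ltngtP p 2) p_odd => // ->. Qed.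

Lemma zeta_exp n m : z (n + m) ^+ (p ^ m) = z n.
Proof. by elim: m => [|m IH]; rewrite ?addn0 // addnS expnS exprM zS. Qed.

Lemma zeta_unity n : z n ^+ (p ^ n) = 1.
Proof. by rewrite -[n in z n]add0n zeta_exp. Qed.

Lemma O_zeta n : O (z n).
Proof.
apply: (valued_root V (n := p ^ n)); first by rewrite expn_gt0 prime_gt0.
by rewrite zeta_unity; apply: valued_1 V.
Qed.

Lemma zetaS_neq1 n : z n.+1 != 1.
Proof. by elim: n => [|n IH] //; apply: contra IH => /eqP e; rewrite -zS e expr1n. Qed.

Lemma zeta_prim n : (p ^ n).-primitive_root (z n).
Proof.
have pn0 : (0 < p ^ n)%N by rewrite expn_gt0 prime_gt0.
have [m pm dm] := prim_order_exists pn0 (zeta_unity n).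
have [j jn em] : exists2 j, (j <= n)%N & m = (p ^ j)%N by apply/dvdn_pfactor.
suff e : j = n by rewrite -{1}e -em.
apply/eqP; rewrite eqn_leq jn leqNgt; apply/negP => lt.
have : z (n - j) = 1.
  by rewrite -(zeta_exp (n - j) j) subnK ?(ltnW lt) // -em; apply: prim_expr_order.
by move=> e1; have := zetaS_neq1 (n - j).-1; rewrite prednK ?subn_gt0 // e1 eqxx.
Qed.

Lemma binomial_tail (x : Kb) : O x -> exists2 t, O t & (1 + x) ^+ p - 1 = x ^+ p + p%:R * x * (1 + x * t).
Proof.
move=> Ox; rewrite (binomial_tail_ring x pP p2) -/(_ + _).
exists (\sum_(i < p.-2) ('C(p, i.+2) %/ p)%N%:R * x ^+ i) => //.
by apply: (O_sum V) => i _; apply: (valued_M V); [apply: (Onat V)|apply: (OX V)].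
Qed.

(** At the first level [x^(p-1) = - p (1 + x t)] fixes the valuation. At the next ones [x^p] agrees
    with the preceding [y] up to a multiple of [p], and [y] has valuation below 1. *)
Lemma vl_zeta_sub1 n : vl (z n.+1 - 1) = ((p ^ n * p.-1)%N%:R)^-1.
Proof.
have pr0 : p%:R != 0 :> rat by rewrite pnatr_eq0 -lt0n prime_gt0.
have p10 : p.-1%:R != 0 :> rat by rewrite pnatr_eq0; move: p2; case: (p) => [|[|]].
have vpos (x : Kb) : O x -> vge 1 (x ^+ p) -> vgt 0 x.
  move=> Ox; rewrite /Valuations.vge /Valuations.vgt expf_eq0 prime_gt0 //=; have [//|x0] := eqVneq x 0.
  by rewrite (vlX V) //= -mulr_natr => h; rewrite -(@pmulr_lgt0 _ p%:R) ?ltr0n ?prime_gt0 // (lt_le_trans ltr01).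
have Oz1 m : O (z m - 1) by apply: (valued_B V); [apply: O_zeta|apply: valued_1 V].
elim: n => [|n IH].
  set x := z 1 - 1; have x0 : x != 0 by rewrite subr_eq0.
  have Ox : O x := Oz1 1%N.
  have [t Ot] := binomial_tail Ox; rewrite subrKC zS z0 subrr -/x => /esym e.
  have v0 : vgt 0 x.
    apply: vpos; first exact: Oz1.
    rewrite -[X in vge _ X](addrK (p%:R * x * (1 + x * t))) e sub0r (vgeN V).
    rewrite -[1]addr0 -mulrA (vge_pM V); apply/(vge0P V)/(valued_M V) => //.
    by apply: (OD V); [apply: valued_1 V|apply: (valued_M V)].
  have e2 : x ^+ p.-1 = - (p%:R * (1 + x * t)).
    apply: (mulfI x0); rewrite -exprS prednK ?prime_gt0 //; apply/eqP; rewrite -subr_eq0 -e; apply/eqP; ring.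
  have v1 : vl (1 + x * t) = 0 /\ 1 + x * t != 0.
    have [] := @vl_sub_lt _ _ _ V 1 (1 + x * t); rewrite ?oner_eq0 // ?(vl1 V) //.
    by rewrite addrAC subrr add0r -[0]addr0; apply: (vgtM V) => //; apply/(vge0P V).
  have : vl (x ^+ p.-1) = 1.
    by rewrite e2 (vlN V) (vlM V) ?(valued_p0 V) ?v1.2 // v1.1 (vl_p V) addr0.
  rewrite (vlX V) // expn0 mul1n -[vl x *+ _]mulr_natr => h.
  by apply: (mulIf p10); rewrite h mulVf.
set x := z n.+2 - 1; set y := z n.+1 - 1 in IH *.
have y0 : y != 0 by rewrite subr_eq0 zetaS_neq1.
have Ox : O x := Oz1 n.+2.
have [t Ot] := binomial_tail Ox; rewrite subrKC zS -/x -/y => e.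
have lt1 : vl y < 1.
  rewrite IH invf_lt1 ?ltr1n ?ltr0n.
    by apply: (@leq_trans (1 * p.-1)); [rewrite mul1n; move: p2; case: (p) => [|[|[|]]]|rewrite leq_mul2r expn_gt0 prime_gt0 // orbT].
  by rewrite muln_gt0 expn_gt0 prime_gt0 //; move: p2; case: (p) => [|[|]].
have [vx x0] : vl (x ^+ p) = vl y /\ x ^+ p != 0.
  apply: (vl_sub_lt V) => //.
  have -> : x ^+ p - y = - (p%:R * (x * (1 + x * t))) by rewrite e; ring.
  rewrite (vgtN V); apply: (@vge_vgt _ _ _ _ 1) => //.
  have := vge_pM V 0 (x * (1 + x * t)); rewrite addr0 => ->.
  apply/(vge0P V)/(valued_M V) => //.
  by apply: (OD V); [apply: valued_1 V|apply: (valued_M V)].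
have xn0 : x != 0 by rewrite subr_eq0 zetaS_neq1.
move: vx; rewrite (vlX V) // IH -[vl x *+ _]mulr_natr => h.
apply: (mulIf pr0); rewrite h expnS -mulnA [in RHS]natrM invfM [in RHS]mulrAC mulVf // mul1r //.
Qed.

Lemma frac_vl (c : {fraction W}) : c != 0 -> exists2 i : int, vl (fracKb Kb c) = i%:~R
  & (0 <= i)%R -> exists w, c = tofrac w.
Proof.
move=> c0; have [n [w e]] := frac_witt c.
have p0 : p%:R != 0 :> {fraction W}.
  by rewrite -(fmorph_eq0 (fracKb Kb)) rmorph_nat (valued_p0 V).
have w0 : w != 0.
  by rewrite -(tofrac_eq0 w) -e mulf_neq0 // expf_neq0.
have [m [u [uu ew]]] := witt_decomp w0.
have iu0 : iotaK Kb u != 0.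
  by rewrite (raddf_eq0 _ (@iotaK_inj _ _ _ _ Kb)); apply: contraTneq uu => ->; rewrite unitr0.
have vu : vl (iotaK Kb u) = 0.
  apply: (vl_unit V) => //; first exact: integral_id.
  by rewrite -rmorphV //; exact: integral_id.
have ec : fracKb Kb c = p%:R ^+ m * iotaK Kb u / p%:R ^+ n.
  have h : p%:R ^+ n * fracKb Kb c = p%:R ^+ m * iotaK Kb u.
    have := congr1 (fracKb Kb) e; rewrite rmorphM rmorphXn rmorph_nat ew => ->.
    by rewrite -[LHS]/(iotaK Kb (p%:R ^+ m * u)) rmorphM rmorphXn rmorph_nat.
  by rewrite -h mulrAC divff ?mul1r // expf_neq0 // (valued_p0 V).
exists (m%:Z - n%:Z).
  rewrite ec (vlM V) ?(vlM V) ?(vlV V) ?(vl_pX V) ?vu ?mulf_neq0 ?invr_eq0 ?expf_neq0 ?(valued_p0 V) //.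
  by rewrite addr0 rmorphB.
rewrite subr_ge0 => nm; exists (p%:R ^+ (m - n) * u).
apply: (mulfI (expf_neq0 n p0)); rewrite e ew !rmorphM !rmorphXn rmorph_nat mulrA -exprD subnKC //.
Qed.

End Cyclotomic.

End CyclotomicValuations.

(** * Integers and automorphisms of the cyclotomic tower over the fraction field of [W] *)

Module CyclotomicIntegers.
Import Valuations ClosureAndCompletion FieldIsomorphisms GaloisGroups AxApproximation CyclotomicValuations.

(** Modulo [p^2] the sum is [p + p e 'C(p, 2)], and [p] divides ['C(p, 2)] because [p] is odd. *)
Lemma logn_geometric p e : prime p -> odd p -> logn p (\sum_(0 <= u < p) (1 + p * e) ^ u) = 1%N.
Proof.
move=> pP podd.
have /choice[x hx] u : exists x, ((1 + p * e) ^ u = 1 + u * (p * e) + p ^ 2 * x)%N.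
  elim: u => [|u [x IH]]; first by exists 0%N; rewrite expn0; lia.
  exists (x * (1 + p * e) + u * e * e)%N; rewrite expnSr IH; nia.
have d : (p %| 'C(p, 2))%N.
  by apply: prime_dvd_bin => //; move: (prime_gt1 pP) podd; case: (ltngtP p 2) => // ->.
have -> : (\sum_(0 <= u < p) (1 + p * e) ^ u = p * (1 + p * ('C(p, 2) %/ p * e + \sum_(0 <= u < p) x u)))%N.
  under eq_bigr do rewrite hx.
  rewrite !big_split /= sum_nat_const_nat subn0 muln1 -big_distrl -big_distrr /= bin2_sum -{1}(divnK d); nia.
rewrite lognM; [|exact: prime_gt0|by []]; set Y := ('C(p, 2) %/ p * e + _)%N.
have -> : logn p (1 + p * Y) = 0%N.
  by apply: logn_coprime; rewrite -coprime_modr addnC mulnC modnMDl coprime_modr coprimen1.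
by rewrite logn_prime // eqxx.
Qed.

Lemma int_div_uniq (a b : int) (D i j : nat) : (i < D)%N -> (j < D)%N ->
  a * D%:Z + i%:Z = b * D%:Z + j%:Z -> i = j.
Proof.
move=> iD jD e; have ab : a = b.
  case: (ltrgtP a b) => // h; exfalso.
    have h1 : (a + 1) * D%:Z <= b * D%:Z by rewrite ler_wpM2r // -ltzD1 ltrD2r.
    lia.
  have h1 : (b + 1) * D%:Z <= a * D%:Z by rewrite ler_wpM2r // -ltzD1 ltrD2r.
  lia.
by move: e; rewrite ab => /addrI [].
Qed.

Lemma geomX_monic (R : idomainType) q P : (0 < q)%N -> (0 < P)%N ->
  let f : {poly R} := \sum_(i < q) 'X^(i * P) in f \is monic /\ size f = (P * q.-1).+1.
Proof.
case: q => // q _ P0 /=.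
have sf : (size (\sum_(i < q) 'X^(i * P) : {poly R})%R < size ('X^(q * P) : {poly R})%R)%N.
  rewrite size_polyXn ltnS; apply: leq_trans (size_sum _ _ _) _; apply/bigmax_leqP => i _.
  by rewrite size_polyXn; have := ltn_ord i; nia.
rewrite big_ord_recr /= addrC monicE lead_coefDl // lead_coefXn eqxx size_polyDl // size_polyXn.
by rewrite mulnC.
Qed.

Lemma eval_shift (R S : fieldType) (f : {rmorphism R -> S}) (g : {poly R}) x :
  (map_poly f (g \Po ('X + 1))).[x] = (map_poly f g).[x + 1].
Proof.
rewrite map_comp_poly horner_comp; congr (_.[_]).
have -> : map_poly f ('X + 1) = 'X + 1 by rewrite rmorphD /= map_polyX rmorph1.
by rewrite !hornerE.
Qed.

Section CycloRings.
Variables (p : nat) (k : fieldType) (W : witt_vectors p k).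
Hypotheses (pP : prime p) (p_odd : odd p).
Variables (K : fieldExtType {fraction W}) (Kb : alg_closure K).
Let V := valuedK pP Kb.
Local Notation O := (OK Kb).
Local Notation vl := (vl p (OK Kb)).
Local Notation vge := (vge p (OK Kb)).
Local Notation F := {fraction W}.
Variable z : nat -> Kb.
Hypothesis hz : compatible_roots z.

(** [Kb] seen as an algebraic closure of the fraction field of [W], over which the cyclotomic tower
    is totally ramified; over [K] this can fail. *)
Definition Kb0 : alg_closure {fraction W} := @AlgClosure {fraction W} Kb (fracKb Kb) (@algKb_frac _ _ _ _ Kb).
Local Notation G0 := (abs_galois Kb0).

Lemma gal0_O (g : G0) (x : Kb) : O x -> O (g x).
Proof.
move=> [f mf rf]; exists f => //; rewrite -(fmorph_root (gal_mor g)) -map_poly_comp in rf.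
congr (is_true (root _ _)): rf; apply: eq_map_poly => w /=; exact: (gal_fix g (tofrac w)).
Qed.

Lemma gal0_vge (g : G0) r (x : Kb) : vge r (g x) = vge r x.
Proof. exact: (vge_galO (Kb := Kb0) V gal0_O). Qed.

Definition Wz n (x : Kb) := exists h : {poly W}, x = (map_poly (iotaK Kb) h).[z n].
Definition Fz n (x : Kb) := exists h : {poly F}, x = (map_poly (fracKb Kb) h).[z n].

Lemma Wz_O n x : Wz n x -> O x.
Proof.
move=> [h ->]; rewrite horner_coef; apply: (O_sum V) => i _; apply: (valued_M V).
  by rewrite coef_map; exact: integral_id.
by apply/(OX V)/O_zeta.
Qed.

Lemma WzF n x : Wz n x -> Fz n x.
Proof. by move=> [h ->]; exists (map_poly (@tofrac W) h); rewrite -map_poly_comp. Qed.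

Lemma WzB n x y : Wz n x -> Wz n y -> Wz n (x - y).
Proof. by move=> [h ->] [h' ->]; exists (h - h'); rewrite rmorphB !hornerE. Qed.
Lemma WzM n x y : Wz n x -> Wz n y -> Wz n (x * y).
Proof. by move=> [h ->] [h' ->]; exists (h * h'); rewrite rmorphM !hornerE. Qed.
Lemma Wz_iota n w : Wz n (iotaK Kb w).
Proof. by exists w%:P; rewrite map_polyC hornerC. Qed.
Lemma Wz_nat n m : Wz n m%:R.
Proof. by rewrite -(rmorph_nat (iotaK Kb)); exact: Wz_iota. Qed.
Lemma WzD n x y : Wz n x -> Wz n y -> Wz n (x + y).
Proof. by move=> h h'; rewrite -[y]opprK -[X in - X]sub0r; do 2 apply: WzB => //; exact: (Wz_nat _ 0). Qed.
Lemma Wz_zeta n i : Wz n (z n ^+ i).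
Proof. by exists 'X^i; rewrite map_polyXn hornerXn. Qed.
Lemma Wz_sum n (I : Type) (s : seq I) (P : pred I) (E : I -> Kb) :
  (forall i, P i -> Wz n (E i)) -> Wz n (\sum_(i <- s | P i) E i).
Proof. by move=> h; elim/big_rec: _ => [|i x Pi hx]; [exact: (Wz_nat _ 0)|apply: WzD => //; apply: h]. Qed.

Lemma Fz_subfield n : subfield (Fz n).
Proof.
have FM x y : Fz n x -> Fz n y -> Fz n (x * y).
  by move=> [h ->] [h' ->]; exists (h * h'); rewrite rmorphM !hornerE.
have FB x y : Fz n x -> Fz n y -> Fz n (x - y).
  by move=> [h ->] [h' ->]; exists (h - h'); rewrite rmorphB !hornerE.
have Fc c : Fz n (fracKb Kb c) by exists c%:P; rewrite map_polyC hornerC.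
have F0 : Fz n 0 by rewrite -(rmorph0 (fracKb Kb)).
have FD x y : Fz n x -> Fz n y -> Fz n (x + y).
  by move=> h h'; rewrite -[y]opprK -[X in - X]sub0r; exact: (FB _ _ h (FB _ _ F0 h')).
split => //; first by rewrite -(rmorph1 (fracKb Kb)).
move=> x Fx; have [->|x0] := eqVneq x 0; first by rewrite invr0.
have [g [S [_ FS rg SV]]] := alg_inv_poly (baseF_subfield Kb0) (@baseF_alg _ Kb0) x0.
have FX i : Fz n (x ^+ i).
  by elim: i => [|i IH]; rewrite ?expr0 ?exprS; [rewrite -(rmorph1 (fracKb Kb))|apply: FM].
rewrite (SV _ rg) horner_coef; elim/big_rec: _ => // i y _ Fy; apply: FD => //.
have [c ->] := FS i; exact: (FM _ _ (Fc c) (FX i)).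
Qed.

Section Level.
Variable m : nat.
Let D := (p ^ m * p.-1)%N.
Let lam := z m.+1 - 1.

Let D0 : (0 < D)%N.
Proof. by rewrite muln_gt0 expn_gt0 prime_gt0 //; move: (prime_gt1 pP); case: (p) => [|[]]. Qed.

Let lam0 : lam != 0. Proof. by rewrite subr_eq0; apply: zetaS_neq1. Qed.

(** Nonzero elements of the base field have integral valuation, so the nonzero terms have valuations
    in distinct classes [i / D] modulo the integers. *)
Lemma lam_lin (c : nat -> F) r : vge r (\sum_(i < D) fracKb Kb (c i) * lam ^+ i) ->
  forall i, (i < D)%N -> vge r (fracKb Kb (c i) * lam ^+ i).
Proof.
have Dr0 : D%:R != 0 :> rat by rewrite pnatr_eq0 -lt0n.
move=> h i iD; apply: (vge_sum_distinct V _ h (Ordinal iD)) => {i iD h} i j.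
rewrite !mulf_eq0 !negb_or => /andP[ci _] /andP[cj _].
rewrite fmorph_eq0 in ci; rewrite fmorph_eq0 in cj.
have [a ea _] := frac_vl pP Kb ci; have [b eb _] := frac_vl pP Kb cj.
rewrite !(vlM V) ?fmorph_eq0 ?expf_neq0 // ea eb !(vlX V) // vl_zeta_sub1 // -/D.
rewrite -[_ *+ i]mulr_natr -[_ *+ j]mulr_natr => e.
have {}e : a * D%:Z + i%:Z = b * D%:Z + j%:Z.
  have : (a * D%:Z + i%:Z)%:~R = (b * D%:Z + j%:Z)%:~R :> rat.
    rewrite !intrD !intrM; apply: (mulfI (invr_neq0 Dr0)).
    by rewrite !mulrDr ![_^-1 * (_ * _)]mulrCA !mulVf // !mulr1.
  exact: intr_inj.
apply: val_inj => /=; exact: int_div_uniq e.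
Qed.

(** The cyclotomic polynomial of order [p^(m+1)] in the variable [X + 1], of which [lam] is a
    root. *)
Let Psi : {poly F} := (\sum_(i < p) 'X^(i * p ^ m)) \Po ('X + 1).

Lemma Psi_monic : Psi \is monic /\ size Psi = D.+1.
Proof.
rewrite /Psi; set f := \sum_(i < p) _.
have [mf sf] : f \is monic /\ size f = D.+1 by apply: geomX_monic; rewrite ?expn_gt0 ?prime_gt0.
have sX : size ('X + 1 : {poly F}) = 2%N by rewrite size_XaddC.
have lX : lead_coef ('X + 1 : {poly F}) = 1 by rewrite lead_coefXaddC.
split; first by rewrite monicE lead_coef_comp ?sX // lX expr1n mulr1 (monicP mf).
by rewrite size_comp_poly2 // sf.
Qed.

Lemma Psi_root j : coprime p j -> (map_poly (fracKb Kb) Psi).[z m.+1 ^+ j - 1] = 0.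
Proof.
move=> cop; rewrite eval_shift subrK.
rewrite rmorph_sum horner_sum; set w := z 1%N ^+ j.
have -> : \sum_(i < p) (map_poly (fracKb Kb) 'X^(i * p ^ m)).[z m.+1 ^+ j] = \sum_(i < p) w ^+ i.
  apply: eq_bigr => i _; rewrite map_polyXn hornerXn /w -(zeta_exp hz 1 m) add1n -!exprM.
  by congr (_ ^+ _); lia.
have w1 : w != 1.
  rewrite /w -(prim_order_dvd (zeta_prim pP hz 1)) expn1.
  by rewrite -prime_coprime.
have wp : w ^+ p = 1 by rewrite /w exprAC -[X in _ ^+ X ^+ _]expn1 zeta_unity // expr1n.
apply: (mulfI (_ : w - 1 != 0)); first by rewrite subr_eq0.
by rewrite -subrX1 wp subrr mulr0.
Qed.

Lemma eval_lam (h : {poly F}) : (map_poly (fracKb Kb) h).[z m.+1] =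
  \sum_(i < D) fracKb Kb ((h \Po ('X + 1)) %% Psi)`_i * lam ^+ i.
Proof.
have [mP sP] := Psi_monic; set h1 := h \Po ('X + 1).
have -> : (map_poly (fracKb Kb) h).[z m.+1] = (map_poly (fracKb Kb) h1).[lam].
  by rewrite eval_shift subrK.
rewrite {1}(divp_eq h1 Psi) rmorphD rmorphM !hornerE.
have := Psi_root (coprimen1 p); rewrite expr1 -/lam => ->; rewrite mulr0 add0r.
rewrite (@horner_coef_wide _ D); last first.
  rewrite size_map_poly -ltnS -sP ltn_modp; exact: monic_neq0.
by apply: eq_bigr => i _; rewrite coef_map.
Qed.

(** In the basis of powers of [lam], [lam_lin] makes the valuations of the coefficients greater than
    [-1]; being integers, they are nonnegative. *)
Lemma Fz_integral x : Fz m.+1 x -> O x -> Wz m.+1 x.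
Proof.
move=> [h ->]; rewrite eval_lam; set r := _ %% Psi => Ox.
apply: Wz_sum => i _; apply: WzM; last first.
  have Wl : Wz m.+1 lam by apply: WzB; [rewrite -[z _]expr1; exact: Wz_zeta|exact: (Wz_nat _ 1)].
  by elim: (nat_of_ord i) => [|j IH]; rewrite ?expr0 ?exprS; [exact: (Wz_nat _ 1)|exact: WzM].
have /(vge0P V)/(lam_lin (c := fun i => r`_i)) h1 := Ox.
have {h1} : vge 0 (fracKb Kb r`_i * lam ^+ i) := h1 i (ltn_ord i).
have [->|c0] := eqVneq r`_i 0; first by rewrite rmorph0; move=> _; exact: (Wz_nat _ 0).
have [a ea aW] := frac_vl pP Kb c0.
rewrite /Valuations.vge mulf_eq0 fmorph_eq0 (negPf c0) expf_eq0 (negPf lam0) andbF !orFb.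
rewrite (vlM V) ?fmorph_eq0 ?expf_neq0 // ea (vlX V) // vl_zeta_sub1 // -/D -[_ *+ i]mulr_natr => h0.
have [w ->] : exists w, r`_i = tofrac w.
  apply: aW; have Di : D%:R^-1 * i%:R < 1 :> rat by rewrite mulrC ltr_pdivrMr ?ltr0n // mul1r ltr_nat.
  have : - 1 < a%:~R :> rat by lra.
  by rewrite -[- 1 : rat]/((-1)%:~R) ltr_int; lia.
exact: Wz_iota.
Qed.

(** By [lam_lin] the powers of [lam] below [D] are linearly independent, so the polynomial is a
    multiple of [Psi], which has all the primitive roots of unity shifted by 1 as roots. *)
Lemma zeta_conj (h : {poly F}) j : coprime p j -> (map_poly (fracKb Kb) h).[z m.+1] = 0 ->
  (map_poly (fracKb Kb) h).[z m.+1 ^+ j] = 0.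
Proof.
move=> cop h0; have [mP sP] := Psi_monic; set h1 := h \Po ('X + 1).
have r0 : h1 %% Psi = 0.
  apply/polyP => i; rewrite coef0; case: (ltnP i D) => iD; last first.
    rewrite nth_default //; apply: leq_trans iD.
    rewrite -ltnS -sP ltn_modp; exact: monic_neq0.
  apply/eqP/negPn/negP => c0.
  have h2 r : vge r (fracKb Kb (h1 %% Psi)`_i * lam ^+ i).
    by apply: (@lam_lin (fun i => (h1 %% Psi)`_i)) => //; rewrite -eval_lam h0 vge_0.
  have := h2 (vl (fracKb Kb (h1 %% Psi)`_i * lam ^+ i) + 1).
  rewrite /Valuations.vge mulf_eq0 fmorph_eq0 (negPf c0) expf_eq0 (negPf lam0) andbF !orFb; lra.
have -> : (map_poly (fracKb Kb) h).[z m.+1 ^+ j] = (map_poly (fracKb Kb) h1).[z m.+1 ^+ j - 1].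
  by rewrite eval_shift subrK.
by rewrite (divp_eq h1 Psi) r0 addr0 rmorphM hornerM Psi_root // mulr0.
Qed.

Lemma zeta_aut j : coprime p j -> exists s : G0, s (z m.+1) = z m.+1 ^+ j.
Proof.
move=> cop; have [||s [_ es]] := @gal_conj _ Kb0 (@baseF _ Kb0) (baseF_subfield Kb0) _ (z m.+1) (z m.+1 ^+ j).
- by move=> c; exists c.
- move=> P /choice[c hc].
  have -> : P = map_poly (fracKb Kb) (\poly_(i < size P) c i).
    apply/polyP => i; rewrite coef_map coef_poly; case: ltnP => h; first exact: hc.
    rewrite nth_default //; exact/esym/rmorph0.
  by rewrite /root => /eqP /(zeta_conj cop) ->.
- by exists s.
Qed.

End Level.
End CycloRings.

End CyclotomicIntegers.

(** * Descent of twisted invariants along the cyclotomic tower *)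

Module TateDescent.
Import Valuations ClosureAndCompletion FieldIsomorphisms GaloisGroups AxApproximation CyclotomicValuations CyclotomicIntegers.

Section Descent.
Variables (p : nat) (k : fieldType) (W : witt_vectors p k).
Hypotheses (pP : prime p) (p_odd : odd p).
Variables (K : fieldExtType {fraction W}) (Kb : alg_closure K).
Let V := valuedK pP Kb.
Local Notation O := (OK Kb).
Local Notation vl := (vl p (OK Kb)).
Local Notation vge := (vge p (OK Kb)).
Variable z : nat -> Kb.
Hypothesis hz : compatible_roots z.
Local Notation G0 := (abs_galois (Kb0 Kb)).

Let z0 : z 0%N = 1. Proof. by case: hz. Qed.
Let zS n : z n.+1 ^+ p = z n. Proof. by case: hz. Qed.

Variables (M j : nat).
Hypothesis j0 : (0 < j)%N.
Variables (N : nat) (sg : nat -> G0).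
Hypothesis sgN : forall l, (0 < l)%N -> sg l (z N) = z N ^+ (1 + p ^ l).

Lemma sg_zeta l n : (0 < l)%N -> (n <= N)%N -> sg l (z n) = z n ^+ (1 + p ^ l).
Proof.
move=> l0 nN; have <- : z N ^+ (p ^ (N - n)) = z n.
  by rewrite -{1}(subnKC nN) zeta_exp.
by rewrite rmorphXn sgN // -!exprM mulnC.
Qed.

Lemma sg_zetaS l u : (0 < l)%N -> (l < N)%N -> iter u (sg l) (z l.+1) = z l.+1 * z 1%N ^+ u.
Proof.
move=> l0 lN; have zl : z l.+1 ^+ (p ^ l) = z 1%N by rewrite -[l.+1]add1n zeta_exp.
elim: u => [|u IH] /=; first by rewrite expr0 mulr1.
rewrite IH rmorphM rmorphXn !sg_zeta //; last exact: leq_ltn_trans lN.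
have -> : z 1%N ^+ (1 + p ^ l) = z 1%N.
  by rewrite exprD -[l]prednK // expnS exprM zS z0 expr1n expr1 mulr1.
by rewrite exprD expr1 zl -mulrA -exprS.
Qed.

Lemma G0_iter (s : G0) u : exists t : G0, forall x, t x = iter u s x.
Proof. exact: gal_iter. Qed.

Lemma G0_horner (s : G0) (h : {poly W}) x :
  s (map_poly (iotaK Kb) h).[x] = (map_poly (iotaK Kb) h).[s x].
Proof.
rewrite -horner_map -map_poly_comp; congr (_.[_]); apply: eq_map_poly => w /=.
exact: (gal_fix s (tofrac w)).
Qed.

(** On level [l + 1] this is the trace to level [l], since there [sg l] has order [p]
    ([sg_zetaS]). *)
Definition tr l (x : Kb) : Kb := \sum_(u < p) iter u (sg l) x.

(** The sum over [u] of the powers [z_1^(i u)] is [p] or 0, so the trace keeps the powers of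
    [z_(l+1)] with exponent divisible by [p], multiplied by [p]. *)
Lemma tr_Wz l x : (0 < l)%N -> (l < N)%N -> Wz z l.+1 x ->
  exists2 x', Wz z l x' & tr l x = p%:R * x'.
Proof.
move=> l0 lN [h ->].
have sums i : (\sum_(u < p) z 1%N ^+ i ^+ u = if (p %| i)%N then p%:R else 0).
  case: ifPn => [|nd].
    rewrite -[X in (X %| _)%N]expn1 (prim_order_dvd (zeta_prim pP hz 1)) => /eqP->.
    under eq_bigr do rewrite expr1n.
    by rewrite sumr_const card_ord.
  have w1 : z 1%N ^+ i != 1.
    by rewrite -(prim_order_dvd (zeta_prim pP hz 1)) expn1.
  apply: (mulfI (_ : z 1%N ^+ i - 1 != 0)); first by rewrite subr_eq0.
  by rewrite -subrX1 mulr0 exprAC -[X in _ ^+ X ^+ _]expn1 zeta_unity // expr1n subrr.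
exists (\sum_(i < size h | (p %| i)%N) iotaK Kb h`_i * z l ^+ (i %/ p)).
  by apply: Wz_sum => i _; apply: WzM; [exact: Wz_iota|exact: Wz_zeta].
have -> : tr l (map_poly (iotaK Kb) h).[z l.+1] =
    \sum_(i < size h) iotaK Kb h`_i * z l.+1 ^+ i * \sum_(u < p) z 1%N ^+ i ^+ u.
  transitivity (\sum_(u < p) \sum_(i < size h) iotaK Kb h`_i * z l.+1 ^+ i * z 1%N ^+ i ^+ u).
    apply: eq_bigr => u _; have [t tE] := G0_iter (sg l) u.
    rewrite -tE G0_horner tE sg_zetaS // horner_coef size_map_inj_poly ?rmorph0 //; last exact: iotaK_inj.
    by apply: eq_bigr => i _; rewrite coef_map exprMn mulrA exprAC.
  by rewrite exchange_big; apply: eq_bigr => i _; rewrite mulr_sumr.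
rewrite (bigID (fun i : 'I_(size h) => (p %| i)%N)) /= [X in _ + X]big1 ?addr0; last first.
  by move=> i nd; rewrite sums (negPf nd) mulr0.
rewrite mulr_sumr; apply: eq_bigr => i d.
by rewrite sums d mulrC -(zS l) -exprM mulnC divnK.
Qed.

Definition cst l : nat := ((1 + p ^ l) ^ j)%N.

(** [cst i] is the value at [sg i] of the [j]-th power of the cyclotomic character. The error is
    required in [W[z_l]], and not only integral, so that its trace can be divided by [p]. *)
Definition St l (a : Kb) := Wz z l a /\
  forall i, (0 < i)%N -> exists2 o, Wz z l o & sg i a = (cst i)%:R * a + p%:R ^+ M * o.

Lemma Wz_gal (s : G0) n e x : s (z n) = z n ^+ e -> Wz z n x -> Wz z n (s x).
Proof.
move=> es [h ->]; rewrite G0_horner es; exists (h \Po 'X^e).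
by rewrite map_comp_poly map_polyXn horner_comp hornerXn.
Qed.

Lemma sg_comm i l u x : (0 < i)%N -> (0 < l)%N -> (l < N)%N -> Wz z l.+1 x ->
  sg i (iter u (sg l) x) = iter u (sg l) (sg i x).
Proof.
move=> i0 l0 lN [h ->]; have [t tE] := G0_iter (sg l) u.
rewrite -!tE !G0_horner tE sg_zetaS // sg_zeta // rmorphM rmorphXn !sg_zeta //; last exact: leq_ltn_trans lN.
by rewrite rmorphXn tE sg_zetaS // exprMn exprAC.
Qed.

(** The normalised trace [a'] satisfies the same congruences, and [tr l a] is [T a] modulo [p^M]
    with [T] of valuation exactly 1. Both sides thus contain one factor [p], and no precision is
    lost from one level to the next. *)
Lemma descent l a : (0 < l)%N -> (l < N)%N -> St l.+1 a -> exists2 a', St l a' &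
  forall r, r <= M%:R - 1 -> vge r a' -> vge r a.
Proof.
move=> l0 lN [Wa Sa]; have [a' Wa' ea'] := tr_Wz l0 lN Wa.
have p0 : p%:R != 0 :> Kb := valued_p0 V.
exists a'.
  split=> // i i0; have [o Wo eo] := Sa i i0; have [o' Wo' eo'] := tr_Wz l0 lN Wo.
  exists o' => //; apply: (mulfI p0).
  have -> : p%:R * sg i a' = sg i (tr l a) by rewrite ea' rmorphM rmorph_nat.
  rewrite /tr rmorph_sum.
  have -> : \sum_(u < p) sg i (iter u (sg l) a) = (cst i)%:R * tr l a + p%:R ^+ M * tr l o.
    rewrite /tr !mulr_sumr -big_split; apply: eq_bigr => u _ /=.
    rewrite sg_comm // eo; have [t tE] := G0_iter (sg l) u.
    by rewrite -!tE rmorphD !rmorphM rmorphXn !rmorph_nat.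
  by rewrite ea' eo'; ring.
have [o Wo eo] := Sa l l0; have Oo := Wz_O pP hz Wo.
have [X OX_ eX] : exists2 X, O X & tr l a = (\sum_(0 <= u < p) cst l ^ u)%N%:R * a + p%:R ^+ M * X.
  have /choice[x hx] u : exists x, O x /\ iter u (sg l) a = (cst l ^ u)%:R * a + p%:R ^+ M * x.
    elim: u => [|u [x [Ox IH]]].
      by exists 0; rewrite mul1r mulr0 addr0; split => //; exact: (O0 V).
    exists ((cst l ^ u)%:R * o + sg l x); split.
      by apply: (OD V); [apply: (valued_M V) => //; exact: (Onat V)|exact: (gal0_O (Kb := Kb))].
    rewrite iterS IH rmorphD rmorphM rmorphM rmorph_nat -!natrX rmorph_nat eo expnS natrM [(p ^ M)%:R]natrX; ring.
  exists (\sum_(u < p) x u); first by apply: (O_sum V) => u _; case: (hx u).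
  rewrite /tr natr_sum big_mkord mulr_suml mulr_sumr -big_split; apply: eq_bigr => u _ /=.
  by case: (hx u).
move=> r rM ha'.
set T := (\sum_(0 <= u < p) cst l ^ u)%N in eX.
have eT : logn p T = 1%N.
  have [e ec] : exists e, cst l = (1 + p * e)%N.
    rewrite /cst -[l]prednK // expnS; elim: (j) => [|i [e IH]]; first by exists 0%N; rewrite muln0.
    by exists (e + p ^ l.-1 * (1 + p * e))%N; rewrite expnSr IH; lia.
  by rewrite /T ec logn_geometric.
have T0 : (0 < T)%N by rewrite lt0n; apply: contra_eq_neq eT => ->; rewrite logn0.
have TL0 : T%:R != 0 :> Kb by apply: (valued_nat0 V).
have h : vge (1 + r) (T%:R * a).
  have -> : T%:R * a = p%:R * a' - p%:R ^+ M * X by rewrite -ea' eX addrK.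
  apply: (vgeB V); first by rewrite (vge_pM V).
  by apply: (@vge_le _ _ _ M%:R); [lra|apply: (vge_mulr V OX_ (vge_pX V M))].
have := vge_mulIr V r a TL0; by rewrite (vl_nat V) // eT [r + _]addrC [a * _]mulrC h => <-.
Qed.

Lemma descent_all a : (0 < N)%N -> St N a -> exists2 a', St 1 a' &
  forall r, r <= M%:R - 1 -> vge r a' -> vge r a.
Proof.
move=> N0 SN; suff H n : (n < N)%N -> exists2 a', St (N - n) a' & forall r, r <= M%:R - 1 -> vge r a' -> vge r a.
  have e1 : (N - N.-1 = 1)%N by rewrite -[X in (X - _)%N](prednK N0) subSnn.
  by have := H N.-1; rewrite e1 prednK // => /(_ (leqnn _)).
elim: n => [|n IH] nN; first by rewrite subn0; exists a.
have [b Sb hb] := IH (ltnW nN).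
have [|||b' Sb' hb'] := @descent (N - n.+1) b; rewrite ?subn_gt0 ?ltn_subrL //; first by rewrite subnSK // ltnW.
by exists b' => // r rM h; apply: hb => //; apply: hb'.
Qed.

(** [sg 1] fixes level 1, so the congruence says that [(cst 1 - 1) a] vanishes modulo [p^M]. *)
Lemma St1_small a : (0 < N)%N -> St 1 a -> vge (M%:R - (logn p (cst 1 - 1))%:R) a.
Proof.
move=> N0 [Wa Sa]; have [o Wo eo] := Sa 1%N isT; have Oo := Wz_O pP hz Wo.
have fix_a : sg 1 a = a.
  have [h eh] := Wa; rewrite eh G0_horner sg_zeta // expn1 exprD zS z0 expr1 mulr1 //.
have c1 : (0 < cst 1 - 1)%N.
  have p1 := prime_gt1 pP; rewrite subn_gt0 /cst expn1 -[j]prednK // expnS.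
  have : (0 < (1 + p) ^ j.-1)%N by rewrite expn_gt0.
  nia.
have cL0 : (cst 1 - 1)%:R != 0 :> Kb by apply: (valued_nat0 V).
rewrite -(vge_mulIr V _ _ cL0) (vl_nat V) // subrK.
have -> : a * (cst 1 - 1)%:R = p%:R ^+ M * - o.
  have c1' : (1 <= cst 1)%N by move: c1; rewrite subn_gt0 => /ltnW.
  rewrite natrB //; transitivity ((cst 1)%:R * a - sg 1%N a); first by rewrite fix_a; ring.
  by rewrite eo; ring.
by apply: (vge_mulr V); [exact: (ON V)|exact: (vge_pX V)].
Qed.

End Descent.

Section Tate0.
Variables (p : nat) (k : fieldType) (W : witt_vectors p k).
Hypotheses (pP : prime p) (p_odd : odd p).
Variables (K : fieldExtType {fraction W}) (Kb : alg_closure K).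
Let V := valuedK pP Kb.
Local Notation O := (OK Kb).
Local Notation vl := (vl p (OK Kb)).
Local Notation vge := (vge p (OK Kb)).
Variable z : nat -> Kb.
Hypothesis hz : compatible_roots z.
Local Notation G0 := (abs_galois (Kb0 Kb)).

(** Ax's lemma moves [y] into the cyclotomic level [N], the descent brings it to level 1, and there
    it must be small. *)
Lemma tate_frac (j : nat) : (0 < j)%N -> exists N, forall y : Kb, O y ->
  (forall (s : G0) m, s (z N) = z N ^+ m -> vge N%:R (s y - (m ^ j)%:R * y)) -> vge 1 y.
Proof.
(* In [N] the summand [p] is the loss in [ax_fixed_approx]. In [M] the summand [B] is the loss in
   [St1_small], and 2 makes [1 <= M - 1], as the descent demands. *)
move=> j0; set B := logn p ((1 + p ^ 1) ^ j - 1); pose M := (2 + B)%N; pose N := (M + p)%N.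
exists N => y Oy hy.
have N0 : (0 < N)%N by [].
have [n eN] : exists n, N = n.+1 by exists N.-1; rewrite prednK.
pose S (s : G0) := s (z N) = z N.
have [|||a [aS ha]] := @ax_fixed_approx p {fraction W} (Kb0 Kb) O V (@gal0_O _ _ _ _ Kb) S _ _ y N%:R.
- by [].
- by move=> g h Sg Sh; rewrite /S /= Sh Sg.
- move=> g Sg; have := hy g 1%N; rewrite expr1 exp1n mul1r; exact.
have {}ha : vge M%:R (a - y) by move: ha; rewrite /N natrD addrK.
have Oa : O a.
  rewrite -(subrK y a); apply: (OD V) => //; apply/(vge0P V).
  by apply: vge_le ha; rewrite ler0n.
have Fa : Fz z N a.
  apply: (@gal_fixed_field _ (Kb0 Kb) (Fz z N) (Fz_subfield z N)).
  - by move=> c; exists c%:P; rewrite map_polyC hornerC.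
  - by move=> i; apply: (valued_nat0 V).
  - move=> g Fg; apply: aS; apply: Fg; exists 'X; by rewrite map_polyX hornerX.
have /choice[sg hsg] l : exists s : G0, (0 < l)%N -> s (z N) = z N ^+ (1 + p ^ l).
  case: l => [|l]; first by exists (gal_id _).
  rewrite eN; have [|s hs] := @zeta_aut _ _ _ pP p_odd _ Kb z hz n (1 + p ^ l.+1); last by exists s.
  by rewrite expnS -coprime_modr addnC mulnC modnMDl coprime_modr coprimen1.
have Sta : St z M j sg N a.
  have Wa : Wz z N a by move: Fa; rewrite eN => Fa; apply: (Fz_integral pP p_odd hz).
  split => // l l0; have WsA : Wz z N (sg l a) by apply: Wz_gal Wa; exact: hsg.
  have : vge M%:R (sg l a - ((1 + p ^ l) ^ j)%:R * a).
    have -> : sg l a - ((1 + p ^ l) ^ j)%:R * a = sg l (a - y) + (sg l y - ((1 + p ^ l) ^ j)%:R * y) - ((1 + p ^ l) ^ j)%:R * (a - y).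
      by rewrite rmorphB; ring.
    apply: (vgeB V); [apply: (vgeD V)|by apply: (vge_mull V) => //; exact: (Onat V)].
      by rewrite gal0_vge.
    by apply: vge_le (hy _ _ (hsg l l0)); rewrite ler_nat leq_addr.
  move=> /(vge_nP V)[o Oo eo]; exists o; last by rewrite -eo addrC subrK.
  rewrite eN; apply: (Fz_integral pP p_odd hz) => //; rewrite -eN.
  have sF := Fz_subfield z N.
  have -> : o = (sg l a - ((1 + p ^ l) ^ j)%:R * a) * (p%:R ^+ M)^-1.
    by rewrite eo mulrAC divff ?mul1r // expf_neq0 // (valued_p0 V).
  apply: (sfM sF).
    by apply/WzF/WzB => //; apply: WzM => //; exact: Wz_nat.
  by apply: (sfV sF); apply: WzF; rewrite -natrX; exact: Wz_nat.
have [a' Sa' haa'] := descent_all pP p_odd hz j0 hsg N0 Sta.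
have h1 := St1_small pP p_odd hz j0 hsg N0 Sa'.
have ha1 : vge 1 a.
  apply: haa'; first by rewrite /M natrD; have : 0 <= B%:R :> rat by []; lra.
  by apply: vge_le h1; rewrite /cst -/B /M natrD; lra.
have -> : y = a - (a - y) by ring.
apply: (vgeB V) => //; apply: vge_le ha; rewrite /M natrD.
by have : 0 <= B%:R :> rat by []; lra.
Qed.

End Tate0.

End TateDescent.

(** * Tate's theorem on the invariants of the twists of [C] *)

Module TateInvariants.
Import Valuations WittRings ClosureAndCompletion GaloisGroups CyclotomicValuations CyclotomicIntegers TateDescent.

Section Congr.
Variables (p : nat) (L : fieldType) (O : L -> Prop).
Hypothesis V : valued p O.

Lemma vge_natmod n i j : i = j %[mod p ^ n] -> vge p O n%:R (i%:R - j%:R).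
Proof.
wlog le : i j / (j <= i)%N => [hw|].
  by case: (leqP j i) => [|/ltnW] le e; [|rewrite (vge_subC V)]; apply: hw.
move=> /eqP; rewrite eqn_mod_dvd // => /dvdnP[q e].
by rewrite -natrB // e mulnC natrM natrX; apply/(vge_nP V); exists q%:R => //; exact: (Onat V).
Qed.

Lemma vge_prodB (I : Type) (s : seq I) (P : pred I) (a b : I -> L) r : 0 <= r ->
  (forall i, P i -> [/\ O (a i), O (b i) & vge p O r (a i - b i)]) ->
  vge p O r (\prod_(i <- s | P i) a i - \prod_(i <- s | P i) b i).
Proof.
move=> r0 h.
suff [] : [/\ O (\prod_(i <- s | P i) a i), O (\prod_(i <- s | P i) b i) &
  vge p O r (\prod_(i <- s | P i) a i - \prod_(i <- s | P i) b i)] by [].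
elim/big_rec2: _ => [|i x y Pi [Oy Ox hxy]].
  by rewrite subrr; split; [exact: (valued_1 V)|exact: (valued_1 V)|exact: vge_0].
have [Oa Ob hab] := h i Pi; split; [exact: (valued_M V)|exact: (valued_M V)|].
have -> : a i * y - b i * x = (a i - b i) * y + b i * (y - x) by ring.
by apply: (vgeD V); [apply: (vge_mulr V)|apply: (vge_mull V)].
Qed.

Lemma vl_eq_vge x y : x != 0 -> y != 0 -> (forall r, vge p O r x = vge p O r y) -> vl p O x = vl p O y.
Proof.
move=> x0 y0 h; have := h (vl p O x); have := h (vl p O y).
by rewrite /vge (negPf x0) (negPf y0) /= !lexx => h1 h2; apply/le_anti; rewrite h1 -h2.
Qed.

Lemma vl_prod_const (I : Type) (s : seq I) (F : I -> L) r :
  (forall i, F i != 0) -> (forall i, vl p O (F i) = r) -> vl p O (\prod_(i <- s) F i) = r *+ size s.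
Proof.
move=> F0 hF; rewrite (vl_prod V) //; elim: s => [|i s IH]; first by rewrite big_nil mulr0n.
by rewrite big_cons IH hF -mulrS.
Qed.

End Congr.

Lemma nat_floor (r : rat) : 0 <= r -> exists i : nat, i%:R <= r < i.+1%:R.
Proof.
move=> r0; have ex : exists n : nat, r < n%:R by exists (Num.bound r); apply: archi_boundP.
case: (ex_minnP ex) => [[|n]] hn mn; first by rewrite ltNge r0 in hn.
by exists n; rewrite hn andbT leNgt; apply/negP => /mn; rewrite ltnn.
Qed.

Lemma nth_map_comp (R : nmodType) (f g h : R -> R) (l : seq R) i :
  map f (map g l) = map h l -> (i < size l)%N -> f (g l`_i) = h l`_i.
Proof.
by move=> e il; have := congr1 (fun s : seq R => s`_i) e; rewrite !(nth_map 0) ?size_map.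
Qed.

Lemma twist_divr (L : fieldType) (s : {rmorphism L -> L}) (q i : nat) (x c c1 : L) :
  s (x / q%:R ^+ i) - c * (x / q%:R ^+ i) = (s x - c1 * x) / q%:R ^+ i + (c1 - c) * (x / q%:R ^+ i).
Proof. by rewrite fmorph_div rmorphXn rmorph_nat; ring. Qed.

Section NormTate.
Variables (p : nat) (k : fieldType) (W : witt_vectors p k).
Hypotheses (pP : prime p) (p_odd : odd p).
Variables (K : fieldExtType {fraction W}) (Kb : alg_closure K).
Let V := valuedK pP Kb.
Local Notation O := (OK Kb).
Local Notation vl := (vl p (OK Kb)).
Local Notation vge := (vge p (OK Kb)).
Variable z : nat -> Kb.
Hypothesis hz : compatible_roots z.
Local Notation G0 := (abs_galois (Kb0 Kb)).
Local Notation G := (abs_galois Kb).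

Lemma endo_zeta (s : {rmorphism Kb -> Kb}) n : (0 < n)%N -> exists m, coprime p m /\ s (z n) = z n ^+ m.
Proof.
move=> n0; have pr := zeta_prim pP hz n.
have [|i ei] := prim_rootP pr (x := s (z n)); first by rewrite -rmorphXn zeta_unity // rmorph1.
exists i; split=> //; have : (p ^ n).-primitive_root (s (z n)) by rewrite fmorph_primitive_root.
by rewrite ei prim_root_exp_coprime // coprime_pexpr // coprime_sym.
Qed.

Lemma finite_map (s : seq Kb) : exists R : seq (seq Kb), forall g : G0, map g s \in R.
Proof.
elim: s => [|x s [R hR]]; first by exists [:: [::]].
have [r hr] := @gal_finite _ (Kb0 Kb) x.
exists [seq a :: t | a <- r, t <- R] => g /=; apply/allpairsP; exists (g x : Kb, map g s) => /=.
by split; [exact: (hr g)|exact: (hR g)|].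
Qed.

Let b : seq Kb := [seq closure_emb Kb x | x <- vbasis {:K}].

Lemma fix_basis (s : Kb -> Kb) : {morph s : x y / x + y} -> {morph s : x y / x * y} ->
  (forall c, s (fracKb Kb c) = fracKb Kb c) -> (forall x, x \in b -> s x = x) ->
  forall x : K, s (closure_emb Kb x) = closure_emb Kb x.
Proof.
move=> sD sM sF sb x; rewrite (coord_vbasis (memvf x)) rmorph_sum.
have s0 : s 0 = 0 by apply: (addrI (s 0)); rewrite -sD !addr0.
have ssum (I : Type) (r : seq I) (E : I -> Kb) : s (\sum_(i <- r) E i) = \sum_(i <- r) s (E i).
  by elim: r => [|i r IH]; rewrite ?big_nil // !big_cons sD IH.
rewrite ssum; apply: eq_bigr => i _.
have -> : forall c (y : K), closure_emb Kb (c *: y) = fracKb Kb c * closure_emb Kb y.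
  by move=> c y; rewrite -[c *: y]mulr_algl rmorphM.
rewrite sM sF sb // /b; apply/mapP; exists (vbasis {:K})`_i => //.
by apply: mem_nth; rewrite size_tuple.
Qed.

(** Reduction from [K] to the fraction field of [W]: the product of the conjugates of [y], one for
    each embedding of [K], each twisted by a power of [M' e], satisfies the hypothesis of
    [tate_frac] for the exponent [j d]. *)
Lemma tate_norm (j : nat) : (0 < j)%N -> exists N, forall y : Kb, O y ->
  (forall (s : G) m, s (z N) = z N ^+ m -> vge N%:R (s y - (m ^ j)%:R * y)) -> vge 1 y.
Proof.
move=> j0; have [R hR] := finite_map b.
pose E := undup [seq e <- R | `[< exists g : G0, map g b = e >]].
have EP e : e \in E <-> exists g : G0, map g b = e.
  rewrite mem_undup mem_filter; split=> [/andP[/asboolP //]|[g eg]].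
  by rewrite -{2}eg hR andbT; apply/asboolP; exists g.
have uE : uniq E := undup_uniq _.
have bE : b \in E by apply/EP; exists (gal_id _); rewrite map_id.
have d0 : (0 < size E)%N by case: (E) bE.
set d := size E in d0.
have [N1 hN1] : exists N, forall y : Kb, O y -> (forall (s : G0) m, s (z N) = z N ^+ m ->
    vge N%:R (s y - (m ^ (j * d))%:R * y)) -> vge 1 y.
  by apply: (tate_frac pP p_odd hz); rewrite muln_gt0 j0.
(* The extra [d] pays for dividing the norm by [p^i] with [i < d], which brings its valuation into
   the interval from 0 to 1. *)
pose N := (N1 + d)%N; have N0 : (0 < N)%N by rewrite addn_gt0 d0 orbT.
exists N => y Oy hy; apply: contrapT => /negP ny.
have /choice[rep hrep] e : exists g : G0, e \in E -> map g b = e.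
  by have [/EP[g eg]|] := boolP (e \in E); [exists g|exists (gal_id _)].
(* [M' e] inverts modulo [p^N] the exponent by which [rep e] acts on [z N]; the twist makes [t e]
   independent of the representative up to [p^N]. *)
have /choice[M' hM'] e : exists m', exists m, [/\ coprime p m', rep e (z N) = z N ^+ m & z N ^+ (m * m') = z N].
  have [h [hg gh]] := gal_inv_ex (rep e).
  have [m [_ em]] := endo_zeta (rep e) N0; have [m' [cm' em']] := endo_zeta h N0.
  by exists m', m; split => //; rewrite mulnC exprM -em' -rmorphXn -em hg.
pose t e := (M' e ^ j)%:R * rep e y.
have Ot e : O (t e) by apply: (valued_M V); [exact: (Onat V)|exact: (gal0_O (Kb := Kb))].
pose y' := \prod_(e <- E) t e.
have Oy' : O y' by apply: (O_prod V) => e _.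
have key (s : G0) m : s (z N) = z N ^+ m -> vge N%:R (s y' - (m ^ (j * d))%:R * y').
  move=> es; have -> : (m ^ (j * d))%:R * y' = \prod_(e <- E) ((m ^ j)%:R * t (map s e)).
    rewrite big_split big_const_seq count_predT iter_mulr_1 -/d expnM natrX; congr (_ * _).
    rewrite -(big_map (map s) xpredT t) /y'; apply: perm_big.
    have us : uniq (map (map s) E) by rewrite map_inj_uniq // => e e'; apply: inj_map; exact: fmorph_inj.
    apply: uniq_perm => //; have sub : {subset map (map s) E <= E}.
      move=> _ /mapP[e /EP[g <-] ->]; apply/EP; exists (gal_comp s g); by rewrite -map_comp.
    by have [_ ee] := uniq_min_size us sub (eq_leq (esym (size_map _ E))); move=> e; rewrite ee.
  rewrite /y' rmorph_prod !big_seq; apply: (vge_prodB V) => [|e eE]; first by rewrite ler0n.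
  have e'E : map s e \in E by have /EP[g <-] := eE; apply/EP; exists (gal_comp s g); rewrite -map_comp.
  split; [exact: (gal0_O (Kb := Kb))|by apply: (valued_M V) => //; exact: (Onat V)|].
  set e' := map s e in e'E *.
  have [h [hg gh]] := gal_inv_ex (rep e').
  have gb x : x \in b -> h (s (rep e x)) = x.
    move=> /(nthP 0)[i ib <-].
    have -> : s (rep e b`_i) = rep e' b`_i.
      have E1 : map s (map (rep e) b) = map (rep e') b by rewrite !hrep.
      exact: (nth_map_comp E1 ib).
    by rewrite hg.
  (* The automorphisms [rep e] followed by [s], and [rep e'], agree on [K]; they differ by an
     element [g] of the Galois group of [K], to which the hypothesis on [y] applies. *)
  have [||||g gE] := @mkgal _ Kb (fun x => h (s (rep e x))).
  - by move=> x1 x2; rewrite !rmorphB.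
  - by rewrite !rmorph1.
  - by move=> x1 x2; rewrite !rmorphM.
  - apply: fix_basis gb => [x1 x2|x1 x2|c]; rewrite ?rmorphD ?rmorphM //.
    by rewrite (gal_fix (rep e) c) (gal_fix s c) (gal_fix h c).
  have gE' x : rep e' (g x) = s (rep e x) by rewrite gE gh.
  have [mg [_ emg]] := endo_zeta g N0.
  have hg1 := hy g mg emg.
  have [me [_ eme eMe]] := hM' e; have [me' [_ eme' eMe']] := hM' e'.
  have ez : z N ^+ (mg * M' e) = z N ^+ (m * M' e').
    have h1 : z N ^+ (me' * mg) = z N ^+ (m * me).
      by rewrite exprM -eme' -rmorphXn -emg gE' eme rmorphXn es -exprM.
    rewrite -{1}eMe' -exprM (_ : (me' * M' e' * (mg * M' e) = me' * mg * (M' e * M' e'))%N); last by ring.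
    by rewrite exprM h1 -exprM (_ : (m * me * (M' e * M' e') = me * M' e * (m * M' e'))%N); [rewrite exprM eMe|ring].
  have cong : (mg * M' e = m * M' e' %[mod p ^ N])%N.
    by apply/eqP; rewrite -(eq_prim_root_expr (zeta_prim pP hz N)) ez.
  have -> : s (t e) - (m ^ j)%:R * t e' = (M' e ^ j)%:R * rep e' (g y - (mg ^ j)%:R * y)
     + (((mg * M' e) ^ j)%:R - ((m * M' e') ^ j)%:R) * rep e' y.
    rewrite /t rmorphM rmorph_nat -gE' rmorphB rmorphM rmorph_nat !expnMn !natrM; ring.
  apply: (vgeD V); first by apply: (vge_mull V); [exact: (Onat V)|rewrite gal0_vge].
  apply: (vge_mulr V); first exact: (gal0_O (Kb := Kb)).
  rewrite !natrX; apply: (vge_exprB V); rewrite ?ler0n //; try exact: (Onat V).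
  exact: (vge_natmod V).
have y0 : y != 0 by apply: contraNneq ny => ->; exact: vge_0.
have cM e : coprime p (M' e ^ j) by have [m [c _ _]] := hM' e; exact: coprimeXr.
have t0 e : t e != 0 by have [n0 _] := vl_natcoprime V (cM e); rewrite mulf_neq0 ?fmorph_eq0.
have y'0 : y' != 0 by rewrite prodf_seq_neq0; apply/allP => e _ /=.
have vy0 : 0 <= vl y by have /(vge0P V) := Oy; rewrite /Valuations.vge (negPf y0).
have vy1 : vl y < 1 by rewrite ltNge; apply: contraNN ny; rewrite /Valuations.vge (negPf y0).
have vt e : vl (t e) = vl y.
  rewrite (vlM V) ?fmorph_eq0 // ?(vl_natcoprime V (cM e)).1 // (vl_natcoprime V (cM e)).2 add0r.
  have [->|y0'] := eqVneq y 0; first by rewrite rmorph0.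
  by apply: (vl_eq_vge (x := rep e y) (y := y)) => [||r]; rewrite ?fmorph_eq0 ?gal0_vge.
have vy' : vl y' = vl y *+ d.
  exact: (vl_prod_const V).
have [i /andP[i1 i2]] := nat_floor (mulrn_wge0 d vy0).
have id_ : (i < d)%N.
  rewrite -(ltr_nat rat); apply: le_lt_trans i1 _; rewrite -[vl y *+ d]mulr_natr.
  by rewrite -[X in _ < X]mul1r ltr_pM2r // ltr0n.
have pi0 : p%:R ^+ i != 0 :> Kb by rewrite expf_neq0 // (valued_p0 V).
have : vge 1 (y' / p%:R ^+ i).
  apply: hN1 => [|s m esm].
    by apply/(vge0P V); rewrite (vge_divr V) // (vl_pX V) add0r /Valuations.vge vy' i1 orbT.
  have [m1 [_ em1]] := endo_zeta s N0.
  have cm1 : (m1 = m %[mod p ^ N1])%N.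
    apply/eqP; rewrite -(eq_prim_root_expr (zeta_prim pP hz N1)); apply/eqP; rewrite -esm.
    have -> : z N1 = z N ^+ (p ^ d) by rewrite /N (zeta_exp hz).
    by rewrite rmorphXn em1 -!exprM mulnC.
  have -> : s (y' / p%:R ^+ i) - (m ^ (j * d))%:R * (y' / p%:R ^+ i) =
     (s y' - (m1 ^ (j * d))%:R * y') / p%:R ^+ i + ((m1 ^ (j * d))%:R - (m ^ (j * d))%:R) * (y' / p%:R ^+ i).
    exact: (twist_divr s).
  apply: (vgeD V).
    rewrite (vge_divr V) // (vl_pX V) -natrD; apply: (vge_le _ (key _ _ em1)).
    by rewrite ler_nat leq_add2l ltnW.
  apply: (vge_mulr V); first by apply/(vge0P V); rewrite (vge_divr V) // (vl_pX V) add0r /Valuations.vge vy' i1 orbT.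
  rewrite !natrX; apply: (vge_exprB V); rewrite ?ler0n //; try exact: (Onat V).
  exact: (vge_natmod V).
rewrite (vge_divr V) // (vl_pX V) /Valuations.vge (negPf y'0) /= vy' leNgt.
by rewrite -natr1 addrC in i2; rewrite i2.
Qed.

End NormTate.

Section ZpNat.
Variables (p : nat) (pP : prime p) (Zp : witt_vectors p 'F_p).

Lemma zp_nat_dense (chi : Zp) n : exists m : nat, in_pX p n (chi - m%:R).
Proof.
elim: n chi => [|n IH] chi; first by exists 0%N; exact: in_pX_all.
pose a := witt_residue Zp chi; have ea : witt_residue Zp (chi - (nat_of_ord a)%:R) = 0.
  by rewrite rmorphB rmorph_nat natr_Zp subrr.
have [y ey] := (witt_residue_ker _).1 ea; have [m [w ew]] := IH y.
exists (a + p * m)%N, w.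
by rewrite natrD natrM opprD addrA ey -[y](subrK m%:R) ew expr1 exprS; ring.
Qed.

Lemma zp_nat_dvd n (m : nat) : in_pX p n (m%:R : Zp) -> (p ^ n %| m)%N.
Proof.
elim: n m => [|n IH] m; first by rewrite expn0 dvd1n.
move=> h; have [y ey] := h.
have r0 : witt_residue Zp m%:R = 0 by apply/witt_residue_ker; exists (p%:R ^+ n * y); rewrite ey exprS expr1 mulrA.
have /dvdnP[q eq] : (p %| m)%N.
  by move: r0; rewrite rmorph_nat => /eqP; rewrite -(dvdn_pcharf (pchar_Fp pP)).
rewrite eq expnS mulnC dvdn_pmul2l ?prime_gt0 // in ey *; apply: IH; exists y.
by apply: (mulfI (witt_p_neq0 Zp)); rewrite -natrM ey exprS mulrA.
Qed.

Lemma zp_nat_cong n (chi : Zp) i j :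
  in_pX p n (chi - i%:R) -> in_pX p n (chi - j%:R) -> (i = j %[mod p ^ n])%N.
Proof.
wlog le : i j / (j <= i)%N => [hw|hi hj].
  by case: (leqP j i) => [|/ltnW] le hi hj; [|symmetry]; apply: hw.
apply/eqP; rewrite eqn_mod_dvd //; apply: (zp_nat_dvd (n := n)); rewrite natrB //.
by have := in_pXB hj hi; congr (in_pX _ _ _); ring.
Qed.

End ZpNat.

Section CycExists.
Variables (p : nat) (k : fieldType) (W : witt_vectors p k).
Hypotheses (pP : prime p) (p_odd : odd p).
Variables (K : fieldExtType {fraction W}) (Kb : alg_closure K).
Variable z : nat -> Kb.
Hypothesis hz : compatible_roots z.
Variable Zp : witt_vectors p 'F_p.

(** The exponents of [g] on the [z n] are coherent modulo [p^n] and converge in [Zp]. *)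
Lemma cyc_exists (g : abs_galois Kb) : exists chi : Zp,
  cyclotomic_value g chi /\ (forall n, exists m, in_pX p n (chi - m%:R) /\ g (z n) = z n ^+ m).
Proof.
have /choice[m hm] n : exists m, g (z n) = z n ^+ m.
  case: n => [|n]; last by have [m [_ e]] := endo_zeta pP hz g (ltn0Sn n); exists m.
  by exists 0%N; case: hz => -> _ _; rewrite rmorph1.
have cong i n : (m (n + i)%N = m n %[mod p ^ n])%N.
  apply/eqP; rewrite -(eq_prim_root_expr (zeta_prim pP hz n)) -hm.
  by rewrite -{1 2}(zeta_exp hz n i) rmorphXn hm -!exprM mulnC.
have inp n i : in_pX p n ((m (n + i)%N)%:R - (m n)%:R : Zp).
  have c := cong i n; case: (leqP (m n) (m (n + i)%N)) => h.
    move/eqP: c; rewrite eqn_mod_dvd // => /dvdnP[q e].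
    by exists q%:R; rewrite -natrB // e mulnC natrM natrX.
  rewrite -opprB; apply: in_pXN; move/eqP: c; rewrite eq_sym eqn_mod_dvd 1?ltnW // => /dvdnP[q e].
  by exists q%:R; rewrite -natrB 1?ltnW // e mulnC natrM natrX.
have [n|chi hchi] := (witt_complete Zp).2 (fun n => (m n)%:R : Zp); first by have := inp n 1%N; rewrite addn1.
exists chi; split=> [n j hj x xn|n]; last by exists (m n).
have [i ->] := prim_rootP (zeta_prim pP hz n) xn.
rewrite rmorphXn hm -!exprM mulnC; apply/eqP; rewrite (eq_prim_root_expr (zeta_prim pP hz n)).
by rewrite -modnMmr (zp_nat_cong pP (hchi n) hj) modnMmr.
Qed.

End CycExists.

Section TateC.
Variables (p : nat) (k : fieldType) (W : witt_vectors p k).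
Hypotheses (pP : prime p) (p_odd : odd p).
Variables (K : fieldExtType {fraction W}) (Kb : alg_closure K) (C : completion Kb).
Variable z : nat -> Kb.
Hypothesis hz : compatible_roots z.
Variables (Zp : witt_vectors p 'F_p) (f : {rmorphism Zp -> C}).
Local Notation OC := (@comp_int p k W K Kb C).
Hypothesis fO : forall x, OC (f x).
Let V := valuedC pP C.
Local Notation emb := (comp_emb C).

(** After scaling by a power of [p], the valuation of [x] is at least 0 and below 1. An
    approximation of [x] in [Kb] satisfies the congruences of [tate_norm], whose conclusion is then
    absurd. *)
Lemma tate_C_nat (j : nat) (x : C) : (0 < j)%N -> x != 0 ->
  (forall g chi, cyclotomic_value g chi -> comp_act C g x = f chi ^+ j * x) -> False.
Proof.
move=> j0 x0 hx; have [N hN] := tate_norm pP p_odd hz j0.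
have [n On] := comp_int_frac x; have p0 := valued_p0 V.
have pn0 : p%:R ^+ n * x != 0 by rewrite mulf_neq0 ?expf_neq0.
have vn : 0 <= vl p OC (p%:R ^+ n * x) by have /(vge0P V) := On; rewrite /vge (negPf pn0).
have [i /andP[i1 i2]] := nat_floor vn.
pose x' := (p%:R ^+ n / p%:R ^+ i) * x.
have x'0 : x' != 0 by rewrite !mulf_neq0 ?invr_eq0 ?expf_neq0.
have vx' : vl p OC x' = vl p OC (p%:R ^+ n * x) - i%:R.
  have pi0 : p%:R ^+ i != 0 :> C by rewrite expf_neq0.
  by rewrite /x' mulrAC (vlM V pn0) ?invr_eq0 // (vlV V pi0) (vl_pX V).
have Ox' : OC x' by apply/(vge0P V); rewrite /vge vx' subr_ge0 i1 orbT.
have hx' g chi : cyclotomic_value g chi -> comp_act C g x' = f chi ^+ j * x'.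
  move=> h; rewrite /x' [LHS]rmorphM fmorph_div !rmorphXn (rmorph_nat (comp_act C g) p) (hx _ _ h); ring.
have [y hy] := comp_approx pP x' N.+1.
have hyN : vge p OC N%:R (x' - emb y) by apply: (vge_le _ hy); rewrite ler_nat.
have hy1 : vge p OC 1 (x' - emb y) by apply: (vge_le _ hy); rewrite ler1n.
have Oy : OK Kb y.
  apply/comp_int_emb/(vge0P V); rewrite (_ : emb y = x' - (x' - emb y)); last by ring.
  by apply: (vgeB V); [exact/(vge0P V)|apply: (vge_le _ hy); rewrite ler0n].
have : vge p OC 1 x'.
  rewrite -[x'](subrK (emb y)); apply: (vgeD V) => //; rewrite (vge_emb pP C); apply: hN => // s m em.
  have [chi [hchi /(_ N) [m' [c1 e1]]]] := cyc_exists pP hz Zp s.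
  have cg : (m = m' %[mod p ^ N])%N.
    by apply/eqP; rewrite -(eq_prim_root_expr (zeta_prim pP hz N)) -em -e1.
  have c2 : vge p OC N%:R (f chi - m%:R).
    rewrite -(subrKA m'%:R) -(rmorph_nat f m') -rmorphB; apply: (vgeD V).
      by have [w ->] := c1; rewrite rmorphM rmorphXn rmorph_nat; apply/(vge_nP V); exists (f w).
    by rewrite rmorph_nat; apply: (vge_natmod V).
  rewrite -(vge_emb pP C) rmorphB rmorphM rmorph_nat -comp_act_emb.
  have -> : comp_act C s (emb y) - (m ^ j)%:R * emb y = - comp_act C s (x' - emb y)
     + (f chi ^+ j - m%:R ^+ j) * x' + (m ^ j)%:R * (x' - emb y).
    by rewrite rmorphB (hx' _ _ hchi) natrX; ring.
  apply: (vgeD V); first apply: (vgeD V).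
  - by rewrite (vgeN V) (vge_act pP).
  - apply: (vge_mulr V) => //; apply: (vge_exprB V); rewrite ?ler0n //; exact: (Onat V).
  - by apply: (vge_mull V) => //; exact: (Onat V).
by rewrite /vge (negPf x'0) vx' /= leNgt ltrBlDr nat1r i2.
Qed.

Lemma tate_C (j : int) (x : C) : j != 0 -> x != 0 ->
  (forall g chi, cyclotomic_value g chi -> comp_act C g x = f chi ^ j * x) -> False.
Proof.
move=> j0 x0 hx; case: j j0 hx => n n0 hx; first by apply: (@tate_C_nat n x); rewrite ?lt0n.
apply: (@tate_C_nat n.+1 x^-1); rewrite ?invr_eq0 // => g chi h.
by rewrite fmorphV (hx _ _ h) NegzE -exprnN invfM invrK mulrC.
Qed.

End TateC.

End TateInvariants.

(** * The ring [E] of sequences and its Teichmueller elements *)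

Module GhostSequences.
Import Valuations.

(** The polynomial [((a + b)^p - a^p - b^p) / p] with its integral coefficients, see [paddE]. *)
Definition padd (R : comNzRingType) (p : nat) (a b : R) : R :=
  \sum_(i < p.-1) ('C(p, i.+1) %/ p)%:R * (a ^+ (p.-1 - i) * b ^+ i.+1).

Lemma paddE (R : comNzRingType) p (a b : R) : prime p ->
  (a + b) ^+ p = a ^+ p + b ^+ p + p%:R * padd p a b.
Proof.
move=> pP; case: p pP => // n pP; rewrite exprDn big_ord_recl big_ord_recr /= !bin0 subn0 expr0 mulr1 mulr1n.
rewrite /bump /= !add1n subnn binn expr0 mul1r mulr1n -addrA; congr (_ + _); rewrite addrC; congr (_ + _).
rewrite /padd /= mulr_sumr; apply: eq_bigr => i _; rewrite mulrA -natrM /bump /= add1n.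
have dv : (n.+1 %| 'C(n.+1, i.+1))%N by apply: prime_dvd_bin => //=; rewrite ltnS.
by rewrite muln_divA // mulKn ?prime_gt0 // subSS mulr_natl.
Qed.

Lemma divp_aux (L : fieldType) (q f s : L) n : q != 0 -> (0 < n)%N ->
  (q * f - q ^+ n * s) / q = f - q ^+ n.-1 * s.
Proof. by case: n => // n q0 _; rewrite exprS /=; field. Qed.

Section Ering.
Variables (p : nat) (L : fieldType) (O : L -> Prop).
Hypotheses (V : valued p O) (p_odd : odd p).
Hypothesis lim : forall u : nat -> L,
  (forall n : nat, exists m0, forall m, (m0 <= m)%N -> vge p O n%:R (u m - u m0)) ->
  exists l, forall n : nat, exists m0, forall m, (m0 <= m)%N -> vge p O n%:R (l - u m).
Hypothesis sep : forall x, (forall n : nat, vge p O n%:R x) -> x = 0.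
Local Notation vge := (vge p O).
Local Notation fn := (int -> L).
Let pP := valued_prime V.
Let p0 : p%:R != 0 :> L := valued_p0 V.

(** The shift to index [m + 1] is the inverse of Frobenius, so this is the delta operator
    [(phi u - u^p) / p] at [u = phi^-1 f]. Integrality of all its iterates characterises the
    sequences that have a Teichmueller expansion. *)
Definition dE (f : fn) : fn := fun m => (f m - f (m + 1) ^+ p) / p%:R.
Fixpoint Ek k (f : fn) : Prop :=
  (forall m, O (f m)) /\ (if k is k'.+1 then Ek k' (dE f) else True).
Definition E f := forall k, Ek k f.

Lemma Ek_O k f m : Ek k f -> O (f m). Proof. by case: k => [|k] []. Qed.

Lemma Ek_S k f : Ek k.+1 f -> Ek k f.
Proof. by elim: k f => [|k IH] f [fO h]; split => //; apply: IH. Qed.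

Lemma Ek_const0 k : Ek k (fun=> 0).
Proof.
have d0 : dE (fun=> 0) = fun=> 0.
  by apply/funext => i; rewrite /dE expr0n gtn_eqF ?prime_gt0 // subr0 mul0r.
by elim: k => [|k IH]; (split; first by move=> m; exact: (O0 V)); rewrite ?d0.
Qed.

Lemma Ek_pow k f : (forall m, O (f m)) -> (forall m, f (m + 1) ^+ p = f m) -> Ek k f.
Proof.
case: k => [|k] fO h; split => //.
rewrite (_ : dE _ = fun=> 0); first exact: Ek_const0.
by apply/funext => i; rewrite /dE h subrr mul0r.
Qed.

Lemma dE_shift i f : dE (fun m => f (m - i)) = fun m => dE f (m - i).
Proof. by apply/funext => m; rewrite /dE addrAC. Qed.

Lemma Ek_shift k i f : Ek k f -> Ek k (fun m => f (m - i)).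
Proof.
elim: k f => [|k IH] f [fO h]; split => // ; try by move=> m; apply: fO.
by rewrite dE_shift; apply: IH.
Qed.

Lemma dE_add f g : dE (fun m => f m + g m) =
  fun m => dE f m + dE g m - padd p (f (m + 1)) (g (m + 1)).
Proof.
apply/funext => m; rewrite /dE (paddE _ _ pP).
by field.
Qed.

Lemma dE_mul f g : dE (fun m => f m * g m) =
  fun m => f m * dE g m + dE f m * g (m + 1) ^+ p.
Proof. by apply/funext => m; rewrite /dE exprMn; field. Qed.

(** Sums and products are treated together because [dE] of a sum or of a product involves both
    operations one level lower. *)
Lemma Ek_DM k : (forall f g, Ek k f -> Ek k g -> Ek k (fun m => f m + g m)) /\
  (forall f g, Ek k f -> Ek k g -> Ek k (fun m => f m * g m)).
Proof.
elim: k => [|k [IHD IHM]].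
  split=> f g [fO _] [gO _]; split => // m; first exact: (OD V).
  exact: (valued_M V).
have E1 : Ek k (fun=> 1) by apply: Ek_pow => m; [exact: (valued_1 V)|rewrite expr1n].
have EX f n : Ek k f -> Ek k (fun m => f m ^+ n).
  move=> h; elim: n => [|n IH]; first exact: E1.
  by rewrite (_ : (fun m => _) = fun m => f m * f m ^+ n); [apply: (IHM _ _)|apply/funext => m; rewrite exprS].
have ES (I : Type) (s : seq I) (F : I -> fn) : (forall i, Ek k (F i)) -> Ek k (fun m => \sum_(i <- s) F i m).
  move=> h; elim: s => [|i s IH].
    by rewrite (_ : (fun m => _) = fun=> 0); [exact: Ek_const0|apply/funext => m; rewrite big_nil].
  rewrite (_ : (fun m => _) = fun m => F i m + \sum_(j <- s) F j m); first exact: (IHD _ _).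
  by apply/funext => m; rewrite big_cons.
have En n : Ek k (fun=> n%:R).
  elim: n => [|n IH]; first exact: Ek_const0.
  by rewrite -nat1r; exact: (IHD (fun=> 1) (fun=> n%:R)).
have EN f : Ek k f -> Ek k (fun m => - f m).
  move=> h; rewrite (_ : (fun m => _) = fun m => -1 * f m); last by apply/funext => m; rewrite mulN1r.
  apply: (IHM (fun=> -1)) => //; apply: Ek_pow => m; first exact/(ON V)/(valued_1 V).
  by rewrite -signr_odd p_odd.
have sh f : Ek k f -> Ek k (fun m => f (m + 1)).
  by move=> h; have := @Ek_shift k (-1) f h; rewrite opprK.
split=> f g fE gE; have [fO fd] := fE; have [gO gd] := gE; have [fE' gE'] := (Ek_S fE, Ek_S gE).
- split=> [m|]; first exact: (OD V).
  rewrite dE_add; apply: (IHD _ _); first exact: (IHD _ _).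
  apply: EN; apply: ES => i; apply: (IHM (fun=> _)); first exact: En.
  by apply: (IHM _ _); apply: EX; apply: sh.
- split=> [m|]; first exact: (valued_M V).
  by rewrite dE_mul; apply: (IHD _ _); apply: (IHM _ _) => //; apply: EX; apply: sh.
Qed.

Lemma E_O f m : E f -> O (f m). Proof. by move=> h; apply: Ek_O (h 0%N). Qed.
Lemma E_shift i f : E f -> E (fun m => f (m - i)). Proof. by move=> h k; apply: Ek_shift. Qed.
Lemma E_pow f : (forall m, O (f m)) -> (forall m, f (m + 1) ^+ p = f m) -> E f.
Proof. by move=> h1 h2 k; apply: Ek_pow. Qed.
Lemma E0 : E (fun=> 0). Proof. by move=> k; apply: Ek_const0. Qed.
Lemma E1 : E (fun=> 1).
Proof. by apply: E_pow => m; [exact: (valued_1 V)|rewrite expr1n]. Qed.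
Lemma ED f g : E f -> E g -> E (fun m => f m + g m).
Proof. by move=> h1 h2 k; apply: (Ek_DM k).1. Qed.
Lemma E_M f g : E f -> E g -> E (fun m => f m * g m).
Proof. by move=> h1 h2 k; apply: (Ek_DM k).2. Qed.
Lemma EN f : E f -> E (fun m => - f m).
Proof.
move=> h; rewrite (_ : (fun m => _) = fun m => -1 * f m); last by apply/funext => m; rewrite mulN1r.
apply: (E_M (f := fun=> -1)) => //; apply: E_pow => m; first exact/(ON V)/(valued_1 V).
by rewrite -signr_odd p_odd.
Qed.
Lemma EB f g : E f -> E g -> E (fun m => f m - g m).
Proof. by move=> h1 h2; apply: ED => //; apply: EN. Qed.
Lemma EX f n : E f -> E (fun m => f m ^+ n).
Proof.
move=> h; elim: n => [|n IH]; first exact: E1.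
by rewrite (_ : (fun m => _) = fun m => f m * f m ^+ n); [apply: E_M|apply/funext => m; rewrite exprS].
Qed.
Lemma Esum (I : Type) (s : seq I) (F : I -> fn) : (forall i, E (F i)) -> E (fun m => \sum_(i <- s) F i m).
Proof.
move=> h; elim: s => [|i s IH].
  by rewrite (_ : (fun m => _) = fun=> 0); [exact: E0|apply/funext => m; rewrite big_nil].
rewrite (_ : (fun m => _) = fun m => F i m + \sum_(j <- s) F j m); first exact: ED.
by apply/funext => m; rewrite big_cons.
Qed.
Lemma Eprod (I : Type) (s : seq I) (F : I -> fn) : (forall i, E (F i)) -> E (fun m => \prod_(i <- s) F i m).
Proof.
move=> h; elim: s => [|i s IH].
  by rewrite (_ : (fun m => _) = fun=> 1); [exact: E1|apply/funext => m; rewrite big_nil].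
rewrite (_ : (fun m => _) = fun m => F i m * \prod_(j <- s) F j m); first exact: E_M.
by apply/funext => m; rewrite big_cons.
Qed.
Lemma Enat n : E (fun=> n%:R).
Proof.
elim: n => [|n IH]; first exact: E0.
by rewrite -nat1r; exact: (ED (f := fun=> 1) (g := fun=> n%:R) E1 IH).
Qed.
Lemma E_dE f : E f -> E (dE f). Proof. by move=> h k; have [] := h k.+1. Qed.

Lemma E_morph (s : {rmorphism L -> L}) f : (forall x, O x -> O (s x)) -> E f -> E (fun m => s (f m)).
Proof.
move=> sO h k; elim: k f h => [|k IH] f h; (split; first by move=> m; apply/sO/E_O) => //.
have -> : dE (fun m => s (f m)) = fun m => s (dE f m).
  by apply/funext => m; rewrite /dE fmorph_div rmorphB rmorphXn rmorph_nat.
by apply: IH; apply: E_dE.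
Qed.

(** Each application of [dE] costs one index and one digit of the approximation, which is harmless
    for locally uniform limits. *)
Lemma E_limpt f : (forall M n : nat, exists2 g, E g &
   forall m, (`|m| <= M)%N -> vge n%:R (f m - g m)) -> E f.
Proof.
move=> h k; elim: k f h => [|k IH] f h.
all: have fO m : O (f m).
all: try by (have [g gE /(_ m (leqnn _)) hg] := h `|m|%N 0%N; rewrite -[f m](subrK (g m)); apply: (OD V); [exact/(vge0P V)|exact: E_O]).
  by split.
split=> //; apply: IH => M n; have [g gE hg] := h M.+1 n.+1; exists (dE g); first exact: E_dE.
move=> m hm; have -> : dE f m - dE g m = ((f m - g m) - (f (m + 1) ^+ p - g (m + 1) ^+ p)) / p%:R.
  by rewrite /dE; field.
rewrite (vge_divr V) // (vl_p V) natr1; apply: (vgeB V); first by apply: hg; lia.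
by apply: (vge_exprB V); rewrite ?ler0n //; [exact: E_O|apply: hg; lia].
Qed.

Lemma Ek_sub_pow k f : Ek k f -> Ek k (fun m => p%:R ^+ p.-1 * f (m + 1) ^+ p).
Proof.
move=> h; have [_ M] := Ek_DM k; have EX' g n : Ek k g -> Ek k (fun m => g m ^+ n).
  move=> hg; elim: n => [|n IH]; first by move: (E1 k).
  by rewrite (_ : (fun m => _) = fun m => g m * g m ^+ n); [apply: M|apply/funext => m; rewrite exprS].
apply: (M (fun=> _)); first by rewrite -natrX; apply: Enat.
by apply: (EX' (fun m => f (m + 1))); have := @Ek_shift k (-1) f h; rewrite opprK.
Qed.

Lemma Ek_pM k f : Ek k f -> Ek k.+1 (fun m => p%:R * f m).
Proof.
move=> h; split=> [m|]; first by apply: (valued_M V); [exact: (Onat V)|exact: Ek_O h].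
have -> : dE (fun m => p%:R * f m) = fun m => f m + -1 * (p%:R ^+ p.-1 * f (m + 1) ^+ p).
  by apply/funext => m; rewrite /dE exprMn mulN1r divp_aux ?prime_gt0.
have [A M] := Ek_DM k; apply: A => //; apply: (M (fun=> -1)); last exact: Ek_sub_pow.
by move: (EN E1 k).
Qed.

(** Since [dE (p f) = f - p^(p-1) f(m+1)^p] and multiplication by [p] gains a level ([Ek_pM]),
    membership of [f] at level [k] improves to level [k + 1]. *)
Lemma E_divp f : E (fun m => p%:R * f m) -> (forall m, O (f m)) -> E f.
Proof.
move=> h fO k; elim: k => [|k IH] //.
have -> : f = fun m => dE (fun m => p%:R * f m) m + p%:R * (p%:R ^+ p.-2 * f (m + 1) ^+ p).
  apply/funext => m; rewrite /dE exprMn divp_aux ?prime_gt0 // mulrA -exprS.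
  by rewrite -subn2 -subSn ?prime_gt1 // subSS subn1 subrK.
apply: (Ek_DM k.+1).1; first exact: E_dE h k.+1.
apply: Ek_pM; have [_ M] := Ek_DM k; apply: (M (fun=> _)); first by rewrite -natrX; apply: Enat.
have EX' g n : Ek k g -> Ek k (fun m => g m ^+ n).
  move=> hg; elim: n => [|n IHn]; first by move: (E1 k).
  by rewrite (_ : (fun m => _) = fun m => g m * g m ^+ n); [apply: M|apply/funext => m; rewrite exprS].
by apply: (EX' (fun m => f (m + 1))); have := @Ek_shift k (-1) f IH; rewrite opprK.
Qed.

Lemma E_inv f : E f -> (forall m, f m != 0) -> (forall m, O (f m)^-1) -> E (fun m => (f m)^-1).
Proof.
move=> h f0 fV k; elim: k => [|k IH] //; split=> //.
have -> : dE (fun m => (f m)^-1) = fun m => dE f m * (-1 * ((f m)^-1 * (f (m + 1))^-1 ^+ p)).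
  apply/funext => m; rewrite /dE exprVn.
  by have /= h1 := f0 m; have h2 : f (m + 1) ^+ p != 0 by [rewrite expf_neq0]; field; rewrite h1 h2 p0.
have [_ M] := Ek_DM k; have EX' g n : Ek k g -> Ek k (fun m => g m ^+ n).
  move=> hg; elim: n => [|n IHn]; first by move: (E1 k).
  by rewrite (_ : (fun m => _) = fun m => g m * g m ^+ n); [apply: M|apply/funext => m; rewrite exprS].
apply: (M _ _); first exact: E_dE h k.
apply: (M (fun=> -1)); first by move: (EN E1 k).
apply: (M _ _) => //; apply: (EX' (fun m => (f (m + 1))^-1)).
by have := @Ek_shift k (-1) (fun m => (f m)^-1) IH; rewrite opprK.
Qed.

(** Such a system is an element of the tilt of [OC], prolonged to negative indices by [p]-th powers;
    as a sequence it is the corresponding Teichmueller element. *)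
Definition compat (x : fn) := (forall m, O (x m)) /\ (forall m, x (m + 1) ^+ p = x m).

Lemma compat_E x : compat x -> E x. Proof. by case; apply: E_pow. Qed.

Lemma compat_X x n : compat x -> compat (fun m => x m ^+ n).
Proof. by case=> xO h; split=> m; [exact: (OX V)|rewrite exprAC h]. Qed.

Lemma compat_shift i x : compat x -> compat (fun m => x (m - i)).
Proof. by case=> xO hx; split=> m //; rewrite addrAC hx. Qed.

Lemma compat_morph (s : {rmorphism L -> L}) x : (forall x, O x -> O (s x)) ->
  compat x -> compat (fun m => s (x m)).
Proof. by move=> sO [xO hx]; split=> m; [exact: sO|rewrite -rmorphXn hx]. Qed.

Lemma compat_iter x (j : nat) m : compat x -> x (m + j%:Z) ^+ (p ^ j) = x m.
Proof.
case=> _ h; elim: j => [|j IH]; first by rewrite addr0 expn0 expr1.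
by rewrite expnS exprM intS [1 + _]addrC addrA h.
Qed.

Lemma vge_exprX_grow r x y j : 0 <= r <= 1 -> O x -> O y -> vge r (x - y) ->
  vge (r *+ j.+1) (x ^+ (p ^ j) - y ^+ (p ^ j)).
Proof.
move=> /andP[r0 r1] Ox Oy h; elim: j => [|j IH]; first by rewrite mulr1n expn0 !expr1.
rewrite expnSr !exprM.
have := vge_exprpB V (mulrn_wge0 j.+1 r0) (OX V (p ^ j) Ox) (OX V (p ^ j) Oy) IH.
apply: vge_le; rewrite le_min -mulrnA; apply/andP; split; last by rewrite mulrS lerD2r.
by apply: ler_wpMn2l => //; have := prime_gt1 pP; nia.
Qed.

Lemma mulrn_large (r : rat) (n : nat) : 0 < r -> exists j, n%:R <= r *+ j.
Proof.
move=> r0; have r0' : 0 <= n%:R / r by rewrite divr_ge0 ?ler0n // ltW.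
have := archi_boundP r0'; set b := Num.bound _ => hb.
by exists b; rewrite -[r *+ b]mulr_natl -ler_pdivrMr // ltW.
Qed.

(** [x m] is a high [p]-power of a value at a large index, and [p]-th powers contract
    ([vge_exprX_grow]); any uniform closeness at large indices therefore forces equality. *)
Lemma compat_uniq r n0 x y : compat x -> compat y -> 0 < r ->
  (forall n : nat, (n0 <= n)%N -> vge r (x n%:Z - y n%:Z)) -> x = y.
Proof.
move=> cx cy r0 h; apply/funext => m; apply/eqP; rewrite -subr_eq0; apply/eqP/sep => n.
pose r' := Num.min r 1; have r'0 : 0 < r' by rewrite lt_min r0 ltr01.
have [j hj] := mulrn_large n r'0.
(* [j] powers reach the precision [n]; the other summands bring the index [m + i] beyond [n0]. *)
pose i : nat := (j + n0 + `|m|%N)%N.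
rewrite -(compat_iter i m cx) -(compat_iter i m cy).
have [[xO _] [yO _]] := (cx, cy).
have hi : vge r' (x (m + i%:Z) - y (m + i%:Z)).
  have [l -> ln] : exists2 l : nat, m + i%:Z = l%:Z & (n0 <= l)%N.
    by exists (absz (m + i%:Z)); rewrite /i; lia.
  by apply: vge_le (h l ln); rewrite ge_min lexx.
have r'b : 0 <= r' <= 1 by rewrite ltW //= ge_min lexx orbT.
apply: vge_le (vge_exprX_grow i r'b (xO _) (yO _) hi).
by apply: le_trans hj _; apply: ler_wpMn2l; [exact: ltW|rewrite /i; lia].
Qed.

(** [x m] is the limit of [u (m + j)^(p^j)], the usual passage from systems modulo [p] to the
    tilt. *)
Lemma compat_lim r (u : fn) : 0 < r <= 1 -> (forall m, O (u m)) ->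
  (forall m, vge r (u (m + 1) ^+ p - u m)) ->
  exists x, compat x /\ forall m, vge r (x m - u m).
Proof.
move=> /andP[r0 r1] uO h.
have rb : 0 <= r <= 1 by rewrite ltW.
pose a m j := u (m + Posz j) ^+ (p ^ j).
have aO m j : O (a m j) by apply: (OX V).
have hS m j : vge (r *+ j.+1) (a m j.+1 - a m j).
  rewrite /a expnS exprM intS [1 + _]addrC addrA; apply: vge_exprX_grow => //; exact: (OX V).
have hd m j j' : (j <= j')%N -> vge (r *+ j.+1) (a m j' - a m j).
  move=> /subnK <-; elim: (j' - j)%N => [|i IH]; first by rewrite subrr vge_0.
  apply: (vge_trans V (y := a m (i + j)%N)) => //; apply: vge_le (hS m (i + j)%N).
  by apply: ler_wpMn2l; [exact: ltW|lia].
have /choice[x hx] m : exists l, forall n : nat, exists m0, forall j, (m0 <= j)%N -> vge n%:R (l - a m j).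
  apply: lim => n; have [j0 hj0] := mulrn_large n r0; exists j0 => j le.
  apply: vge_le (hd m j0 j le); apply: le_trans hj0 _.
  by apply: ler_wpMn2l; [exact: ltW|lia].
have xu m : vge r (x m - u m).
  have [m0 /(_ m0 (leqnn _)) h1] := hx m 1%N; apply: (vge_trans V (y := a m m0)); first exact: vge_le h1.
  have := hd m 0%N m0 (leq0n _); rewrite mulr1n /a expn0 expr1 addr0; exact.
exists x; split=> //; have xO m : O (x m).
  by rewrite -[x m](subrK (u m)); apply: (OD V) => //; apply/(vge0P V); apply: vge_le (xu m); exact: ltW.
split=> // m; apply/eqP; rewrite -subr_eq0; apply/eqP/sep => n.
have [m0 h0] := hx m n; have [m1 h1] := hx (m + 1) n.
pose j := maxn m0 m1.
apply: (vge_trans V (y := a m j.+1)); last first.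
  by rewrite (vge_subC V); apply: h0; rewrite /j leqW // leq_maxl.
rewrite /a expnSr exprM intS addrA; apply: (vge_exprB V); rewrite ?ler0n //; first exact: (OX V).
by apply: h1; rewrite leq_maxr.
Qed.

(** Integrality of [dE f] says that [f] is a compatible system modulo [p]; [compat_lim] turns it
    into the first Teichmueller digit of [f]. *)
Lemma E_teich f : E f -> exists2 x, compat x & E (fun m => (f m - x m) / p%:R).
Proof.
move=> h; have fO m : O (f m) by apply: E_O.
have f1 m : vge 1 (f (m + 1) ^+ p - f m).
  rewrite (vge_subC V); have := E_O m (E_dE h).
  by rewrite /dE -(vge0P V) (vge_divr V) // (vl_p V) add0r.
have [x [cx hx]] := @compat_lim 1 f (introT andP (conj ltr01 (lexx 1))) fO f1.
exists x => //; apply: E_divp => [|m].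
  move: (EB h (compat_E cx)); congr (E _); apply/funext => m; by field.
by apply/(vge0P V); rewrite (vge_divr V) // (vl_p V) add0r (vge_subC V).
Qed.

End Ering.

End GhostSequences.

(** * Divisibility, constants and algebraic equations in [E] *)

Module GhostEquations.
Import finfield Valuations ClosureAndCompletion GhostSequences.

Lemma closed_nroot (F : closedFieldType) n (u : F) : (0 < n)%N -> exists t, t ^+ n = u.
Proof.
move=> n0; have [t ht] := @solve_monicpoly F n (fun i => if i == 0%N then u else 0) n0.
exists t; rewrite ht; case: n n0 {ht} => // n _.
by rewrite big_ord_recl /= expr0 mulr1 big1 ?addr0 // => i _; rewrite mul0r.
Qed.

Lemma rat_aux1 (p D : nat) : (0 < p)%N -> (0 < D)%N ->
  D%:R^-1 <= Num.min ((p * D)%:R^-1 *+ p) (1 + (p * D)%:R^-1) :> rat.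
Proof.
move=> p0 D0; have [pr Dr] : (p%:R != 0 :> rat) /\ (D%:R != 0 :> rat) by rewrite !pnatr_eq0 -!lt0n.
rewrite le_min -[_ *+ p]mulr_natr natrM invfM mulrAC mulVf // mul1r lexx /=.
apply: ler_wpDr; first by rewrite mulr_ge0 ?invr_ge0 ?ler0n.
by rewrite invf_le1 ?ltr0n // ler1n.
Qed.

Lemma rat_aux2 (p D : nat) (x : rat) : (0 < p)%N -> (0 < D)%N ->
  1 <= x *+ p -> (p * D)%:R^-1 *+ D <= x.
Proof.
move=> p0 D0; have [pr Dr] : (p%:R != 0 :> rat) /\ (D%:R != 0 :> rat) by rewrite !pnatr_eq0 -!lt0n.
rewrite -[x *+ p]mulr_natr -[_ *+ D]mulr_natr natrM invfM mulfVK // => h.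
by rewrite -[_^-1]mul1r ler_pdivrMr ?ltr0n.
Qed.

Lemma mulrn_lt_neg (r : rat) (i D : nat) : r < 0 -> (i < D)%N -> r *+ D < r *+ i.
Proof.
by move=> r0 iD; rewrite -(subnK (ltnW iD)) mulrnDr gtrDr pmulrn_llt0 ?subn_gt0.
Qed.

Section Ering2.
Variables (p : nat) (L : fieldType) (O : L -> Prop).
Hypotheses (V : valued p O) (p_odd : odd p).
Hypothesis lim : forall u : nat -> L,
  (forall n : nat, exists m0, forall m, (m0 <= m)%N -> vge p O n%:R (u m - u m0)) ->
  exists l, forall n : nat, exists m0, forall m, (m0 <= m)%N -> vge p O n%:R (l - u m).
Hypothesis sep : forall x, (forall n : nat, vge p O n%:R x) -> x = 0.
Local Notation vge := (vge p O).
Local Notation vl := (vl p O).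
Local Notation E := (E p O).
Local Notation compat := (compat p O).
Let pP := valued_prime V.
Let p0 : p%:R != 0 :> L := valued_p0 V.

Lemma compat0 : compat (fun=> 0).
Proof. by split=> m; [exact: (O0 V)|rewrite expr0n gtn_eqF ?prime_gt0]. Qed.

(** A nonzero Teichmueller digit has valuations tending to 0 as the index grows, so a positive lower
    bound at large indices makes the first digit vanish. *)
Lemma E_div_small r n0 f : 0 < r -> E f ->
  (forall n : nat, (n0 <= n)%N -> vge r (f n%:Z)) -> E (fun m => f m / p%:R).
Proof.
move=> r0 Ef h; have [x cx Ex] := E_teich V p_odd lim sep Ef.
have x0 : x = fun=> 0.
  apply: (@compat_uniq _ _ _ V p_odd sep (Num.min r 1) n0) => // [||n le]; first exact: compat0.
    by rewrite lt_min r0 ltr01.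
  rewrite subr0 -[x n%:Z](subKr (f n%:Z)); apply: (vgeB V); first by apply: vge_le (h n le); rewrite ge_min lexx.
  have := E_O n%:Z Ex; rewrite -(vge0P V) (vge_divr V) // (vl_p V) add0r => h1.
  by apply: vge_le h1; rewrite ge_min lexx orbT.
by move: Ex; rewrite x0; congr (E _); apply/funext => m; rewrite subr0.
Qed.

(** By [E_div_small] such a sequence is divisible by [p] arbitrarily often. Identities in [E] can
    thus be checked at large indices only. *)
Lemma E_vanish n0 f : E f -> (forall n : nat, (n0 <= n)%N -> f n%:Z = 0) -> f = fun=> 0.
Proof.
move=> Ef h; apply/funext => m; apply: sep => n; elim: n f Ef h => [|n IH] f Ef h.
  by apply/(vge0P V); exact: (E_O m Ef).
have Ed : E (fun m => f m / p%:R).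
  by apply: (E_div_small ltr01 Ef (n0 := n0)) => j /h ->; exact: vge_0.
have h' j : (n0 <= j)%N -> f j%:Z / p%:R = 0 by move=> /h ->; rewrite mul0r.
have := IH _ Ed h'.
by rewrite (vge_divr V) // (vl_p V) natr1.
Qed.

Lemma Fp_int_eq0 (z : int) : z%:~R = 0 :> 'F_p -> exists y : int, z = p%:R * y.
Proof.
have h (n : nat) : n%:R = 0 :> 'F_p -> exists y : int, n%:Z = p%:R * y.
  move=> e; have : (p %| n)%N by rewrite (dvdn_pcharf (pchar_Fp pP)) e.
  by case/dvdnP => q ->; exists q%:Z; rewrite PoszM mulrC natz.
case: z => n /=; first exact: h.
rewrite NegzE rmorphN /= => /eqP; rewrite oppr_eq0 => /eqP /h[y ->].
by exists (- y); rewrite mulrN.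
Qed.

(** Over the integers, the product of the [X - a] for [0 <= a < p] is [X^p - X] modulo [p]. *)
Lemma prod_sub_Fp (c : L) : O c -> vge 1 (c ^+ p - c) ->
  vge 1 (\prod_(x : 'F_p) (c - (x : nat)%:R)).
Proof.
move=> Oc hc; pose P : {poly int} := \prod_(x : 'F_p) ('X - ((x : nat)%:R)%:P) - ('X^p - 'X).
have P0 : map_poly (intr : int -> 'F_p) P = 0.
  rewrite rmorphB rmorph_prod /= (eq_bigr (fun x => 'X - x%:P)) => [|x _]; last first.
    by rewrite rmorphB /= map_polyX map_polyC /= rmorph_nat natr_Zp.
  rewrite -finField_genPoly card_Fp // !rmorphB /= map_polyXn map_polyX; ring.
have -> : \prod_(x : 'F_p) (c - (x : nat)%:R) = (map_poly (intr : int -> L) P).[c] + (c ^+ p - c).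
  rewrite /P !rmorphB /= map_polyXn map_polyX; set Q := map_poly _ _; rewrite hornerD hornerN hornerD hornerN hornerXn hornerX subrK /Q.
  rewrite rmorph_prod horner_prod; apply: eq_bigr => x _.
  by rewrite rmorphB /= map_polyX map_polyC /= hornerD hornerN hornerX hornerC rmorph_nat.
apply: (vgeD V) => //; rewrite horner_coef; apply: (vge_sum V) => i _; apply: (vge_mulr V); first exact: (OX V).
rewrite coef_map /=; have [|y ->] := @Fp_int_eq0 P`_i; first by rewrite -coef_map P0 coef0.
by rewrite rmorphM /= rmorph_nat; apply: (vge_mulr V); [exact: (O_intr V)|exact: (vge_pX V 1)].
Qed.

Lemma vl_prod_large r (I : finType) (F : I -> L) : 0 < r ->
  vge (r *+ #|I|) (\prod_i F i) -> (0 < #|I|)%N -> exists i, vge r (F i).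
Proof.
move=> r0 h I0; apply: contrapT => nh.
have n_ i : F i != 0 /\ vl (F i) < r.
  have : ~ vge r (F i) by move=> h1; apply: nh; exists i.
  by rewrite /Valuations.vge => /negP; rewrite negb_or -ltNge => /andP[].
have pr0 : \prod_i F i != 0 by apply/prodf_neq0 => i _; case: (n_ i).
move: h; rewrite /Valuations.vge (negPf pr0) /= (vl_prod V) => [|i _]; last by case: (n_ i).
rewrite leNgt -sumr_const => /negP; apply; have [i0 _] : exists i : I, true by case/card_gt0P: I0 => i _; exists i.
rewrite (bigD1 i0) // [ltRHS](bigD1 i0) //=; apply: ltr_leD; first by case: (n_ i0).
by apply: ler_sum => i _; case: (n_ i) => _ /ltW.
Qed.

(** Constants are fixed by Frobenius: [c^p = c] modulo [p] places [c] near one of [0, ..., p - 1],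
    the difference is divisible by [p] in [E], and the argument is repeated. *)
Lemma E_const_nat c n : E (fun=> c) -> exists a : nat, vge n%:R (c - a%:R).
Proof.
elim: n c => [|n IH] c Ec.
  by exists 0%N; rewrite subr0; apply/(vge0P V); exact: (E_O 0 Ec).
have Oc := E_O 0 Ec; have := E_O 0 (E_dE Ec).
rewrite /dE -(vge0P V) (vge_divr V) // (vl_p V) add0r (vge_subC V) => h.
have cF : (0 < #|'F_p|)%N by rewrite card_Fp ?prime_gt0.
have r0 : 0 < p%:R^-1 :> rat by rewrite invr_gt0 ltr0n prime_gt0.
have hp : vge (p%:R^-1 *+ #|'F_p|) (\prod_(x : 'F_p) (c - (x : nat)%:R)).
  rewrite card_Fp // (_ : p%:R^-1 *+ p = 1 :> rat); first exact: prod_sub_Fp.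
  by rewrite -[LHS]mulr_natl mulfV // pnatr_eq0 -lt0n prime_gt0.
have [x hx] := vl_prod_large r0 hp cF.
have Ed : E (fun=> c - (x : nat)%:R) by apply: (EB V p_odd Ec); exact: Enat.
have [a ha] := IH _ (E_div_small r0 Ed (n0 := 0) (fun _ _ => hx)).
exists (x + p * a)%N; rewrite natrD natrM opprD addrA.
have -> : c - (x : nat)%:R - p%:R * a%:R = p%:R * ((c - (x : nat)%:R) / p%:R - a%:R) by field.
by rewrite -nat1r (vge_pM V).
Qed.

Lemma E_const c : (forall n, exists a : nat, vge n%:R (c - a%:R)) -> E (fun=> c).
Proof.
by move=> h; apply: (E_limpt V p_odd) => M n; have [a ha] := h n; exists (fun=> a%:R) => //; exact: Enat.
Qed.

Lemma O_root_monic (D : nat) (c : 'I_D -> L) v : (forall i, O (c i)) ->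
  v ^+ D + \sum_i c i * v ^+ i = 0 -> O v.
Proof.
move=> Oc e; apply/(vge0P V); rewrite /Valuations.vge; have [//|v0] := eqVneq v 0.
rewrite leNgt; apply/negP => hv.
have [|_ /eqP] := @vl_add_lt _ _ _ V (v ^+ D) (\sum_i c i * v ^+ i) (expf_neq0 _ v0); last exact.
apply: (vgt_sum V) => i _; have [->|c0] := eqVneq (c i) 0; first by rewrite mul0r vgt_0.
rewrite /vgt (vlM V) ?expf_neq0 // !(vlX V) //.
have /(vge0P V) := Oc i; rewrite /Valuations.vge (negPf c0) /= => hc.
apply/orP; right; apply: (@lt_le_trans _ _ (vl v *+ i)); last by rewrite lerDr.
exact: mulrn_lt_neg.
Qed.

End Ering2.

Section Frob.
Variables (p : nat) (L : fieldType) (O : L -> Prop).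
Hypothesis V : valued p O.
Local Notation vge := (vge p O).

Lemma vge_sumXp (I : Type) (s : seq I) (F : I -> L) : (forall i, O (F i)) ->
  vge 1 ((\sum_(i <- s) F i) ^+ p - \sum_(i <- s) F i ^+ p).
Proof.
move=> h; elim: s => [|i s IH].
  by rewrite !big_nil expr0n gtn_eqF ?prime_gt0 ?(valued_prime V) // subr0 vge_0.
have OF : O (\sum_(j <- s) F j) by apply: (O_sum V).
rewrite !big_cons (paddE _ _ (valued_prime V)).
have -> (a b c d : L) : a + b + d - (a + c) = (b - c) + d by ring.
apply: (vgeD V) => //; apply: (vge_mulr V); last exact: (vge_pX V 1).
apply: (O_sum V) => j _; apply: (valued_M V); first exact: (Onat V).
by apply: (valued_M V); apply: (OX V).
Qed.

(** Only the lower coefficients of the monic polynomial are recorded, as a family, so that they can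
    be taken at a varying index of a sequence. *)
Definition mpev (D : nat) (c : 'I_D -> L) (t : L) := t ^+ D + \sum_i c i * t ^+ i.

Lemma O_mpev D (c : 'I_D -> L) t : (forall i, O (c i)) -> O t -> O (mpev c t).
Proof.
move=> Oc Ot; apply: (OD V); first exact: (OX V).
by apply: (O_sum V) => i _; apply: (valued_M V) => //; apply: (OX V).
Qed.

Lemma mpev_frob D (c c' : 'I_D -> L) t : (forall i, O (c i)) -> O t ->
  (forall i, vge 1 (c i ^+ p - c' i)) -> vge 1 (mpev c t ^+ p - mpev c' (t ^+ p)).
Proof.
move=> Oc Ot h; pose F (i : option 'I_D) := if i is Some i then c i * t ^+ i else t ^+ D.
have OF i : O (F i) by case: i => [i|] /=; [apply: (valued_M V) => //|]; apply: (OX V).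
have e : mpev c t = \sum_(i <- None :: map Some (index_enum 'I_D)) F i.
  by rewrite big_cons big_map.
rewrite e; apply: (vge_trans V (vge_sumXp _ OF)); rewrite big_cons big_map /mpev /= -exprM mulnC exprM.
rewrite opprD addrACA subrr add0r -sumrB; apply: (vge_sum V) => i _.
rewrite exprMn -exprM mulnC exprM -mulrBl; apply: (vge_mulr V) => //.
by apply: (OX V); apply: (OX V).
Qed.

Lemma vge_mpevB r D (c : 'I_D -> L) t u : 0 <= r -> (forall i, O (c i)) -> O t -> O u ->
  vge r (t - u) -> vge r (mpev c t - mpev c u).
Proof.
move=> r0 Oc Ot Ou h; rewrite /mpev opprD addrACA -sumrB; apply: (vgeD V); first exact: (vge_exprB V).
by apply: (vge_sum V) => i _; rewrite -mulrBr; apply: (vge_mull V) => //; apply: (vge_exprB V).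
Qed.

Lemma vge_mpev_coef r D (c c' : 'I_D -> L) t : O t ->
  (forall i, vge r (c i - c' i)) -> vge r (mpev c t - mpev c' t).
Proof.
move=> Ot h; rewrite /mpev opprD addrACA subrr add0r -sumrB; apply: (vge_sum V) => i _.
by rewrite -mulrBl; apply: (vge_mulr V) => //; apply: (OX V).
Qed.
End Frob.

Section Alg.
Variables (p : nat) (k : fieldType) (W : witt_vectors p k).
Hypotheses (pP : prime p) (p_odd : odd p).
Variables (K : fieldExtType {fraction W}) (Kb : alg_closure K) (C : completion Kb).
Local Notation OC := (@comp_int p k W K Kb C).
Local Notation OK := (OK Kb).
Local Notation emb := (comp_emb C).
Let V := valuedC pP C.
Let VK := valuedK pP Kb.
Local Notation E := (E p OC).
Local Notation compat := (compat p OC).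

Lemma C_lim (u : nat -> C) :
  (forall n : nat, exists m0, forall m, (m0 <= m)%N -> vge p OC n%:R (u m - u m0)) ->
  exists l, forall n : nat, exists m0, forall m, (m0 <= m)%N -> vge p OC n%:R (l - u m).
Proof. exact: vC_lim. Qed.

Lemma C_sep (x : C) : (forall n : nat, vge p OC n%:R x) -> x = 0.
Proof. by move=> h; apply: (vC_sep pP) => n; rewrite subr0. Qed.

Lemma mpev_roots D (c : 'I_D -> Kb) : exists v : 'I_D -> Kb, forall t, mpev c t = \prod_i (t - v i).
Proof.
pose q : {poly Kb} := \poly_(i < D) oapp c 0 (insub i : option 'I_D).
pose P := 'X^D + q.
have sP : (size q < size ('X^D : {poly Kb}))%N.
  by rewrite size_polyXn ltnS size_poly.
have [r er] := closed_field_poly_normal P.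
have lP : lead_coef P = 1 by rewrite lead_coefDl // lead_coefXn.
have sr : size r = D.
  by have := size_polyDl sP; rewrite -/P er lP scale1r size_prod_XsubC size_polyXn => -[].
exists (fun i => r`_i) => t; transitivity P.[t].
  rewrite /P hornerD hornerXn horner_poly; congr (_ + _); apply: eq_bigr => i _.
  by rewrite valK.
by rewrite er lP scale1r horner_prod (big_nth 0) sr big_mkord; apply: eq_bigr => i _; rewrite !hornerE.
Qed.

(** For [t^p = u], the value at [t] of the polynomial with coefficients [c'] has a [p]-th power
    divisible by [p]. Spread over [D] linear factors, this gives a root at valuation at least
    [1/(p D)] from [t]; taking [p]-th powers yields [1/D]. *)
Lemma mpev_lift_root D (c c' : 'I_D -> Kb) u : (0 < D)%N -> (forall i, OK (c i)) -> (forall i, OK (c' i)) ->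
  (forall i, vge p OK 1 (c' i ^+ p - c i)) -> OK u -> vge p OK 1 (mpev c u) ->
  exists v, [/\ OK v, mpev c' v = 0 & vge p OK (D%:R^-1) (v ^+ p - u)].
Proof.
move=> D0 Oc Oc' hc Ou hu; have [v hv] := mpev_roots c'.
have Ov i : OK (v i).
  apply: (O_root_monic VK Oc' (D := D)); rewrite -[LHS]/(mpev c' (v i)) hv.
  by rewrite (bigD1 i) //= subrr mul0r.
have [t et] := closed_nroot u (prime_gt0 pP).
have Ot : OK t by apply: (valued_root VK (prime_gt0 pP)); rewrite et.
have h1 : vge p OK 1 (mpev c' t ^+ p).
  by rewrite -[_ ^+ p](subrK (mpev c (t ^+ p))); apply: (vgeD VK); [exact: (mpev_frob VK)|rewrite et].
have r0 : 0 < (p * D)%:R^-1 :> rat by rewrite invr_gt0 ltr0n muln_gt0 prime_gt0.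
have [||i hi] := @vl_prod_large _ _ _ VK (p * D)%:R^-1 'I_D (fun i => t - v i) r0; last 1 first.
- exists (v i); split => //; first by rewrite hv (bigD1 i) //= subrr mul0r.
  rewrite -et (vge_subC VK); apply: vge_le (vge_exprpB VK (ltW r0) Ot (Ov i) hi).
  exact: rat_aux1 (prime_gt0 pP) D0.
- have [e0|n0] := eqVneq (\prod_i (t - v i)) 0; first by rewrite e0 vge_0.
  move: h1; rewrite hv /Valuations.vge expf_eq0 (negPf n0) andbF /= (vlX VK) // card_ord.
  exact: rat_aux2 (prime_gt0 pP) D0.
- by rewrite card_ord.
Qed.

(** This is the algebraic closedness of the tilt. Roots [u n] of approximating equations over [Kb]
    are chosen successively so that [u_(n+1)^p] is close to [u_n], and [compat_lim] makes them a
    compatible system. *)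
Lemma E_alg D (c : 'I_D -> int -> C) : (0 < D)%N -> (forall i, E (c i)) ->
  exists2 x, compat x & forall m, vge p OC 1 (mpev (c^~ m) (x m)).
Proof.
move=> D0 Ec.
have /choice[a ha] (im : 'I_D * nat) : exists y, vge p OC 1 (c im.1 im.2 - emb y) by exact: (comp_approx pP _ 1).
have Oa i n : OK (a (i, n)).
  have h : OC (emb (a (i, n))).
    rewrite -[emb _](subKr (c i n)); apply: (valued_B V); first exact: E_O.
    by apply/(vge0P V); apply: vge_le (ha (i, n)); rewrite ler01.
  exact/comp_int_emb/h.
pose b n i := a (i, n).
have fb n i : vge p OK 1 (b n.+1 i ^+ p - b n i).
  rewrite -(vge_emb pP C) rmorphB rmorphXn /=.
  have -> : emb (b n.+1 i) ^+ p - emb (b n i) = - (c i n.+1 ^+ p - emb (b n.+1 i) ^+ p) -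
      (c i n - c i (n%:Z + 1) ^+ p) + (c i n - emb (b n i)) by rewrite (_ : n%:Z + 1 = n.+1%:Z); [ring|lia].
  apply: (vgeD V) (ha (i, n)); apply: (vgeB V); first rewrite (vgeN V).
    have h1 : OC (emb (b n.+1 i)) by apply/comp_int_emb; exact: Oa.
    by apply: (vge_exprB V); [rewrite ler01|exact: (E_O _ (Ec i))|exact: h1|exact: (ha (i, n.+1))].
  have := E_O n (E_dE (Ec i)); by rewrite /dE -(vge0P V) (vge_divr V) ?(valued_p0 V) // (vl_p V) add0r.
have /choice[F hF] (nu : nat * Kb) : exists v, OK nu.2 -> vge p OK 1 (mpev (b nu.1) nu.2) ->
    [/\ OK v, mpev (b nu.1.+1) v = 0 & vge p OK (D%:R^-1) (v ^+ p - nu.2)].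
  case: (pselect (OK nu.2)) => h1; last by exists 0.
  case: (pselect (vge p OK 1 (mpev (b nu.1) nu.2))) => h2; last by exists 0.
  by have [v hv] := @mpev_lift_root D (b nu.1) (b nu.1.+1) nu.2 D0 (fun i => Oa i _) (fun i => Oa i _) (fb nu.1) h1 h2; exists v.
have [u0 [Ou0 hu0]] : exists u, OK u /\ mpev (b 0%N) u = 0.
  have [v hv] := mpev_roots (b 0%N); exists (v (Ordinal D0)); have e : mpev (b 0%N) (v (Ordinal D0)) = 0.
    by rewrite hv (bigD1 (Ordinal D0)) //= subrr mul0r.
  by split=> //; apply: (O_root_monic VK (fun i => Oa i 0%N)).
pose u := fix u n := if n is n'.+1 then F (n', u n') else u0.
have hu n : OK (u n) /\ mpev (b n) (u n) = 0.
  elim: n => [|n [IH1 IH2]] //=; have e : vge p OK 1 (mpev (b n) (u n)) by rewrite IH2 vge_0.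
  by have [] := hF (n, u n) IH1 e.
have hu2 n : vge p OK (D%:R^-1) (u n.+1 ^+ p - u n).
  have [h1 h2] := hu n; have e : vge p OK 1 (mpev (b n) (u n)) by rewrite h2 vge_0.
  by have [] := hF (n, u n) h1 e.
(* Negative indices are filled with powers of [u0], which satisfy the compatibility exactly. *)
pose U (m : int) := match m with Posz n => emb (u n) | Negz n => emb u0 ^+ (p ^ n.+1) end.
have r0 : 0 < D%:R^-1 :> rat by rewrite invr_gt0 ltr0n.
have r1 : D%:R^-1 <= 1 :> rat by rewrite invf_le1 ?ltr0n // ler1n.
have OU m : OC (U m).
  by case: m => n /=; [apply/comp_int_emb; case: (hu n)|apply: (OX V); apply/comp_int_emb].
have [|m|x [cx hx]] := @compat_lim _ _ _ V p_odd C_lim C_sep (D%:R^-1) U _ OU; first by rewrite r0.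
  case: m => n.
    have -> : Posz n + 1 = Posz n.+1 by lia.
    by rewrite /U -rmorphXn -rmorphB (vge_emb pP).
  case: n => [|n].
    have -> : Negz 0 + 1 = Posz 0 by lia.
    by rewrite /U expn1 subrr vge_0.
  have -> : Negz n.+1 + 1 = Negz n by lia.
  by rewrite /U -exprM -expnSr subrr vge_0.
exists x => // m; pose G m := mpev (c^~ m) (x m).
have EG : E G.
  apply: (@ED _ _ _ V p_odd (fun m => x m ^+ D) (fun m => \sum_i c i m * x m ^+ i)).
    exact: (EX V p_odd _ (compat_E V cx)).
  apply: (Esum V p_odd _ (F := fun i m => c i m * x m ^+ i)) => i.
  exact: (@E_M _ _ _ V p_odd (c i) (fun m => x m ^+ i) (Ec i) (EX V p_odd i (compat_E V cx))).
(* [x] is close to the roots up to [1/D] only; [E_div_small] improves the resulting bound to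
   divisibility by [p]. *)
have := E_O m (@E_div_small _ _ _ V p_odd C_lim C_sep _ 0 _ r0 EG _).
rewrite -(vge0P V) (vge_divr V) ?(valued_p0 V) // (vl_p V) add0r; apply => n _.
have [h1 h2] := hu n.
rewrite /G -[mpev _ _](subrK (mpev (c^~ n) (emb (u n)))); apply: (vgeD V).
  by apply: (vge_mpevB V); [exact: ltW|move=> i; exact: (E_O _ (Ec i))|have [] := cx|exact/comp_int_emb|exact: (hx n)].
have e0 : mpev (fun i => emb (b n i)) (emb (u n)) = 0.
  by rewrite -(rmorph0 emb) -h2 /mpev rmorphD rmorphXn rmorph_sum; congr (_ + _); apply: eq_bigr => i _; rewrite rmorphM rmorphXn.
rewrite -[mpev _ _]subr0 -e0; apply: (@vge_le _ _ _ 1) => //; apply: (vge_mpev_coef V); first exact/comp_int_emb.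
by move=> i; apply: (ha (i, n)).
Qed.
End Alg.

End GhostEquations.

(** * Tame representations are controlled by one radical and finitely many residues *)

Module TameAction.
Import Valuations ClosureAndCompletion GaloisGroups GhostSequences.

Section OneUnits.
Variables (p : nat) (L : fieldType) (O : L -> Prop).
Hypothesis V : valued p O.
Local Notation vgt := (vgt p O).
Local Notation vge := (vge p O).
Definition one_unit (x : L) : bool := vgt 0 (x - 1).

Lemma one_unit_O x : one_unit x -> [/\ O x, O x^-1 & x != 0].
Proof.
move=> h; have [|h1 h2] := @vl_sub_lt _ _ _ V 1 x (oner_neq0 L); first by rewrite (vl1 V).
rewrite (vl1 V) in h1; split=> //; apply/(vge0P V); rewrite /Valuations.vge ?invr_eq0 ?(vlV V) // h1 ?oppr0 lexx orbT //.
Qed.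

Lemma one_unit1 : one_unit 1. Proof. by rewrite /one_unit subrr vgt_0. Qed.

Lemma one_unitM x y : one_unit x -> one_unit y -> one_unit (x * y).
Proof.
move=> hx hy; have [Ox _ _] := one_unit_O hx.
rewrite /one_unit (_ : x * y - 1 = (y - 1) * x + (x - 1)); last by ring.
apply: (vgtD V) => //; rewrite -[0]addr0; apply: (vgtM V) => //; exact/(vge0P V).
Qed.

Lemma one_unitV x : one_unit x -> one_unit x^-1.
Proof.
move=> hx; have [_ OxV x0] := one_unit_O hx.
rewrite /one_unit (_ : x^-1 - 1 = - (x - 1) * x^-1); last by field.
rewrite -[0]addr0; apply: (vgtM V); [by rewrite (vgtN V)|exact/(vge0P V)].
Qed.

Lemma one_unitX x n : one_unit x -> one_unit (x ^+ n).
Proof. by move=> h; elim: n => [|n IH]; rewrite ?exprS; [exact: one_unit1|exact: one_unitM]. Qed.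

Lemma one_unitXz x (z : int) : one_unit x -> one_unit (x ^ z).
Proof. by case: z => n h; [exact: one_unitX|rewrite NegzE -exprnN; apply/one_unitV/one_unitX]. Qed.

(** Modulo [p], [x^p - 1] is [(x - 1)^p]. This is what makes the [p]-part of a denominator of
    valuations harmless. *)
Lemma one_unit_rootp x : O x -> one_unit (x ^+ p) -> one_unit x.
Proof.
move=> Ox; rewrite /one_unit -{1}[x](subrK 1) (paddE _ _ (valued_prime V)) expr1n => h.
have Ox1 : O (x - 1) by apply: (valued_B V) => //; exact: (valued_1 V).
have h1 : vgt 0 ((x - 1) ^+ p).
  have := h; rewrite addrAC addrK => h2.
  rewrite -[X in vgt _ X](addrK (p%:R * padd p (x - 1) 1)); apply: (vgtB V) => //.
  apply: (vge_vgt ltr01); apply: (vge_mulr V); last exact: (vge_pX V 1).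
  apply: (O_sum V) => i _; rewrite expr1n mulr1; apply: (valued_M V); [exact: (Onat V)|exact: (OX V)].
move: h1; rewrite /Valuations.vgt expf_eq0 prime_gt0 ?(valued_prime V) //=.
have [//|n0] := eqVneq (x - 1) 0; rewrite (vlX V) //=.
by rewrite pmulrn_lgt0 // prime_gt0 ?(valued_prime V).
Qed.

Lemma one_unit_rootpX x s : O x -> one_unit (x ^+ (p ^ s)) -> one_unit x.
Proof.
move=> Ox; elim: s => [|s IH]; first by rewrite expn0 expr1.
by rewrite expnSr exprM => h; apply: IH; apply: one_unit_rootp => //; exact: (OX V).
Qed.

Lemma one_unit_div u v : u != 0 -> O u^-1 -> vgt 0 (v - u) -> one_unit (v / u).
Proof.
move=> u0 Ou h; rewrite /one_unit (_ : v / u - 1 = (v - u) * u^-1); last by field.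
rewrite -[0]addr0; apply: (vgtM V) => //; exact/(vge0P V).
Qed.
End OneUnits.

Lemma tame_rat_aux (r : rat) (q m M : nat) (z : int) : (0 < m)%N -> (0 < M)%N -> (m %| M)%N ->
  r *+ (q * m) = z%:~R -> r *+ q - (M%:R)^-1 *~ (z * (M %/ m)%N%:Z) = 0.
Proof.
move=> m0 M0 /dvdnP[n e]; rewrite {}e in M0 *; rewrite mulnK // => e.
have n0 : (n%:R : rat) != 0 by rewrite pnatr_eq0; case: (n) M0.
have m0' : (m%:R : rat) != 0 by rewrite pnatr_eq0 -lt0n.
rewrite -mulrzl intrM -e -pmulrn mulrnA -[_ *+ q *+ m]mulr_natr natrM.
by move: (r *+ q) n0 m0' => x; move: (n%:R : rat) (m%:R : rat) => y w y0 w0; field; rewrite y0 w0.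
Qed.

Lemma tame_field_aux (L : fieldType) (a b c d : L) : a != 0 -> b != 0 -> c != 0 -> d != 0 ->
  a * b^-1 = c * d^-1 * (a / c / (b / d)).
Proof. by move=> *; field; do !(apply/andP; split). Qed.

Section Tame.
Variables (p : nat) (k : fieldType) (W : witt_vectors p k).
Hypothesis pP : prime p.
Variables (K : fieldExtType {fraction W}) (Kb : alg_closure K).
Variables (T : vectType 'F_p) (tau : abs_galois Kb -> 'End(T)).
Hypotheses (tau_cont : discrete_continuous tau) (tau_tame : tamely_ramified tau).
Let V := valuedK pP Kb.
Local Notation O := (OK Kb).
Local Notation vl := (vl p (OK Kb)).
Local Notation vgt := (vgt p (OK Kb)).
Local Notation G := (abs_galois Kb).
Local Notation one_unit := (one_unit p (OK Kb)).

Lemma rep_agree g0 : exists s, forall g, gal_agree s g0 g -> tau g = tau g0.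
Proof.
have /choice[s hs] t := tau_cont g0 t.
exists (flatten [seq s t | t <- vbasis {:T}]) => g hg; apply/lfunP => t.
rewrite (coord_vbasis (memvf t)) !linear_sum; apply: eq_bigr => i _; rewrite !linearZ; congr (_ *: _).
apply: hs => x xs; apply: hg; apply/flatten_mapP; exists (vbasis {:T})`_i => //.
by apply: mem_nth; rewrite size_tuple.
Qed.

(** Otherwise an ultrafilter limit of counterexamples would lie in wild inertia, hence act
    trivially, and by continuity so would one of the counterexamples. *)
Lemma tame_finite : exists l : seq Kb, forall g : G,
  (forall x, x \in l -> (O x -> vgt 0 (g x - x)) /\ (x != 0 -> one_unit (g x / x))) -> tau g = \1%VF.
Proof.
apply: contrapT => nh.
have /choice[gl hgl] (l : seq Kb) : exists g : G, (forall x, x \in l ->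
    (O x -> vgt 0 (g x - x)) /\ (x != 0 -> one_unit (g x / x))) /\ tau g <> \1%VF.
  apply: contrapT => h; apply: nh; exists l => g hg; apply: contrapT => ht; apply: h; by exists g.
pose F : set_system (seq Kb) := [set A | exists l : seq Kb, forall l' : seq Kb, {subset l <= l'} -> A l']%classic.
have PF : ProperFilter F.
  split; first by move=> [l /(_ l)]; apply.
  split; first by exists [::].
  - move=> A B [l hl] [l' hl']; exists (l ++ l') => m hm; split; [apply: hl|apply: hl'] => x xl;
      by apply: hm; rewrite mem_cat xl ?orbT.
  - by move=> A B AB [l hl]; exists l => l' /hl /AB.
have [U [UU FU]] := ultraFilterLemma PF.
have Umem x : U [set l : seq Kb | x \in l]%classic.
  by apply: FU; exists [:: x] => l' /(_ x); rewrite mem_head => h /=; apply: h.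
have [h hh] := @gal_ultralimit _ _ _ _ UU gl.
have hx x : (O x -> vgt 0 (h x - x)) /\ (x != 0 -> one_unit (h x / x)).
  have [l [/= e xl]] := filter_ex (filterI (hh x) (Umem x)).
  by rewrite -e; have [/(_ x xl)] := hgl l.
have tauh : tau h = \1%VF.
  apply: tau_tame; split=> x; first by move=> Ox; apply/(max_idealK pP); case: (hx x) => + _; exact.
  by move=> x0; apply/(max_idealK pP); case: (hx x) => _; exact.
have [s hs] := rep_agree h.
have [l /= hl] := filter_ex (ultra_all UU (s := s) (P := fun x l => gl l x = h x) (fun x _ => hh x)).
have [_ []] := hgl l; rewrite -tauh; apply: hs => x xs; exact: hl.
Qed.

(** For each [x] in the list of [tame_finite], some [x^(p^s)] is a power of [w] times an element of
    valuation 0, because the prime-to-[p] part of the denominator of its valuation divides [M'].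
    These elements join the list [z], and [one_unit_rootpX] removes the exponent [p^s]. *)
Lemma tame_coprime : exists M : nat, coprime p M /\
  forall M' (w : Kb), (0 < M')%N -> (M %| M')%N -> w != 0 -> vl w = (M'%:R)^-1 ->
  exists z : seq Kb, (forall x, x \in z -> O x) /\
    forall g : G, (forall x, x \in z -> vgt 0 (g x - x)) -> one_unit (g w / w) -> tau g = \1%VF.
Proof.
have [l hl] := tame_finite.
have /choice[f hf] (x : Kb) : exists n : nat * nat * int, x != 0 ->
    [/\ (0 < n.1.2)%N, coprime p n.1.2 & vl x *+ (p ^ n.1.1 * n.1.2) = n.2%:~R].
  have [->|x0] := eqVneq x 0; first by exists (0%N, 0%N, 0).
  have [N [z [u [N0 [Ou OuV] u0 e]]]] := valued_pow V x0.
  have [m cm em] := pfactor_coprime pP N0; exists (logn p N, m, z) => _ /=.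
  split=> //; first by rewrite lt0n; apply: contraL N0 => /eqP m0; rewrite em m0.
  rewrite mulnC -em -(vlX V) // e (vlM V) // ?expfz_neq0 ?(valued_p0 V) // (vl_unit V u0 Ou OuV) addr0.
  case: (z) => n; first by rewrite (vl_pX V).
  by rewrite NegzE -exprnN (vlV V) ?expf_neq0 ?(valued_p0 V) // (vl_pX V) rmorphN.
pose M := (\prod_(x <- l | x != 0%R) (f x).1.2)%N.
have cM : coprime p M.
  by rewrite /M; elim/big_rec: _ => [|x m x0 IH]; rewrite ?coprimen1 // coprimeMr IH andbT; case: (hf x x0).
have dM x : x \in l -> x != 0 -> ((f x).1.2 %| M)%N.
  by move=> xl x0; rewrite /M (big_rem x) //= x0 dvdn_mulr.
exists M; split => // M' w M'0 dM' w0 vw.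
pose u x := x ^+ (p ^ (f x).1.1) / w ^ ((f x).2 * (M' %/ (f x).1.2)%N%:Z).
have u0 x : x != 0 -> u x != 0 by move=> x0; rewrite mulf_neq0 ?invr_eq0 ?expfz_neq0 ?expf_neq0.
have vu x : x \in l -> x != 0 -> vl (u x) = 0.
  move=> xl x0; have [m0 cm em] := hf x x0.
  have vwz (z : int) : vl (w ^ z) = vl w *~ z.
    by case: z => n; rewrite ?NegzE -?exprnN ?(vlV V) ?expf_neq0 // (vlX V) // ?mulrNz.
  rewrite /u (vlM V) ?expf_neq0 ?invr_eq0 ?expfz_neq0 // (vlV V) ?expfz_neq0 // vwz (vlX V) // vw.
  apply: tame_rat_aux m0 M'0 (dvdn_trans (dM x xl x0) dM') em.
exists ([seq x <- l | `[< O x >]] ++ [seq u x | x <- l & x != 0]); split => [x|g hz hw].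
  rewrite mem_cat mem_filter => /orP[/andP[/asboolP //]|/mapP[y]].
  rewrite mem_filter => /andP[y0 yl] ->; apply/(vge0P V); by rewrite /vge vu ?lexx ?orbT.
apply: hl => x xl; split=> [Ox|x0].
  by apply: hz; rewrite mem_cat mem_filter xl andbT (introT (asboolP _) Ox).
have Or : O (g x / x).
  apply/(vge0P V); rewrite /vge (vlM V) ?invr_eq0 ?fmorph_eq0 // (vlV V) // (vl_gal pP) subrr lexx.
  by rewrite orbT.
apply: (one_unit_rootpX V (s := (f x).1.1)) => //.
have hu : one_unit (g (u x) / u x).
  apply: (one_unit_div V); [exact: u0| |].
    by apply/(vge0P V); rewrite /vge (vlV V) ?u0 // vu // oppr0 lexx orbT.
  by apply: hz; rewrite mem_cat map_f ?orbT // mem_filter x0.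
pose e := (f x).2 * (M' %/ (f x).1.2)%N%:Z.
have -> : (g x / x) ^+ (p ^ (f x).1.1) = (g w / w) ^ e * (g (u x) / u x).
  rewrite /u fmorph_div fmorphXz rmorphXn expfzMl -expfV exprMn exprVn -/e.
  by apply: tame_field_aux; rewrite ?expf_neq0 ?expfz_neq0 ?fmorph_eq0.
by apply: (one_unitM V) => //; apply: (one_unitXz V).
Qed.

End Tame.

End TameAction.

(** * The evaluation map from [E] to [A] *)

Module GhostToAcris.
Import Valuations WittRings ClosureAndCompletion GhostSequences GhostEquations.

Lemma vge_expr_pos (p : nat) (L : fieldType) (O : L -> Prop) (V : valued p O) r x n :
  (0 < n)%N -> O x -> vge p O r x -> vge p O r (x ^+ n).
Proof. by case: n => // n _ Ox h; rewrite exprS; apply: (vge_mulr V) => //; exact: (OX V). Qed.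

Section Ev.
Variables (p : nat) (k : fieldType) (W : witt_vectors p k).
Hypotheses (pP : prime p) (p_odd : odd p).
Variables (K : fieldExtType {fraction W}) (Kb : alg_closure K) (C : completion Kb).
Variable A : Acris C.
Local Notation OC := (@comp_int p k W K Kb C).
Let V := valuedC pP C.
Let limC := @C_lim p k W pP K Kb C.
Let sepC := @C_sep p k W pP K Kb C.
Local Notation E := (E p OC).
Local Notation compat := (compat p OC).
Local Notation vge := (vge p OC).
Local Notation theta := (acris_theta A).
Local Notation gam := (@acris_gam _ _ _ _ _ _ A).
Local Notation act := (acris_act A).
Local Notation fn := (int -> C).

Lemma cA : padically_complete p A.
Proof. by case: (acris_thickening A). Qed.

Lemma theta_lift (c : C) : OC c -> exists a, theta a = c.
Proof. by case: (acris_thickening A) => _ h _ /h. Qed.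

Lemma theta_O (a : A) : OC (theta a).
Proof. by case: (acris_thickening A) => _ h _; apply/h; exists a. Qed.

Lemma gamP : pd_structure (fun x => theta x = 0) gam.
Proof. by case: (acris_thickening A). Qed.

Lemma gam_mul m n x : theta x = 0 -> gam m x * gam n x = 'C(m + n, m)%:R * gam (m + n)%N x.
Proof. by case: gamP => _ _ _ _ [h _]; apply: h. Qed.

Lemma gam0 x : theta x = 0 -> gam 0%N x = 1. Proof. by case: gamP => h _ _ _ _ /h[]. Qed.
Lemma gam1 x : theta x = 0 -> gam 1%N x = x. Proof. by case: gamP => h _ _ _ _ /h[]. Qed.
Lemma gamZ n a x : theta x = 0 -> gam n (a * x) = a ^+ n * gam n x.
Proof. by case: gamP => _ _ _ h _ /h. Qed.

Lemma pd_pow n x : theta x = 0 -> x ^+ n = n`!%:R * gam n x.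
Proof.
move=> hx; elim: n => [|n IH]; first by rewrite gam0 // mulr1 expr0.
have := gam_mul 1 n hx; rewrite (gam1 hx) add1n bin1 => e.
by rewrite exprS IH mulrCA e factS natrM mulrA [_%:R * n`!%:R]mulrC.
Qed.

(** With [j = a - a'], the term ['C(p^n, i) j^i] is ['C(p^n, i) i!] times a divided power, and this
    coefficient is a falling factorial starting with [p^n]. *)
Lemma J_pow_cong n (a a' : A) : theta a = theta a' -> in_pX p n (a ^+ (p ^ n) - a' ^+ (p ^ n)).
Proof.
move=> h; have hj : theta (a - a') = 0 by rewrite rmorphB h subrr.
rewrite -[a](subrKC a'); set j := a - a' in hj *.
rewrite exprDn big_ord_recl /= subn0 expr0 mulr1 bin0 mulr1n addrAC subrr add0r.
apply: in_pX_sum => i _; rewrite (pd_pow _ hj) -mulr_natl.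
exists (((p ^ n).-1 ^_ i)%:R * a' ^+ (p ^ n - bump 0 i) * gam (bump 0 i) j)%R.
rewrite /bump /= add1n.
have -> : (p%:R ^+ n : A) * (((p ^ n).-1 ^_ i)%:R * a' ^+ (p ^ n - i.+1) * gam i.+1 j)
  = ((p ^ n) * (p ^ n).-1 ^_ i)%N%:R * (a' ^+ (p ^ n - i.+1) * gam i.+1 j) by rewrite natrM natrX; ring.
by rewrite -ffactnS -bin_ffact natrM; ring.
Qed.

Definition is_teich (x : fn) (b : A) : Prop :=
  forall (n : nat) (a : A), theta a = x n -> in_pX p n (b - a ^+ (p ^ n)).

Lemma teich_ex x : compat x -> exists b, is_teich x b.
Proof.
case=> xO hx; have /choice[a ha] n : exists a, theta a = x n%:Z by exact: theta_lift.
have [n|l hl] := cA.2 (fun n => a n ^+ (p ^ n)).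
  rewrite expnS exprM; apply: J_pow_cong; rewrite rmorphXn !ha -[x n%:Z]hx.
  by congr (x _ ^+ p); lia.
exists l => n b hb; rewrite -(subrKA (a n ^+ (p ^ n))); apply: in_pXD; first exact: hl.
by apply: J_pow_cong; rewrite hb ha.
Qed.

Lemma teich_uniq x b c : compat x -> is_teich x b -> is_teich x c -> b = c.
Proof.
move=> [xO _] hb hc; apply/eqP; rewrite -subr_eq0; apply/eqP/cA.1 => n.
have [a ha] := theta_lift (xO n%:Z).
by rewrite -[b - c](subrKA (a ^+ (p ^ n))) -[_ - c]opprB; apply: in_pXB; [exact: hb|exact: hc].
Qed.

Lemma teich_theta x b : compat x -> is_teich x b -> theta b = x 0.
Proof.
move=> cx hb; apply: (vC_sep pP) => n; have [xO hx] := cx.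
have [a ha] := theta_lift (xO n%:Z); have [y ey] := hb n a ha.
have -> : theta b - x 0 = p%:R ^+ n * theta y.
  rewrite -(rmorph_nat theta p) -rmorphXn -rmorphM -ey rmorphB rmorphXn ha.
  by rewrite -(compat_iter n 0 cx) add0r.
by apply/(vge_nP V); exists (theta y) => //; exact: theta_O.
Qed.

(** Pairs of a sequence and its intended value in [A]; that the value depends on the sequence only
    follows from [ec_small]. *)
Inductive ecomb : fn -> A -> Prop :=
| EcTeich x b : compat x -> is_teich x b -> ecomb x b
| EcAdd f g b c : ecomb f b -> ecomb g c -> ecomb (fun m => f m + g m) (b + c)
| EcMul f g b c : ecomb f b -> ecomb g c -> ecomb (fun m => f m * g m) (b * c)
| EcOpp f b : ecomb f b -> ecomb (fun m => - f m) (- b).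

Lemma ec0 : ecomb (fun=> 0) 0.
Proof.
apply: EcTeich; first exact: (compat0 V).
move=> n a ha; have h0 : theta a = theta 0 by rewrite ha rmorph0.
have e0 : 0 ^+ (p ^ n) = 0 :> A by rewrite expr0n gtn_eqF // expn_gt0 prime_gt0.
by have := in_pXN (J_pow_cong n h0); rewrite e0 opprB.
Qed.

Lemma ec1 : ecomb (fun=> 1) 1.
Proof.
apply: EcTeich; first by split=> m; [exact: (valued_1 V)|rewrite expr1n].
move=> n a ha; have h0 : theta 1 = theta a by rewrite ha rmorph1.
by have := J_pow_cong n h0; rewrite expr1n.
Qed.

Lemma ec_nat n : ecomb (fun=> n%:R) n%:R.
Proof.
by elim: n => [|n IH]; [exact: ec0|rewrite -!nat1r; exact: (EcAdd ec1 IH)].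
Qed.

Lemma ec_X f b n : ecomb f b -> ecomb (fun m => f m ^+ n) (b ^+ n).
Proof.
move=> h; elim: n => [|n IH]; first exact: ec1.
by rewrite exprS (_ : (fun m => _) = fun m => f m * f m ^+ n); [exact: EcMul|apply/funext => m; rewrite exprS].
Qed.

Lemma ec_sum (I : Type) (s : seq I) (F : I -> fn) (b : I -> A) :
  (forall i, ecomb (F i) (b i)) -> ecomb (fun m => \sum_(i <- s) F i m) (\sum_(i <- s) b i).
Proof.
move=> h; elim: s => [|i s IH].
  by rewrite big_nil (_ : (fun m => _) = fun=> 0); [exact: ec0|apply/funext => m; rewrite big_nil].
rewrite big_cons (_ : (fun m => _) = fun m => F i m + \sum_(j <- s) F j m); first exact: EcAdd.
by apply/funext => m; rewrite big_cons.
Qed.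

Lemma ec_padd f g b c : ecomb f b -> ecomb g c -> ecomb (fun m => padd p (f m) (g m)) (padd p b c).
Proof.
move=> hf hg; apply: (@ec_sum 'I_p.-1 _ (fun i m => ('C(p, i.+1) %/ p)%:R * (f m ^+ (p.-1 - i) * g m ^+ i.+1))
  (fun i => ('C(p, i.+1) %/ p)%:R * (b ^+ (p.-1 - i) * c ^+ i.+1))) => i.
exact: (EcMul (ec_nat _) (EcMul (ec_X _ hf) (ec_X _ hg))).
Qed.

Lemma ec_E f b : ecomb f b -> E f.
Proof.
elim=> {f b} [x b cx _|f g b c _ hf _ hg|f g b c _ hf _ hg|f b _ h].
- exact: compat_E.
- exact: (ED V p_odd).
- exact: (E_M V p_odd).
- exact: (EN V p_odd).
Qed.

Lemma ec_theta f b : ecomb f b -> theta b = f 0.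
Proof.
elim=> {f b} [x b cx hb|f g b c _ hf _ hg|f g b c _ hf _ hg|f b _ h].
- exact: teich_theta.
- by rewrite rmorphD hf hg.
- by rewrite rmorphM hf hg.
- by rewrite rmorphN h.
Qed.

(** The decomposition [f = (phi^-1 f)^p + p f2] holds for the sequence and for its value in
    parallel, so smallness can be transported by induction. The sequence [f2] is [dE f]. *)
Lemma ec_frob f b : ecomb f b -> exists b' f2 b2,
  [/\ ecomb (fun m => f (m + 1)) b', ecomb f2 b2,
      f = (fun m => f (m + 1) ^+ p + p%:R * f2 m) & b = b' ^+ p + p%:R * b2].
Proof.
elim=> {f b} [x b cx hb|f g b c hf [b' [f2 [b2 [h1 h2 h3 h4]]]] hg [c' [g2 [c2 [h1' h2' h3' h4']]]]
  |f g b c hf [b' [f2 [b2 [h1 h2 h3 h4]]]] hg [c' [g2 [c2 [h1' h2' h3' h4']]]]|f b hf [b' [f2 [b2 [h1 h2 h3 h4]]]]].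
- have cx1 : compat (fun m => x (m + 1)) by have := compat_shift (-1) cx; rewrite opprK.
  have [b' hb'] := teich_ex cx1; exists b', (fun=> 0), 0; split; [exact: EcTeich|exact: ec0| |].
    by apply/funext => m; rewrite mulr0 addr0; case: cx => _ ->.
  rewrite mulr0 addr0; apply: (teich_uniq cx hb) => n a ha.
  have [a' ha'] := theta_lift (cx1.1 n%:Z); have h := hb' n a' ha'.
  rewrite -(subrKA (a' ^+ (p ^ n) ^+ p)); apply: in_pXD; first exact: in_pXXB.
  by rewrite exprAC; apply: J_pow_cong; rewrite rmorphXn ha' ha; case: cx => _ ->.
- exists (b' + c'), (fun m => f2 m + g2 m - padd p (f (m + 1)) (g (m + 1))), (b2 + c2 - padd p b' c'); split.
  + exact: EcAdd.
  + exact: (EcAdd (EcAdd h2 h2') (EcOpp (ec_padd h1 h1'))).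
  + by apply/funext => m; rewrite {1}h3 {1}h3' (paddE _ _ pP); ring.
  + by rewrite {1}h4 {1}h4' (paddE _ _ pP); ring.
- exists (b' * c'), (fun m => f2 m * g m + f (m + 1) ^+ p * g2 m), (b2 * c + b' ^+ p * c2); split.
  + exact: EcMul.
  + exact: (EcAdd (EcMul h2 hg) (EcMul (ec_X p h1) h2')).
  + apply/funext => m; rewrite {1}h3 {1}h3' exprMn mulrDr.
    have -> : g m = g (m + 1) ^+ p + p%:R * g2 m by rewrite {1}h3'.
    by ring.
  + by rewrite {1}h4 h4' exprMn; ring.
- exists (- b'), (fun m => - f2 m), (- b2); split; [exact: EcOpp|exact: EcOpp| |].
    by apply/funext => m; rewrite {1}h3 exprNn -signr_odd p_odd; ring.
  by rewrite {1}h4 exprNn -signr_odd p_odd; ring.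
Qed.

Lemma in_pX_pow1 (b : A) : vge 1 (theta b) -> in_pX p 1 (b ^+ p).
Proof.
move=> /(vge_nP V 1)[y Oy ey]; have [a ha] := theta_lift Oy.
have := @J_pow_cong 1 b (p%:R * a); rewrite expn1 => /(_ _) h.
have -> : b ^+ p = (b ^+ p - (p%:R * a) ^+ p) + (p%:R * a) ^+ p by ring.
apply: in_pXD; first by apply: h; rewrite ey rmorphM rmorph_nat ha.
exists (p%:R ^+ p.-1 * a ^+ p); rewrite exprMn mulrA -exprD add1n prednK ?prime_gt0 //.
Qed.

(** Induction through [ec_frob]. At level 1, [b'^p] is divisible by [p] because [theta b'] is
    ([in_pX_pow1]); at higher levels the [p]-th power multiplies the divisibility already known for
    [b']. *)
Lemma ec_small N f b : ecomb f b -> (forall m : nat, (m <= N)%N -> vge N%:R (f m)) -> in_pX p N b.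
Proof.
elim: N f b => [|N IH] f b hf hN; first exact: in_pX_all.
have [b' [f2 [b2 [h1 h2 h3 h4]]]] := ec_frob hf.
have hf' (m : nat) : (m <= N)%N -> vge N.+1%:R (f (m%:Z + 1)).
  by move=> le; rewrite (_ : m%:Z + 1 = m.+1%:Z); [apply: hN|lia].
have Of m : OC (f m) := E_O m (ec_E hf).
rewrite h4; apply: in_pXD; last first.
  have [y ->] : in_pX p N b2.
    apply: IH h2 _ => m le; rewrite -(vge_pM V) nat1r.
    have -> : p%:R * f2 m = f m - f (m%:Z + 1) ^+ p by rewrite {1}h3; ring.
    apply: (vgeB V); first by apply: hN; exact: leqW.
    by apply: (vge_expr_pos V) => //; [exact: prime_gt0|exact: hf'].
  by exists y; rewrite exprS mulrA.
case: N => [|N] in IH hN hf' *.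
  by apply: in_pX_pow1; rewrite (ec_theta h1) add0r; exact: (hf' 0%N).
have [y ->] : in_pX p N.+1 b'.
  by apply: IH h1 _ => m le; apply: vge_le (hf' m le); rewrite ler_nat.
rewrite exprMn -exprM; exists (p%:R ^+ (N.+1 * p - N.+2) * y ^+ p); rewrite mulrA -exprD subnKC //.
by have := prime_gt1 pP; nia.
Qed.

Lemma ec_approx f n : E f -> exists u c h, [/\ ecomb u c, E h & forall m, f m = u m + p%:R ^+ n * h m].
Proof.
move=> Ef; elim: n => [|n [u [c [h [hu Eh e]]]]].
  by exists (fun=> 0), 0, f; split => // [|m]; [exact: ec0|rewrite add0r expr0 mul1r].
have [x cx Ex] := E_teich V p_odd limC sepC Eh.
have [b hb] := teich_ex cx.
exists (fun m => u m + (p ^ n)%:R * x m), (c + (p ^ n)%:R * b), (fun m => (h m - x m) / p%:R); split=> //.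
  exact: (EcAdd hu (EcMul (ec_nat _) (EcTeich cx hb))).
move=> m; rewrite e exprSr -mulrA [p%:R * _]mulrC divfK ?(valued_p0 V) // natrX; ring.
Qed.

(** The approximation is uniform in the index, but by [is_ev_small] the value depends only on the
    indices [m >= 0]. *)
Definition is_ev (f : fn) (b : A) : Prop := forall N, exists u c,
  [/\ ecomb u c, forall m, vge N%:R (f m - u m) & in_pX p N (b - c)].

Lemma ev_ex f : E f -> exists b, is_ev f b.
Proof.
move=> Ef; have /choice[u hu] N := ec_approx N Ef.
have /choice[c hc] N : exists c, ecomb (u N) c /\ forall m, vge N%:R (f m - u N m).
  have [c [h [h1 h2 h3]]] := hu N; exists c; split=> // m; rewrite h3 addrAC subrr add0r.
  by apply/(vge_nP V); exists (h m) => //; exact: E_O.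
have [n|b hb] := cA.2 c.
  apply: (ec_small (EcAdd (hc n.+1).1 (EcOpp (hc n).1))) => m _.
  have -> : u n.+1 m - u n m = (f m - u n m) - (f m - u n.+1 m) by ring.
  apply: (vgeB V); first exact: (hc n).2.
  by apply: vge_le ((hc n.+1).2 m); rewrite ler_nat.
by exists b => N; exists (u N), (c N); split; [exact: (hc N).1|exact: (hc N).2|exact: hb].
Qed.

Lemma is_ev_small N f b : is_ev f b -> (forall m : nat, (m <= N)%N -> vge N%:R (f m)) -> in_pX p N b.
Proof.
move=> h hN; have [u [c [h1 h2 h3]]] := h N; rewrite -[b](subrK c); apply: in_pXD => //.
apply: (ec_small h1) => m le; rewrite -[u m](subKr (f m)); apply: (vgeB V) => //; exact: hN.
Qed.

Lemma is_ev_ec f b : ecomb f b -> is_ev f b.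
Proof.
move=> h N; exists f, b; split => // [m|]; first by rewrite subrr vge_0.
by rewrite subrr; exact: in_pX0.
Qed.

Lemma is_evD f g b c : is_ev f b -> is_ev g c -> is_ev (fun m => f m + g m) (b + c).
Proof.
move=> hf hg N; have [u [b' [h1 h2 h3]]] := hf N; have [v [c' [h1' h2' h3']]] := hg N.
exists (fun m => u m + v m), (b' + c'); split => [|m|]; first exact: EcAdd.
  by rewrite opprD addrACA; apply: (vgeD V).
by rewrite opprD addrACA; apply: in_pXD.
Qed.

Lemma is_evN f b : is_ev f b -> is_ev (fun m => - f m) (- b).
Proof.
move=> hf N; have [u [b' [h1 h2 h3]]] := hf N; exists (fun m => - u m), (- b'); split=> [|m|]; first exact: EcOpp.
  by rewrite -opprD (vgeN V).
by rewrite -opprD; apply: in_pXN.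
Qed.

Lemma is_evM f g b c : E f -> E g -> is_ev f b -> is_ev g c -> is_ev (fun m => f m * g m) (b * c).
Proof.
move=> Ef Eg hf hg N; have [u [b' [h1 h2 h3]]] := hf N; have [v [c' [h1' h2' h3']]] := hg N.
exists (fun m => u m * v m), (b' * c'); split => [|m|]; first exact: EcMul.
  have -> : f m * g m - u m * v m = (f m - u m) * g m + u m * (g m - v m) by ring.
  apply: (vgeD V); [apply: (vge_mulr V)|apply: (vge_mull V)] => //; [exact: (E_O m Eg)|exact: (E_O m (ec_E h1))].
have -> : b * c - b' * c' = (b - b') * c + b' * (c - c') by ring.
by apply: in_pXD; [apply: in_pXMl|apply: in_pXMr].
Qed.

Lemma is_ev_uniq f b c : is_ev f b -> is_ev f c -> b = c.
Proof.
move=> hb hc; apply/eqP; rewrite -subr_eq0; apply/eqP/cA.1 => n.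
by apply: (is_ev_small (is_evD hb (is_evN hc))) => m _; rewrite subrr vge_0.
Qed.

Lemma is_ev_theta f b : is_ev f b -> theta b = f 0.
Proof.
move=> h; apply: (vC_sep pP) => n; have [u [c [h1 h2 [y ey]]]] := h n.
rewrite -[b](subrK c) rmorphD (ec_theta h1) ey -addrA.
apply: (vgeD V); last by rewrite (vge_subC V).
by rewrite rmorphM rmorphXn rmorph_nat; apply/(vge_nP V); exists (theta y) => //; exact: theta_O.
Qed.

Lemma ec_act g f b : ecomb f b -> ecomb (fun m => comp_act C g (f m)) (act g b).
Proof.
elim=> {f b} [x b cx hb|f h b c _ hf _ hg|f h b c _ hf _ hg|f b _ h].
- apply: EcTeich; first by apply: compat_morph cx => y; exact: comp_act_int.
  move=> n a ha; have [a' ha'] := theta_lift (cx.1 n%:Z); have [y ey] := hb n a' ha'.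
  rewrite -(subrKA (act g a' ^+ (p ^ n))); apply: in_pXD.
    by rewrite -rmorphXn -rmorphB ey; exists (act g y); rewrite rmorphM rmorphXn rmorph_nat.
  by apply: J_pow_cong; rewrite acris_act_theta ha' ha.
- rewrite rmorphD (_ : (fun m => _) = fun m => comp_act C g (f m) + comp_act C g (h m)); first exact: EcAdd.
  by apply/funext => m; rewrite rmorphD.
- rewrite rmorphM (_ : (fun m => _) = fun m => comp_act C g (f m) * comp_act C g (h m)); first exact: EcMul.
  by apply/funext => m; rewrite rmorphM.
- rewrite rmorphN (_ : (fun m => _) = fun m => - comp_act C g (f m)); first exact: EcOpp.
  by apply/funext => m; rewrite rmorphN.
Qed.

Lemma is_ev_act g f b : is_ev f b -> is_ev (fun m => comp_act C g (f m)) (act g b).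
Proof.
move=> h N; have [u [c [h1 h2 [y ey]]]] := h N.
exists (fun m => comp_act C g (u m)), (act g c); split; first exact: ec_act.
  by move=> m; rewrite -rmorphB (vge_act pP).
by rewrite -rmorphB ey; exists (act g y); rewrite rmorphM rmorphXn rmorph_nat.
Qed.

Definition ev (f : fn) : A := if pselect (E f) is left e then projT1 (cid (ev_ex e)) else 0.

Lemma evP f : E f -> is_ev f (ev f).
Proof. by move=> h; rewrite /ev; case: pselect => [e|//]; case: cid. Qed.

Lemma ev_eq f b : E f -> is_ev f b -> ev f = b.
Proof. by move=> h; apply: is_ev_uniq; apply: evP. Qed.

Lemma evD f g : E f -> E g -> ev (fun m => f m + g m) = ev f + ev g.
Proof. by move=> hf hg; apply: ev_eq; [exact: (ED V p_odd)|apply: is_evD; exact: evP]. Qed.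
Lemma evN f : E f -> ev (fun m => - f m) = - ev f.
Proof. by move=> hf; apply: ev_eq; [exact: (EN V p_odd)|apply: is_evN; exact: evP]. Qed.
Lemma evB f g : E f -> E g -> ev (fun m => f m - g m) = ev f - ev g.
Proof. by move=> hf hg; rewrite evD ?evN //; exact: (EN V p_odd). Qed.
Lemma evM f g : E f -> E g -> ev (fun m => f m * g m) = ev f * ev g.
Proof. by move=> hf hg; apply: ev_eq; [exact: (E_M V p_odd)|apply: is_evM => //; exact: evP]. Qed.
Lemma ev_nat n : ev (fun=> n%:R) = n%:R.
Proof. by apply: ev_eq; [exact: (Enat V p_odd)|apply/is_ev_ec/ec_nat]. Qed.
Lemma ev1 : ev (fun=> 1) = 1. Proof. exact: (ev_nat 1). Qed.
Lemma ev0 : ev (fun=> 0) = 0. Proof. exact: (ev_nat 0). Qed.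
Lemma evX f n : E f -> ev (fun m => f m ^+ n) = ev f ^+ n.
Proof.
move=> h; elim: n => [|n IH]; first exact: ev1.
rewrite exprS -IH -evM //; last exact: (EX V p_odd).
by congr ev; apply/funext => m; rewrite exprS.
Qed.
Lemma ev_sum (I : Type) (s : seq I) (F : I -> fn) : (forall i, E (F i)) ->
  ev (fun m => \sum_(i <- s) F i m) = \sum_(i <- s) ev (F i).
Proof.
move=> h; elim: s => [|i s IH].
  by rewrite big_nil -ev0; congr ev; apply/funext => m; rewrite big_nil.
rewrite big_cons -IH -evD //; last exact: (Esum V p_odd).
by congr ev; apply/funext => m; rewrite big_cons.
Qed.
Lemma ev_prod (I : Type) (s : seq I) (F : I -> fn) : (forall i, E (F i)) ->
  ev (fun m => \prod_(i <- s) F i m) = \prod_(i <- s) ev (F i).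
Proof.
move=> h; elim: s => [|i s IH].
  by rewrite big_nil -ev1; congr ev; apply/funext => m; rewrite big_nil.
rewrite big_cons -IH -evM //; last exact: (Eprod V p_odd).
by congr ev; apply/funext => m; rewrite big_cons.
Qed.
Lemma ev_teich x b : compat x -> is_teich x b -> ev x = b.
Proof. by move=> h hb; apply: ev_eq; [exact: compat_E|apply: is_ev_ec; exact: EcTeich]. Qed.
Lemma ev_theta f : E f -> theta (ev f) = f 0.
Proof. by move=> h; apply/is_ev_theta/evP. Qed.
Lemma ev_act g f : E f -> act g (ev f) = ev (fun m => comp_act C g (f m)).
Proof.
move=> h; symmetry; apply: ev_eq; last by apply/is_ev_act/evP.
by apply: E_morph h => x; exact: comp_act_int.
Qed.
Lemma ev_small N f : E f -> (forall m : nat, (m <= N)%N -> vge N%:R (f m)) -> in_pX p N (ev f).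
Proof. by move=> h; apply/is_ev_small/evP. Qed.

End Ev.

End GhostToAcris.

(** * The equation [phi^n w = xi w] *)

Module RankOne.
Import Valuations ClosureAndCompletion GhostSequences GhostEquations.

Lemma frob_cancel (R : comNzRingType) (a b x u v : R) :
  (u - a) * (v * b) = (u * (v * b) - x * (a * b)) - (v - x) * (a * b).
Proof. by ring. Qed.

Section RankOne.
Variables (p : nat) (k : fieldType) (W : witt_vectors p k).
Hypotheses (pP : prime p) (p_odd : odd p).
Variables (K : fieldExtType {fraction W}) (Kb : alg_closure K) (C : completion Kb).
Local Notation OC := (@comp_int p k W K Kb C).
Local Notation emb := (comp_emb C).
Let V := valuedC pP C.
Let VK := valuedK pP Kb.
Let limC := @C_lim p k W pP K Kb C.
Let sepC := @C_sep p k W pP K Kb C.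
Local Notation E := (E p OC).
Local Notation compat := (compat p OC).
Local Notation vge := (vge p OC).
Local Notation vgt := (vgt p OC).
Local Notation vl := (vl p OC).
Local Notation fn := (int -> C).
Let p0 : p%:R != 0 :> C := valued_p0 V.

Lemma E_natM (a : nat) f : E f -> E (fun m => a%:R * f m).
Proof. by move=> h; apply: (@E_M _ _ _ V p_odd (fun=> a%:R) f _ h); exact: (Enat V p_odd). Qed.

Lemma E_series (x : nat -> fn) : (forall i, E (x i)) ->
  exists2 y, E y & forall N m, vge N%:R (y m - \sum_(i < N) p%:R ^+ i * x i m).
Proof.
move=> Ex; pose s m N := \sum_(i < N) p%:R ^+ i * x i m.
have hs m N N' : (N <= N')%N -> vge N%:R (s m N' - s m N).
  move=> /subnK <-; elim: (N' - N)%N => [|j IH]; first by rewrite subrr vge_0.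
  rewrite addSn /s big_ord_recr /= -/(s m _) -/(s m N) addrAC; apply: (vgeD V) => //.
  apply: (vge_mulr V); first exact: (E_O m (Ex _)).
  by apply: vge_le (vge_pX V _); rewrite ler_nat leq_addl.
have /choice[y hy] m : exists l, forall n : nat, exists m0, forall j, (m0 <= j)%N -> vge n%:R (l - s m j).
  by apply: limC => n; exists n => j le; apply: hs.
have hy' N m : vge N%:R (y m - s m N).
  have [m0 h] := hy m N; apply: (vge_trans V (y := s m (maxn N m0))).
    by apply: h; rewrite leq_maxr.
  by apply: hs; rewrite leq_maxl.
exists y => //; apply: (E_limpt V p_odd) => M N; exists (fun m => s m N) => [|m _]; last exact: hy'.
apply: (@Esum _ _ _ V p_odd _ _ (fun (i : 'I_N) m => p%:R ^+ i * x i m)) => i.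
by move: (@E_natM (p ^ i) _ (Ex i)); congr (E _); apply/funext => m; rewrite natrX.
Qed.

Lemma int_shiftE (f : fn) (n : nat) m : compat f -> f (m - n%:Z) = f m ^+ (p ^ n).
Proof. by move=> cf; rewrite -(compat_iter n (m - n%:Z) cf) subrK. Qed.

Section Base.
Variables (n : nat) (xi x y : fn) (m0 : nat).
Local Notation q := (p ^ n)%N.
Hypotheses (n0 : (0 < n)%N) (Exi : E xi) (cx : compat x) (Ey : E y).
Hypotheses (xy : forall m, vge 1 (y m - x m)) (yR : forall m, y (m - n%:Z) = xi m * y m).
Hypotheses (x0 : forall m, x m != 0) (xq : forall m, vge 1 (x m ^+ q.-1 - xi m)).
Hypothesis xv : forall m : nat, (m0 <= m)%N -> vl (x m) *+ q <= 2%:R^-1.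
Let q1 : (1 < q)%N. Proof. by rewrite -{1}(expn0 p) ltn_exp2l ?prime_gt1. Qed.

(** The quotient [kp] of the first Teichmueller digits of [w] and [y] satisfies [kp^q = kp] modulo
    [p], up to division by [x^q]. At large indices this costs at most 1/2, so a positive bound is
    left and [compat_uniq] gives exact equality. *)
Lemma rank_one_step w : E w -> (forall m, w (m - n%:Z) = xi m * w m) ->
  exists kp, [/\ compat kp, forall m, kp (m - n%:Z) = kp m & E (fun m => (w m - kp m * y m) / p%:R)].
Proof.
move=> Ew Rw; have [x' cx' Ex'] := E_teich V p_odd limC sepC Ew.
have wx m : vge 1 (w m - x' m).
  by have := E_O m Ex'; rewrite -(vge0P V) (vge_divr V) // (vl_p V) add0r.
pose kp m := x' m / x m.
have kpx m : kp m * x m = x' m by rewrite divfK.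
have kpS m : kp (m + 1) ^+ p = kp m by rewrite expr_div_n cx.2 cx'.2.
have hk (m : nat) : (m0 <= m)%N -> vge 2%:R^-1 (kp m%:Z ^+ q - kp m%:Z).
  move=> le; set a := kp m; set b := x m.
  have h1 : vge 1 ((a * b) ^+ q - xi m * (a * b)).
    rewrite kpx -(int_shiftE n m cx').
    have -> : x' (m%:Z - n%:Z) - xi m * x' m = xi m * (w m - x' m) - (w (m%:Z - n%:Z) - x' (m%:Z - n%:Z)).
      by rewrite Rw; ring.
    by apply: (vgeB V) => //; apply: (vge_mull V) => //; exact: (E_O m Exi).
  have h2 : vge 1 ((a ^+ q - a) * b ^+ q).
    have -> : (a ^+ q - a) * b ^+ q = ((a * b) ^+ q - xi m * (a * b)) - (b ^+ q.-1 - xi m) * (a * b).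
      have eb : b ^+ q = b ^+ q.-1 * b by rewrite -exprSr prednK // ltnW.
      by rewrite [(a * b) ^+ q]exprMn eb; exact: frob_cancel.
    apply: (vgeB V) => //; apply: (vge_mulr V); last exact: xq.
    by rewrite kpx; exact: cx'.1.
  have bq0 : b ^+ q != 0 by apply: expf_neq0; exact: x0.
  rewrite -(vge_mulIr V _ _ bq0); apply: vge_le h2; rewrite (vlX V) ?x0 //.
  by have := xv le; rewrite -/b; set u := _ *+ _; lra.
(* [kp] at [m] is a root of [X^q - X + (kp - kp^q)], whose constant term was just seen to be
   integral. *)
have Ok0 (m : nat) : (m0 <= m)%N -> OC (kp m%:Z).
  move=> le; have hc := hk m le.
  pose c (i : 'I_q) : C := if i == 0%N :> nat then kp m - kp m ^+ q else if i == 1%N :> nat then -1 else 0.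
  apply: (O_root_monic V (D := q) (c := c)) => [i|].
    rewrite /c; case: ifP => _; last by case: ifP => _; [exact/(ON V)/(valued_1 V)|exact: (O0 V)].
    by apply/(vge0P V); rewrite (vge_subC V); apply: vge_le hc; rewrite invr_ge0.
  rewrite (bigD1 (Ordinal (ltnW q1))) //= (bigD1 (Ordinal q1)) //= big1 => [|i]; last first.
    rewrite -!(inj_eq val_inj) /= /c => /andP[/negPf -> /negPf ->]; exact: mul0r.
  rewrite /c /= expr0 expr1; ring.
have ckp : compat kp.
  split=> // m; have [N [e le]] : exists N : nat, m + N%:Z = (`|m| + m + m0%:Z)%R /\ (m0 <= `|(m + N%:Z)%R|)%N /\ 0 <= m + N%:Z.
    by exists (`|m| + m0)%N; lia.
  have it (j : nat) : kp m = kp (m + j%:Z) ^+ (p ^ j).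
    elim: j => [|j ->]; first by rewrite addr0 expr1.
    by rewrite -(kpS (m + j%:Z)) -exprM -expnS -addrA; congr (kp _ ^+ _); lia.
  rewrite (it N); apply: (OX V).
  have [l -> ll] : exists2 l : nat, m + N%:Z = l%:Z & (m0 <= l)%N by exists `|(m + N%:Z)%R|%N; lia.
  exact: Ok0.
have kq : (fun m => kp m ^+ q) = kp.
  apply: (compat_uniq V p_odd sepC (compat_X V q ckp) ckp (r := 2%:R^-1) (n0 := m0)) => //.
exists kp; split=> //; first by move=> m; rewrite (int_shiftE n m ckp) -[in RHS]kq.
apply: (E_divp V p_odd) => [|m].
  move: (EB V p_odd Ew (E_M V p_odd (compat_E V ckp) Ey)); congr (E _); apply/funext => m.
  by rewrite [RHS]mulrC divfK.
apply/(vge0P V); rewrite (vge_divr V) // (vl_p V) add0r.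
have -> : w m - kp m * y m = (w m - x' m) - kp m * (y m - x m) by rewrite -kpx; ring.
by apply: (vgeB V) => //; apply: (vge_mull V) => //; exact: ckp.1.
Qed.

(** Subtracting [kp y] and dividing by [p] gives another solution of the same equation; the
    successive digits [kp] are those of [r]. *)
Lemma rank_one w : E w -> (forall m, w (m - n%:Z) = xi m * w m) ->
  exists r, [/\ E r, forall m, r (m - n%:Z) = r m & forall m, w m = r m * y m].
Proof.
move=> Ew Rw.
have /choice[F hF] (u : fn) : exists kp, E u -> (forall m, u (m - n%:Z) = xi m * u m) ->
   [/\ compat kp, forall m, kp (m - n%:Z) = kp m & E (fun m => (u m - kp m * y m) / p%:R)].
  case: (pselect (E u)) => h1; last by exists (fun=> 0).
  case: (pselect (forall m, u (m - n%:Z) = xi m * u m)) => h2; last by exists (fun=> 0).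
  by have [kp hkp] := rank_one_step h1 h2; exists kp.
pose u := fix u i := if i is j.+1 then (fun m => (u j m - F (u j) m * y m) / p%:R) else w.
have hu i : E (u i) /\ forall m, u i (m - n%:Z) = xi m * u i m.
  elim: i => [|i [IH1 IH2]] //=; have [h1 h2 h3] := hF _ IH1 IH2; split=> // m.
  by rewrite IH2 h2 yR; field.
have hFu i := hF _ (hu i).1 (hu i).2.
have [r Er hr] := @E_series (fun i => F (u i)) (fun i => ltac:(by have [h _ _] := hFu i; exact: compat_E)).
have ur N m : w m = (\sum_(i < N) p%:R ^+ i * F (u i) m) * y m + p%:R ^+ N * u N m.
  elim: N => [|N IH]; first by rewrite big_ord0 mul0r add0r mul1r.
  by rewrite IH big_ord_recr /= exprSr; field.
exists r; split=> // m.
  apply/eqP; rewrite -subr_eq0; apply/eqP/sepC => N.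
  apply: (vge_trans V (hr N _)); rewrite (vge_subC V).
  rewrite (_ : \sum_(i < N) _ = \sum_(i < N) p%:R ^+ i * F (u i) m); first exact: hr.
  by apply: eq_bigr => i _; have [_ -> _] := hFu i.
apply/eqP; rewrite -subr_eq0; apply/eqP/sepC => N.
rewrite (ur N m) (_ : _ - _ = p%:R ^+ N * u N m - (r m - \sum_(i < N) p%:R ^+ i * F (u i) m) * y m); last by ring.
apply: (vgeB V); last by apply: (vge_mulr V); [exact: (E_O m Ey)|exact: hr].
by apply: (vge_mulr V); [exact: (E_O m (hu N).1)|exact: (vge_pX V)].
Qed.

End Base.
End RankOne.

End RankOne.

(** * Divided power polynomials and the logarithm *)

Module DividedPowers.
Import Valuations WittRings GhostSequences.

(** These are the coefficients of [((1 + X)^q - 1) / q] on the divided powers of [X], compared with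
    those of [log (1 + X)]. *)
Lemma ffact_pred_mod (q j : nat) : (0 < q)%N ->
  exists z : int, ((q.-1 ^_ j)%:R : int) = (-1) ^+ j * j`!%:R + q%:R * z.
Proof.
move=> q0; elim: j => [|j [z IH]]; first by exists 0; rewrite ffactn0 mulr0 addr0 expr0 mul1r.
rewrite ffactnSr natrM IH; have [le|lt] := leqP j.+1 q.
  have -> : (q.-1 - j)%N = (q - j.+1)%N by lia.
  rewrite natrB // factS natrM exprS.
  by exists ((-1) ^+ j * j`!%:R + q%:R * z - z * j.+1%:R); ring.
have e0 : (-1) ^+ j * j`!%:R + q%:R * z = 0 :> int by rewrite -IH ffact_small //; lia.
exists (- (j.+1%:R * z)); rewrite e0 mul0r factS natrM exprS.
have eX : (-1) ^+ j * j`!%:R = - (q%:R * z) :> int by apply/eqP; rewrite -addr_eq0 e0.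
rewrite -mulrA [(-1) ^+ j * _]mulrCA eX; ring.
Qed.

Lemma coefXaddC1_aux n i : ((1 + 'X : {poly rat}) ^+ n)`_i = 'C(n, i)%:R.
Proof.
rewrite addrC exprDn coef_sum; have [le|lt] := leqP i n; last first.
  rewrite bin_small // big1 // => j _; rewrite expr1n mulr1 coefMn coefXn.
  by rewrite gtn_eqF ?mul0rn // ltn_subLR ?leq_ord //; lia.
have h : (n - i < n.+1)%N by rewrite ltnS leq_subr.
rewrite (bigD1 (Ordinal h)) //= big1 => [|j /eqP nj]; rewrite expr1n mulr1 coefMn coefXn.
  by rewrite subKn // eqxx addr0 bin_sub.
case: eqP => [e|_]; rewrite ?mul0rn //; case: nj; apply: val_inj => /=.
by rewrite e subKn // -ltnS.
Qed.

Lemma size_exp_XaddC1_aux n : (size ((1 + 'X : {poly rat}) ^+ n) <= n.+1)%N.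
Proof.
apply/leq_sizeP => j lj; rewrite coefXaddC1_aux bin_small //.
Qed.

Section PDPoly.
Variables (A : comNzRingType) (ga : nat -> A).
Hypotheses (ga0 : ga 0%N = 1)
  (gaM : forall m n, ga m * ga n = 'C(m + n, m)%:R * ga (m + n)%N).

(** The span of the [X^i / i!] over the integers. Divisions are carried out there and mapped to [A]
    by [Phi]. *)
Definition pdint (P : {poly rat}) := forall i, P`_i * i`!%:R \is a Num.int.
Definition pdc (P : {poly rat}) i : int := numq (P`_i * i`!%:R).
Definition Phi (P : {poly rat}) : A := \sum_(i < size P) (pdc P i)%:~R * ga i.
Definition pdm i : {poly rat} := (i`!%:R)^-1 *: 'X^i.

Lemma fact_neq0 i : i`!%:R != 0 :> rat.
Proof. by rewrite pnatr_eq0 -lt0n fact_gt0. Qed.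

Lemma pdcE P i : pdint P -> (pdc P i)%:~R = P`_i * i`!%:R.
Proof. by move=> h; rewrite /pdc numqK. Qed.

Lemma Phi_widen (P : {poly rat}) n : (size P <= n)%N -> Phi P = \sum_(i < n) (pdc P i)%:~R * ga i.
Proof.
move=> le; rewrite /Phi (big_ord_widen n (fun i => (pdc P i)%:~R * ga i)) // big_mkcond.
apply: eq_bigr => i _; case: ifP => // /negbT; rewrite -leqNgt => h.
by rewrite /pdc nth_default // mul0r mul0r.
Qed.

Lemma pdintD P Q : pdint P -> pdint Q -> pdint (P + Q).
Proof. by move=> h1 h2 i; rewrite coefD mulrDl rpredD. Qed.

Lemma pdint_sum (I : Type) (s : seq I) (F : I -> {poly rat}) :
  (forall i, pdint (F i)) -> pdint (\sum_(i <- s) F i).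
Proof.
move=> h; elim: s => [|i s IH]; first by move=> i; rewrite big_nil coef0 mul0r.
by rewrite big_cons; apply: pdintD.
Qed.

Lemma PhiD P Q : pdint P -> pdint Q -> Phi (P + Q) = Phi P + Phi Q.
Proof.
move=> h1 h2; pose n := maxn (size P) (size Q).
rewrite (Phi_widen (size_polyD P Q)) -/n (@Phi_widen P n) ?leq_maxl // (@Phi_widen Q n) ?leq_maxr //.
rewrite -big_split /=; apply: eq_bigr => i _; rewrite -mulrDl -intrD; congr (_%:~R * _).
apply: (@intr_inj rat); rewrite intrD !pdcE //; last exact: pdintD.
by rewrite coefD mulrDl.
Qed.

Lemma Phi0 : Phi 0 = 0. Proof. by rewrite /Phi size_poly0 big_ord0. Qed.

Lemma Phi_sum (I : Type) (s : seq I) (F : I -> {poly rat}) :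
  (forall i, pdint (F i)) -> Phi (\sum_(i <- s) F i) = \sum_(i <- s) Phi (F i).
Proof.
move=> h; elim: s => [|i s IH]; first by rewrite !big_nil Phi0.
by rewrite !big_cons PhiD ?IH //; apply: pdint_sum.
Qed.

Lemma pdmE i j : (pdm i)`_j = (i == j)%:R / i`!%:R.
Proof. by rewrite /pdm coefZ coefXn eq_sym mulrC. Qed.

Lemma pdint_pdm (z : int) i : pdint (z%:~R *: pdm i).
Proof.
move=> j; rewrite coefZ pdmE; have [<-|_] := eqVneq i j; last by rewrite !(mul0r, mulr0).
by rewrite mul1r mulfVK ?fact_neq0.
Qed.

Lemma Phi_pdm (z : int) i : Phi (z%:~R *: pdm i) = z%:~R * ga i.
Proof.
have le : (size (z%:~R *: pdm i) <= i.+1)%N.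
  apply: leq_trans (size_scale_leq _ _) _; apply: leq_trans (size_scale_leq _ _) _.
  by rewrite size_polyXn.
rewrite (Phi_widen le) big_ord_recr big1 /= ?add0r => [|j _].
  congr (_%:~R * _); apply: (@intr_inj rat); rewrite pdcE; last exact: pdint_pdm.
  by rewrite coefZ pdmE eqxx mul1r mulfVK ?fact_neq0.
by rewrite /pdc coefZ pdmE gtn_eqF ?ltn_ord // mul0r mulr0 mul0r mul0r.
Qed.

Lemma pd_decomp P : pdint P -> P = \sum_(i < size P) (pdc P i)%:~R *: pdm i.
Proof.
move=> h; rewrite -[LHS](coefK P) poly_def; apply: eq_bigr => i _.
by rewrite pdcE // scalerA mulfK ?fact_neq0.
Qed.

Lemma pdmM i j : pdm i * pdm j = ('C(i + j, i)%:~R) *: pdm (i + j).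
Proof.
rewrite /pdm -scalerAl -scalerAr scalerA -exprD scalerA; congr (_ *: _).
have /(congr1 (fun n => n%:R : rat)) := bin_fact (leq_addr j i); rewrite addKn !natrM => e.
have h1 := fact_neq0 i; have h2 := fact_neq0 j; have h3 := fact_neq0 (i + j).
by rewrite -e in h3 *; rewrite -pmulrn; move: h3; rewrite !mulf_eq0 !negb_or => /andP[h3 _]; field; rewrite h3 h1 h2.
Qed.

Lemma PhiM_aux P Q : pdint P -> pdint Q -> pdint (P * Q) /\ Phi (P * Q) = Phi P * Phi Q.
Proof.
move=> hP hQ.
have e : P * Q = \sum_(i < size P) \sum_(j < size Q)
    (pdc P i * pdc Q j * 'C(i + j, i)%:Z)%:~R *: pdm (i + j).
  rewrite {1}(pd_decomp hP) mulr_suml; apply: eq_bigr => i _.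
  rewrite {1}(pd_decomp hQ) mulr_sumr; apply: eq_bigr => j _.
  by rewrite -scalerAl -scalerAr scalerA pdmM scalerA !intrM.
split; first by rewrite e; apply: pdint_sum => i; apply: pdint_sum => j; exact: pdint_pdm.
rewrite e Phi_sum => [|i]; last by apply: pdint_sum => j; exact: pdint_pdm.
rewrite [Phi P]/Phi mulr_suml; apply: eq_bigr => i _.
rewrite Phi_sum => [|j]; last exact: pdint_pdm.
rewrite [Phi Q]/Phi mulr_sumr; apply: eq_bigr => j _.
by rewrite Phi_pdm mulrACA gaM !intrM -!mulrA.
Qed.

Lemma pdintM P Q : pdint P -> pdint Q -> pdint (P * Q).
Proof. by move=> h1 h2; have [] := PhiM_aux h1 h2. Qed.
Lemma PhiM P Q : pdint P -> pdint Q -> Phi (P * Q) = Phi P * Phi Q.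
Proof. by move=> h1 h2; have [] := PhiM_aux h1 h2. Qed.

Lemma pdm_0 : 1 = 1%:~R *: pdm 0. Proof. by rewrite /pdm fact0 invr1 !scale1r expr0. Qed.
Lemma pdm_1 : 'X = 1%:~R *: pdm 1. Proof. by rewrite /pdm invr1 !scale1r expr1. Qed.
Lemma pdint1 : pdint 1. Proof. by rewrite pdm_0; exact: pdint_pdm. Qed.
Lemma pdintX : pdint 'X. Proof. by rewrite pdm_1; exact: pdint_pdm. Qed.
Lemma Phi1 : Phi 1 = 1. Proof. by rewrite pdm_0 Phi_pdm ga0 mul1r. Qed.
Lemma PhiX : Phi 'X = ga 1%N. Proof. by rewrite pdm_1 Phi_pdm mul1r. Qed.
Lemma pdint_exp P n : pdint P -> pdint (P ^+ n).
Proof. by move=> h; elim: n => [|n IH]; rewrite ?exprS; [exact: pdint1|exact: pdintM]. Qed.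
Lemma Phi_exp P n : pdint P -> Phi (P ^+ n) = Phi P ^+ n.
Proof. by move=> h; elim: n => [|n IH]; rewrite ?exprS ?Phi1 ?PhiM ?IH //; exact: pdint_exp. Qed.
Lemma pdint_nat n : pdint n%:R.
Proof. by elim: n => [|n IH] i; rewrite ?coef0 ?mul0r // -nat1r; exact: (pdintD pdint1 IH). Qed.
Lemma Phi_nat n : Phi n%:R = n%:R.
Proof. by elim: n => [|n IH]; rewrite ?Phi0 // -!nat1r PhiD ?Phi1 ?IH //; [exact: pdint1|exact: pdint_nat]. Qed.

Lemma pdint1X n : pdint ((1 + 'X) ^+ n). Proof. apply/pdint_exp/pdintD; [exact: pdint1|exact: pdintX]. Qed.
Lemma Phi1X n : Phi ((1 + 'X) ^+ n) = (1 + ga 1%N) ^+ n.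
Proof. by rewrite Phi_exp ?PhiD ?Phi1 ?PhiX //; try exact: pdintD pdint1 pdintX; [exact: pdint1|exact: pdintX]. Qed.

Section Frobenius.
Variable p : nat.
Hypothesis pP : prime p.
Let pr0 : p%:R != 0 :> rat. Proof. by rewrite pnatr_eq0 -lt0n prime_gt0. Qed.
Let pX0 m : (p ^ m)%:R != 0 :> rat. Proof. by rewrite natrX expf_neq0. Qed.
Let pp0 m : (p ^ m)%:R != 0 :> {poly rat}. Proof. by rewrite -polyC_natr polyC_eq0. Qed.

(** With [1 + X] standing for [[eps]], this is [phi^m(mu) / p^m], which converges to the logarithm
    [t]. *)
Definition tauP m : {poly rat} := ((p ^ m)%:R)^-1 *: ((1 + 'X) ^+ (p ^ m) - 1).
Definition tauc m := Phi (tauP m).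
Definition kapP m : {poly rat} := \sum_(i < p) \sum_(l < i) (1 + 'X) ^+ (p ^ m * l).
(** This is [phi^m(xi) / p], see [lamPE]. The chosen form shows that it tends to 1, as needed for
    the infinite products in [Lam_ex]. *)
Definition lamP m : {poly rat} := 1 + (p ^ m.-1)%:R * (tauP m * kapP m).
Definition lamc m := Phi (lamP m).

Lemma tauP_coef m i : (tauP m)`_i * i`!%:R = (if i is j.+1 then (p ^ m).-1 ^_ j else 0)%:R.
Proof.
rewrite /tauP coefZ coefB coefXaddC1_aux coef1.
case: i => [|j]; first by rewrite bin0 subrr mulr0 mul0r.
rewrite subr0 -mulrA -natrM bin_ffact ffactnS natrM mulrA mulVf // mul1r //.
Qed.

Lemma tauP_int m : pdint (tauP m).
Proof. by move=> i; rewrite tauP_coef. Qed.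

Lemma tauPE m : (p ^ m)%:R * tauP m = (1 + 'X) ^+ (p ^ m) - 1.
Proof. by rewrite /tauP mulr_natl -scaler_nat scalerA mulfV // scale1r. Qed.

Lemma kapP_int m : pdint (kapP m).
Proof. by apply: pdint_sum => i; apply: pdint_sum => l; exact: pdint1X. Qed.

Lemma lamP_int m : pdint (lamP m).
Proof.
apply: pdintD; first exact: pdint1.
apply: pdintM; first exact: pdint_nat.
by apply: pdintM; [exact: tauP_int|exact: kapP_int].
Qed.

Lemma lamPE m : (0 < m)%N -> p%:R * lamP m = \sum_(i < p) (1 + 'X) ^+ (p ^ m * i).
Proof.
case: m => // m _; rewrite /lamP /= mulrDr mulr1 mulrA -natrM -expnS mulrA tauPE /kapP mulr_sumr.
rewrite -[X in X + _ = _]mulr1 -[p in p%:R]card_ord -sumr_const mulr_suml -big_split /=.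
apply: eq_bigr => i _; rewrite mul1r exprM.
under [X in (_ - 1) * X]eq_bigr => l _ do rewrite exprM.
by rewrite -subrX1 subrKC.
Qed.

Lemma tauP_S m : (0 < m)%N -> tauP m.+1 = lamP m * tauP m.
Proof.
move=> m0; apply: (mulfI (pp0 m.+1)); rewrite tauPE expnS natrM mulrACA lamPE // tauPE.
rewrite mulnC exprM subrX1 mulrC; congr (_ * _); apply: eq_bigr => i _.
by rewrite exprM.
Qed.

Lemma tauP1 : tauP 1 = (p.-1)`!%:~R *: pdm p + padd p 1 'X.
Proof.
have hp : p%:R * ((p.-1)`!%:~R *: pdm p) = 'X^p :> {poly rat}.
  rewrite mulr_natl -scaler_nat !scalerA -natrM -{1}(prednK (prime_gt0 pP)) -factS (prednK (prime_gt0 pP)) mulfV ?scale1r //; exact: fact_neq0.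
by apply: (mulfI (pp0 1)); rewrite tauPE expn1 (paddE _ _ pP) expr1n mulrDr hp; ring.
Qed.

Lemma tauc_mul m : (p ^ m)%:R * tauc m = (1 + ga 1%N) ^+ (p ^ m) - 1.
Proof.
rewrite -[(p ^ m)%:R]Phi_nat -PhiM ?tauPE; [|exact: pdint_nat|exact: tauP_int].
have h : pdint ((1 + 'X) ^+ (p ^ m) - 1).
  by move=> i; rewrite coefB mulrBl rpredB //; [exact: pdint1X|exact: pdint1].
by apply: (addIr 1); rewrite subrK -{1}Phi1 -(PhiD h pdint1) subrK Phi1X.
Qed.

Lemma tauc_S m : (0 < m)%N -> tauc m.+1 = lamc m * tauc m.
Proof. by move=> m0; rewrite /tauc tauP_S // PhiM //; [exact: lamP_int|exact: tauP_int]. Qed.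

Definition kapc m := \sum_(i < p) \sum_(l < i) (1 + ga 1%N) ^+ (p ^ m * l).

Lemma lamc_kap m : lamc m = 1 + (p ^ m.-1)%:R * (tauc m * kapc m).
Proof.
have h : pdint (tauP m * kapP m) by apply: pdintM; [exact: tauP_int|exact: kapP_int].
rewrite /lamc /lamP PhiD ?Phi1; [|exact: pdint1|exact: (pdintM (pdint_nat _) h)].
rewrite PhiM ?Phi_nat; [|exact: pdint_nat|exact: h].
rewrite PhiM; [|exact: tauP_int|exact: kapP_int]; congr (1 + _ * (_ * _)).
rewrite /kapP Phi_sum => [|i]; last by apply: pdint_sum => l; exact: pdint1X.
by apply: eq_bigr => i _; rewrite Phi_sum => [|l]; [apply: eq_bigr => l _; exact: Phi1X|exact: pdint1X].
Qed.

(** The first division by [p] uses [(p-1)! ga p] for [X^p / p]; the later [tauc m] are obtained from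
    [tauc_S]. *)
Lemma tauc1 : tauc 1 = (p.-1)`!%:R * ga p + padd p 1 (ga 1%N).
Proof.
have h1 : pdint ((p.-1)`!%:~R *: pdm p) by apply: pdint_pdm.
have hX i : pdint (('C(p, i.+1) %/ p)%:R * (1 ^+ (p.-1 - i) * 'X ^+ i.+1)).
  apply: pdintM; first exact: pdint_nat.
  by apply: pdintM; apply: pdint_exp; [exact: pdint1|exact: pdintX].
rewrite /tauc tauP1 PhiD ?Phi_pdm //; last by apply: pdint_sum => i; exact: hX.
congr (_ + _); rewrite /padd Phi_sum => [|i]; last exact: hX.
apply: eq_bigr => i _; rewrite !expr1n !mul1r PhiM ?Phi_nat ?Phi_exp ?PhiX //; try exact: pdintX; first exact: pdint_nat.
exact/pdint_exp/pdintX.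
Qed.

Lemma tauc_log m M : (p ^ m <= M)%N ->
  in_pX p m (tauc m - \sum_(1 <= n < M.+1) (-1) ^+ n.-1 * n.-1`!%:R * ga n).
Proof.
move=> le; rewrite big_add1 /= big_mkord.
have sz : (size (tauP m) <= M.+1)%N.
  apply: leq_trans (size_scale_leq _ _) _; apply: leq_trans (size_polyD _ _) _.
  rewrite geq_max size_polyN size_poly1 /= andbT.
  by apply: leq_trans (size_exp_XaddC1_aux _) _; rewrite ltnS.
rewrite /tauc (Phi_widen sz) big_ord_recl /pdc tauP_coef mul0r add0r -sumrB.
apply: in_pX_sum => i _; rewrite lift0 tauP_coef -mulrBl; apply: in_pXMl.
have q0 : (0 < p ^ m)%N by rewrite expn_gt0 prime_gt0.
have [z ez] := ffact_pred_mod i q0; exists z%:~R.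
have -> : numq ((p ^ m).-1 ^_ i)%:R = ((p ^ m).-1 ^_ i)%:R.
  by apply: (@intr_inj rat); rewrite numqK // rmorph_nat.
rewrite ez rmorphD !rmorphM rmorphXn !rmorph_nat rmorphN rmorph1 natrX; ring.
Qed.
End Frobenius.
End PDPoly.

End DividedPowers.

(** * The sequences of [[eps]], [mu], [xi] and their Galois cocycles *)

Module CyclotomicSequences.
Import Valuations WittRings ClosureAndCompletion CyclotomicValuations TateInvariants GhostSequences GhostEquations TameAction.

Lemma cyclo_rat_aux (p i : nat) : (1 < p)%N ->
  ((p ^ i * p.-1)%N%:R)^-1 - ((p ^ i.+1 * p.-1)%N%:R)^-1 = ((p ^ i.+1)%N%:R)^-1 :> rat.
Proof.
case: p => [|[|r]] // _; rewrite /= expnS !natrM !natrX.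
have h1 : r.+2%:R != 0 :> rat by rewrite pnatr_eq0.
have h2 : r.+1%:R != 0 :> rat by rewrite pnatr_eq0.
have h3 : r.+2%:R ^+ i != 0 :> rat by rewrite expf_neq0.
by move: h1 h2 h3; move: (r.+2%:R ^+ i) => u; rewrite -[r.+2%:R]natr1; move: r.+1%:R => w h1 h2 h3; field; rewrite h1 h2 h3.
Qed.

Lemma invf_le2_aux (a b : nat) : (0 < a)%N -> (0 < b)%N -> ((a * b)%N%:R)^-1 <= 2%:R :> rat.
Proof.
move=> a0 b0; apply: (@le_trans _ _ 1); last by rewrite ler1n.
by rewrite invf_le1 ?ltr0n ?muln_gt0 ?a0 // ler1n muln_gt0 a0.
Qed.

Lemma bin2_aux a : (2 * 'C(a.+1, 2) = a.+1 * a)%N.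
Proof. by rewrite -(mul_bin_diag a.+1 1) /= bin1. Qed.

Lemma exprp_split (R : comNzRingType) (x : R) p i : (0 < p)%N -> x ^+ p ^+ i = x ^+ i * x ^+ (p.-1 * i).
Proof. by case: p => // p _; rewrite -exprM mulSn exprD. Qed.

Lemma prime_pred_gt0 p : prime p -> (0 < p.-1)%N.
Proof. by move=> /prime_gt1; case: p => [|[]]. Qed.

Section Cyclo.
Variables (p : nat) (k : fieldType) (W : witt_vectors p k).
Hypotheses (pP : prime p) (p_odd : odd p).
Variables (K : fieldExtType {fraction W}) (Kb : alg_closure K) (C : completion Kb).
Variable z : nat -> Kb.
Hypothesis hz : compatible_roots z.
Variables (Zp : witt_vectors p 'F_p) (f : {rmorphism Zp -> C}).
Local Notation OC := (@comp_int p k W K Kb C).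
Hypothesis fO : forall x, OC (f x).
Local Notation emb := (comp_emb C).
Let V := valuedC pP C.
Let VK := valuedK pP Kb.
Let limC := @C_lim p k W pP K Kb C.
Let sepC := @C_sep p k W pP K Kb C.
Local Notation E := (E p OC).
Local Notation compat := (compat p OC).
Local Notation vge := (vge p OC).
Local Notation vgt := (vgt p OC).
Local Notation vl := (vl p OC).
Local Notation one_unit := (one_unit p OC).
Local Notation G := (abs_galois Kb).
Let p0 : p%:R != 0 :> C := valued_p0 V.

Definition eps (m : int) : C := if m is Posz i then emb (z i) else 1.
Definition mu m := eps m - 1.
(** It satisfies [phi(mu) = xi mu] ([mu_S]). Its value is [p] at indices up to 0, then 0 at index 1,
    and nonzero above. *)
Definition xi m := \sum_(i < p) eps m ^+ i.

Lemma eps_compat : compat eps.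
Proof.
split=> -[i|i]; rewrite /eps.
- apply/comp_int_emb; exact: (O_zeta pP hz).
- exact: (valued_1 V).
- rewrite (_ : Posz i + 1 = Posz i.+1); last by lia.
  by rewrite -rmorphXn; case: hz => _ _ ->.
- case: i => [|i].
    by rewrite (_ : Negz 0 + 1 = Posz 0) //=; case: hz => -> _ _; rewrite rmorph1 expr1n.
  by rewrite (_ : Negz i.+1 + 1 = Negz i) ?expr1n //; lia.
Qed.
Lemma E_eps : E eps. Proof. exact: (compat_E V eps_compat). Qed.
Lemma E_mu : E mu. Proof. by apply: (EB V p_odd E_eps); exact: (E1 V). Qed.
Lemma E_xi : E xi.
Proof. by apply: (@Esum _ _ _ V p_odd _ _ (fun (i : 'I_p) m => eps m ^+ i)) => i; exact: (EX V p_odd _ E_eps). Qed.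

Lemma eps_le0 m : m <= 0 -> eps m = 1.
Proof. by case: m => -[|i] //= _; case: hz => -> _ _; rewrite rmorph1. Qed.
Lemma mu_le0 m : m <= 0 -> mu m = 0.
Proof. by move=> h; rewrite /mu eps_le0 // subrr. Qed.
Lemma xi_le0 m : m <= 0 -> xi m = p%:R.
Proof.
move=> h; rewrite /xi eps_le0 //.
by rewrite (eq_bigr (fun=> 1)) => [|i _]; rewrite ?expr1n // sumr_const card_ord.
Qed.
Lemma mu_S m : mu (m - 1) = xi m * mu m.
Proof.
rewrite /mu /xi mulrC -subrX1; congr (_ - 1).
by have [_ h] := eps_compat; rewrite -[in RHS](subrK 1 m) h.
Qed.
Lemma mu_ge1 m : 1 <= m -> mu m != 0.
Proof.
case: m => [[|i]|i] // _; rewrite /mu /= -(rmorph1 emb) -rmorphB fmorph_eq0 subr_eq0.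
exact: (zetaS_neq1 hz).
Qed.
Lemma vl_mu (i : nat) : vl (mu i.+1%:Z) = ((p ^ i * p.-1)%N%:R)^-1.
Proof. by rewrite /mu /= -(rmorph1 emb) -rmorphB (vl_emb pP) (vl_zeta_sub1 pP p_odd hz). Qed.
Lemma xi_ge2 m : 2 <= m -> xi m != 0.
Proof.
move=> h; have := @mu_ge1 (m - 1); rewrite mu_S mulf_eq0 negb_or => h1.
by have /andP[] := h1 ltac:(lia).
Qed.
Lemma vl_xi (i : nat) : vl (xi i.+2%:Z) = ((p ^ i.+1)%N%:R)^-1.
Proof.
have m1 : mu i.+2%:Z != 0 by apply: mu_ge1.
have x1 : xi i.+2%:Z != 0 by apply: xi_ge2.
have := congr1 vl (mu_S i.+2%:Z); rewrite (vlM V) // (_ : i.+2%:Z - 1 = i.+1%:Z); last by lia.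
rewrite !vl_mu => /esym/eqP; rewrite eq_sym -subr_eq => /eqP <-.
exact: cyclo_rat_aux (prime_gt1 pP).
Qed.

Section GalAction.
Variables (g : G) (chi : Zp).
Hypothesis hchi : cyclotomic_value g chi.
Local Notation act := (comp_act C g).

(** The cocycle [g(mu) / mu]. At indices up to 0 both terms vanish and the value is the limit [chi],
    read off from [[eps]^chi = 1 + chi mu + ...]. *)
Definition vg (m : int) : C := if m <= 0 then f chi else act (mu m) / mu m.
(** The quotient [(vg - phi vg) / mu]; at indices up to 0 its value is the limit of the expression
    in [RN_le0]. *)
Definition rhog (m : int) : C :=
  if m <= 0 then - ((p.-1)%:R * (f chi * (f chi - 1)) / 2%:R) else (vg m - vg (m - 1)) / mu m.

Lemma act_mu m : act (mu m) = vg m * mu m.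
Proof.
rewrite /vg; case: leP => h; last by rewrite divfK // mu_ge1 //; lia.
by rewrite mu_le0 // rmorph0 mulr0.
Qed.

Lemma vg_rho m : vg m - vg (m - 1) = mu m * rhog m.
Proof.
rewrite /rhog; case: leP => h; last by rewrite mulrC divfK // mu_ge1 //; lia.
by rewrite /vg h (_ : m - 1 <= 0) ?subrr ?mu_le0 ?mul0r //; lia.
Qed.

(** To finite precision and up to a finite index, [g] raises [eps] to a natural power, so its
    cocycles are approximated by polynomials in [eps]. *)
Lemma chi_nat N : exists a : nat, [/\ vge N%:R (f chi - a%:R), coprime p a &
  forall m : int, m <= N%:Z -> act (eps m) = eps m ^+ a].
Proof.
have N0 : (0 < N.+1)%N by [].
have [a [ca ea]] := endo_zeta pP hz g N0.
have [chi' [_ /(_ N.+1)[m' [hm' em']]]] := cyc_exists pP hz Zp g.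
have [m1 hm1] := zp_nat_dense chi N.+1.
have em1 := hchi hm1 (zeta_unity hz N.+1).
exists m1; split.
- apply: vge_le (_ : vge N.+1%:R _); first by rewrite ler_nat.
  have [w ew] := hm1; rewrite -(rmorph_nat f m1) -rmorphB ew rmorphM rmorphXn rmorph_nat.
  by apply/(vge_nP V); exists (f w).
- have : (m1 = a %[mod p ^ N.+1])%N.
    by apply/eqP; rewrite -(eq_prim_root_expr (zeta_prim pP hz N.+1)) -em1 -ea.
  by move=> e; rewrite -(@coprime_pexpl N.+1 p m1) // -coprime_modr e coprime_modr coprime_pexpl.
- case=> [i|i] le; last by rewrite /eps rmorph1 expr1n.
  have e : g (z i) = z i ^+ m1.
    have le' : (i <= N.+1)%N by lia.
    exact: (hchi (in_pX_le le' hm1) (zeta_unity hz i)).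
  by rewrite /eps comp_act_emb e rmorphXn.
Qed.

(** [VN] and [RN] are what [vg] and [rhog] become when [chi] is a natural number [a]; they exhibit
    both as limits of elements of [E]. *)
Definition VN (a : nat) (m : int) : C := \sum_(i < a) eps m ^+ i.
Definition RN (a : nat) (m : int) : C :=
  - \sum_(i < a) eps m ^+ i * \sum_(l < (p.-1 * i)%N) eps m ^+ l.

Lemma E_VN a : E (VN a).
Proof. by apply: (@Esum _ _ _ V p_odd _ _ (fun (i : 'I_a) m => eps m ^+ i)) => i; exact: (EX V p_odd _ E_eps). Qed.
Lemma E_RN a : E (RN a).
Proof.
apply: (EN V p_odd); apply: (@Esum _ _ _ V p_odd _ _ (fun (i : 'I_a) m => eps m ^+ i * \sum_(l < (p.-1 * i)%N) eps m ^+ l)) => i.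
apply: (E_M V p_odd); first exact: (EX V p_odd _ E_eps).
by apply: (@Esum _ _ _ V p_odd _ _ (fun (l : 'I_(p.-1 * i)) m => eps m ^+ l)) => l; exact: (EX V p_odd _ E_eps).
Qed.

Lemma VN_mu a m : VN a m * mu m = eps m ^+ a - 1.
Proof. by rewrite mulrC -subrX1. Qed.

Lemma VN_RN a m : VN a m - VN a (m - 1) = mu m * RN a m.
Proof.
have ee : eps (m - 1) = eps m ^+ p by have [_ h] := eps_compat; rewrite -[in RHS](subrK 1 m) h.
rewrite /VN /RN ee -sumrB mulrN mulr_sumr -sumrN; apply: eq_bigr => i _.
rewrite /mu mulrCA -subrX1 exprp_split ?prime_gt0 //; move: (eps m ^+ i) (eps m ^+ _) => u w; ring.
Qed.

Lemma vg_approx N a m : vge N%:R (f chi - a%:R) -> (forall m : int, m <= N%:Z -> act (eps m) = eps m ^+ a) ->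
  m <= N%:Z -> vge N%:R (vg m - VN a m).
Proof.
move=> h1 h2 le; rewrite /vg; case: leP => h.
  rewrite /VN (eq_bigr (fun=> 1)) => [|i _]; last by rewrite eps_le0 // expr1n.
  by rewrite sumr_const card_ord.
have m0 : mu m != 0 by apply: mu_ge1; lia.
by rewrite {1}/mu rmorphB rmorph1 h2 // -VN_mu mulfK // subrr vge_0.
Qed.

Lemma E_vg : E vg.
Proof.
apply: (E_limpt V p_odd) => M N; have [a [h1 _ h2]] := chi_nat (maxn M N).
exists (VN a); first exact: E_VN.
move=> m le; have := vg_approx (m := m) h1 h2 ltac:(lia); apply: vge_le.
by rewrite ler_nat leq_maxr.
Qed.

Lemma vl2 : vl 2%:R = 0 /\ 2%:R != 0 :> C.
Proof. by have [] := @vl_natcoprime _ _ _ V 2 (ltac:(by rewrite coprimen2)). Qed.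

Lemma RN_le0 a m : m <= 0 -> RN a m = - ((p.-1)%:R * (a%:R * (a%:R - 1)) / 2%:R).
Proof.
move=> h; rewrite /RN; congr (- _); have [_ t0] := vl2.
apply: (canRL (mulfK t0)); rewrite (eq_bigr (fun i : 'I_a => (p.-1)%:R * (i : nat)%:R)) => [|i _]; last first.
  rewrite eps_le0 // expr1n mul1r (eq_bigr (fun=> 1)) => [|l _]; last by rewrite expr1n.
  by rewrite sumr_const card_ord natrM.
rewrite -mulr_sumr -natr_sum -mulrA; congr (_ * _).
have -> : (\sum_(i < a) i = 'C(a, 2))%N by rewrite -bin2_sum big_mkord.
case: a => [|a]; first by rewrite bin0n !mul0r.
by rewrite -natrM muln2 -mul2n bin2_aux -[in RHS]natr1 addrK natr1 -natrM.
Qed.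

Lemma E_rhog : E rhog.
Proof.
(* The two extra digits absorb the division by [mu m], whose valuation is at most 2 by
   [invf_le2_aux]. *)
apply: (E_limpt V p_odd) => M N; have [a [h1 _ h2]] := chi_nat (maxn M N + 2).
exists (RN a); first exact: E_RN.
have [v2 t0] := vl2.
move=> m le; rewrite /rhog; case: leP => h.
  rewrite RN_le0 //; apply: (@vge_le _ _ _ (maxn M N + 2)%:R); first by rewrite ler_nat; lia.
  have -> : - ((p.-1)%:R * (f chi * (f chi - 1)) / 2%:R) - - ((p.-1)%:R * (a%:R * (a%:R - 1)) / 2%:R)
     = (f chi - a%:R) * ((p.-1)%:R * (1 - f chi - a%:R)) / 2%:R by field.
  rewrite (vge_divr V) // v2 addr0; apply: (vge_mulr V) => //.
  apply: (valued_M V); first exact: (Onat V).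
  by apply: (valued_B V); [apply: (valued_B V)|exact: (Onat V)]; [exact: (valued_1 V)|].
have m0 : mu m != 0 by apply: mu_ge1; lia.
have -> : (vg m - vg (m - 1)) / mu m - RN a m = ((vg m - VN a m) - (vg (m - 1) - VN a (m - 1))) / mu m.
  by apply: (mulIf m0); rewrite mulrBl !divfK // [RN a m * _]mulrC -VN_RN; ring.
rewrite (vge_divr V) //; apply: (@vge_le _ _ _ (maxn M N + 2)%:R).
  case: m h m0 {le} => [[|i]|i] // _ _; rewrite vl_mu natrD lerD ?ler_nat ?leq_maxr //.
  by apply: invf_le2_aux; rewrite ?expn_gt0 ?(prime_gt0 pP) ?(prime_pred_gt0 pP).
by apply: (vgeB V); apply: vg_approx => //; lia.
Qed.

Lemma act_xi m : act (xi m) * vg m = vg (m - 1) * xi m.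
Proof.
case: (leP m 0) => h.
  by rewrite xi_le0 // rmorph_nat /vg h (_ : m - 1 <= 0) 1?mulrC //; lia.
have m0 : mu m != 0 by apply: mu_ge1; lia.
by apply: (mulIf m0); rewrite -mulrA -act_mu -rmorphM -mu_S act_mu mu_S mulrA.
Qed.

Lemma vg_unit m : vg m != 0 /\ vl (vg m) = 0.
Proof.
have h1 (j : int) : 1 <= j -> vg j != 0 /\ vl (vg j) = 0.
  move=> h; have m0 := mu_ge1 h; rewrite /vg leNgt (_ : 0 < j) /=; last by lia.
  by rewrite mulf_neq0 ?invr_eq0 ?fmorph_eq0 // (vlM V) ?invr_eq0 ?fmorph_eq0 // (vlV V) // (vl_act pP) subrr.
have [le|lt] := lerP m 0; last by apply: h1; lia.
have -> : vg m = vg 0 by rewrite /vg le lexx.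
have [a0 b0] := h1 1 (lexx 1).
have ap0 : vg 1 ^+ p != 0 by rewrite expf_neq0.
have vp : vl (vg 1 ^+ p) = 0 by rewrite (vlX V) // b0 mul0rn.
have := E_O 0 (E_dE E_vg); rewrite /dE -(vge0P V) (vge_divr V) // (vl_p V) !add0r => h.
have [|-> ->] // := @vl_sub_lt _ _ _ V _ (vg 0) ap0.
by rewrite vp; apply: vge_vgt h; rewrite ltr01.
Qed.

Lemma vg_unitV m : OC (vg m)^-1.
Proof.
by have [h1 h2] := vg_unit m; apply/(vge0P V); rewrite /Valuations.vge (vlV V) // h2 oppr0 lexx orbT.
Qed.

(** The factor with [g(xi) wg = xi], by [act_xi]. *)
Definition wg m := vg m / vg (m - 1).
Lemma E_wg : E wg.
Proof.
apply: (E_M V p_odd E_vg); apply: (E_inv V p_odd).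
- exact: (E_shift 1 E_vg).
- by move=> m; case: (vg_unit (m - 1)).
- by move=> m; exact: vg_unitV.
Qed.
Lemma wg_le0 m : m <= 0 -> wg m = 1.
Proof.
move=> h; rewrite /wg /vg h (_ : m - 1 <= 0); last by lia.
by rewrite divff //; have [+ _] := vg_unit 0; rewrite /vg lexx.
Qed.
Lemma wg_neq0 m : wg m != 0.
Proof. by have [h1 _] := vg_unit m; have [h2 _] := vg_unit (m - 1); rewrite mulf_neq0 ?invr_eq0. Qed.
Lemma vl_wg m : vl (wg m) = 0.
Proof.
have [h1 h2] := vg_unit m; have [h1' h2'] := vg_unit (m - 1).
by rewrite /wg (vlM V) ?invr_eq0 // (vlV V) // h2 h2' subrr.
Qed.

Section BG.
Variable n : nat.
Hypothesis n0 : (0 < n)%N.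
(** The product of all [phi^(n j) wg], a solution of [bg = phi^n(bg) wg]. At each index it is finite
    because [wg] is 1 at indices up to 0. *)
Definition bg (m : int) := \prod_(j < `|m|%N) wg (m - (n * j)%N%:Z).

Lemma bgE J m : (`|m| <= J)%N -> bg m = \prod_(j < J) wg (m - (n * j)%N%:Z).
Proof.
move=> le; rewrite /bg (big_ord_widen J (fun j : nat => wg (m - (n * j)%N%:Z))) // big_mkcond.
apply: eq_bigr => j _; case: ifP => // /negbT; rewrite -leqNgt => h; rewrite wg_le0 //.
by have : (j <= n * j)%N by [rewrite leq_pmull]; lia.
Qed.
Lemma bg_le0 m : m <= 0 -> bg m = 1.
Proof. by move=> h; rewrite /bg big1 // => j _; apply: wg_le0; lia. Qed.
Lemma bg_S m : bg (m - n%:Z) * wg m = bg m.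
Proof.
pose J := (`|m| + n)%N; rewrite (@bgE J.+1 m) ?(@bgE J (m - n%:Z)) /J; try by lia.
rewrite big_ord_recl muln0 subr0 mulrC; congr (_ * _); apply: eq_bigr => j _.
by congr wg; rewrite lift0 mulnS; lia.
Qed.
Lemma E_bg : E bg.
Proof.
apply: (E_limpt V p_odd) => M N; exists (fun m => \prod_(j < M) wg (m - (n * j)%N%:Z)).
  by apply: (@Eprod _ _ _ V p_odd _ _ (fun (j : 'I_M) m => wg (m - (n * j)%N%:Z))) => j; exact: (E_shift _ E_wg).
by move=> m le; rewrite (bgE le) subrr vge_0.
Qed.
Lemma bg_unit m : bg m != 0 /\ vl (bg m) = 0.
Proof.
split; first by apply/prodf_neq0 => j _; exact: wg_neq0.
by rewrite (vl_prod V) => [|j _]; [rewrite big1 // => j _; exact: vl_wg|exact: wg_neq0].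
Qed.
Lemma bg1 : one_unit (bg 1).
Proof.
rewrite /bg /= big_ord1 muln0 subr0; have [h1 h2] := vg_unit 0.
apply: (one_unit_div V) => //; first exact: vg_unitV.
have [a [h3 _ h4]] := chi_nat 1.
have e1 := vg_approx (m := 1) h3 h4 (lexx 1); have e0 := vg_approx (m := 0) h3 h4 ltac:(lia).
have -> : vg 1 - vg 0 = (vg 1 - VN a 1) - (vg 0 - VN a 0) + (VN a 1 - VN a 0) by ring.
apply: (vgtD V); first by apply: (vge_vgt ltr01); apply: (vgeB V).
rewrite /VN -sumrB; apply: (vgt_sum V) => i _; rewrite (eps_le0 (lexx 0)).
have hm : vgt 0 (eps 1 - 1).
  by rewrite -/(mu 1) /Valuations.vgt (vl_mu 0) expn0 mul1n invr_gt0 ltr0n prime_pred_gt0 ?orbT.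
have [s s0 hs] := vgt_vge hm; apply: (vge_vgt s0); apply: (vge_exprB V) => //; first exact: ltW.
  exact: (E_O _ E_eps).
exact: (valued_1 V).
Qed.
(** Over all [i] and [j] the factors [phi^(i + n j) wg] telescope to [vg] divided by its value [chi]
    at indices up to 0. *)
Lemma bg_prod (m : nat) : \prod_(i < n) bg (m%:Z - (i : nat)%:Z) = vg m / f chi.
Proof.
have v00 : vg 0 = f chi by rewrite /vg lexx.
have [h0 _] := vg_unit 0; rewrite v00 in h0.
elim: m => [|m IH].
  by rewrite v00 divff // big1 // => i _; apply: bg_le0; lia.
have e : bg (m.+1%:Z - n%:Z) * \prod_(i < n) bg (m.+1%:Z - (i : nat)%:Z) =
    bg m.+1 * \prod_(i < n) bg (m%:Z - (i : nat)%:Z).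
  transitivity (\prod_(i < n.+1) bg (m.+1%:Z - (i : nat)%:Z)); first by rewrite big_ord_recr mulrC.
  rewrite big_ord_recl subr0; congr (_ * _).
  by apply: eq_bigr => i _; congr bg; rewrite lift0; lia.
have [b0 _] := bg_unit (m.+1%:Z - n%:Z); apply: (mulfI b0).
rewrite e IH -(bg_S m.+1) /wg (_ : m.+1%:Z - 1 = m%:Z); last by lia.
by have [hv _] := vg_unit m; field; rewrite hv h0.
Qed.
End BG.
End GalAction.
End Cyclo.

End CyclotomicSequences.

(** * Periodic sequences, that is, the unramified ring Z_q *)

Module PeriodicSequences.
Import fingroup perm Valuations WittRings ClosureAndCompletion TateInvariants GhostSequences GhostEquations.

Lemma coprime_pred_pow p n : (0 < n)%N -> prime p -> coprime p (p ^ n).-1.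
Proof.
move=> n0 pP; have h : (0 < p ^ n)%N by rewrite expn_gt0 prime_gt0.
rewrite -(coprime_pexpl _ _ n0) -{1}(prednK h); exact: coprimeSn.
Qed.

Section Periodic.
Variables (p : nat) (k : fieldType) (W : witt_vectors p k).
Hypotheses (pP : prime p) (p_odd : odd p).
Variables (K : fieldExtType {fraction W}) (Kb : alg_closure K) (C : completion Kb).
Variables (Zp : witt_vectors p 'F_p) (f : {rmorphism Zp -> C}).
Local Notation OC := (@comp_int p k W K Kb C).
Hypothesis fO : forall x, OC (f x).
Local Notation emb := (comp_emb C).
Let V := valuedC pP C.
Let VK := valuedK pP Kb.
Let limC := @C_lim p k W pP K Kb C.
Let sepC := @C_sep p k W pP K Kb C.
Local Notation E := (E p OC).
Local Notation compat := (compat p OC).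
Local Notation vge := (vge p OC).
Local Notation vgt := (vgt p OC).
Local Notation vl := (vl p OC).
Local Notation fn := (int -> C).
Let p0 : p%:R != 0 :> C := valued_p0 V.
Variable n : nat.
Hypothesis n0 : (0 < n)%N.
Local Notation q := (p ^ n)%N.

(** On [E] these are the fixed points of [phi^n], the Witt vectors of the field with [q]
    elements. *)
Definition per (r : fn) := forall m, r (m - n%:Z) = r m.

Lemma per_iter r (j : nat) m : per r -> r (m + (n * j)%N%:Z) = r m.
Proof.
move=> h; elim: j => [|j IH]; first by rewrite muln0 addr0.
by rewrite -IH -(h (m + (n * j.+1)%N%:Z)); congr r; rewrite mulnS; lia.
Qed.

Lemma pow_stable_one (u : C) s : (0 < s)%N -> OC u -> u ^+ (p ^ s) = u -> vgt 0 (u - 1) -> u = 1.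
Proof.
move=> s0 Ou uq h; have [t t0 ht] := vgt_vge h.
pose r := Num.min t 1; have r0 : 0 < r by rewrite lt_min t0 ltr01.
have hr : vge r (u - 1) by apply: vge_le ht; rewrite ge_min lexx.
have it j : u ^+ (p ^ (s * j)) = u.
  by elim: j => [|j IH]; rewrite ?muln0 ?expr1 // mulnS expnD exprM uq.
apply/eqP; rewrite -subr_eq0; apply/eqP/sepC => N; have [j hj] := mulrn_large N r0.
have rb : 0 <= r <= 1 by rewrite ltW //= ge_min lexx orbT.
have := vge_exprX_grow V p_odd (s * j) rb Ou (valued_1 V) hr; rewrite it expr1n; apply: vge_le.
apply: le_trans hj _; apply: ler_wpMn2l; [exact: ltW|].
by apply: leqW; rewrite leq_pmull.
Qed.

Lemma pow_stable_zero (u : C) s : (0 < s)%N -> u ^+ (p ^ s) = u -> vgt 0 u -> u = 0.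
Proof.
move=> s0 uq h; apply/eqP; apply/negPn/negP => u0.
have := congr1 vl uq; rewrite (vlX V) //.
move: h; rewrite /Valuations.vgt (negPf u0) /=; set v := vl u => v0 e.
have : (1 < p ^ s)%N by rewrite -{1}(expn0 p) ltn_exp2l ?prime_gt1.
move=> h1; have : v *+ 1 < v *+ (p ^ s) by rewrite ltr_pMn2l.
by rewrite e ltxx.
Qed.

(** The first Teichmueller digit [x] satisfies [x^q = x], so it vanishes identically once one of its
    values lies in the maximal ideal. A congruence at one index thus holds at all indices. *)
Lemma per_small r m1 : E r -> per r -> vgt 0 (r m1) -> E (fun m => r m / p%:R).
Proof.
move=> Er pr h; have [x cx Ex] := E_teich V p_odd limC sepC Er.
have rx m : vge 1 (r m - x m).
  by have := E_O m Ex; rewrite -(vge0P V) (vge_divr V) // (vl_p V) add0r.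
have cxn := compat_shift n%:Z cx.
have px : (fun m => x (m - n%:Z)) = x.
  apply: (compat_uniq V p_odd sepC cxn cx (r := 1) (n0 := 0)) => // j _.
  have -> : x (j%:Z - n%:Z) - x j%:Z = (r j%:Z - x j%:Z) - (r (j%:Z - n%:Z) - x (j%:Z - n%:Z)) by rewrite pr; ring.
  exact: (vgeB V).
have xq m : x m ^+ q = x m.
  by rewrite -{1}[m](addrK n%:Z) -[in RHS]px -(compat_iter n (m - n%:Z) cx) subrK addrK.
have x1 : x m1 = 0.
  apply: (pow_stable_zero n0 (xq m1)); rewrite -[x m1](subKr (r m1)); apply: (vgtB V) => //.
  exact: vge_vgt ltr01 (rx m1).
have x0 m : x m = 0.
  have [[j e]|[j e]] : (exists j : nat, m = m1 + j%:Z) \/ exists j : nat, m1 = m + j%:Z.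
      case: (leP m1 m) => le; [left; exists `|m - m1|%N|right; exists `|m1 - m|%N]; lia.
    apply/eqP; have := compat_iter j m1 cx; rewrite -e x1 => /eqP.
    by rewrite expf_eq0 => /andP[].
  by rewrite -(compat_iter j m cx) -e x1 expr0n gtn_eqF // expn_gt0 prime_gt0.
by move: Ex; congr (E _); apply/funext => m; rewrite x0 subr0.
Qed.

Lemma per_divX r m1 N : E r -> per r -> vge N%:R (r m1) -> E (fun m => r m / p%:R ^+ N).
Proof.
elim: N r => [|N IH] r Er pr h.
  by move: Er; congr (E _); apply/funext => m; rewrite expr0 divr1.
have Ed : E (fun m => r m / p%:R).
  by apply: (per_small (m1 := m1)) => //; apply: vge_vgt h; rewrite ltr0n.
have := IH _ Ed; rewrite (vge_divr V) // (vl_p V) natr1 => /(_ _ h) h'.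
have := h' (fun m => congr1 (fun x => x / p%:R) (pr m)); congr (E _); apply/funext => m.
by rewrite exprS invfM mulrA.
Qed.

Lemma per_zero r m1 : E r -> per r -> r m1 = 0 -> forall m, r m = 0.
Proof.
move=> Er pr h m; apply: sepC => N.
have Ed : E (fun m => r m / p%:R ^+ N) by apply: (per_divX (m1 := m1)) => //; rewrite h vge_0.
by have := E_O m Ed; rewrite -(vge0P V) (vge_divr V) ?expf_neq0 // (vl_pX V) add0r.
Qed.

Lemma E_lim_Zp c : E (fun=> c) -> exists x : Zp, f x = c.
Proof.
move=> Ec; have /choice[a ha] N := E_const_nat V p_odd limC sepC N Ec.
have natin N (i j : nat) : vge N%:R (i%:R - j%:R : C) -> in_pX p N (i%:R - j%:R : Zp).
  have hw (u v : nat) : (v <= u)%N -> vge N%:R (u%:R - v%:R : C) -> in_pX p N (u%:R - v%:R : Zp).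
    move=> le; rewrite -!natrB //; have [->|d0] := eqVneq (u - v)%N 0%N; first by move=> _; exact: in_pX0.
    rewrite /Valuations.vge (negPf (valued_nat0 V _)) ?lt0n //= (vl_nat V) ?lt0n // ler_nat => h.
    have /dvdnP[w ->] : (p ^ N %| u - v)%N by rewrite pfactor_dvdn // lt0n.
    by exists w%:R; rewrite mulnC natrM natrX.
  case: (leqP j i) => [le|/ltnW le] h; first exact: hw.
  by rewrite -opprB; apply: in_pXN; apply: hw => //; rewrite (vge_subC V).
have [N|x hx] := (witt_complete Zp).2 (fun N => (a N)%:R : Zp).
  apply: natin; have -> : (a N.+1)%:R - (a N)%:R = (c - (a N)%:R) - (c - (a N.+1)%:R) by ring.
  by apply: (vgeB V); [exact: ha|apply: vge_le (ha N.+1); rewrite ler_nat].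
exists x; apply/eqP; rewrite -subr_eq0; apply/eqP/sepC => N.
rewrite -(subrKA (a N)%:R); apply: (vgeD V); last by rewrite (vge_subC V); exact: ha.
have [w ew] := hx N; rewrite -(rmorph_nat f (a N)) -rmorphB ew rmorphM rmorphXn rmorph_nat.
by apply/(vge_nP V); exists (f w).
Qed.

Lemma E_Zp x : E (fun=> f x).
Proof.
apply: (E_const V p_odd) => N; have [a [w ew]] := zp_nat_dense x N; exists a.
rewrite -(rmorph_nat f a) -rmorphB ew rmorphM rmorphXn rmorph_nat.
by apply/(vge_nP V); exists (f w).
Qed.

Lemma fZp_ker x : f x = 0 -> x = 0.
Proof.
move=> fx0; apply/eqP/negPn/negP => x0.
have [N [u [eu [v uv]]]] : exists N u, x = p%:R ^+ N * u /\ exists v, u * v = 1.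
  by have [N [u [h1 h2]]] := witt_decomp x0; exists N, u; split=> //; exists u^-1; rewrite divrr.
have := fx0; rewrite eu rmorphM rmorphXn rmorph_nat => /eqP; rewrite mulf_eq0 expf_eq0 (negPf p0) andbF /=.
move=> /eqP fu; have := congr1 f uv; rewrite rmorphM fu mul0r rmorph1 => /eqP.
by rewrite eq_sym oner_eq0.
Qed.

Lemma fZp_inj : injective f.
Proof.
by move=> a b e; apply/eqP; rewrite -subr_eq0; apply/eqP/fZp_ker; rewrite rmorphB e subrr.
Qed.

Lemma E_det (d : nat) (M : int -> 'M[C]_d) : (forall i j, E (fun m => M m i j)) -> E (fun m => \det (M m)).
Proof.
move=> h; apply: (@Esum _ _ _ V p_odd _ _ (fun (s : 'S_d) m => (-1) ^+ s * \prod_i M m i (s i))) => s.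
apply: (@E_M _ _ _ V p_odd (fun=> (-1) ^+ s)).
  by apply: (@EX _ _ _ V p_odd (fun=> -1)); exact: (EN V p_odd (E1 V)).
by apply: (@Eprod _ _ _ V p_odd _ _ (fun i m => M m i (s i))) => i; exact: h.
Qed.

Lemma E_adj (d : nat) (M : int -> 'M[C]_d) i j : (forall i j, E (fun m => M m i j)) -> E (fun m => (\adj (M m)) i j).
Proof.
move=> h.
have -> : (fun m => (\adj (M m)) i j) = fun m => (-1) ^+ (j + i) * \det (row' j (col' i (M m))).
  by apply/funext => m; rewrite mxE.
apply: (@E_M _ _ _ V p_odd (fun=> (-1) ^+ (j + i))).
  by apply: (@EX _ _ _ V p_odd (fun=> -1)); exact: (EN V p_odd (E1 V)).
apply: E_det => a b; move: (h (lift j a) (lift i b)); congr (E _); apply/funext => m.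
by rewrite !mxE.
Qed.

Variable kap : Kb.
Hypothesis hkap : (q.-1).-primitive_root kap.
Let q0 : (0 < q)%N. Proof. by rewrite expn_gt0 prime_gt0. Qed.
Let q1 : (1 < q)%N. Proof. by rewrite -{1}(expn0 p) ltn_exp2l ?prime_gt1. Qed.

(** The Teichmueller element of [kap]: its value at [m] is the [p^m]-th root of [kap] among the
    powers of [kap], whence the exponent [-m] modulo [n]. *)
Definition kp (m : int) : C := emb kap ^+ (p ^ `|(- m %% n%:Z)%Z|).

Lemma kap_q : kap ^+ q = kap.
Proof. by rewrite -{1}(prednK q0) exprS prim_expr_order // mulr1. Qed.

Lemma kap_unit : [/\ OK Kb kap, kap != 0 & forall i, OK Kb (kap ^- i)].
Proof.
have q10 : (0 < q.-1)%N by rewrite -ltnS prednK.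
have Ok : OK Kb kap by apply: (valued_root VK q10); rewrite prim_expr_order //; exact: (valued_1 VK).
have k0 : kap != 0 by apply: contraTneq (oner_neq0 Kb) => e; rewrite -(prim_expr_order hkap) e expr0n gtn_eqF // eqxx.
split=> // i; rewrite -exprVn; apply: (OX VK); apply: (valued_root VK q10).
by rewrite exprVn prim_expr_order // invr1; exact: (valued_1 VK).
Qed.

Lemma kap_mod e1 e2 : (e1 = e2 %[mod n])%N -> kap ^+ (p ^ e1) = kap ^+ (p ^ e2).
Proof.
have h e j : kap ^+ (p ^ (e + n * j)) = kap ^+ (p ^ e).
  elim: j => [|j IH]; first by rewrite muln0 addn0.
  by rewrite -IH mulnS addnCA expnD exprM kap_q.
by move=> e; rewrite (divn_eq e1 n) (divn_eq e2 n) e ![(_ * n)%N]mulnC ![(n * _ + _)%N]addnC !h.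
Qed.

Lemma kpE m (e : nat) : (e%:Z = - m %[mod n%:Z])%Z -> kp m = emb kap ^+ (p ^ e).
Proof.
move=> h; rewrite /kp -!rmorphXn; congr (emb _); apply: kap_mod.
have nz : n%:Z != 0 by rewrite eqz_nat -lt0n.
by apply/eqP; rewrite -eqz_nat -!modz_nat gez0_abs ?modz_ge0 // modz_mod h.
Qed.

Lemma kp_compat : compat kp.
Proof.
have [Ok _ _] := kap_unit.
split=> m; first by rewrite /kp; apply: (OX V); apply/comp_int_emb.
have [e he] : exists e : nat, (e%:Z = - (m + 1) %[mod n%:Z])%Z.
  by exists `|(- (m + 1) %% n%:Z)%Z|%N; rewrite gez0_abs ?modz_ge0 ?modz_mod // eqz_nat -lt0n.
rewrite (kpE he) -exprM -expnSr; symmetry; apply: kpE.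
by rewrite intS -modzDmr he modzDmr; congr modz; ring.
Qed.

Lemma kp_per : per kp.
Proof. by move=> m; rewrite /kp opprB addrC modzDr. Qed.

(** The quotient of two distinct Frobenius conjugates of [kap] is a nontrivial root of unity fixed
    by the [q]-th power, which by [pow_stable_one] is not 1 in the residue field. *)
Lemma kp_diff m i j : (i < n)%N -> (j < n)%N -> i != j ->
  kp (m - i%:Z) - kp (m - j%:Z) != 0 /\ vl (kp (m - i%:Z) - kp (m - j%:Z)) = 0.
Proof.
have [Ok k0 OkV] := kap_unit.
wlog lt : i j / (i < j)%N => [hw|] hi hj ne.
  case: (ltngtP i j) ne => // lt _; first by apply: hw => //; rewrite ltn_eqF.
  have ne' : j != i by rewrite ltn_eqF.
  have [h1 h2] := hw j i lt hj hi ne'.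
  by rewrite -opprB oppr_eq0 (vlN V) h1 h2.
pose e := (j - i)%N; have e0 : (0 < e)%N by rewrite subn_gt0.
have en : (e < n)%N by rewrite /e; apply: leq_ltn_trans hj; rewrite leq_subr.
pose a := (p ^ `|(- (m - i%:Z) %% n%:Z)%Z|)%N.
have eu : kp (m - i%:Z) = emb kap ^+ a by [].
have ev : kp (m - j%:Z) = emb kap ^+ (a * p ^ e).
  by rewrite exprM -eu -(compat_iter e (m - j%:Z) kp_compat); congr (kp _ ^+ _); rewrite /e; lia.
have pe1 : (0 < p ^ e)%N by rewrite expn_gt0 prime_gt0.
pose s := kap ^+ (a * (p ^ e).-1).
have s1 : s != 1.
  rewrite -(prim_order_dvd hkap) Gauss_dvdr.
    rewrite gtnNdvd //; first by rewrite -ltnS prednK // -{1}(expn0 p) ltn_exp2l ?prime_gt1.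
    by rewrite -ltnS !prednK // ltn_exp2l ?prime_gt1.
  by rewrite coprime_sym coprimeXl // coprime_pred_pow.
have e1 : kp (m - i%:Z) - kp (m - j%:Z) = emb (kap ^+ a) * (1 - emb s).
  by rewrite eu ev /s !rmorphXn mulrBr mulr1 -exprD -mulnS prednK.
have s1' : 1 - emb s != 0 by rewrite subr_eq0 eq_sym -(rmorph1 emb) (inj_eq (fmorph_inj emb)).
have ka0 : emb (kap ^+ a) != 0 by rewrite fmorph_eq0 expf_neq0.
rewrite e1 mulf_neq0 //; split=> //; rewrite (vlM V) //.
have Os : OC (emb s) by apply/comp_int_emb; exact: (OX VK).
have -> : vl (emb (kap ^+ a)) = 0.
  by apply: (vl_unit V) => //; [apply/comp_int_emb; exact: (OX VK)|rewrite -fmorphV; apply/comp_int_emb; exact: OkV].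
rewrite add0r; apply/eqP; rewrite eq_le; apply/andP; split; last first.
  have : vge 0 (1 - emb s) by apply/(vge0P V)/(valued_B V) => //; exact: (valued_1 V).
  by rewrite /Valuations.vge (negPf s1').
rewrite leNgt; apply: contraNN s1 => ltv; have sq : emb s ^+ q = emb s.
  by rewrite -rmorphXn /s exprAC kap_q.
have := pow_stable_one n0 Os sq; rewrite -(vgtN V) opprB /Valuations.vgt ltv orbT => /(_ isT) e2.
by rewrite -(inj_eq (fmorph_inj emb)) e2 rmorph1.
Qed.

Definition Vm (m : int) : 'M[C]_n := \matrix_(i, j) kp (m - (i : nat)%:Z) ^+ j.

Lemma det_Vm m : \det (Vm m) != 0 /\ OC (\det (Vm m))^-1.
Proof.
have -> : Vm m = (Vandermonde n (\row_(i < n) kp (m - (i : nat)%:Z)))^T.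
  by apply/matrixP => i j; rewrite !mxE.
rewrite det_tr det_Vandermonde.
set P := \prod_(i < n) _; have [h1 h2] : P != 0 /\ vl P = 0.
  have hne (i j : 'I_n) : (i < j)%N -> kp (m - (j : nat)%:Z) - kp (m - (i : nat)%:Z) != 0 /\
      vl (kp (m - (j : nat)%:Z) - kp (m - (i : nat)%:Z)) = 0.
    by move=> lt; apply: kp_diff; rewrite ?ltn_ord // gtn_eqF.
  split; first by apply/prodf_neq0 => i _; apply/prodf_neq0 => j lt; rewrite !mxE; case: (hne i j lt).
  rewrite (vl_prod V) => [|i _]; last by apply/prodf_neq0 => j lt; rewrite !mxE; case: (hne i j lt).
  rewrite big1 // => i _; rewrite (vl_prod V) => [|j lt]; last by rewrite !mxE; case: (hne i j lt).
  by rewrite big1 // => j lt; rewrite !mxE; case: (hne i j lt).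
by split=> //; apply/(vge0P V); rewrite /Valuations.vge (vlV V) // h2 oppr0 lexx orbT.
Qed.

Lemma per_mod r m i : per r -> exists2 i' : nat, (i' < n)%N & r (m - i) = r (m - i'%:Z).
Proof.
move=> pr; have nz : n%:Z != 0 by rewrite eqz_nat -lt0n.
exists `|(i %% n%:Z)%Z|%N.
  by have := ltz_pmod i (_ : 0 < n%:Z); have := modz_ge0 i nz; lia.
rewrite gez0_abs ?modz_ge0 // {1}(divz_eq i n%:Z).
set a := (i %/ n%:Z)%Z; set b := (i %% n%:Z)%Z.
case: a => a.
  by rewrite -(per_iter a (m - (a%:Z * n%:Z + b)) pr); congr r; rewrite PoszM; ring.
rewrite -[in RHS](per_iter a.+1 (m - b) pr); congr r; rewrite NegzE PoszM; ring.
Qed.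

(** Inverting the Vandermonde matrix of the conjugates of [kap] gives coefficients in [E]; they are
    invariant under the shift, hence constant, hence in [Zp] by [E_lim_Zp]. *)
Lemma Zq_coord r : E r -> per r -> exists zc : 'I_n -> Zp, forall m, r m = \sum_j f (zc j) * kp m ^+ j.
Proof.
move=> Er pr; pose zv m : 'cV[C]_n := invmx (Vm m) *m \col_i r (m - (i : nat)%:Z).
have Vu m : Vm m \in unitmx by rewrite unitmxE unitfE; case: (det_Vm m).
have sol m (i : 'I_n) : \sum_j zv m j 0 * kp (m - (i : nat)%:Z) ^+ j = r (m - (i : nat)%:Z).
  have : (Vm m *m zv m) i 0 = r (m - (i : nat)%:Z) by rewrite mulKVmx // mxE.
  by rewrite mxE => <-; apply: eq_bigr => j _; rewrite [in RHS]mxE mulrC.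
have sol' m (i : int) : \sum_j zv m j 0 * kp (m - i) ^+ j = r (m - i).
  have pG : per (fun m' => \sum_j zv m j 0 * kp m' ^+ j - r m').
    by move=> m'; rewrite pr; congr (_ - _); apply: eq_bigr => j _; rewrite kp_per.
  have [i' hi' e] := per_mod m i pG; apply/eqP; rewrite -subr_eq0 e subr_eq0; apply/eqP.
  exact: (sol m (Ordinal hi')).
have Ez j : E (fun m => zv m j 0).
  have -> : (fun m => zv m j 0) = fun m => \sum_i (\det (Vm m))^-1 * (\adj (Vm m)) j i * r (m - (i : nat)%:Z).
    apply/funext => m; rewrite mxE; apply: eq_bigr => i _; congr (_ * _); last by rewrite mxE.
    by rewrite /invmx Vu mxE.
  have Em i' j' : E (fun m => Vm m i' j').
    have -> : (fun m => Vm m i' j') = fun m => kp (m - (i' : nat)%:Z) ^+ j' by apply/funext => m; rewrite mxE.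
    by apply: (EX V p_odd); apply: E_shift; exact: (compat_E V kp_compat).
  apply: (@Esum _ _ _ V p_odd _ _ (fun (i : 'I_n) m => (\det (Vm m))^-1 * (\adj (Vm m)) j i * r (m - (i : nat)%:Z))) => i.
  apply: (E_M V p_odd); last exact: E_shift.
  apply: (E_M V p_odd); last exact: E_adj.
  by apply: (E_inv V p_odd) => [|m|m]; [exact: E_det|case: (det_Vm m)|case: (det_Vm m)].
have zS m : zv (m - 1) = zv m.
  rewrite -(mulKmx (Vu m) (zv (m - 1))) -(mulKmx (Vu m) (zv m)); congr (_ *m _).
  apply/matrixP => i o; rewrite ord1 mulKVmx // [in RHS]mxE mxE.
  rewrite -(_ : m - 1 - ((i : nat)%:Z - 1) = m - (i : nat)%:Z); last by ring.
  rewrite -(sol' (m - 1)); apply: eq_bigr => j _; rewrite mxE mulrC; congr (_ * kp _ ^+ _); ring.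
have zc m : zv m = zv 0.
  have hp (i : nat) : zv i%:Z = zv 0 by elim: i => [//|i IH]; rewrite -[zv i.+1%:Z]zS -IH; congr zv; lia.
  have hn (i : nat) : zv (- i%:Z) = zv 0 by elim: i => [//|i <-]; rewrite -[zv (- i%:Z)]zS; congr zv; lia.
  by case: m => i; [exact: hp|rewrite NegzE; exact: hn].
have /choice[x hx] j : exists x : Zp, f x = zv 0 j 0.
  by apply: E_lim_Zp; move: (Ez j); congr (E _); apply/funext => m; rewrite zc.
exists x => m; have := sol' m 0; rewrite subr0 => <-; apply: eq_bigr => j _.
by rewrite hx zc.
Qed.

Lemma Zq_uniq (zc zc' : 'I_n -> Zp) : (forall m, \sum_j f (zc j) * kp m ^+ j = \sum_j f (zc' j) * kp m ^+ j) ->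
  zc =1 zc'.
Proof.
move=> h j; have Vu : Vm 0 \in unitmx by rewrite unitmxE unitfE; case: (det_Vm 0).
pose a : 'cV[C]_n := \col_j f (zc j); pose b : 'cV[C]_n := \col_j f (zc' j).
have : Vm 0 *m a = Vm 0 *m b.
  apply/matrixP => i o; rewrite !mxE; have := h (0 - (i : nat)%:Z).
  by under eq_bigr => l _ do rewrite mulrC; under [RHS]eq_bigr => l _ do rewrite mulrC; move=> e;
     under eq_bigr => l _ do rewrite !mxE; under [RHS]eq_bigr => l _ do rewrite !mxE.
move/(congr1 (mulmx (invmx (Vm 0)))); rewrite !mulKmx // => /matrixP/(_ j 0).
by rewrite !mxE => /fZp_inj.
Qed.

End Periodic.

End PeriodicSequences.

(** * The solution [y] and its characters of Lubin-Tate type *)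

Module LubinTate.
Import Valuations ClosureAndCompletion GhostSequences GhostEquations TameAction RankOne CyclotomicSequences.

Lemma sum_first2 (R : comNzRingType) D (a b x : R) : (1 < D)%N ->
  \sum_(i < D) [:: a; b]`_i * x ^+ i = a + b * x.
Proof.
case: D => [|[|D]] // _; rewrite !big_ord_recl big1 /= ?expr0 ?mulr1 ?addr0 ?expr1 // => i _.
by rewrite /bump /= !add1n nth_nil mul0r.
Qed.

Lemma lt_rat1 (p i q : nat) : (3 <= p)%N -> (3 <= q)%N -> (1 <= i)%N ->
  ((p ^ i * q.-1)%N%:R)^-1 *+ q <= 2%:R^-1 :> rat.
Proof.
move=> p3 q3 i1; have pi3 : (3 <= p ^ i)%N.
  by apply: (leq_trans p3 _); rewrite -{1}(expn1 p) leq_exp2l //; lia.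
have pos : 0 < (p ^ i * q.-1)%N%:R :> rat by rewrite ltr0n muln_gt0; lia.
rewrite -[_ *+ q]mulr_natl ler_pdivrMr // mulrC ler_pdivlMr ?ltr0n // -natrM ler_nat.
have : (3 * q.-1 <= p ^ i * q.-1)%N by rewrite leq_mul2r pi3 orbT.
lia.
Qed.

(** Equality, at index [n], of the valuations of the product of the conjugates of [y] and of [mu],
    used in [N_mu]. *)
Lemma geom_rat (p n : nat) : (2 <= p)%N -> (0 < n)%N ->
  \sum_(i < n) ((p ^ (n.-1 - i) * (p ^ n).-1)%N%:R)^-1 = ((p ^ n.-1 * p.-1)%N%:R)^-1 :> rat.
Proof.
move=> p2 n0.
have pn1 : (1 < p ^ n)%N by rewrite -{1}(expn0 p) ltn_exp2l.
have hp : p%:R - 1 != 0 :> rat by rewrite subr_eq0 pnatr_eq1; lia.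
have hp0 : p%:R != 0 :> rat by rewrite pnatr_eq0; lia.
have hq : p%:R ^+ n - 1 != 0 :> rat by rewrite subr_eq0 -natrX pnatr_eq1; lia.
have hpn : p%:R ^+ n.-1 != 0 :> rat by rewrite expf_neq0.
have e1 : (p.-1)%:R = p%:R - 1 :> rat by rewrite -subn1 natrB //; lia.
have e2 : ((p ^ n).-1)%:R = p%:R ^+ n - 1 :> rat by rewrite -subn1 natrB ?natrX //; lia.
transitivity (\sum_(i < n) (p%:R ^+ i) / (p%:R ^+ n.-1 * (p%:R ^+ n - 1)) : rat).
  apply: eq_bigr => i _; rewrite natrM e2 natrX.
  have -> : p%:R ^+ n.-1 = p%:R ^+ (n.-1 - i) * p%:R ^+ i :> rat.
    by rewrite -exprD subnK //; have := ltn_ord i; lia.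
  have h1 : p%:R ^+ i != 0 :> rat by rewrite expf_neq0.
  have h2 : p%:R ^+ (n.-1 - i) != 0 :> rat by rewrite expf_neq0.
  by field; rewrite h1 h2 hq.
rewrite -mulr_suml natrM natrX e1; apply: (mulIf hp).
rewrite mulrAC [_ * (p%:R - 1)]mulrC -subrX1; field.
by rewrite hp hpn hq.
Qed.

Lemma invr_natM_mulrn (p r : nat) : (0 < p)%N -> ((p * r)%N%:R)^-1 *+ p = (r%:R)^-1 :> rat.
Proof.
move=> p0; have h : p%:R != 0 :> rat by rewrite pnatr_eq0 -lt0n.
by rewrite -[_ *+ p]mulr_natl natrM invfM mulrA mulfV // mul1r.
Qed.

Section LT.
Variables (p : nat) (k : fieldType) (W : witt_vectors p k).
Hypotheses (pP : prime p) (p_odd : odd p).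
Variables (K : fieldExtType {fraction W}) (Kb : alg_closure K) (C : completion Kb).
Variable z : nat -> Kb.
Hypothesis hz : compatible_roots z.
Variables (Zp : witt_vectors p 'F_p) (f : {rmorphism Zp -> C}).
Local Notation OC := (@comp_int p k W K Kb C).
Hypothesis fO : forall x, OC (f x).
Local Notation emb := (comp_emb C).
Let V := valuedC pP C.
Let VK := valuedK pP Kb.
Let limC := @C_lim p k W pP K Kb C.
Let sepC := @C_sep p k W pP K Kb C.
Local Notation E := (E p OC).
Local Notation compat := (compat p OC).
Local Notation vge := (vge p OC).
Local Notation vgt := (vgt p OC).
Local Notation vl := (vl p OC).
Local Notation one_unit := (one_unit p OC).
Local Notation fn := (int -> C).
Local Notation G := (abs_galois Kb).
Let p0 : p%:R != 0 :> C := valued_p0 V.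
Variable n : nat.
Hypothesis n1 : (1 < n)%N.
Local Notation q := (p ^ n)%N.
Local Notation mu := (mu C z).
Local Notation xi := (xi C z).
Let n0 : (0 < n)%N := ltnW n1.
Let p3 : (3 <= p)%N. Proof. by have := prime_gt1 pP; have := p_odd; case: (p) => [|[|[|]]]. Qed.
Let q0 : (0 < q)%N. Proof. by rewrite expn_gt0 prime_gt0. Qed.
Let q9 : (9 <= q)%N.
Proof. by apply: (@leq_trans (3 ^ n)); [rewrite -[9%N]/(3 ^ 2)%N leq_exp2l|rewrite leq_exp2r]. Qed.

Let q1 : (1 < q.-1)%N. Proof. by move: q9; case: (p ^ n)%N => [|[|[|]]]. Qed.

Lemma E_first2 (a b : fn) i : E a -> E b -> E (fun m => [:: a m; b m]`_i).
Proof.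
case: i => [|[|i]] // _ _.
have -> : (fun m => [:: a m; b m]`_i.+2) = fun=> 0 by apply/funext => m; rewrite /= nth_nil.
exact: (E0 V).
Qed.

(** [x] is a [(q-1)]-th root of [xi] modulo [p], and the higher digits of [y] solve equations
    [X^q - xi X + r = 0] modulo [p]; all of them come from [E_alg]. *)
Lemma y_ex : exists (x y : fn), [/\ compat x, E y, forall m, vge 1 (y m - x m) &
  [/\ forall m, y (m - n%:Z) = xi m * y m, forall m, x m != 0, forall m, vge 1 (x m ^+ q.-1 - xi m)
    & forall i : nat, vl (x i.+1%:Z) = ((p ^ i * q.-1)%N%:R)^-1]].
Proof.
have Exi : E xi := E_xi pP p_odd C hz.
have Exi' : E (fun m => - xi m) := EN V p_odd Exi.
have D0 : (1 < q.-1)%N by lia.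
have [x cx hx] := @E_alg p k W pP p_odd K Kb C q.-1 (fun i m => [:: - xi m; 0]`_i) (ltnW D0)
  (fun i => E_first2 i Exi' (E0 V)).
have xq m : vge 1 (x m ^+ q.-1 - xi m) by have := hx m; rewrite /mpev sum_first2 // mul0r addr0.
have vx2 (i : nat) : x i.+2%:Z != 0 /\ vl (x i.+2%:Z) = ((p ^ i.+1 * q.-1)%N%:R)^-1.
  have xi0 : xi i.+2%:Z != 0 by apply: (xi_ge2 pP p_odd C hz).
  have vxi := vl_xi pP p_odd C hz i.
  have [|h1 h2] := @vl_sub_lt _ _ _ V (xi i.+2%:Z) (x i.+2%:Z ^+ q.-1) xi0.
    apply: vge_vgt (xq _); rewrite vxi invf_lt1 ?ltr0n ?expn_gt0 ?prime_gt0 // ltr1n.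
    by rewrite -{1}(expn0 p) ltn_exp2l ?prime_gt1.
  have x0 : x i.+2%:Z != 0 by move: h2; rewrite expf_eq0 negb_and; case/orP => //; lia.
  split=> //; move: h1; rewrite (vlX V) // vxi natrM invfM => <-.
  by rewrite -[_ *+ _]mulr_natr mulfK // pnatr_eq0; lia.
have x0 m : x m != 0.
  apply/negP => /eqP xm; have [h2 _] := vx2 0%N; move/eqP: h2; apply.
  case: (leP m 2) => le.
    have [j e] : exists j : nat, m + j%:Z = 2 by exists `|2 - m|%N; lia.
    have := compat_iter j m cx; rewrite e xm => /eqP; rewrite expf_eq0 => /andP[_ /eqP //].
  have [j e] : exists j : nat, 2 + j%:Z = m by exists `|m - 2|%N; lia.
  by rewrite -(compat_iter j 2 cx) e xm expr0n gtn_eqF // expn_gt0 prime_gt0.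
(* [Rr u] is the defect [phi^n u - xi u]; below, [h i] is the defect left after [i] corrections,
   divided by the power of [p] it contains. *)
pose Rr (u : fn) m := u (m - n%:Z) - xi m * u m.
have ER u : E u -> E (Rr u).
  by move=> Eu; apply: (EB V p_odd); [exact: E_shift|exact: (E_M V p_odd)].
have step r : E r -> exists x', compat x' /\ E (fun m => (Rr x' m + r m) / p%:R).
  move=> Er; have [x' cx' hx'] := @E_alg p k W pP p_odd K Kb C q (fun i m => [:: r m; - xi m]`_i) q0
    (fun i => E_first2 i Er Exi').
  exists x'; split=> //; apply: (E_divp V p_odd) => [|m].
    move: (ED V p_odd (ER _ (compat_E V cx')) Er); congr (E _); apply/funext => m.
    by rewrite [RHS]mulrC divfK.
  apply/(vge0P V); rewrite (vge_divr V) // (vl_p V) add0r; have := hx' m.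
  rewrite /mpev sum_first2; last by lia.
  by rewrite /Rr (int_shiftE n m cx'); congr (vge _ _); ring.
have Eh0 : E (fun m => Rr x m / p%:R).
  apply: (E_divp V p_odd) => [|m].
    by move: (ER _ (compat_E V cx)); congr (E _); apply/funext => m; rewrite [RHS]mulrC divfK.
  apply/(vge0P V); rewrite (vge_divr V) // (vl_p V) add0r /Rr (int_shiftE n m cx).
  have -> : x m ^+ q = x m ^+ q.-1 * x m by rewrite -exprSr prednK.
  by rewrite -mulrBl; apply: (vge_mulr V) => //; exact: cx.1.
have /choice[F hF] (u : fn) : exists x', E u -> compat x' /\ E (fun m => (Rr x' m + u m) / p%:R).
  by case: (pselect (E u)) => h1; [have [x' hx'] := step u h1; exists x'|exists (fun=> 0)].
pose h := fix h i := if i is j.+1 then (fun m => (Rr (F (h j)) m + h j m) / p%:R) else fun m => Rr x m / p%:R.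
have Eh i : E (h i) by elim: i => [//|i IH]; case: (hF _ IH).
pose xs i := F (h i).
have cxs i : compat (xs i) by case: (hF _ (Eh i)).
have [s Es hs] := E_series pP p_odd (fun i => compat_E V (cxs i)).
pose y m := x m + p%:R * s m.
have Ey : E y by apply: (ED V p_odd (compat_E V cx)); exact: E_natM.
exists x, y; split=> //.
  move=> m; rewrite /y addrAC subrr add0r; apply: (vge_mulr V); [exact: (E_O m Es)|exact: (vge_pX V 1)].
have xv i : vl (x i.+1%:Z) = ((p ^ i * q.-1)%N%:R)^-1.
  case: i => [|i]; last by case: (vx2 i).
  have [h2 v2] := vx2 0%N; have := cx.2 1; rewrite (_ : 1 + 1 = 2%:Z) // => <-.
  by rewrite (vlX V) // v2 expn1 expn0 mul1n invr_natM_mulrn // prime_gt0.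
split=> // m; apply/eqP; rewrite -subr_eq0; apply/eqP/sepC => N.
have key j : Rr x m + p%:R * Rr (fun m => \sum_(i < j) p%:R ^+ i * xs i m) m = p%:R ^+ j.+1 * h j m.
  elim: j => [|j IH]; first by rewrite /Rr !big_ord0 mulr0 subr0 mulr0 addr0 expr1 /= [RHS]mulrC divfK.
  have hS : p%:R * h j.+1 m = Rr (xs j) m + h j m by rewrite /= [LHS]mulrC divfK.
  rewrite [in RHS]exprSr -[in RHS]mulrA hS [in RHS]mulrDr -IH /Rr !big_ord_recr /= exprS; ring.
have -> : y (m - n%:Z) - xi m * y m = p%:R ^+ N.+1 * h N m +
    p%:R * ((s (m - n%:Z) - \sum_(i < N) p%:R ^+ i * xs i (m - n%:Z)) - xi m * (s m - \sum_(i < N) p%:R ^+ i * xs i m)).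
  by rewrite -key /y /Rr; ring.
apply: (vgeD V).
  apply: (vge_mulr V); first exact: (E_O m (Eh N)).
  by apply: vge_le (vge_pX V _); rewrite ler_nat.
apply: (vge_mull V); first exact: (Onat V).
by apply: (vgeB V); [exact: hs|apply: (vge_mull V); [exact: (E_O m Exi)|exact: hs]].
Qed.

(** Provides for [mu] and [n = 1] the hypotheses of [rank_one], so that the solutions of
    [phi w = xi w] are constant multiples of [mu]. *)
Lemma mu_base : exists x, [/\ compat x, forall m, vge 1 (mu m - x m), forall m, x m != 0,
  forall m, vge 1 (x m ^+ (p ^ 1).-1 - xi m) & forall m : nat, (2 <= m)%N -> vl (x m) *+ (p ^ 1) <= 2%:R^-1].
Proof.
have Emu : E mu := E_mu pP p_odd C hz.
have [x cx Ex] := E_teich V p_odd limC sepC Emu.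
have mx m : vge 1 (mu m - x m).
  by have := E_O m Ex; rewrite -(vge0P V) (vge_divr V) // (vl_p V) add0r.
have vx (i : nat) : x i.+2%:Z != 0 /\ vl (x i.+2%:Z) = ((p ^ i.+1 * p.-1)%N%:R)^-1.
  have m0 : mu i.+2%:Z != 0 by apply: (mu_ge1 C hz).
  have vm := vl_mu pP p_odd C hz i.+1.
  have [|h1 h2] := @vl_sub_lt _ _ _ V (mu i.+2%:Z) (x i.+2%:Z) m0; last by rewrite h1.
  have big : (1 < p ^ i.+1 * p.-1)%N.
    have h3 : (3 <= p ^ i.+1)%N by apply: (leq_trans p3 _); rewrite -{1}(expn1 p) leq_exp2l ?prime_gt1.
    by apply: (leq_trans (ltnW h3)); rewrite leq_pmulr // (prime_pred_gt0 pP).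
  by rewrite (vgt_subC V); apply: vge_vgt (mx _); rewrite vm invf_lt1 ?ltr1n // ltr0n ltnW.
exists x; split=> // [m|m|[|[|m]]] //; last first.
- move=> _; have [_ ->] := vx m; rewrite expn1; exact: lt_rat1.
- rewrite expn1 -(subrKA (mu m ^+ p.-1)); apply: (vgeD V).
    apply: (vge_exprB V); rewrite ?ler01 //; [exact: cx.1|exact: (E_O m Emu)|].
    by rewrite (vge_subC V).
  rewrite (vge_subC V); case: (leP m 0) => le.
    rewrite (xi_le0 C hz) // (mu_le0 C hz) // expr0n gtn_eqF ?prime_pred_gt0 // subr0.
    exact: (vge_pX V 1).
  have m0 : mu m != 0 by apply: (mu_ge1 C hz); lia.
  have -> : xi m - mu m ^+ p.-1 = p%:R * \sum_(i < p.-1) ('C(p, i.+1) %/ p)%:R * mu m ^+ i.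
    apply: (mulIf m0); rewrite mulrBl -(mu_S pP p_odd C hz) -exprSr prednK ?prime_gt0 //.
    have -> : mu (m - 1) = (1 + mu m) ^+ p - 1.
      by rewrite /CyclotomicSequences.mu (subrKC) ; have [_ h] := eps_compat pP p_odd C hz; rewrite -[in RHS](subrK 1 m) h.
    rewrite (paddE _ _ pP) expr1n (_ : _ - 1 - mu m ^+ p = p%:R * padd p 1 (mu m)); last ring.
    rewrite -mulrA; congr (_ * _).
    by rewrite /padd mulr_suml; apply: eq_bigr => i _; rewrite expr1n mul1r -mulrA -exprSr.
  apply: (vge_mulr V); last exact: (vge_pX V 1).
  by apply: (O_sum V) => i _; apply: (valued_M V); [exact: (Onat V)|apply: (OX V); exact: (E_O m Emu)].
- apply/negP => /eqP xm; have [h2 _] := vx 0%N; move/eqP: h2; apply.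
  case: (leP m 2) => le.
    have [j e] : exists j : nat, m + j%:Z = 2 by exists `|2 - m|%N; lia.
    have := compat_iter j m cx; rewrite e xm => /eqP; rewrite expf_eq0 => /andP[_ /eqP //].
  have [j e] : exists j : nat, 2 + j%:Z = m by exists `|m - 2|%N; lia.
  by rewrite -(compat_iter j 2 cx) e xm expr0n gtn_eqF // expn_gt0 prime_gt0.
Qed.

Variables (x y : fn).
Hypotheses (cx : compat x) (Ey : E y) (xy : forall m, vge 1 (y m - x m))
  (yR : forall m, y (m - n%:Z) = xi m * y m) (x0 : forall m, x m != 0)
  (xq : forall m, vge 1 (x m ^+ q.-1 - xi m))
  (xv : forall i : nat, vl (x i.+1%:Z) = ((p ^ i * q.-1)%N%:R)^-1).

Lemma xv_small (m : nat) : (2 <= m)%N -> vl (x m) *+ q <= 2%:R^-1.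
Proof. by case: m => [|[|m]] // _; rewrite xv; apply: lt_rat1 => //; lia. Qed.

Lemma y_ge1 (i : nat) : y i.+1%:Z != 0 /\ vl (y i.+1%:Z) = ((p ^ i * q.-1)%N%:R)^-1.
Proof.
have [|h1 h2] := @vl_sub_lt _ _ _ V (x i.+1%:Z) (y i.+1%:Z) (x0 _); last by rewrite h1 xv.
have big : (1 < p ^ i * q.-1)%N by apply: (leq_trans q1); rewrite leq_pmull // expn_gt0 prime_gt0.
by apply: vge_vgt (xy _); rewrite xv invf_lt1 ?ltr1n // ltr0n ltnW.
Qed.

Lemma y_neq0 m : 2 - n%:Z <= m -> y m != 0.
Proof.
move=> h; case: (leP 1 m) => le.
  by case: m le h => [[|i]|i] // _ _; case: (y_ge1 i).
rewrite -[m](addrK n%:Z) yR mulf_neq0 //; first by apply: (xi_ge2 pP p_odd C hz); lia.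
have [i ->] : exists i : nat, m + n%:Z = i.+1%:Z by exists (absz (m + n%:Z)).-1; lia.
by case: (y_ge1 i).
Qed.

(** The product of the conjugates of [y] satisfies the equation [phi w = xi w] of [mu]; comparing
    valuations at index [n] shows that the constant factor is a unit. *)
Lemma N_mu : exists c : C, [/\ E (fun=> c), c != 0, OC c^-1 & forall m, \prod_(i < n) y (m - (i : nat)%:Z) = c * mu m].
Proof.
have [xm [h1 h2 h3 h4 h5]] := mu_base.
pose N m := \prod_(i < n) y (m - (i : nat)%:Z).
have EN' : E N by apply: (@Eprod _ _ _ V p_odd _ _ (fun (i : 'I_n) m => y (m - (i : nat)%:Z))) => i; exact: E_shift.
have NR m : N (m - 1%:Z) = xi m * N m.
  rewrite /N; case: (n) n0 yR => // n' _ yR'; rewrite big_ord_recr big_ord_recl /= subr0 mulrA -yR' mulrC; congr (_ * _).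
    by congr y; lia.
  by apply: eq_bigr => i _; congr y; rewrite /bump leq0n add1n; lia.
have muR m : mu (m - 1%:Z) = xi m * mu m := mu_S pP p_odd C hz m.
have [c [Ec cS hc]] := rank_one pP p_odd (ltnSn 0) (E_xi pP p_odd C hz) h1 (E_mu pP p_odd C hz) h2 muR h3 h4 h5 EN' NR.
have cc m : c m = c 0.
  have hp (i : nat) : c i%:Z = c 0 by elim: i => [//|i IH]; rewrite -[c i.+1%:Z]cS -IH; congr c; lia.
  have hn (i : nat) : c (- i%:Z) = c 0 by elim: i => [//|i <-]; rewrite -[c (- i%:Z)]cS; congr c; lia.
  by case: m => i; [exact: hp|rewrite NegzE; exact: hn].
exists (c 0).
have en : N n = c 0 * mu n by rewrite hc cc.
have Nn0 : N n != 0.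
  apply/prodf_neq0 => i _; apply: y_neq0; have := ltn_ord i; lia.
have c0 : c 0 != 0 by apply: contraNneq Nn0 => e; rewrite en e mul0r.
have vN : vl (N n) = vl (mu n).
  rewrite (vl_prod V) => [|i _]; last by apply: y_neq0; have := ltn_ord i; lia.
  have e (i : 'I_n) : n%:Z - (i : nat)%:Z = (n.-1 - i).+1%:Z by have := ltn_ord i; lia.
  rewrite (eq_bigr (fun i : 'I_n => ((p ^ (n.-1 - i) * q.-1)%N%:R)^-1)) => [|i _]; last first.
    by rewrite e; case: (y_ge1 (n.-1 - i)).
  have -> : mu n = mu (n.-1).+1%:Z by rewrite prednK.
  by rewrite geom_rat ?prime_gt1 // (vl_mu pP p_odd C hz).
have mun : mu n != 0 by apply: (mu_ge1 C hz); lia.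
have vc : vl (c 0) = 0 by move: vN; rewrite en (vlM V) // => /eqP; rewrite -subr_eq0 addrK => /eqP.
split=> //; first by move: Ec; congr (E _); apply/funext => m; rewrite cc.
  by apply/(vge0P V); rewrite /Valuations.vge (vlV V) // vc oppr0 lexx orbT.
by move=> m; rewrite -[LHS]/(N m) hc cc.
Qed.

Lemma E_const_fixed c (g : G) : E (fun=> c) -> comp_act C g c = c.
Proof.
move=> Ec; apply/eqP; rewrite -subr_eq0; apply/eqP/sepC => N.
have [a ha] := E_const_nat V p_odd limC sepC N Ec.
have -> : comp_act C g c - c = comp_act C g (c - a%:R) - (c - a%:R) by rewrite rmorphB rmorph_nat; ring.
by apply: (vgeB V) => //; rewrite (vge_act pP).
Qed.

Section Chi.
Variables (g : G) (chi : Zp).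
Hypothesis hchi : cyclotomic_value g chi.
Local Notation act := (comp_act C g).
Local Notation b := (bg z f g chi n).

(** [g(y) / bg] solves the same equation as [y], so [rank_one] makes their quotient [X] periodic.
    [N_mu] and [bg_prod] give its norm; at index 1 both [y] and [bg] are one-units times simpler
    terms, which leaves the tame character of [x 1]. *)
Lemma chi_ex : exists X : fn, [/\ E X, forall m, X (m - n%:Z) = X m,
  forall m, act (y m) = X m * (b m * y m), forall m, X m != 0 /\ vl (X m) = 0 &
  (forall m, \prod_(i < n) X (m - (i : nat)%:Z) = f chi) /\ one_unit (X 1 / (act (x 1) / x 1))].
Proof.
have bu := bg_unit pP p_odd hz fO hchi n.
have Eb : E b := E_bg pP p_odd hz fO hchi n0.
pose y' m := act (y m) / b m.
have b0 m : b m != 0 by case: (bu m).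
have Ey' : E y'.
  apply: (E_M V p_odd); first by apply: E_morph Ey => u; exact: comp_act_int.
  apply: (E_inv V p_odd) => // m; apply/(vge0P V); rewrite /Valuations.vge (vlV V) //.
  by case: (bu m) => _ ->; rewrite oppr0 lexx orbT.
have y'R m : y' (m - n%:Z) = xi m * y' m.
  rewrite /y' yR rmorphM /=; have hb := bg_S pP p_odd hz fO hchi n0 m.
  have w0 := wg_neq0 pP p_odd hz fO hchi m.
  have [v0 _] := vg_unit pP p_odd hz fO hchi m; have [v1 _] := vg_unit pP p_odd hz fO hchi (m - 1).
  have hx := act_xi pP p_odd hz f g chi m; have bn := b0 (m - n%:Z).
  have hxi : act (xi m) * wg z f g chi m = xi m by rewrite /wg mulrA hx mulrAC mulfV // mul1r.
  by rewrite -hb -{2}hxi; field; rewrite bn w0.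
have [X [EX' XS hX]] := rank_one pP p_odd n0 (E_xi pP p_odd C hz) cx Ey xy yR x0 xq xv_small Ey' y'R.
have hX' m : act (y m) = X m * (b m * y m) by rewrite mulrCA -hX /y' mulrC divfK.
have Xu1 (i : nat) : X i.+1%:Z != 0 /\ vl (X i.+1%:Z) = 0.
  have [yn vy] := y_ge1 i; have [bn vb] := bu i.+1%:Z; have e := hX' i.+1%:Z.
  have Xn : X i.+1%:Z != 0.
    by apply: contraNneq yn => X0; rewrite X0 mul0r in e; rewrite -(fmorph_eq0 act) e.
  split=> //; have := congr1 vl e; rewrite (vl_act pP) !(vlM V) ?mulf_neq0 // vb add0r => /eqP.
  by rewrite -subr_eq0 opprD addrCA subrr addr0 oppr_eq0 => /eqP.
have XS' (j : nat) m : X (m + (n * j)%N%:Z) = X m.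
  elim: j => [|j IH]; first by rewrite muln0 addr0.
  by rewrite -IH -(XS (m + (n * j.+1)%N%:Z)); congr X; rewrite mulnS; lia.
have Xu m : X m != 0 /\ vl (X m) = 0.
  rewrite -(XS' `|m|.+1 m).
  have [i ->] : exists i : nat, m + (n * `|m|.+1)%N%:Z = i.+1%:Z.
    have : (`|m|.+1 <= n * `|m|.+1)%N by rewrite leq_pmull.
    by exists (absz (m + (n * `|m|.+1)%N%:Z)).-1; lia.
  exact: Xu1.
exists X; split=> //; split; last first.
  have [yn vy] := y_ge1 0; have [bn vb] := bu 1; have [Xn vX] := Xu 1.
  have b1 := bg1 pP p_odd hz fO hchi n0.
  have yx : one_unit (y 1 / x 1).
    rewrite /TameAction.one_unit (_ : y 1 / x 1 - 1 = (y 1 - x 1) / x 1); last by field; exact: x0.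
    have x1V : (x 1)^-1 != 0 by rewrite invr_eq0.
    have h : vge (1 + vl (x 1)^-1) ((y 1 - x 1) / x 1) by rewrite (vge_mulIr V).
    have big : (1 < p ^ 0 * q.-1)%N by rewrite mul1n.
    apply: vge_vgt h; rewrite (vlV V) // (xv 0) subr_gt0 invf_lt1 ?ltr1n // ltr0n ltnW //.
  have gyx : one_unit (act (y 1 / x 1)) by rewrite /TameAction.one_unit -(rmorph1 act) -rmorphB (vgt_act pP).
  have -> : X 1 / (act (x 1) / x 1) = act (y 1 / x 1) * ((b 1)^-1 * (y 1 / x 1)^-1).
    have ax0 : act (x 1) != 0 by rewrite fmorph_eq0.
    by rewrite fmorph_div hX'; have := x0 1 => x10; field; rewrite yn bn x10 ax0.
  by apply: (one_unitM V) => //; apply: (one_unitM V); apply: (one_unitV V).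
have [c [Ec c0 _ hN]] := N_mu.
have key (m : nat) : (n <= m)%N -> \prod_(i < n) X (m%:Z - (i : nat)%:Z) = f chi.
  move=> le; have m0 : mu m != 0 by apply: (mu_ge1 C hz); lia.
  have := congr1 act (hN m); rewrite rmorph_prod rmorphM (E_const_fixed g Ec) (act_mu hz f g chi).
  rewrite (eq_bigr (fun i : 'I_n => X (m%:Z - (i : nat)%:Z) * (b (m%:Z - (i : nat)%:Z) * y (m%:Z - (i : nat)%:Z)))) => [|i _]; last exact: hX'.
  rewrite !big_split /= hN (bg_prod pP p_odd hz fO hchi n0 m); set P := \prod_(i < n) X _ => e.
  have v0 : vg z f g chi m != 0 by case: (vg_unit pP p_odd hz fO hchi m).
  have f0 : f chi != 0 by have [h _] := vg_unit pP p_odd hz fO hchi 0; move: h; rewrite /vg lexx.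
  have cm : c * (vg z f g chi m * mu m) != 0 by rewrite !mulf_neq0.
  apply: (mulIf cm); rewrite -[in RHS]e; by field.
move=> m; have h2 : (n <= `|(m + (n * (`|m| + n))%N%:Z)%R|)%N /\ 0 <= m + (n * (`|m| + n))%N%:Z.
  by have : (`|m| + n <= n * (`|m| + n))%N; [rewrite leq_pmull|lia].
rewrite -(key _ h2.1); apply: eq_bigr => i _.
rewrite -(XS' (`|m| + n)%N); congr X; case: h2 => _; lia.
Qed.

End Chi.
End LT.

End LubinTate.

(** * Periods of the characters in [A] *)

Module CrystallinePeriods.
Import Valuations WittRings ClosureAndCompletion GhostSequences GhostEquations GhostToAcris RankOne DividedPowers CyclotomicSequences.

Lemma fact_pred n : (0 < n)%N -> (n * (n.-1)`! = n`!)%N.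
Proof. by case: n. Qed.

Section Periods.
Variables (p : nat) (k : fieldType) (W : witt_vectors p k).
Hypotheses (pP : prime p) (p_odd : odd p).
Variables (K : fieldExtType {fraction W}) (Kb : alg_closure K) (C : completion Kb) (A : Acris C).
Variable z : nat -> Kb.
Hypothesis hz : compatible_roots z.
Variables (Zp : witt_vectors p 'F_p) (f : {rmorphism Zp -> C}).
Local Notation OC := (@comp_int p k W K Kb C).
Hypothesis fO : forall x, OC (f x).
Variable e : A.
Hypothesis he : teichmuller_eps z e.
Local Notation emb := (comp_emb C).
Let V := valuedC pP C.
Let limC := @C_lim p k W pP K Kb C.
Let sepC := @C_sep p k W pP K Kb C.
Local Notation E := (E p OC).
Local Notation compat := (compat p OC).
Local Notation vge := (vge p OC).
Local Notation fn := (int -> C).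
Local Notation G := (abs_galois Kb).
Local Notation ev := (ev pP p_odd A).
Local Notation eps := (eps C z).
Local Notation mu := (mu C z).
Local Notation xi := (xi C z).
Local Notation gam := (@acris_gam _ _ _ _ _ _ A).
Local Notation theta := (acris_theta A).
Local Notation cA := (cA A).
Let p0 : p%:R != 0 :> C := valued_p0 V.

Definition sh (i : nat) (u : fn) : fn := fun m => u (m - i%:Z).
Lemma E_sh i u : E u -> E (sh i u). Proof. exact: E_shift. Qed.

Lemma ev_eps : ev eps = e.
Proof. by apply: ev_teich; [exact: eps_compat|move=> n a h; apply: he; rewrite h]. Qed.

Lemma ev_sh_eps i : ev (sh i eps) = e ^+ (p ^ i).
Proof.
rewrite -ev_eps -evX; last exact: E_eps.
by congr ev; apply/funext => m; rewrite /sh (int_shiftE i m (eps_compat pP p_odd C hz)).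
Qed.

Definition M : A := e - 1.
Lemma ev_mu : ev mu = M.
Proof. by rewrite /M -ev_eps -(ev1 pP p_odd A) -evB //; [exact: E_eps|exact: E1]. Qed.
Lemma theta_M : theta M = 0.
Proof. by rewrite -ev_mu ev_theta ?(mu_le0 C hz) //; exact: E_mu. Qed.
Definition ga i := gam i M.
Lemma ga_0 : ga 0 = 1. Proof. exact: gam0 theta_M. Qed.
Lemma ga_1 : ga 1 = M. Proof. exact: gam1 theta_M. Qed.
Lemma ga_M m n : ga m * ga n = 'C(m + n, m)%:R * ga (m + n). Proof. exact: gam_mul theta_M. Qed.
Lemma ga_1e : 1 + ga 1 = e. Proof. by rewrite ga_1 /M subrKC. Qed.

Local Notation tau := (tauc ga p).
Local Notation lam := (lamc ga p).
Local Notation kap := (kapc ga p).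

Lemma ev_sh_mu m : ev (sh m mu) = (p ^ m)%:R * tau m.
Proof.
rewrite (tauc_mul ga_0 ga_M pP) ga_1e -ev_sh_eps -(ev1 pP p_odd A) -evB //; last exact: E1.
exact/E_sh/E_eps.
Qed.

Definition kap0 : fn := fun m => \sum_(i < p) \sum_(l < i) eps m ^+ l.
Lemma E_kap0 : E kap0.
Proof.
apply: (@Esum _ _ _ V p_odd _ _ (fun (i : 'I_p) m => \sum_(l < i) eps m ^+ l)) => i.
apply: (@Esum _ _ _ V p_odd _ _ (fun (l : 'I_i) m => eps m ^+ l)) => l.
by apply: (EX V p_odd); exact: E_eps.
Qed.
Lemma xi_kap0 m : xi m = p%:R + mu m * kap0 m.
Proof.
rewrite /xi /CyclotomicSequences.xi /kap0 mulr_sumr -[p in p%:R](card_ord p) -sumr_const -big_split /=.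
by apply: eq_bigr => i _; rewrite /CyclotomicSequences.mu -subrX1 subrKC.
Qed.
Lemma ev_kap0 m : ev (sh m kap0) = kap m.
Proof.
have Ee l : E (fun m' => sh m eps m' ^+ l) by apply: (EX V p_odd); exact/E_sh/E_eps.
have Es i : E (fun m' => \sum_(l < i) sh m eps m' ^+ l).
  by apply: (@Esum _ _ _ V p_odd _ _ (fun (l : 'I_i) m' => sh m eps m' ^+ l)) => l; exact: Ee.
rewrite /kapc ga_1e.
rewrite (@ev_sum _ _ _ pP p_odd _ _ _ A 'I_p _ (fun (i : 'I_p) m' => \sum_(l < i) sh m eps m' ^+ l)) => [|i]; last exact: Es.
apply: eq_bigr => i _.
rewrite (@ev_sum _ _ _ pP p_odd _ _ _ A 'I_i _ (fun (l : 'I_i) m' => sh m eps m' ^+ l)) => [|l]; last exact: Ee.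
apply: eq_bigr => l _; rewrite evX; last exact/E_sh/E_eps.
by rewrite ev_sh_eps exprM.
Qed.

Lemma ev_padd u v : E u -> E v -> ev (fun m => padd p (u m) (v m)) = padd p (ev u) (ev v).
Proof.
move=> Eu Ev; have Ei (i : 'I_p.-1) : E (fun m => u m ^+ (p.-1 - i) * v m ^+ i.+1).
  by apply: (E_M V p_odd); apply: (EX V p_odd).
rewrite (@ev_sum _ _ _ pP p_odd _ _ _ A 'I_p.-1 _ (fun (i : 'I_p.-1) m => ('C(p, i.+1) %/ p)%:R * (u m ^+ (p.-1 - i) * v m ^+ i.+1))); last first.
  by move=> i; apply: (E_natM pP p_odd).
apply: eq_bigr => i _.
rewrite (@evM _ _ _ pP p_odd _ _ _ A (fun=> ('C(p, i.+1) %/ p)%:R)) //; last exact: Enat.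
rewrite ev_nat; congr (_ * _); rewrite evM; try exact: (EX V p_odd).
by rewrite !evX.
Qed.

Section Act.
Variables (g : G) (chi : Zp).
Hypothesis hchi : cyclotomic_value g chi.
Local Notation act := (acris_act A g).
Local Notation cact := (comp_act C g).
Local Notation v := (vg z f g chi).
Local Notation w := (wg z f g chi).
Local Notation rho := (rhog z f g chi).
Let Ev : E v := E_vg pP p_odd hz fO hchi.
Let Er : E rho := E_rhog pP p_odd hz fO hchi.
Let Ew : E w := E_wg pP p_odd hz fO hchi.

Lemma act_M : act M = ev v * M.
Proof.
rewrite -ev_mu ev_act; last exact: E_mu.
rewrite -evM //; last exact: E_mu.
by congr ev; apply/funext => m; rewrite (act_mu hz f g chi).
Qed.

(** [tau 1] is [phi(mu) / p], but [p] is not cancelled in [A]: the action is computed on the divided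
    power expression [tauc1], and the remaining terms match by an identity in [E], where division by
    [p] takes place in [C]. *)
Lemma act_tau1 : act (tau 1) = ev (sh 1 v) * tau 1.
Proof.
rewrite (tauc1 ga_0 ga_M pP) ga_1 rmorphD rmorphM rmorph_nat (acris_act_gam _ _ theta_M) act_M gamZ ?theta_M //.
have -> : act (padd p 1 M) = padd p 1 (ev v * M).
  by rewrite /padd rmorph_sum; apply: eq_bigr => i _; rewrite !rmorphM rmorph_nat !rmorphXn rmorph1 act_M.
have eD : ev (sh 1 v) = ev v ^+ p + p%:R * ev (sh 1 (dE p v)).
  rewrite -evX // -(ev_nat pP p_odd A p) -evM; [|exact: Enat|exact/E_sh/E_dE].
  rewrite -evD; [|exact: (EX V p_odd)|by apply: (E_natM pP p_odd); exact/E_sh/E_dE].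
  congr ev; apply/funext => m; rewrite /sh /dE subrK [p%:R * _]mulrC divfK //; ring.
have eP : padd p 1 (ev v * M) = ev (sh 1 v) * padd p 1 M + ev (sh 1 (dE p v)) * M ^+ p.
  rewrite -ev_mu -evX; last exact: E_mu.
  rewrite -(ev1 pP p_odd A) -evM //; last exact: E_mu.
  have Evm : E (fun m => v m * mu m) by apply: (E_M V p_odd); [exact: Ev|exact: E_mu].
  have Emu : E mu by exact: E_mu.
  rewrite -ev_padd //; last exact: E1.
  rewrite -ev_padd //; last exact: E1.
  have Ep : E (fun m => padd p 1 (mu m)).
    apply: (@Esum _ _ _ V p_odd _ _ (fun (i : 'I_p.-1) m => ('C(p, i.+1) %/ p)%:R * (1 ^+ (p.-1 - i) * mu m ^+ i.+1))) => i.
    apply: (E_natM pP p_odd); apply: (@E_M _ _ _ V p_odd (fun=> 1 ^+ (p.-1 - i))); last exact: (EX V p_odd).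
    by rewrite expr1n; exact: E1.
  have Eps : E (fun m => mu m ^+ p) by apply: (EX V p_odd).
  have Ev1 : E (sh 1 v) by exact: E_sh.
  have Ed1 : E (sh 1 (dE p v)) by apply/E_sh/E_dE.
  rewrite -(evM pP p_odd A Ev1 Ep) -(evM pP p_odd A Ed1 Eps) -evD; try exact: (E_M V p_odd).
  congr ev; apply/funext => m; apply: (mulfI p0).
  have h1 := paddE 1 (v m * mu m) pP; have h2 := paddE 1 (mu m) pP.
  have [_ he1] := eps_compat pP p_odd C hz.
  have h3 : (1 + mu m) ^+ p = 1 + mu (m - 1) by rewrite /CyclotomicSequences.mu !subrKC -[in LHS](subrK 1 m) he1.
  have h4 : (1 + v m * mu m) ^+ p = 1 + v (m - 1) * mu (m - 1).
    rewrite -(act_mu hz f g chi m) -(act_mu hz f g chi (m - 1)).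
    by have := congr1 cact h3; rewrite rmorphXn !rmorphD rmorph1.
  have h5 : p%:R * sh 1 (dE p v) m = v (m - 1) - v m ^+ p by rewrite /sh /dE subrK mulrC divfK.
  have h6 : p%:R * padd p 1 (v m * mu m) = v (m - 1) * mu (m - 1) - (v m * mu m) ^+ p.
    by apply: (addrI (1 ^+ p + (v m * mu m) ^+ p)); rewrite -h1 h4 expr1n; ring.
  have h7 : p%:R * padd p 1 (mu m) = mu (m - 1) - mu m ^+ p.
    by apply: (addrI (1 ^+ p + mu m ^+ p)); rewrite -h2 h3 expr1n; ring.
  have -> : p%:R * (sh 1 v m * padd p 1 (mu m) + sh 1 (dE p v) m * mu m ^+ p) =
     sh 1 v m * (p%:R * padd p 1 (mu m)) + (p%:R * sh 1 (dE p v) m) * mu m ^+ p by ring.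
  by rewrite h5 h6 h7 exprMn /sh; ring.
have gp : p%:R * ((p.-1)`!%:R * gam p M) = M ^+ p.
  by rewrite (pd_pow p theta_M) mulrA -natrM fact_pred ?prime_gt0.
have gp' : ev (sh 1 (dE p v)) * M ^+ p = p%:R * ev (sh 1 (dE p v)) * ((p.-1)`!%:R * gam p M) by rewrite -gp; ring.
by rewrite eP gp' mulrDr eD /ga; ring.
Qed.

(** Multiplied by [mu], this is [g(xi) v = phi(v) xi] written with [xi = p + mu kap0]. [E_vanish]
    permits to cancel [mu] although it vanishes at indices up to 0. *)
Lemma rho_kap m : p%:R * rho m + v m ^+ 2 * cact (kap0 m) - v (m - 1) * kap0 m = 0.
Proof.
pose h m := p%:R * rho m + v m ^+ 2 * cact (kap0 m) - v (m - 1) * kap0 m.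
have Egk : E (fun m => cact (kap0 m)) by apply: E_morph E_kap0 => x; exact: comp_act_int.
have Eh : E h.
  apply: (EB V p_odd); last by apply: (E_M V p_odd); [exact: (E_shift 1 Ev)|exact: E_kap0].
  apply: (ED V p_odd); first exact: (E_natM pP p_odd).
  by apply: (E_M V p_odd) => //; exact: (EX V p_odd).
have h0 : h = fun=> 0.
  apply: (E_vanish V p_odd limC sepC Eh (n0 := 1)) => i i1.
  have m0 : mu i != 0 by apply: (mu_ge1 C hz); lia.
  apply: (mulfI m0); rewrite mulr0 /h.
  have hx : mu i * kap0 i = xi i - p%:R by rewrite xi_kap0; ring.
  have hgx : v i * mu i * cact (kap0 i) = cact (xi i) - p%:R.
    by rewrite -(act_mu hz f g chi) -rmorphM hx rmorphB rmorph_nat.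
  have hr := vg_rho pP p_odd hz f g chi i.
  have hxi := act_xi pP p_odd hz f g chi i.
  transitivity (p%:R * (mu i * rho i) + v i * (v i * mu i * cact (kap0 i)) - v (i%:Z - 1) * (mu i * kap0 i)); first by ring.
  have hxi' : v i * cact (xi i) = v (i%:Z - 1) * xi i by rewrite mulrC.
  rewrite -hr hgx hx.
  transitivity (p%:R * (v i - v (i%:Z - 1)) + (v i * cact (xi i) - v i * p%:R) - v (i%:Z - 1) * (xi i - p%:R)); first by ring.
  rewrite hxi'; ring.
by rewrite -[LHS]/(h m) h0.
Qed.

Lemma ev_v_sub m : ev (sh m v) - ev (sh m.+1 v) = (p ^ m)%:R * tau m * ev (sh m rho).
Proof.
rewrite -ev_sh_mu -evM; [|exact/E_sh/E_mu|exact: E_sh].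
rewrite -evB; [|exact: E_sh|exact: E_sh]; congr ev; apply/funext => i.
by rewrite /sh -(vg_rho pP p_odd hz f g chi); congr (_ - v _); lia.
Qed.

(** With [lam m] expanded around 1 by [lamc_kap], the difference of the two sides is a multiple of
    the relation [rho_kap]. *)
Lemma lam_step m : (0 < m)%N -> act (tau m) = ev (sh m v) * tau m ->
  ev (sh m v) * act (lam m) = ev (sh m.+1 v) * lam m.
Proof.
move=> m0 ht; rewrite !(lamc_kap ga_0 ga_M pP) rmorphD rmorph1 rmorphM rmorph_nat rmorphM ht -ev_kap0 ev_act; last exact/E_sh/E_kap0.
set a := ev (sh m v); set b := ev (sh m.+1 v); set t := tau m; set P := (p ^ m.-1)%:R.
set kg := ev (fun i => _); set kk := ev (sh m kap0).
have e1 : p%:R * ev (sh m rho) + a ^+ 2 * kg - b * kk = 0.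
  have Ekg : E (fun i => cact (sh m kap0 i)) by apply: E_morph (E_sh m E_kap0) => x; exact: comp_act_int.
  have h1 : E (sh m rho) := E_sh m Er.
  have h2 : E (fun i => sh m v i ^+ 2) by apply: (EX V p_odd); exact: E_sh.
  have h3 : E (sh m.+1 v) := E_sh _ Ev.
  have h4 : E (sh m kap0) := E_sh _ E_kap0.
  rewrite -(ev_nat pP p_odd A p) -(evX pP p_odd A 2 (E_sh m Ev)).
  have h5 : E (fun=> p%:R : C) by exact: Enat.
  rewrite -(evM pP p_odd A h5 h1) -(evM pP p_odd A h2 Ekg) -(evM pP p_odd A h3 h4).
  rewrite -evD; [|exact: (E_M V p_odd)|exact: (E_M V p_odd)].
  rewrite -evB; [|by apply: (ED V p_odd); exact: (E_M V p_odd)|exact: (E_M V p_odd)].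
  rewrite -(ev0 pP p_odd A); congr ev; apply/funext => i.
  rewrite -[RHS](rho_kap (i - m%:Z)) /sh; congr (_ - v _ * _); lia.
apply/eqP; rewrite -subr_eq0; apply/eqP.
transitivity (a - b + P * t * (a ^+ 2 * kg - b * kk)); first by rewrite /P; ring.
rewrite ev_v_sub -[in (p ^ m)%N](prednK m0) expnS natrM -/P -/t.
transitivity (P * t * (p%:R * ev (sh m rho) + a ^+ 2 * kg - b * kk)); first by ring.
by rewrite e1 mulr0.
Qed.

Lemma act_tau m : (0 < m)%N -> act (tau m) = ev (sh m v) * tau m.
Proof.
elim: m => // m IH _; case: m IH => [_|m IH]; first exact: act_tau1.
rewrite (tauc_S ga_M pP) // rmorphM IH // mulrA [act (lam _) * _]mulrC.
by rewrite lam_step ?IH // mulrA.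
Qed.

Lemma w_lam m : (0 < m)%N -> ev (sh m w) * act (lam m) = lam m.
Proof.
move=> m0; have h := lam_step m0 (act_tau m0).
have EvV : E (fun i => (sh m.+1 v i)^-1).
  apply: (E_inv V p_odd); [exact: E_sh|by move=> i; case: (vg_unit pP p_odd hz fO hchi (i - m.+1%:Z))|].
  by move=> i; exact: (vg_unitV pP p_odd hz fO hchi).
have e1 : ev (fun i => (sh m.+1 v i)^-1) * ev (sh m.+1 v) = 1.
  rewrite -evM //; last exact: E_sh.
  rewrite -(ev1 pP p_odd A); congr ev; apply/funext => i; rewrite mulVf //.
  by case: (vg_unit pP p_odd hz fO hchi (i - m.+1%:Z)).
have e2 : ev (sh m w) = ev (fun i => (sh m.+1 v i)^-1) * ev (sh m v).
  rewrite -evM //; last exact: E_sh.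
  congr ev; apply/funext => i; rewrite /sh /wg (_ : i - m.+1%:Z = i - m%:Z - 1) 1?[RHS]mulrC //; lia.
by rewrite e2 -mulrA h mulrA e1 mul1r.
Qed.
End Act.

Lemma inf_prod (c : nat -> A) : (forall j, in_pX p j (c j - 1)) ->
  exists P, forall J, in_pX p J (P - \prod_(j < J) c j).
Proof.
move=> h; apply: cA.2 => J; rewrite big_ord_recr /= -[X in _ - X]mulr1 -mulrBr; exact/in_pXMr.
Qed.

Variable n : nat.
Hypothesis n1 : (1 < n)%N.
Let n0 : (0 < n)%N := ltnW n1.
Variables (x y : fn).
Hypotheses (cx : compat x) (Ey : E y).

Lemma Lam_ex (i : nat) : exists P, forall J, in_pX p J (P - \prod_(j < J) lam (n * j + i.+1)).
Proof.
apply: (inf_prod (c := fun j => lam (n * j + i.+1))) => j; rewrite (lamc_kap ga_0 ga_M pP) addrAC subrr add0r natrX.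
apply: in_pXMl; apply: (in_pX_le _ (in_pX_pX p A (n * j + i.+1).-1)).
by rewrite addnS /=; have : (j <= n * j)%N by [rewrite leq_pmull]; lia.
Qed.

(** The infinite product of the [phi^(n j + i + 1)(xi) / p]; by [act_Lam] it absorbs the factor [bg]
    in the action on [phi^(i+1) y]. *)
Definition Lam i := projT1 (cid (Lam_ex i)).
Lemma LamP i J : in_pX p J (Lam i - \prod_(j < J) lam (n * j + i.+1)).
Proof. by rewrite /Lam; case: cid. Qed.

Definition tt (i : nat) : A := ev (sh i.+1 y) * Lam i.

Lemma act_Lam g chi i : cyclotomic_value g chi ->
  ev (sh i.+1 (bg z f g chi n)) * acris_act A g (Lam i) = Lam i.
Proof.
move=> hchi; set b := bg z f g chi n; have Eb : E b := E_bg pP p_odd hz fO hchi n0.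
have Ew : E (wg z f g chi) := E_wg pP p_odd hz fO hchi.
apply/eqP; rewrite -subr_eq0; apply/eqP/cA.1 => J.
pose pl := \prod_(j < J) lam (n * j + i.+1).
pose pw := \prod_(j < J) ev (sh (n * j + i.+1) (wg z f g chi)).
have h1 : pw * acris_act A g pl = pl.
  by rewrite rmorph_prod -big_split; apply: eq_bigr => j _; apply: w_lam => //; rewrite addnS.
(* The tail [phi^(n J + i + 1) b] has value 1 at the indices up to [J], so [ev_small] makes it 1
   modulo [p^J]. *)
have h2 : in_pX p J (ev (sh i.+1 b) - pw).
  have -> : ev (sh i.+1 b) = pw * ev (sh (n * J + i.+1) b).
    rewrite /pw -(@ev_prod _ _ _ pP p_odd _ _ _ A 'I_J _ (fun (j : 'I_J) => sh (n * j + i.+1) (wg z f g chi))) => [|j]; last exact: E_sh.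
    rewrite -evM; [|by apply: (@Eprod _ _ _ V p_odd _ _ (fun (j : 'I_J) => sh (n * j + i.+1) (wg z f g chi))) => j; exact: E_sh|exact: E_sh].
    congr ev; apply/funext => m; rewrite /sh; elim: (J) => [|J' IH].
      by rewrite big_ord0 mul1r muln0 add0n.
    rewrite big_ord_recr /= IH -mulrA; congr (_ * _).
    rewrite /b -[LHS](bg_S pP p_odd hz fO hchi n0) mulrC; congr (_ * _); congr (bg z f g chi n _); rewrite mulnS; lia.
  rewrite -[X in _ - X]mulr1 -mulrBr -(ev1 pP p_odd A) -evB; [|exact: E_sh|exact: E1].
  apply: in_pXMr; apply: ev_small; first by apply: (EB V p_odd); [exact: E_sh|exact: E1].
  move=> m le; rewrite /sh /b (bg_le0 pP p_odd hz fO hchi n0) ?subrr ?vge_0 //.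
  by have : (J <= n * J)%N by [rewrite leq_pmull]; lia.
have [a ea] := LamP i J; have [b' eb'] := h2.
have -> : ev (sh i.+1 b) * acris_act A g (Lam i) - Lam i =
   (ev (sh i.+1 b) - pw) * acris_act A g (Lam i) + pw * acris_act A g (Lam i - pl) - (Lam i - pl).
  by rewrite rmorphB mulrBr h1; ring.
apply: in_pXB; last by exists a.
apply: in_pXD; first by apply: in_pXMl; exists b'.
by apply: in_pXMr; exists (acris_act A g a); rewrite ea rmorphM rmorphXn rmorph_nat.
Qed.

Lemma act_tt g chi X i : cyclotomic_value g chi -> E X ->
  (forall m, comp_act C g (y m) = X m * (bg z f g chi n m * y m)) ->
  acris_act A g (tt i) = ev (sh i.+1 X) * tt i.
Proof.
move=> hchi EX' hX; have Eb : E (bg z f g chi n) := E_bg pP p_odd hz fO hchi n0.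
rewrite /tt rmorphM ev_act; last exact: E_sh.
have -> : ev (fun m => comp_act C g (sh i.+1 y m)) = ev (sh i.+1 X) * (ev (sh i.+1 (bg z f g chi n)) * ev (sh i.+1 y)).
  rewrite -evM; [|exact: E_sh|exact: E_sh].
  rewrite -evM; [|exact: E_sh|by apply: (E_M V p_odd); exact: E_sh].
  by congr ev; apply/funext => m; rewrite /sh hX.
by rewrite -{2}(act_Lam i hchi); ring.
Qed.

Lemma tau_prod J : tau (n * J).+1 = tau 1 * \prod_(i < n) \prod_(j < J) lam (n * j + i.+1).
Proof.
elim: J => [|J IH]; first by rewrite muln0 big1 ?mulr1 // => i _; rewrite big_ord0.
have step r : tau (n * J + r).+1 = tau (n * J).+1 * \prod_(i < r) lam (n * J + i.+1).
  elim: r => [|r IHr]; first by rewrite addn0 big_ord0 mulr1.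
  by rewrite addnS (tauc_S ga_M pP) // IHr big_ord_recr /= addnS mulrC mulrA.
rewrite mulnS addnC step IH -mulrA -big_split; congr (_ * _); apply: eq_bigr => i _.
by rewrite big_ord_recr.
Qed.

Variable t : A.
Hypothesis ht : forall N, exists M0, forall M', (M0 <= M')%N ->
  in_pX p N (t - \sum_(1 <= m < M'.+1) (-1) ^+ m.-1 * m.-1`!%:R * gam m (e - 1)).

Lemma tau_t m : in_pX p m (t - tau m).
Proof.
have [M0 h0] := ht m; pose M' := maxn M0 (p ^ m).
rewrite -(subrKA (\sum_(1 <= l < M'.+1) (-1) ^+ l.-1 * l.-1`!%:R * gam l (e - 1))).
apply: in_pXD; first by apply: h0; rewrite leq_maxl.
by rewrite -opprB; apply: in_pXN; apply: (tauc_log ga pP); rewrite leq_maxr.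
Qed.

Lemma prodB_in_pX (I : Type) (s : seq I) (P : pred I) (a b : I -> A) J :
  (forall i, in_pX p J (a i - b i)) -> in_pX p J (\prod_(i <- s | P i) a i - \prod_(i <- s | P i) b i).
Proof.
move=> h; elim/big_rec2: _ => [|i u w' _ IH]; first by rewrite subrr; exact: in_pX0.
by have -> : a i * w' - b i * u = (a i - b i) * w' + b i * (w' - u) by [ring]; apply: in_pXD; [apply: in_pXMl|apply: in_pXMr].
Qed.

(** The factors [lam m] in the limit [t] of the [tau m] are grouped by the class of [m] modulo
    [n]. *)
Lemma tau_Lam : tau 1 * \prod_(i < n) Lam i = t.
Proof.
apply/eqP; rewrite -subr_eq0; apply/eqP/cA.1 => J.
rewrite -(subrKA (tau (n * J).+1)); apply: in_pXD.
  by rewrite tau_prod -mulrBr; apply: in_pXMr; apply: prodB_in_pX => i; exact: LamP.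
rewrite -opprB; apply: in_pXN; apply: (in_pX_le _ (tau_t _)).
by have : (J <= n * J)%N by [rewrite leq_pmull]; lia.
Qed.

(** [N_mu], shifted once, contributes [phi(mu) = p tau 1], and [tau_Lam] completes it to [p t]. Each
    [tt i] thereby divides a unit of [B]. *)
Lemma tt_prod c : E (fun=> c) -> (forall m, \prod_(i < n) y (m - (i : nat)%:Z) = c * mu m) ->
  \prod_(i < n) tt i = ev (fun=> c) * (p%:R * t).
Proof.
move=> Ec hN; rewrite /tt big_split /= -tau_Lam.
rewrite -(@ev_prod _ _ _ pP p_odd _ _ _ A 'I_n _ (fun i : 'I_n => sh i.+1 y)) => [|i]; last exact: E_sh.
have -> : (fun m => \prod_(i < n) sh i.+1 y m) = fun m => c * sh 1 mu m.
  by apply/funext => m; rewrite /sh -hN; apply: eq_bigr => i _; congr y; lia.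
rewrite (@evM _ _ _ pP p_odd _ _ _ A (fun=> c)) //; last exact/E_sh/E_mu.
by rewrite ev_sh_mu expn1; ring.
Qed.

End Periods.

End CrystallinePeriods.

(** * Finite unramified Galois sets and their periods *)

Module UnramifiedSets.
Import fingroup perm Valuations WittRings ClosureAndCompletion GaloisGroups AxApproximation GhostSequences GhostEquations PeriodicSequences.

Lemma subr_mulB (R : comRingType) (a1 b1 a b x y : R) :
  (a1 - a * x) - (b1 - b * y) = (a1 - b1) - ((a - b) * x + b * (x - y)).
Proof. by ring. Qed.

Lemma inv_mul_subr (R : comRingType) (b B X w : R) : b * B = 1 -> X + w * b = b * - (- X * B - w).
Proof. by move=> h; rewrite -[X in LHS]mul1r -h; ring. Qed.

Section Residues.
Variables (p : nat) (L : fieldType) (O : L -> Prop).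
Hypothesis V : valued p O.
Local Notation vgt := (vgt p O).
Local Notation vge := (vge p O).

Lemma vgt_mull x y : O x -> vgt 0 y -> vgt 0 (x * y).
Proof. by move=> Ox h; rewrite mulrC -[0]addr0; apply: (vgtM V) => //; apply/(vge0P V). Qed.

Lemma vgt_O x : vgt 0 x -> O x.
Proof. by move=> h; apply/(vge0P V); exact: vgtW. Qed.

Lemma vgt_trans0 y x w : vgt 0 (x - y) -> vgt 0 (y - w) -> vgt 0 (x - w).
Proof. by move=> h1 h2; rewrite -(subrKA y); apply: (vgtD V). Qed.

Lemma vgt_pow x s : O x -> vgt 0 (x ^+ s) -> vgt 0 x.
Proof.
case: s => [|s] Ox; first by rewrite expr0 /Valuations.vgt oner_eq0 (vl1 V) ltxx.
rewrite /Valuations.vgt expf_eq0 /=; have [//|x0] := eqVneq x 0; rewrite (vlX V) //=.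
by rewrite pmulrn_lgt0.
Qed.

Lemma vgt_expr s x : (0 < s)%N -> vgt 0 x -> vgt 0 (x ^+ s).
Proof. by case: s => // s _ h; rewrite exprSr; apply: vgt_mull => //; apply/(OX V)/vgt_O. Qed.

(** In the residue field Frobenius is additive and injective. *)
Lemma vgt_exprpB x y s : O x -> O y -> vgt 0 (x - y) <-> vgt 0 (x ^+ (p ^ s) - y ^+ (p ^ s)).
Proof.
have hp u v : O u -> O v -> vgt 0 (u ^+ p - v ^+ p - (u - v) ^+ p).
  move=> Ou Ov; have -> : u ^+ p = (v + (u - v)) ^+ p by rewrite subrKC.
  rewrite (paddE _ _ (valued_prime V)); set P := padd _ _ _.
  have -> : v ^+ p + (u - v) ^+ p + p%:R * P - v ^+ p - (u - v) ^+ p = p%:R * P by ring.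
  rewrite mulrC; apply: vgt_mull; last by apply: (vge_vgt ltr01); exact: (vge_pX V 1).
  apply: (O_sum V) => i _; apply: (valued_M V); first exact: (Onat V).
  by apply: (valued_M V); apply: (OX V) => //; apply: (valued_B V).
have step u v : O u -> O v -> vgt 0 (u - v) <-> vgt 0 (u ^+ p - v ^+ p).
  move=> Ou Ov; have Ouv : O (u - v) by apply: (valued_B V).
  split=> h.
    rewrite -[_ - _](subrK ((u - v) ^+ p)); apply: (vgtD V); first exact: hp.
    by apply: vgt_expr => //; exact: (prime_gt0 (valued_prime V)).
  apply: (vgt_pow (s := p)) => //; rewrite -[X in vgt _ X](subKr (u ^+ p - v ^+ p)).
  by apply: (vgtB V) => //; exact: hp.
move=> Ox Oy; elim: s => [|s IH]; first by rewrite expn0 !expr1.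
by rewrite expnSr !exprM -step //; exact: (OX V).
Qed.

Lemma vgt_prod (I : finType) (F : I -> L) : (forall i, O (F i)) -> vgt 0 (\prod_i F i) -> exists i, vgt 0 (F i).
Proof.
move=> OF h; apply: contrapT => nh.
have n_ i : F i != 0 /\ vl p O (F i) = 0.
  have h1 : ~~ vgt 0 (F i) by apply/negP => h1; apply: nh; exists i.
  move: h1; rewrite /Valuations.vgt negb_or -leNgt => /andP[F0 le]; split=> //; apply/le_anti; rewrite le /=.
  by have /(vge0P V) := OF i; rewrite /Valuations.vge (negPf F0).
move: h; rewrite /Valuations.vgt prodf_seq_eq0 (vl_prod V) => [|i _]; last by case: (n_ i).
rewrite big1 ?ltxx ?orbF => [|i _]; last by case: (n_ i).
by move=> /hasP[i _ /=]; rewrite (negPf (n_ i).1).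
Qed.

Definition pcong (P Q : {poly L}) := forall i, vgt 0 (P`_i - Q`_i).

Lemma pcong_prod (I : Type) (s : seq I) (a b : I -> L) : (forall i, O (a i)) -> (forall i, O (b i)) ->
  (forall i, vgt 0 (a i - b i)) ->
  pcong (\prod_(i <- s) ('X - (a i)%:P)) (\prod_(i <- s) ('X - (b i)%:P)) /\
  (forall j, O (\prod_(i <- s) ('X - (a i)%:P))`_j).
Proof.
move=> Oa Ob h; elim: s => [|i s [IH1 IH2]].
  rewrite !big_nil; split=> j; first by rewrite subrr vgt_0.
  by rewrite coef1; exact: (Onat V).
have cf (c : L) (P : {poly L}) j : (('X - c%:P) * P)`_j = (if j is j'.+1 then P`_j' else 0) - c * P`_j.
  by rewrite mulrBl coefB coefXM coefCM; case: j.
rewrite !big_cons; split=> j; rewrite !cf; last first.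
  by apply: (valued_B V); [case: j => [|j] //; exact: (O0 V)|exact: (valued_M V)].
rewrite subr_mulB.
apply: (vgtB V); first by case: j => [|j]; [rewrite subrr vgt_0|exact: IH1].
by apply: (vgtD V); [rewrite mulrC|]; apply: vgt_mull.
Qed.
End Residues.

Section Unram.
Variables (p : nat) (k : fieldType) (W : witt_vectors p k).
Hypotheses (pP : prime p) (p_odd : odd p) (k_char : p \in [pchar k]).
Hypothesis k_perfect : forall x : k, exists y : k, y ^+ p = x.
Variables (K : fieldExtType {fraction W}) (K_ram : totally_ramified K).
Variables (Kb : alg_closure K) (C : completion Kb).
Local Notation OC := (@comp_int p k W K Kb C).
Local Notation OK := (OK Kb).
Local Notation emb := (comp_emb C).
Local Notation iota := (iotaK Kb).
Let V := valuedC pP C.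
Let VK := valuedK pP Kb.
Let limC := @C_lim p k W pP K Kb C.
Let sepC := @C_sep p k W pP K Kb C.
Local Notation E := (E p OC).
Local Notation compat := (compat p OC).
Local Notation vge := (vge p OC).
Local Notation vgtK := (vgt p OK).
Local Notation vgeK := (Valuations.vge p OK).
Local Notation fn := (int -> C).
Local Notation G := (abs_galois Kb).

Lemma iota_O w : OK (iota w).
Proof.
exists ('X - w%:P); first exact: monicXsubC.
by rewrite -[map_poly _ _]/(map_poly iota _) map_polyXsubC root_XsubC.
Qed.

Lemma iota_res w w' : witt_residue W w = witt_residue W w' -> vgeK 1 (iota w - iota w').
Proof.
move=> e; have [|y ey] := (witt_residue_ker (w - w')).1; first by rewrite rmorphB e subrr.
by rewrite -rmorphB ey rmorphM rmorphXn rmorph_nat; apply/(vge_nP VK 1); exists (iota y) => //; exact: iota_O.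
Qed.

Lemma kroot e (w : W) : exists w', vgtK 0 (iota w' ^+ (p ^ e) - iota w).
Proof.
have h x : exists y : k, y ^+ (p ^ e) = x.
  elim: e x => [|e IH] x; first by exists x; rewrite expr1.
  by have [y ey] := IH x; have [u eu] := k_perfect y; exists u; rewrite expnS exprM eu.
have [y ey] := h (witt_residue W w); have [w' hw'] := witt_residue_surj W y.
exists w'; rewrite -rmorphXn; apply: (vge_vgt ltr01); apply: iota_res.
by rewrite rmorphXn hw'.
Qed.

Lemma proot (w : W) : exists w', vgeK 1 (iota w' ^+ p - iota w).
Proof.
have [y ey] := k_perfect (witt_residue W w); have [w' hw'] := witt_residue_surj W y.
by exists w'; rewrite -rmorphXn; apply: iota_res; rewrite rmorphXn hw'.
Qed.

Lemma val_ring_K (x : K) : OK (closure_emb Kb x) <-> val_ring (@witt_to_K p k W K) x.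
Proof.
have e (h : {poly W}) : map_poly (witt_to_Kb Kb) h = map_poly (closure_emb Kb) (map_poly (@witt_to_K p k W K) h).
  have -> : map_poly (@witt_to_K p k W K) h = map_poly (in_alg K \o @tofrac W : {rmorphism W -> K}) h by [].
  by rewrite -map_poly_comp.
by split=> -[h mh rh]; exists h => //; move: rh; rewrite e fmorph_root.
Qed.

Lemma ram_res (x : K) : OK (closure_emb Kb x) -> exists w, vgtK 0 (closure_emb Kb x - iota w).
Proof.
move=> /val_ring_K /K_ram[w [h1 h2]]; exists w; apply/(max_idealK pP).
have -> : closure_emb Kb x - iota w = closure_emb Kb (x - witt_to_K K w) by rewrite rmorphB.
split; first exact/val_ring_K.
case: h2 => [->|h2]; [by left; rewrite rmorph0|right => h3; apply: h2].
by apply/val_ring_K; rewrite fmorphV.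
Qed.

Lemma coef_XsubC_exp (R : comNzRingType) (c : R) n i : (i <= n)%N ->
  (('X - c%:P) ^+ n)`_(n - i) = (- c) ^+ i *+ 'C(n, i).
Proof.
move=> le; rewrite -polyCN exprDn coef_sum (bigD1 (Ordinal (le : (i < n.+1)%N))) //= big1 => [|j nj].
  by rewrite addr0 coefMn -polyC_exp coefMC coefXn eqxx mul1r.
rewrite coefMn -polyC_exp coefMC coefXn; case: eqP => [e|_]; last by rewrite mul0r mul0rn.
case/eqP: nj; apply: val_inj => /=; have := ltn_ord j; rewrite ltnS => lj.
by rewrite -(subKn lj) -e subKn.
Qed.

(** The orbit polynomial of [c] has coefficients in [K] and reduces to [(X - c)^N]. With [p^e] the
    [p]-part of [N], its coefficient of degree [N - p^e] gives the residue of [c^(p^e)], because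
    ['C(N, p^e)] is prime to [p]; perfectness of [k] then gives that of [c]. *)
Lemma resid c : OK c -> (forall g : G, vgtK 0 (g c - c)) -> exists w, vgtK 0 (c - iota w).
Proof.
move=> Oc hc; have [s us hs] := gal_orbit (fun=> True) c.
have Os a : a \in s -> OK a by move=> /hs[g _ <-]; exact: gal_O.
have sc a : a \in s -> vgtK 0 (a - c) by move=> /hs[g _ <-].
have cs : c \in s by apply/hs; exists (gal_id Kb).
pose N := size s; have N0 : (0 < N)%N by rewrite /N; case: (s) cs.
pose P := \prod_(a <- s) ('X - a%:P).
have Pg (g : G) : map_poly g P = P.
  rewrite rmorph_prod (eq_bigr (fun a => 'X - (g a)%:P)) => [|a _]; last by rewrite rmorphB /= map_polyX map_polyC.
  rewrite -(big_map g xpredT (fun a => 'X - a%:P)); apply: perm_big.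
  have um : uniq (map g s) by rewrite map_inj_uniq //; exact: gal_inj.
  have sub : {subset map g s <= s}.
    by move=> _ /mapP[a /hs[h _ <-] ->]; apply/hs; exists (gal_comp g h).
  have [_ e] := uniq_min_size um sub (eq_leq (esym (size_map _ _))).
  by apply: uniq_perm.
have eP : P = \prod_(i < N) ('X - (s`_i)%:P) by rewrite /P (big_nth 0) big_mkord.
have Osi (i : 'I_N) : OK s`_i by apply: Os; rewrite mem_nth.
have [h1 h2] := pcong_prod VK (index_enum 'I_N) Osi (fun=> Oc) (fun i : 'I_N => sc _ (mem_nth 0 (ltn_ord i))).
rewrite -eP prodr_const card_ord in h1; rewrite -eP in h2.
pose e := logn p N; have de : (p ^ e %| N)%N by exact: pfactor_dvdnn.
have le : (p ^ e <= N)%N := dvdn_leq N0 de.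
have [x ex] : exists x, P`_(N - p ^ e) = closure_emb Kb x.
  apply: gal_fixed_base => [j|g]; first by rewrite (valued_nat0 VK).
  by rewrite -coef_map Pg.
have [w hw] : exists w, vgtK 0 (P`_(N - p ^ e) - iota w) by rewrite ex; apply: ram_res; rewrite -ex.
have := h1 (N - p ^ e)%N; rewrite coef_XsubC_exp //; set B := 'C(N, p ^ e) => h3.
have pB : ~~ (p %| B)%N.
  have B0 : (0 < B)%N by rewrite bin_gt0.
  by rewrite -[p]expn1 pfactor_dvdn // /B logn_bin_pk // subnn.
have uB : (B%:R : W) \is a GRing.unit by apply/witt_unitP; rewrite rmorph_nat -(dvdn_pcharf k_char).
have h4 : vgtK 0 (c ^+ (p ^ e) - iota (- (w / B%:R))).
  have oddq : odd (p ^ e) by rewrite oddX p_odd orbT.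
  have -> : c ^+ (p ^ e) - iota (- (w / B%:R)) =
     iota (B%:R^-1) * (- ((- c) ^+ (p ^ e) *+ B - iota w)).
    have iB : iota (B%:R^-1) * B%:R = 1 by rewrite -(rmorph_nat iota B) -rmorphM mulVr // rmorph1.
    rewrite exprNn -signr_odd oddq expr1 mulN1r rmorphN rmorphM opprK -[- c ^+ _ *+ B]mulr_natr.
    exact: inv_mul_subr.
  apply: (vgt_mull VK); first exact: iota_O.
  rewrite (vgtN VK); have h5 := h3; rewrite (vgt_subC VK) in h5.
  by have := vgtD VK h5 hw; rewrite subrKA.
have [w' hw'] := kroot e (- (w / B%:R)); exists w'.
apply/(vgt_exprpB VK e Oc (iota_O w')).
by apply: (vgt_trans0 VK h4); rewrite (vgt_subC VK).
Qed.

Lemma reps_ex (s : seq Kb) : exists r : seq Kb, [/\ {subset r <= s}, uniq r,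
  forall a, a \in s -> exists2 b, b \in r & vgtK 0 (a - b)
  & forall a b, a \in r -> b \in r -> vgtK 0 (a - b) -> a = b].
Proof.
elim: s => [|a s [r [h1 h2 h3 h4]]]; first by exists [::].
have [[b br hb]|nb] := pselect (exists2 b, b \in r & vgtK 0 (a - b)).
  exists r; split=> // [x /h1|x]; first by rewrite in_cons => ->; rewrite orbT.
  by rewrite in_cons => /predU1P[->|/h3 //]; exists b.
have ar : a \notin r by apply/negP => ar; apply: nb; exists a; rewrite // subrr vgt_0.
exists (a :: r); split=> [x||x|x y].
- by rewrite !in_cons => /predU1P[->|/h1 ->]; rewrite ?eqxx ?orbT.
- by rewrite /= ar.
- rewrite in_cons => /predU1P[->|/h3[b br hb]]; first by exists a; rewrite ?mem_head // subrr vgt_0.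
  by exists b; rewrite // in_cons br orbT.
- rewrite !in_cons => /predU1P[->|xr] /predU1P[->|yr] //; try exact: h4.
    by move=> h; case: nb; exists y.
  by rewrite (vgt_subC VK) => h; case: nb; exists x.
Qed.

Definition good (X : finType) (act : G -> X -> X) (Z Z' : X -> X -> fn) : Prop :=
  [/\ forall x, act (gal_id Kb) x = x, forall g h x, act (gal_comp g h) x = act g (act h x),
      forall g0, exists s, forall g, gal_agree s g0 g -> forall x, act g x = act g0 x
    & [/\ forall x i, E (Z x i), forall x i, E (Z' x i),
      forall g x i m, comp_act C g (Z x i m) = Z (act g x) i m
    & forall x y m, \sum_i Z x i m * Z' i y m = (x == y)%:R]].

Lemma E_inv_matrix d (M : int -> 'M[C]_d) : (forall i j, E (fun m => M m i j)) ->
  (forall m, \det (M m) != 0 /\ OC (\det (M m))^-1) -> exists M' : int -> 'M[C]_d,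
  (forall i j, E (fun m => M' m i j)) /\ forall m, M m *m M' m = 1%:M.
Proof.
move=> EM hM; exists (fun m => invmx (M m)); split=> [i j|m]; last first.
  by rewrite mulmxV // unitmxE unitfE; case: (hM m).
have -> : (fun m => invmx (M m) i j) = fun m => (\det (M m))^-1 * (\adj (M m)) i j.
  by apply/funext => m; rewrite /invmx unitmxE unitfE (hM m).1 mxE.
apply: (E_M V p_odd); last exact: E_adj.
by apply: (E_inv V p_odd) => [|m|m]; [exact: E_det|case: (hM m)|case: (hM m)].
Qed.

(** The set consists of the residue classes of the conjugates of [z]. Their Teichmueller lifts [U i]
    are permuted by the Galois group and stay distinct in the residue field, so their Vandermonde
    matrix is invertible over [E]. *)
Lemma unram_one z : OK z -> exists d (act : G -> 'I_d -> 'I_d) (Z Z' : 'I_d -> 'I_d -> fn) (x0 : 'I_d),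
  good act Z Z' /\ forall g, act g x0 = x0 -> vgtK 0 (g z - z).
Proof.
move=> Oz; have [s us hs] := gal_orbit (fun=> True) z; have [r [rs ur rc rinj]] := reps_ex s.
pose d := size r; pose rep (i : 'I_d) := r`_i.
have repr i : rep i \in r by apply: mem_nth.
have Orep i : OK (rep i) by have /hs[g _ <-] := rs _ (repr i); exact: gal_O.
have rep_inj i j : vgtK 0 (rep i - rep j) -> i = j.
  move=> /(rinj _ _ (repr i) (repr j)) /eqP; rewrite nth_uniq // => /eqP; exact: val_inj.
have cls a : a \in s -> exists i, vgtK 0 (a - rep i).
  move=> /rc[b br hb]; have ib : (index b r < d)%N by rewrite index_mem.
  by exists (Ordinal ib); rewrite /rep /= nth_index.
have /choice[ac hac] (gi : G * 'I_d) : exists j, vgtK 0 (gi.1 (rep gi.2) - rep j).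
  by apply: cls; have /hs[h _ <-] := rs _ (repr gi.2); apply/hs; exists (gal_comp gi.1 h).
pose act (g : G) i := ac (g, i); have hact (g : G) i : vgtK 0 (g (rep i) - rep (act g i)) := hac (g, i).
have actE (g : G) i j : vgtK 0 (g (rep i) - rep j) -> act g i = j.
  by move=> h; apply: rep_inj; apply: (vgt_trans0 VK) h; rewrite (vgt_subC VK).
have act_id i : act (gal_id Kb) i = i by apply: actE; rewrite subrr vgt_0.
have act_comp g h i : act (gal_comp g h) i = act g (act h i).
  apply: actE; apply: (vgt_trans0 VK (y := g (rep (act h i)))); last exact: hact.
  by rewrite -[gal_comp g h _]/(g (h _)) -rmorphB (vgt_gal pP).
have act_inj g : injective (act g).
  move=> i j e; apply: rep_inj; rewrite -(vgt_gal pP g) rmorphB; apply: (vgt_trans0 VK (hact g i)).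
  by rewrite e (vgt_subC VK).
have [x0 hx0] : exists i, vgtK 0 (z - rep i) by apply: cls; apply/hs; exists (gal_id Kb).
pose P := \prod_(i < d) ('X - (rep i)%:P).
have OP j : OK P`_j by have [_ h] := pcong_prod VK (index_enum 'I_d) Orep Orep (fun i => ltac:(rewrite subrr; exact: vgt_0)); exact: h.
(* The reduction of [P] is Galois invariant, so [resid] lifts its coefficients to [W]. Iterating
   [rt] then extracts [p]-th roots of them modulo [p], following inverse Frobenius. *)
have Pres j : exists w, vgtK 0 (P`_j - iota w).
  apply: resid => // g; rewrite -coef_map rmorph_prod.
  rewrite (eq_bigr (fun i => 'X - (g (rep i))%:P)) => [|i _]; last by rewrite rmorphB /= map_polyX map_polyC.
  have -> : P = \prod_(i < d) ('X - (rep (act g i))%:P) by rewrite /P (reindex_inj (act_inj g)).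
  by have [h _] := pcong_prod VK (index_enum 'I_d) (fun i => gal_O g (Orep i)) (fun i => Orep (act g i)) (hact g); exact: h.
have /choice[w0 hw0] := Pres; have /choice[rt hrt] := proot.
pose wl m (j : 'I_d) := iter m rt (w0 j); pose c m j := iota (wl m j).
have Oc m j : OK (c m j) by exact: iota_O.
have cS m j : vgeK 1 (c m.+1 j ^+ p - c m j) by exact: hrt.
have Pev t : mpev (fun j : 'I_d => P`_j) t = \prod_(i < d) (t - rep i).
  have sP : size P = d.+1 by rewrite /P size_prod_XsubC -[RHS]/(d.+1) /index_enum -enumT size_enum_ord.
  transitivity P.[t].
    rewrite horner_coef sP big_ord_recr /= addrC; congr (_ + _).
    have -> : P`_d = lead_coef P by rewrite lead_coefE sP.
    by rewrite (monicP (monic_prod_XsubC _ _ _)) mul1r.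
  by rewrite /P horner_prod; apply: eq_bigr => i _; rewrite hornerXsubC.
have f0 i : vgtK 0 (mpev (c 0%N) (rep i)).
  have e0 : mpev (fun j : 'I_d => P`_j) (rep i) = 0 by rewrite Pev (bigD1 i) //= subrr mul0r.
  rewrite -[mpev _ _]subr0 -e0 /mpev opprD addrACA subrr add0r -sumrB.
  apply: (vgt_sum VK) => j _; rewrite -mulrBl mulrC; apply: (vgt_mull VK); first exact: (OX VK).
  by rewrite (vgt_subC VK); exact: hw0.
have fpow m t : OK t -> vgtK 0 (mpev (c 0%N) (t ^+ (p ^ m))) -> vgtK 0 (mpev (c m) t).
  elim: m t => [|m IH] t Ot; first by rewrite expn0 expr1.
  rewrite expnS exprM => h; have h1 := IH _ (OX VK p Ot) h.
  apply: (vgt_pow VK (s := p)); first exact: (O_mpev VK).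
  rewrite -[_ ^+ p](subrK (mpev (c m) (t ^+ p))); apply: (vgtD VK) => //.
  by apply: (vge_vgt ltr01); apply: (mpev_frob VK (Oc m.+1) Ot (cS m)).
(* [u (m, i)] is the root of the [m]-th polynomial whose [p^m]-th power has the residue of [rep i];
   being the only one, it is permuted as [rep i] is. *)
have /choice[u hu] (mi : nat * 'I_d) : exists v, [/\ OK v, mpev (c mi.1) v = 0 & vgtK 0 (v ^+ (p ^ mi.1) - rep mi.2)].
  case: mi => m i /=; have pm0 : (0 < p ^ m)%N by rewrite expn_gt0 prime_gt0.
  have [t et] := closed_nroot (rep i) pm0.
  have Ot : OK t by apply: (valued_root VK pm0); rewrite et.
  have := fpow m t Ot; rewrite et => /(_ (f0 i)); have [v hv] := mpev_roots (c m).
  have Ov l : OK (v l).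
    apply: (O_root_monic VK (Oc m)); rewrite -[LHS]/(mpev (c m) (v l)) hv.
    by rewrite (bigD1 l) //= subrr mul0r.
  rewrite hv => /(vgt_prod VK)[|l hl]; first by move=> l; exact: (valued_B VK).
  exists (v l); split=> //; first by rewrite hv (bigD1 l) //= subrr mul0r.
  by rewrite -et (vgt_subC VK); apply/(vgt_exprpB VK m Ot (Ov l)).
have Ou m i : OK (u (m, i)) by case: (hu (m, i)).
have uroot m i : mpev (c m) (u (m, i)) = 0 by case: (hu (m, i)).
have up m i : vgtK 0 (u (m, i) ^+ (p ^ m) - rep i) by case: (hu (m, i)).
have uinj m i j : vgtK 0 (u (m, i) - u (m, j)) -> i = j.
  move=> /(vgt_exprpB VK m (Ou m i) (Ou m j)) h; apply: rep_inj.
  apply: (vgt_trans0 VK (y := u (m, i) ^+ (p ^ m))); first by rewrite (vgt_subC VK).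
  exact: (vgt_trans0 VK h (up m j)).
have uprod m t : mpev (c m) t = \prod_i (t - u (m, i)).
  have [v hv] := mpev_roots (c m).
  have /choice[h hh] i : exists l, u (m, i) = v l.
    have := uroot m i; rewrite hv => /eqP; rewrite prodf_seq_eq0 => /hasP[l _ /= /eqP e].
    by exists l; apply/eqP; rewrite -subr_eq0 e.
  have hi : injective h by move=> i j e; apply: (uinj m); rewrite !hh e subrr vgt_0.
  by rewrite hv (reindex_inj hi); apply: eq_bigr => i _; rewrite hh.
have uuniq m i v : OK v -> mpev (c m) v = 0 -> vgtK 0 (v ^+ (p ^ m) - rep i) -> v = u (m, i).
  move=> Ov; rewrite uprod => /eqP; rewrite prodf_seq_eq0 => /hasP[j _ /= /eqP e] h.
  have ev : v = u (m, j) by apply/eqP; rewrite -subr_eq0 e.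
  rewrite ev; congr (u (m, _)); apply: rep_inj; apply: (vgt_trans0 VK (y := v ^+ (p ^ m))) => //.
  by rewrite ev (vgt_subC VK).
have ug (g : G) m i : g (u (m, i)) = u (m, act g i).
  apply: uuniq; first exact: gal_O.
    rewrite -[RHS](rmorph0 g) -(uroot m i) /mpev rmorphD rmorphXn rmorph_sum; congr (_ + _); apply: eq_bigr => j _.
    by rewrite rmorphM rmorphXn; congr (_ * _); rewrite /c; symmetry; exact: (gal_fix g).
  by apply: (vgt_trans0 VK (y := g (rep i))) => //; rewrite -rmorphXn -rmorphB (vgt_gal pP).
(* All factors except that of [u (m, i)] are units, so the bound on the value of the polynomial
   passes to this factor. *)
have uS m i : vgeK 1 (u (m.+1, i) ^+ p - u (m, i)).
  have Oup : OK (u (m.+1, i) ^+ p) by apply: (OX VK).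
  have := mpev_frob VK (Oc m.+1) (Ou m.+1 i) (cS m); rewrite uroot expr0n gtn_eqF ?prime_gt0 // sub0r (vgeN VK) uprod.
  rewrite (bigD1 i) //=; set Q := \prod_(j | _) _.
  have hQ j : j != i -> u (m.+1, i) ^+ p - u (m, j) != 0 /\ vl p OK (u (m.+1, i) ^+ p - u (m, j)) = 0.
    move=> ji; have : ~~ vgtK 0 (u (m.+1, i) ^+ p - u (m, j)).
      apply: contraNN ji => /(vgt_exprpB VK m Oup (Ou m j)); rewrite -exprM -expnS => h.
      apply/eqP/rep_inj; apply: (vgt_trans0 VK (y := u (m, j) ^+ (p ^ m))); first by rewrite (vgt_subC VK).
      apply: (vgt_trans0 VK (y := u (m.+1, i) ^+ (p ^ m.+1))); first by rewrite (vgt_subC VK).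
      exact: up.
    rewrite /Valuations.vgt negb_or -leNgt => /andP[n0 le]; split=> //; apply/le_anti; rewrite le /=.
    by have /(vge0P VK) := valued_B VK Oup (Ou m j); rewrite /Valuations.vge (negPf n0).
  have Q0 : Q != 0 by apply/prodf_neq0 => j /hQ[].
  have vQ : vl p OK Q = 0.
    by rewrite (vl_prod VK) => [|j /hQ[] //]; rewrite big1 // => j /hQ[].
  have vQ0 : vgeK 0 Q^-1 by rewrite /Valuations.vge (vlV VK) // vQ oppr0 lexx orbT.
  move=> h; have := vgeM VK h (vQ0 : vgeK 0 Q^-1); rewrite addr0 mulfK //.
pose uZ i (m : int) : C := match m with Posz l => emb (u (l, i)) | Negz l => emb (u (0%N, i)) ^+ (p ^ l.+1) end.
have OuZ i m : OC (uZ i m).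
  by case: m => l; rewrite /uZ; [|apply: (OX V)]; apply/comp_int_emb; exact: Ou.
have uZS i m : vge 1 (uZ i (m + 1) ^+ p - uZ i m).
  case: m => l.
    have -> : Posz l + 1 = Posz l.+1 by lia.
    by rewrite /uZ -rmorphXn -rmorphB (vge_emb pP).
  case: l => [|l].
    have -> : Negz 0 + 1 = Posz 0 by lia.
    by rewrite /uZ expn1 subrr vge_0.
  have -> : Negz l.+1 + 1 = Negz l by lia.
  by rewrite /uZ -exprM -expnSr subrr vge_0.
have /choice[U hU] i := @compat_lim _ _ _ V p_odd limC sepC 1 (uZ i) (introT andP (conj ltr01 (lexx 1))) (OuZ i) (uZS i).
have Ug (g : G) i m : comp_act C g (U i m) = U (act g i) m.
  have cg : compat (fun m => comp_act C g (U i m)).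
    by apply: compat_morph (hU i).1 => x; exact: comp_act_int.
  have := compat_uniq V p_odd sepC cg (hU (act g i)).1 (r := 1) (n0 := 0) ltr01; move=> h.
  rewrite -[RHS](congr1 (fun F => F m) (h _)) // => l _.
  rewrite -(subrKA (uZ (act g i) l)); apply: (vgeD V); last by rewrite (vge_subC V); exact: (hU _).2.
  by rewrite /uZ -ug -comp_act_emb -rmorphB (vge_act pP); exact: (hU i).2.
have Udiff i j m : i != j -> U i m - U j m != 0 /\ vl p OC (U i m - U j m) = 0.
  move=> ij; have OU a b : OC (U a b) := (hU a).1.1 b.
  have : ~~ vgt p OC 0 (U i m - U j m).
    apply: contraNN ij; rewrite -(compat_iter `|m| m (hU i).1) -(compat_iter `|m| m (hU j).1).
    move=> /(vgt_exprpB V `|m|%N (OU _ _) (OU _ _)).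
    have [l ->] : exists l : nat, m + `|m|%N%:Z = l%:Z by exists (absz (m + `|m|%N%:Z)); lia.
    move=> h; apply/eqP/(uinj l); rewrite -(vgt_emb pP C) rmorphB.
    have hl a : vgt p OC 0 (U a l - emb (u (l, a))) by apply: (vge_vgt ltr01); exact: ((hU a).2 l).
    apply: (vgt_trans0 V (y := U i l)); first by rewrite (vgt_subC V).
    exact: (vgt_trans0 V h (hl j)).
  rewrite /Valuations.vgt negb_or -leNgt => /andP[n0 le]; split=> //; apply/le_anti; rewrite le /=.
  by have /(vge0P V) := valued_B V (OU i m) (OU j m); rewrite /Valuations.vge (negPf n0).
pose M m : 'M[C]_d := \matrix_(i, j) U i m ^+ j.
have EMx i j : E (fun m => M m i j).
  have -> : (fun m => M m i j) = fun m => U i m ^+ j by apply/funext => m; rewrite mxE.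
  by apply: (EX V p_odd); exact: (compat_E V (hU i).1).
have detM m : \det (M m) != 0 /\ OC (\det (M m))^-1.
  have -> : M m = (Vandermonde d (\row_(i < d) U i m))^T by apply/matrixP => i j; rewrite !mxE.
  rewrite det_tr det_Vandermonde; set Q := \prod_(i < d) _.
  have hne (i j : 'I_d) : (i < j)%N -> (\row_(i < d) U i m) 0 j - (\row_(i < d) U i m) 0 i != 0 /\
      vl p OC ((\row_(i < d) U i m) 0 j - (\row_(i < d) U i m) 0 i) = 0.
    by move=> lt; rewrite !mxE; apply: Udiff; rewrite -(inj_eq val_inj) /= gtn_eqF.
  have [h1 h2] : Q != 0 /\ vl p OC Q = 0.
    split; first by apply/prodf_neq0 => i _; apply/prodf_neq0 => j lt; case: (hne i j lt).
    rewrite (vl_prod V) => [|i _]; last by apply/prodf_neq0 => j lt; case: (hne i j lt).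
    rewrite big1 // => i _; rewrite (vl_prod V) => [|j lt]; last by case: (hne i j lt).
    by rewrite big1 // => j lt; case: (hne i j lt).
  by split=> //; apply/(vge0P V); rewrite /Valuations.vge (vlV V) // h2 oppr0 lexx orbT.
have [M' [EM' MM']] := E_inv_matrix EMx detM.
exists d, act, (fun i j m => M m i j), (fun i j m => M' m i j), x0; split.
  split=> //.
    move=> g0; exists r => g hg i; apply: actE; rewrite (hg _ (repr i)); exact: hact.
  split=> // [g x i m|x y m]; first by rewrite !mxE rmorphXn Ug.
  by have /matrixP/(_ x y) := MM' m; rewrite !mxE.
move=> g hg; apply: (vgt_trans0 VK (y := g (rep x0))); first by rewrite -rmorphB (vgt_gal pP).
apply: (vgt_trans0 VK (y := rep x0)); first by rewrite -{2}hg.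
by rewrite (vgt_subC VK).
Qed.

Lemma unram_list (zs : seq Kb) : (forall x, x \in zs -> OK x) ->
  exists (X : finType) (act : G -> X -> X) (Z Z' : X -> X -> fn) (x0 : X),
  good act Z Z' /\ forall g, act g x0 = x0 -> forall x, x \in zs -> vgtK 0 (g x - x).
Proof.
elim: zs => [|z zs IH] Ozs.
  exists unit, (fun _ x => x), (fun _ _ _ => 1), (fun _ _ _ => 1), tt; split=> //; split=> //.
    by move=> g0; exists [::].
  split=> [x i|x i|g x i m|[] [] m]; try exact: (E1 V); first by rewrite rmorph1.
  by rewrite big_const card_unit /= addr0 mulr1.
have [d [ac [Z [Z' [x0 [[a1 a2 a3 [a4 a5 a6 a7]] a8]]]]]] := unram_one (Ozs z (mem_head _ _)).
have [|X [ac2 [Y [Y' [y0 [[b1 b2 b3 [b4 b5 b6 b7]] b8]]]]]] := IH; first by move=> x xs; apply: Ozs; rewrite in_cons xs orbT.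
exists (('I_d * X)%type : finType), (fun g xy => (ac g xy.1, ac2 g xy.2)),
  (fun x i m => Z x.1 i.1 m * Y x.2 i.2 m), (fun x i m => Z' x.1 i.1 m * Y' x.2 i.2 m), (x0, y0).
split; last first.
  move=> g [e1 e2] x; rewrite in_cons => /predU1P[->|xs]; first exact: a8.
  exact: b8.
split=> [[x y]|g h [x y]|g0|]; rewrite ?a1 ?b1 ?a2 ?b2 //=.
  have [s1 h1] := a3 g0; have [s2 h2] := b3 g0; exists (s1 ++ s2) => g hg [x y] /=.
  by rewrite h1 ?h2 // => u us; apply: hg; rewrite mem_cat us ?orbT.
split=> [x i|x i|g x i m|x y m]; try exact: (E_M V p_odd).
  by rewrite rmorphM a6 b6.
rewrite -(pair_bigA _ (fun i j => Z x.1 i m * Y x.2 j m * (Z' i y.1 m * Y' j y.2 m))) /=.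
transitivity ((\sum_i Z x.1 i m * Z' i y.1 m) * (\sum_j Y x.2 j m * Y' j y.2 m)).
  by rewrite mulr_suml; apply: eq_bigr => i _; rewrite mulr_sumr; apply: eq_bigr => j _; ring.
by rewrite a7 b7 -natrM mulnb; case: x y => x1 x2 [y1 y2].
Qed.

End Unram.

End UnramifiedSets.

(** * Equivariant quotients of induced representations, and lattices *)

Module InducedQuotients.
Import WittRings GaloisGroups.

Section IndexedMatrix.
Variable I : finType.

Definition mxI (R : Type) (F : I -> I -> R) : 'M[R]_#|I| := \matrix_(i, j) F (enum_val i) (enum_val j).

Lemma mxI_eq (R : Type) (F F' : I -> I -> R) : (forall a b, F a b = F' a b) -> mxI F = mxI F'.
Proof. by move=> h; apply/matrixP => i j; rewrite !mxE h. Qed.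

Lemma sum_enum_val (R : nmodType) (F : I -> R) : \sum_(i < #|I|) F (enum_val i) = \sum_a F a.
Proof. by rewrite [RHS](reindex _ (onW_bij _ (@enum_val_bij I))). Qed.

Lemma mxIM (R : comNzRingType) (F F' : I -> I -> R) :
  mxI F *m mxI F' = mxI (fun a b => \sum_c F a c * F' c b).
Proof.
apply/matrixP => i j; rewrite !mxE -(sum_enum_val (fun c => F (enum_val i) c * F' c (enum_val j))).
by apply: eq_bigr => l _; rewrite !mxE.
Qed.

Lemma mxI1 (R : comNzRingType) : mxI (fun a b => (a == b)%:R) = 1%:M :> 'M[R]_#|I|.
Proof. by apply/matrixP => i j; rewrite !mxE (inj_eq enum_val_inj). Qed.

Lemma map_mxI (R S : Type) (h : R -> S) F : map_mx h (mxI F) = mxI (fun a b => h (F a b)).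
Proof. by apply/matrixP => i j; rewrite !mxE. Qed.
End IndexedMatrix.

Lemma rmorph_ext (R S : nzRingType) (f g : {rmorphism R -> S}) : f =1 g -> f = g.
Proof.
case: f g => f [[f1] [f2]] [g [[g1] [g2]]] /= /funext e; case: g / e g1 g2 => g1 g2.
by rewrite (Prop_irrelevance f1 g1) (Prop_irrelevance f2 g2).
Qed.

Section Induced.
Variables (K : fieldType) (Kb : alg_closure K).
Local Notation G := (abs_galois Kb).

(** Proof irrelevance makes [abs_galois] a group for Leibniz equality, which the coset computations
    below rely on. *)
Lemma gal_ext (g h : G) : g =1 h -> g = h.
Proof.
case: g h => [g g1 g2] [h h1 h2] /= /rmorph_ext e; case: h / e h1 h2 => h1 h2.
by rewrite (Prop_irrelevance g1 h1) (Prop_irrelevance g2 h2).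
Qed.

Lemma gal_compA (a b c : G) : gal_comp a (gal_comp b c) = gal_comp (gal_comp a b) c.
Proof. exact: gal_ext. Qed.

Lemma gal_comp1 (a : G) : gal_comp a (gal_id Kb) = a.
Proof. exact: gal_ext. Qed.

Lemma gal_1comp (a : G) : gal_comp (gal_id Kb) a = a.
Proof. exact: gal_ext. Qed.

Lemma gal_inverse : exists iv : G -> G, (forall g, gal_comp (iv g) g = gal_id Kb) /\ forall g, gal_comp g (iv g) = gal_id Kb.
Proof.
have /choice[iv h] (g : G) : exists h : G, (forall x, h (g x) = x) /\ (forall x, g (h x) = x) := gal_inv_ex g.
by exists iv; split=> g; apply: gal_ext => x; case: (h g) => h1 h2; [exact: h1|exact: h2].
Qed.

Variables (F : fieldType) (T : vectType F) (tau : G -> 'End(T)).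
Hypothesis tau_rep : linear_rep tau.
Variables (d : nat) (r : G -> 'M[F]_d).
Hypothesis r_rep : matrix_rep r.
Variables (N0 : G -> Prop) (S : finType) (Phi : G -> S).
Hypothesis PhiP : forall g h, Phi (gal_comp g h) = Phi g <-> N0 h.
Local Notation dT := (\dim {:T}).
Variables (Lam : 'I_dT -> 'rV[F]_d) (v : 'I_dT -> 'cV[F]_d).
Hypothesis Lam_N0 : forall b h, N0 h -> Lam b *m r h = Lam b.
Hypothesis tau_N0 : forall h, N0 h -> tau h = \1%VF.
Hypothesis Lam_v : forall b b' h, (Lam b' *m r h *m v b) 0 0 = ((b' == b) && `[< N0 h >])%:R.

(* Averaging over the cosets of N0, which are the values of Phi, turns the forms Lam into an equivariant map. *)
Lemma induced_quotient : exists f : 'cV[F]_d -> T, [/\ forall u w, f (u + w) = f u + f w,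
  forall a u, f (a *: u) = a *: f u, forall g u, f (r g *m u) = tau g (f u) & forall t, exists u, f u = t].
Proof.
have [iv [ivl ivr]] := gal_inverse; have [r1 rM] := r_rep; have [tau1 tauM] := tau_rep.
have ivU a b : gal_comp a b = gal_id Kb -> iv b = a.
  by move=> e; rewrite -[LHS]gal_1comp -e -gal_compA ivr gal_comp1.
have /choice[rp hrp] s : exists g, (exists g', Phi g' = s) -> Phi g = s.
  by have [[g hg]|n] := pselect (exists g', Phi g' = s); [exists g|exists (gal_id Kb)].
pose im s := `[< exists g, Phi g = s >].
have imP g : im (Phi g) by apply/asboolP; exists g.
have rpP s : im s -> Phi (rp s) = s by move=> /asboolP /hrp.
pose tb (b : 'I_dT) := (vbasis {:T})`_b.
pose avg (g : G) (u : 'cV[F]_d) : T := \sum_b (Lam b *m r (iv g) *m u) 0 0 *: tau g (tb b).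
have cls g g' : Phi g = Phi g' -> N0 (gal_comp (iv g) g').
  by move=> e; apply/(PhiP g); rewrite gal_compA ivr gal_1comp.
have avg_cls g g' u : Phi g = Phi g' -> avg g u = avg g' u.
  move=> /cls; set h := gal_comp _ _ => Nh.
  have eg : g' = gal_comp g h by rewrite /h gal_compA ivr gal_1comp.
  have ei : iv g = gal_comp h (iv g') by rewrite /h -gal_compA ivr gal_comp1.
  by apply: eq_bigr => b _; rewrite ei rM mulmxA Lam_N0 // eg tauM (tau_N0 Nh) comp_lfun1r.
have avg_act h g u : avg g (r h *m u) = tau h (avg (gal_comp (iv h) g) u).
  have ei : iv (gal_comp (iv h) g) = gal_comp (iv g) h.
    by apply: ivU; rewrite -gal_compA (gal_compA h) ivr gal_1comp ivl.
  rewrite /avg linear_sum; apply: eq_bigr => b _; rewrite linearZ /= ei rM mulmxA; congr (_ *: _).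
    by rewrite -!mulmxA.
  by rewrite -comp_lfunE -tauM gal_compA ivr gal_1comp.
pose f (u : 'cV[F]_d) := \sum_(s | im s) avg (rp s) u.
have fD u w : f (u + w) = f u + f w.
  rewrite /f -big_split; apply: eq_bigr => s _; rewrite /avg -big_split; apply: eq_bigr => b _ /=.
  by rewrite mulmxDr mxE scalerDl.
have fZ a u : f (a *: u) = a *: f u.
  rewrite /f scaler_sumr; apply: eq_bigr => s _; rewrite /avg scaler_sumr; apply: eq_bigr => b _ /=.
  by rewrite -scalemxAr mxE scalerA.
(* [Lam_v] leaves only the coset of the identity in the average, where it returns the basis
   vector. *)
have fv b : f (v b) = tb b.
  have eN (g : G) : `[< N0 (iv g) >] = (Phi g == Phi (gal_id Kb)).
    by apply/asboolP/eqP => [/(PhiP g)|e]; [rewrite ivr => <-|apply/(PhiP g); rewrite ivr].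
  rewrite /f (bigD1 (Phi (gal_id Kb))) //= big1 ?addr0 => [|s /andP[ims ns]]; last first.
    by rewrite /avg big1 // => b' _; rewrite Lam_v eN rpP // (negPf ns) andbF scale0r.
  rewrite /avg (bigD1 b) //= big1 ?addr0 => [|b' nb]; last by rewrite Lam_v (negPf nb) scale0r.
  rewrite Lam_v eN rpP // !eqxx scale1r tau_N0 ?id_lfunE //.
  by apply/(PhiP (gal_id Kb)); rewrite gal_1comp rpP.
exists f; split=> // [h u|t]; last first.
  exists (\sum_b coord (vbasis {:T}) b t *: v b).
  have f0 : f 0 = 0 by rewrite -(scale0r 0) fZ scale0r.
  rewrite (big_morph f fD f0) [RHS](coord_vbasis (memvf t)).
  by apply: eq_bigr => b _; rewrite fZ fv.
have shift k s : im s -> Phi (gal_comp (iv k) (rp (Phi (gal_comp k (rp s))))) = s.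
  move=> ims; rewrite -[RHS](rpP s ims).
  have /cls N1 : Phi (gal_comp k (rp s)) = Phi (rp (Phi (gal_comp k (rp s)))) by rewrite rpP.
  rewrite -(PhiP (rp s)) in N1; rewrite -[RHS]N1; congr Phi.
  rewrite gal_compA; congr (gal_comp _ _); rewrite -[LHS]gal_1comp -(ivl (gal_comp k (rp s))).
  set j := iv (gal_comp _ _); rewrite -[in RHS](gal_1comp (gal_comp (rp s) j)) -(ivl k).
  by rewrite -(gal_compA (iv k)) (gal_compA k) ivr gal_comp1 ivl gal_1comp.
pose sg s := Phi (gal_comp (iv h) (rp s)); pose sg' s := Phi (gal_comp h (rp s)).
have eiv : iv (iv h) = h by apply: ivU; exact: ivr.
rewrite /f linear_sum (reindex_onto sg' sg) => [|s ims]; last by rewrite /sg' /sg -{1}eiv shift.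
apply: eq_big => [s|s]; last first.
  move=> /andP[_ /eqP es]; rewrite avg_act; congr (tau h _); apply: avg_cls.
  by rewrite rpP; [exact: es|rewrite -es; exact: imP].
rewrite imP /=; apply/eqP/idP => [<-|]; [exact: imP|exact: shift].
Qed.
End Induced.

Section Lattice.
Variables (p : nat) (Zp : witt_vectors p 'F_p).
Hypothesis pP : prime p.
Variables (k : fieldType) (W : witt_vectors p k) (K : fieldExtType {fraction W}) (Kb : alg_closure K).
Variables (T : vectType 'F_p) (tau : abs_galois Kb -> 'End(T)).
Variables (d : nat) (R : abs_galois Kb -> 'M[Zp]_d).
Local Notation res := (witt_residue Zp).
Local Notation tf := (@tofrac Zp).
Variable f : 'cV['F_p]_d -> T.
Hypotheses (fD : forall u w, f (u + w) = f u + f w) (fZ : forall a u, f (a *: u) = a *: f u)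
  (fR : forall g u, f (map_mx res (R g) *m u) = tau g (f u)) (f_surj : forall t, exists u, f u = t).

Lemma lift_mx (m n : nat) (M : 'M['F_p]_(m, n)) : exists M' : 'M[Zp]_(m, n), map_mx res M' = M.
Proof.
have /choice[l hl] x : exists y, res y = x := witt_residue_surj Zp x.
by exists (map_mx l M); apply/matrixP => i j; rewrite !mxE hl.
Qed.

Lemma tofrac_mx_inj (m n : nat) (M M' : 'M[Zp]_(m, n)) : map_mx tf M = map_mx tf M' -> M = M'.
Proof.
move=> /matrixP h; apply/matrixP => i j; have := h i j; rewrite !mxE => /eqP.
by rewrite tofrac_eq => /eqP.
Qed.

(** A lift [Et] of the row base of the matrix of [f] describes the kernel by the vanishing modulo
    [p] of the first [kk] coordinates of [Et z]; the diagonal matrix [D] then yields a basis. *)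
Lemma kernel_lattice : lattice (fun v => exists z : 'cV[Zp]_d, v = map_mx tf z /\ f (map_mx res z) = 0).
Proof.
pose A := \matrix_(i < \dim {:T}, j < d) coord (vbasis {:T}) i (f (delta_mx j 0)).
have f0 : f 0 = 0 by rewrite -(scale0r 0) fZ scale0r.
have AE u i : (A *m u) i 0 = coord (vbasis {:T}) i (f u).
  rewrite mxE {2}[u]matrix_sum_delta (eq_bigr (fun j => u j 0 *: delta_mx j 0)) => [|j _]; last by rewrite big_ord1.
  rewrite (big_morph f fD f0) linear_sum; apply: eq_bigr => j _ /=.
  by rewrite fZ linearZ /= mxE mulrC.
have fA u : f u = 0 <-> A *m u = 0.
  split=> [h|h]; first by apply/matrixP => i o; rewrite ord1 AE h linear0 mxE.
  by rewrite (coord_vbasis (memvf (f u))) big1 // => i _; rewrite -AE h mxE scale0r.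
pose E := row_ebase A; pose kk := \rank A.
have fE u : f u = 0 <-> forall i : 'I_d, (i < kk)%N -> (E *m u) i 0 = 0.
  rewrite fA -{1}(mulmx_ebase A) -/E -/kk -!mulmxA.
  have kd : (kk <= d)%N := rank_leq_col A; have km : (kk <= \dim {:T})%N := rank_leq_row A.
  move: (E *m u) => w; split=> [h i ik|h].
    have /matrixP/(_ (Ordinal (leq_trans ik km)) 0) : pid_mx kk *m w = 0 :> 'cV_(\dim {:T}).
      by rewrite -[LHS](mulKmx (col_ebase_unit A)) h mulmx0.
    rewrite mxE (bigD1 i) //= !mxE eqxx ik mul1r big1 ?addr0 // => j ji.
    by rewrite mxE eq_sym (inj_eq val_inj) (negPf ji) mul0r.
  suff -> : pid_mx kk *m w = 0 :> 'cV_(\dim {:T}) by rewrite mulmx0.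
  apply/matrixP => i o; rewrite ord1 mxE big1 ?mxE // => j _; rewrite mxE.
  by case: eqP => [ij|_]; rewrite ?mul0r //=; case: ltnP => lk; rewrite ?mul0r // h ?mulr0 // -ij.
have [Et hE] := lift_mx E.
have uE : Et \in unitmx.
  rewrite unitmxE; apply/witt_unitP => //.
  by rewrite -det_map_mx hE -unitfE -unitmxE row_ebase_unit.
pose D : 'rV[Zp]_d := \row_i (if (i < kk)%N then p%:R else 1).
have D0 i : D 0 i != 0 by rewrite mxE; case: ifP; rewrite ?oner_eq0 // witt_p_neq0.
exists (map_mx tf (invmx Et *m diag_mx D)).
  rewrite unitmxE unitfE det_map_mx tofrac_eq0 det_mulmx mulf_neq0 //.
    by have := uE; rewrite -unitmx_inv unitmxE; apply: contraTneq => ->; rewrite unitr0.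
  by rewrite det_diag; apply/prodf_neq0 => i _.
have Ez z : (E *m map_mx res z) = map_mx res (Et *m z) by rewrite map_mxM hE.
move=> v; split=> [[z [-> /fE hz]]|[z ->]].
  have /choice[w hw] i : exists y, (Et *m z) i 0 = D 0 i * y.
    have -> : D 0 i = if (i < kk)%N then p%:R else 1 by rewrite mxE.
    case: ltnP => ik; last by exists ((Et *m z) i 0); rewrite mul1r.
    have := hz i ik; rewrite Ez mxE => /witt_residue_ker[y ->].
    by exists y; rewrite expr1.
  exists (\col_i w i); rewrite -map_mxM -mulmxA; congr map_mx.
  rewrite -[LHS](mulKmx uE); congr (_ *m _); apply/matrixP => i o.
  by rewrite ord1 hw mul_diag_mx !mxE.
exists (invmx Et *m diag_mx D *m z); split; first by rewrite !map_mxM.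
apply/fE => i ik; rewrite Ez -mulmxA mulKVmx // mul_diag_mx !mxE ik.
by apply/witt_residue_ker; exists (z i 0); rewrite expr1.
Qed.

Lemma quotient_lattices : exists L L' : 'cV[{fraction Zp}]_d -> Prop,
  [/\ lattice L /\ lattice L',
    gal_stable (fun g => map_mx tf (R g)) L /\ gal_stable (fun g => map_mx tf (R g)) L',
    forall v, L' v -> L v & quotient_iso (fun g => map_mx tf (R g)) tau L L'].
Proof.
exists (fun v => exists z : 'cV[Zp]_d, v = map_mx tf z),
  (fun v => exists z : 'cV[Zp]_d, v = map_mx tf z /\ f (map_mx res z) = 0); split.
- split; last exact: kernel_lattice.
  by exists 1%:M; [exact: unitmx1|move=> v; split=> -[z ->]; exists z; rewrite mul1mx].
- split=> g v [z] => [->|[-> hz]]; exists (R g *m z); first by rewrite map_mxM.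
  by split; [rewrite map_mxM|rewrite map_mxM fR hz linear0].
- by move=> v [z [-> _]]; exists z.
pose ff (v : 'cV[{fraction Zp}]_d) := 
  if pselect (exists z : 'cV[Zp]_d, v = map_mx tf z) is left e then f (map_mx res (projT1 (cid e))) else 0.
have ffE z : ff (map_mx tf z) = f (map_mx res z).
  rewrite /ff; case: pselect => [e|[]]; last by exists z.
  by case: cid => z' /= /tofrac_mx_inj <-.
exists ff; split=> [_ _ [u ->] [w ->]|a _ [u ->]|g _ [u ->]|t|_ [u ->]].
- by rewrite -map_mxD !ffE map_mxD fD.
- by rewrite -map_mxZ !ffE map_mxZ fZ.
- by rewrite -map_mxM !ffE map_mxM fR.
- have [u hu] := f_surj t; have [u' hu'] := lift_mx u.
  by exists (map_mx tf u'); [exists u'|rewrite ffE hu'].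
- rewrite ffE; split=> [h|[z [/tofrac_mx_inj <-]]] //; by exists u.
Qed.
End Lattice.

End InducedQuotients.

(** * The characters [X], their powers, and their matrices over [Zp] *)

Module FundamentalCharacters.
Import Valuations ClosureAndCompletion TateInvariants GhostSequences TameAction CyclotomicSequences PeriodicSequences LubinTate UnramifiedSets.

Lemma digits_sum p n c : (1 < p)%N -> (c < p ^ n)%N -> (\sum_(l < n) (c %/ p ^ l) %% p * p ^ l = c)%N.
Proof.
move=> p1; elim: n c => [|n IH] c; first by rewrite expn0 big_ord0; case: c.
move=> h; have hc : (c %/ p < p ^ n)%N by rewrite ltn_divLR ?(ltnW p1) // -expnSr.
rewrite big_ord_recl expn0 divn1 muln1 [RHS](divn_eq c p) addnC; congr (_ + _)%N.
rewrite -(IH _ hc) big_distrl; apply: eq_bigr => l _ /=.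
by rewrite /bump leq0n add1n expnS divnMA [(p * _)%N]mulnC mulnA.
Qed.

Lemma two_sub_le0 n : (1 < n)%N -> 2 - n%:Z <= 0 :> int.
Proof. lia. Qed.

Section Characters.
Variables (p : nat) (k : fieldType) (W : witt_vectors p k).
Hypotheses (pP : prime p) (p_odd : odd p).
Variables (K : fieldExtType {fraction W}) (Kb : alg_closure K) (C : completion Kb).
Variable z : nat -> Kb.
Hypothesis hz : compatible_roots z.
Variables (Zp : witt_vectors p 'F_p) (f : {rmorphism Zp -> C}).
Local Notation OC := (@comp_int p k W K Kb C).
Hypothesis fO : forall x, OC (f x).
Local Notation emb := (comp_emb C).
Let V := valuedC pP C.
Let VK := valuedK pP Kb.
Local Notation E := (E p OC).
Local Notation compat := (compat p OC).
Local Notation vge := (vge p OC).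
Local Notation vgt := (vgt p OC).
Local Notation vl := (vl p OC).
Local Notation one_unit := (one_unit p OC).
Local Notation fn := (int -> C).
Local Notation G := (abs_galois Kb).
Let p0 : p%:R != 0 :> C := valued_p0 V.
Variable n : nat.
Hypothesis n1 : (1 < n)%N.
Local Notation q := (p ^ n)%N.
Local Notation xi := (xi C z).
Let n0 : (0 < n)%N := ltnW n1.
Variables (x y : fn).
Hypotheses (cx : compat x) (Ey : E y) (xy : forall m, vge 1 (y m - x m))
  (yR : forall m, y (m - n%:Z) = xi m * y m) (x0 : forall m, x m != 0)
  (xq : forall m, vge 1 (x m ^+ q.-1 - xi m)) (xv : forall i : nat, vl (x i.+1%:Z) = ((p ^ i * q.-1)%N%:R)^-1).
Variable kap : Kb.
Hypothesis hkap : (q.-1).-primitive_root kap.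
Local Notation kp := (kp C n kap).

Lemma y0_neq0 : y 0 != 0.
Proof. by apply: (y_neq0 pP p_odd hz n1 xy yR x0 xv); exact: two_sub_le0. Qed.

(** One value suffices: [y 0] is nonzero because [n > 1], and a periodic sequence is determined by
    its value at 0 ([per_zero]). *)
Definition char_spec (g : G) (X : fn) := [/\ E X, per n X & comp_act C g (y 0) = X 0 * y 0].

Lemma per_ext (X X' : fn) : E X -> per n X -> E X' -> per n X' -> X 0 = X' 0 -> X = X'.
Proof.
move=> EX pX EX' pX' e0; apply/funext => m; apply/eqP; rewrite -subr_eq0; apply/eqP.
have ED : E (fun m => X m - X' m) by exact: (EB V p_odd).
have pD : per n (fun m => X m - X' m) by move=> i; rewrite pX pX'.
by apply: (per_zero pP p_odd n0 ED pD (m1 := 0)); rewrite e0 subrr.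
Qed.

Lemma char_uniq g X X' : char_spec g X -> char_spec g X' -> X = X'.
Proof.
move=> [EX pX hX] [EX' pX' hX']; apply: per_ext => //.
by apply: (mulIf y0_neq0); rewrite -hX -hX'.
Qed.

Lemma char_ex g : exists X, char_spec g X.
Proof.
have [chi [hchi _]] := cyc_exists pP hz Zp g.
have [X [EX pX hX _ _]] := chi_ex pP p_odd hz fO n1 cx Ey xy yR x0 xq xv hchi.
exists X; split=> //; rewrite hX (bg_le0 pP p_odd hz fO hchi n0) // mul1r //.
Qed.

Definition charX g : fn := projT1 (cid (char_ex g)).
Lemma charXP g : char_spec g (charX g). Proof. by rewrite /charX; case: cid. Qed.

Lemma charX_chi g chi : cyclotomic_value g chi ->
  [/\ forall m, comp_act C g (y m) = charX g m * (bg z f g chi n m * y m),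
   forall m, charX g m != 0 /\ vl (charX g m) = 0, forall m, \prod_(i < n) charX g (m - (i : nat)%:Z) = f chi
   & one_unit (charX g 1 / (comp_act C g (x 1) / x 1))].
Proof.
move=> hchi; have [X [EX pX hX uX [PX oX]]] := chi_ex pP p_odd hz fO n1 cx Ey xy yR x0 xq xv hchi.
have sX : char_spec g X by split=> //; rewrite hX (bg_le0 pP p_odd hz fO hchi n0) // mul1r.
by rewrite (char_uniq (charXP g) sX).
Qed.

Lemma charX_unit g m : [/\ charX g m != 0, OC (charX g m) & OC (charX g m)^-1].
Proof.
have [chi [hchi _]] := cyc_exists pP hz Zp g; have [_ /(_ m)[h1 h2] _ _] := charX_chi hchi.
have [EX _ _] := charXP g; split=> //; first exact: (E_O m EX).
by apply/(vge0P V); rewrite /Valuations.vge (vlV V) // h2 oppr0 lexx orbT.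
Qed.

Lemma charX_tame g : one_unit (charX g 1 / (comp_act C g (x 1) / x 1)).
Proof. by have [chi [hchi _]] := cyc_exists pP hz Zp g; have [_ _ _] := charX_chi hchi. Qed.

Lemma charX_id : charX (gal_id Kb) = fun=> 1.
Proof.
apply: (char_uniq (charXP _)); split=> //; first exact: (E1 V).
by rewrite mul1r (comp_act_id pP).
Qed.

(** Only a crossed homomorphism, since [g] may act nontrivially on the values in Z_q. *)
Lemma charX_comp g h : charX (gal_comp g h) = fun m => charX g m * comp_act C g (charX h m).
Proof.
have [Eg pg eg] := charXP g; have [Eh ph eh] := charXP h.
apply: (char_uniq (charXP _)); split=> [|m|].
- apply: (E_M V p_odd) => //; apply: E_morph Eh => u; exact: comp_act_int.
- by rewrite pg ph.
- by rewrite (comp_act_comp pP) /= eh rmorphM eg mulrCA mulrA.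
Qed.

(** The value at 0 varies with [g (y 0)], which is approximated through an element [w] of [Kb];
    [per_divX] spreads the congruence to all indices. *)
Lemma charX_cont g0 (N : nat) : exists s, forall g, gal_agree s g0 g -> forall m, vge N%:R (charX g m - charX g0 m).
Proof.
have [j hj] := comp_int_frac (y 0)^-1.
have [w hw] := comp_dense (y 0) (N + j).
have {}hw : vge (N + j)%N%:R (y 0 - emb w) by apply/(vge_nP V).
exists [:: w] => g hg m.
have [Eg pg eg] := charXP g; have [Eg0 pg0 eg0] := charXP g0.
have ED : E (fun m => charX g m - charX g0 m) by exact: (EB V p_odd).
have pD : per n (fun m => charX g m - charX g0 m) by move=> i; rewrite pg pg0.
have h0 : vge N%:R (charX g 0 - charX g0 0).
  have -> : charX g 0 - charX g0 0 = (comp_act C g (y 0) - comp_act C g0 (y 0)) * (y 0)^-1.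
    by rewrite eg eg0 -mulrBl mulfK // y0_neq0.
  have -> : comp_act C g (y 0) - comp_act C g0 (y 0) = comp_act C g (y 0 - emb w) - comp_act C g0 (y 0 - emb w).
    by rewrite !rmorphB !comp_act_emb hg ?mem_head //; ring.
  have h1 : vge (N + j)%N%:R (comp_act C g (y 0 - emb w) - comp_act C g0 (y 0 - emb w)).
    by apply: (vgeB V); rewrite (vge_act pP).
  have h2 : vge (- j%:R) (y 0)^-1.
    move/(vge0P V): hj; rewrite /Valuations.vge !mulf_eq0 expf_eq0 (negPf p0) andbF /= invr_eq0.
    case: (eqVneq (y 0) 0) => //= y00; rewrite (vlM V) ?expf_neq0 ?invr_eq0 // (vl_pX V) => h.
    lra.
  have := vgeM V h1 h2; by rewrite natrD addrK.
have h1 := per_divX pP p_odd n0 ED pD h0.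
by have := E_O m h1; rewrite -(vge0P V) (vge_divr V) ?expf_neq0 // (vl_pX V) add0r.
Qed.

Lemma E_per_cong (X X' : fn) : E X -> per n X -> E X' -> per n X' -> vgt 0 (X 0 - X' 0) -> forall m, vge 1 (X m - X' m).
Proof.
move=> EX pX EX' pX' e0 m.
have ED : E (fun m => X m - X' m) by exact: (EB V p_odd).
have pD : per n (fun m => X m - X' m) by move=> i; rewrite pX pX'.
have := E_O m (per_small pP p_odd n0 ED pD e0).
by rewrite -(vge0P V) (vge_divr V) // (vl_p V) add0r.
Qed.

Definition dig (c l : nat) := ((c %/ p ^ l) %% p)%N.
(** Modulo [p] Frobenius becomes the [p]-th power, and this reduces to the plain power [X^c]
    ([chc_cong]). *)
Definition chc (c : nat) g : fn := fun m => \prod_(l < n) charX g (m - (l : nat)%:Z) ^+ dig c l.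

Lemma E_chc c g : E (chc c g).
Proof.
apply: (@Eprod _ _ _ V p_odd _ _ (fun (l : 'I_n) m => charX g (m - (l : nat)%:Z) ^+ dig c l)) => l.
by apply: (EX V p_odd); apply: E_shift; case: (charXP g).
Qed.

Lemma per_chc c g : per n (chc c g).
Proof. by move=> m; apply: eq_bigr => l _; rewrite addrAC; case: (charXP g) => _ ->. Qed.

Lemma chc_id c m : chc c (gal_id Kb) m = 1.
Proof. by rewrite /chc charX_id big1 // => l _; rewrite expr1n. Qed.

Lemma chc_comp c g h m : chc c (gal_comp g h) m = chc c g m * comp_act C g (chc c h m).
Proof.
by rewrite /chc rmorph_prod -big_split; apply: eq_bigr => l _; rewrite charX_comp exprMn rmorphXn.
Qed.

Lemma vge_prodB (r : rat) (I : Type) (s : seq I) (a b : I -> C) : (forall i, OC (a i)) -> (forall i, OC (b i)) ->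
  (forall i, vge r (a i - b i)) -> vge r (\prod_(i <- s) a i - \prod_(i <- s) b i).
Proof.
move=> Oa Ob h; elim: s => [|i s IH]; first by rewrite !big_nil subrr vge_0.
rewrite !big_cons; have -> (u v u' v' : C) : u * v - u' * v' = (u - u') * v + u' * (v - v') by ring.
apply: (vgeD V).
  by rewrite -[r]addr0; apply: (vgeM V) => //; apply/(vge0P V)/(O_prod V).
by rewrite -[r]add0r; apply: (vgeM V) => //; apply/(vge0P V).
Qed.

Lemma vge_expB (r : rat) (a b : C) j : OC a -> OC b -> vge r (a - b) -> vge r (a ^+ j - b ^+ j).
Proof.
move=> Oa Ob h; have := @vge_prodB r 'I_j (index_enum 'I_j) (fun=> a) (fun=> b) (fun=> Oa) (fun=> Ob) (fun=> h).
by rewrite !prodr_const card_ord.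
Qed.

Lemma chc_cont c g g0 N m : (forall m, vge N%:R (charX g m - charX g0 m)) -> vge N%:R (chc c g m - chc c g0 m).
Proof.
have O h m' : OC (charX h m') by case: (charX_unit h m').
by move=> h; apply: vge_prodB => l; [apply: (OX V)|apply: (OX V)|apply: vge_expB].
Qed.

Lemma kp0 : kp 0 = emb kap.
Proof. by rewrite (kpE pP C n0 hkap (e := 0)) // oppr0. Qed.

Lemma E_kpX e : E (fun m => kp m ^+ e).
Proof. by apply: (EX V p_odd); apply: (compat_E V); exact: (kp_compat pP C n0 hkap). Qed.

Lemma per_kpX e : per n (fun m => kp m ^+ e).
Proof. by move=> m; rewrite kp_per. Qed.

Lemma chc_cong c e g : (c < q)%N -> vgt 0 (charX g 0 - emb kap ^+ e) -> vgt 0 (chc c g 0 - emb kap ^+ (c * e)).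
Proof.
move=> cq h; have [Eg pg _] := charXP g.
have h1 := E_per_cong Eg pg (E_kpX e) (per_kpX e); rewrite kp0 in h1; have {h1}h := h1 h.
have Ok m' : OC (kp m' ^+ e) := E_O m' (E_kpX e).
have O m' : OC (charX g m') := E_O m' Eg.
apply: (vge_vgt ltr01).
have -> : emb kap ^+ (c * e) = \prod_(l < n) (kp (0 - (l : nat)%:Z) ^+ e) ^+ dig c l.
  transitivity (\prod_(l < n) emb kap ^+ (dig c l * p ^ l * e)).
    by rewrite -expr_sum -big_distrl digits_sum // prime_gt1.
  apply: eq_bigr => l _; rewrite (kpE pP C n0 hkap (e := l)) ?sub0r ?opprK //.
  by rewrite -!exprM; congr (_ ^+ _); ring.
by apply: vge_prodB => l; [apply: (OX V)|apply: (OX V)|apply: vge_expB].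
Qed.

Let q1 : (0 < q.-1)%N.
Proof.
have h : (p ^ 1 <= q)%N by rewrite leq_exp2l ?prime_gt1.
by have := prime_gt1 pP; move: h; rewrite expn1; case: (p) => [|[|a]] //; lia.
Qed.

Lemma kap_dist e e' : (e < q.-1)%N -> (e' < q.-1)%N -> vgt 0 (emb kap ^+ e - emb kap ^+ e') -> e = e'.
Proof.
move=> he he' h; have [Ok k0 OkV] := kap_unit pP n0 hkap.
have h1 := one_unit_div (u := emb kap ^+ e') (v := emb kap ^+ e) V.
have {}h1 : one_unit (emb (kap ^+ e / kap ^+ e')).
  rewrite rmorphM fmorphV !rmorphXn; apply: h1 => //; first by rewrite expf_neq0 // fmorph_eq0.
  by rewrite -rmorphXn -fmorphV; apply/comp_int_emb; exact: OkV.
have Ou : OC (emb (kap ^+ e / kap ^+ e')).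
  by apply/comp_int_emb; apply: (valued_M VK); [exact: (OX VK)|exact: OkV].
have uq : emb (kap ^+ e / kap ^+ e') ^+ q = emb (kap ^+ e / kap ^+ e').
  by rewrite -rmorphXn exprMn exprVn -!exprM ![(_ * q)%N]mulnC !exprM (kap_q pP hkap).
have := pow_stable_one pP p_odd n0 Ou uq h1; rewrite -(rmorph1 emb) => /fmorph_inj e1.
have e2 : kap ^+ e = kap ^+ e' by rewrite -[RHS]mul1r -e1 mulfVK // expf_neq0.
by move/eqP: e2; rewrite (eq_prim_root_expr hkap) !modn_small // => /eqP.
Qed.

(** Periodicity and the Frobenius congruences put the residue of [X] in the field with [q] elements,
    whose nonzero elements are the residues of the powers of [kap]. *)
Lemma char_res g : exists e : 'I_q.-1, vgt 0 (charX g 0 - emb kap ^+ e).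
Proof.
have [Eg pg _] := charXP g; have O m' : OC (charX g m') := E_O m' Eg.
have h1 j : vgt 0 (charX g 0 ^+ (p ^ j) - charX g (- j%:Z)).
  elim: j => [|j IH]; first by rewrite oppr0 subrr vgt_0.
  rewrite expnSr exprM -(subrKA (charX g (- j%:Z) ^+ p)); apply: (vgtD V).
    have := vgt_exprpB V 1 (OX V (p ^ j) (O 0)) (O (- j%:Z)); rewrite expn1 => -[+ _]; exact.
  apply: (vge_vgt ltr01); rewrite (vge_subC V).
  have := E_O (- j.+1%:Z) (E_dE Eg); rewrite /dE -(vge0P V) (vge_divr V) // (vl_p V) add0r.
  by congr (vge _ (_ - _ (_ : int) ^+ _)); lia.
have h2 := h1 n; rewrite -[- n%:Z]add0r pg in h2.
have [Xn0 _ OV] := charX_unit g 0.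
have h3 : vgt 0 (charX g 0 ^+ q.-1 - 1).
  have -> : charX g 0 ^+ q.-1 - 1 = (charX g 0)^-1 * (charX g 0 ^+ q - charX g 0).
    by rewrite -{2}(prednK (_ : 0 < q)%N) ?expn_gt0 ?prime_gt0 // exprS mulrBr mulKf // mulVf.
  exact: (vgt_mull V).
have e3 : charX g 0 ^+ q.-1 - 1 = \prod_(i < q.-1) (charX g 0 - emb kap ^+ i).
  have := congr1 (fun P => (map_poly emb P).[charX g 0]) (factor_Xn_sub_1 hkap).
  rewrite [map_poly emb ('X^_ - 1)]rmorphB /= map_polyXn rmorph1 !hornerE => <-.
  rewrite rmorph_prod horner_prod big_mkord; apply: eq_bigr => i _.
  by rewrite rmorphB /= map_polyX map_polyC hornerXsubC /= ?rmorphXn.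
rewrite e3 in h3; have [|e he] := vgt_prod V _ h3; last by exists e.
move=> i; apply: (valued_B V) => //; apply: (OX V); have [Ok _ _] := kap_unit pP n0 hkap.
by apply/comp_int_emb.
Qed.

Lemma coord_divX (zc zc' : 'I_n -> Zp) (N : nat) :
  E (fun m => (\sum_j f (zc j) * kp m ^+ j - \sum_j f (zc' j) * kp m ^+ j) / p%:R ^+ N) ->
  forall j, in_pX p N (zc j - zc' j).
Proof.
set r := fun m => _ => Er; have pr : per n r by move=> m; rewrite /r; congr ((_ - _) / _); apply: eq_bigr => j _; rewrite kp_per.
have [w hw] := Zq_coord pP p_odd fO n0 hkap Er pr; move=> j; exists (w j).
have := @Zq_uniq _ _ _ pP p_odd _ _ _ _ f n n0 kap hkap (fun j => zc j - zc' j) (fun j => p%:R ^+ N * w j).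
apply=> m; transitivity (p%:R ^+ N * r m).
  rewrite /r mulrC divfK ?expf_neq0 // -sumrB; apply: eq_bigr => i _.
  by rewrite rmorphB mulrBl.
by rewrite hw mulr_sumr; apply: eq_bigr => i _; rewrite rmorphM rmorphXn rmorph_nat mulrA.
Qed.

Lemma E_coord (zc : 'I_n -> Zp) : E (fun m => \sum_j f (zc j) * kp m ^+ j).
Proof.
apply: (@Esum _ _ _ V p_odd _ _ (fun (j : 'I_n) m => f (zc j) * kp m ^+ j)) => j.
by apply: (E_M V p_odd); [exact: (E_Zp pP p_odd fO)|exact: E_kpX].
Qed.

Lemma per_coord (zc : 'I_n -> Zp) : per n (fun m => \sum_j f (zc j) * kp m ^+ j).
Proof. by move=> m; apply: eq_bigr => j _; rewrite kp_per. Qed.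

Lemma coord_cong (zc zc' : 'I_n -> Zp) (N : nat) :
  vge N%:R (\sum_j f (zc j) * kp 0 ^+ j - \sum_j f (zc' j) * kp 0 ^+ j) -> forall j, in_pX p N (zc j - zc' j).
Proof.
move=> h; apply: coord_divX; apply: (per_divX pP p_odd n0 (m1 := 0)) => //.
  by apply: (EB V p_odd); exact: E_coord.
by move=> m; rewrite per_coord (per_coord zc').
Qed.

Lemma coord_cong1 (zc zc' : 'I_n -> Zp) :
  vgt 0 (\sum_j f (zc j) * kp 0 ^+ j - \sum_j f (zc' j) * kp 0 ^+ j) ->
  forall j, witt_residue Zp (zc j) = witt_residue Zp (zc' j).
Proof.
move=> h j; apply/eqP; rewrite -subr_eq0 -rmorphB; apply/eqP/witt_residue_ker; apply: coord_divX.
rewrite expr1; apply: (per_small pP p_odd n0 (m1 := 0)) => //.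
  by apply: (EB V p_odd); exact: E_coord.
by move=> m; rewrite per_coord (per_coord zc').
Qed.

Lemma Rm_ex c g (j : 'I_n) : exists zc : 'I_n -> Zp,
  forall m, comp_act C g (kp m ^+ j) * chc c g m = \sum_l f (zc l) * kp m ^+ l.
Proof.
apply: (Zq_coord pP p_odd fO n0 hkap).
  apply: (E_M V p_odd); last exact: E_chc.
  apply: E_morph (E_kpX j) => u; exact: comp_act_int.
by move=> m; rewrite kp_per per_chc.
Qed.

(** The matrix, on the basis of powers of [kp], of the semilinear action [a -> g(a) chc c g] on
    Z_q. *)
Definition Rm c g (l j : 'I_n) : Zp := projT1 (cid (Rm_ex c g j)) l.
Lemma RmE c g (j : 'I_n) m : comp_act C g (kp m ^+ j) * chc c g m = \sum_l f (Rm c g l j) * kp m ^+ l.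
Proof. by rewrite /Rm; case: cid. Qed.

Let uniq2 := @Zq_uniq _ _ _ pP p_odd _ _ _ _ f n n0 kap hkap.

Lemma sum_delta (j : 'I_n) (m : int) : \sum_(l < n) f ((l == j)%:R) * kp m ^+ l = kp m ^+ j.
Proof.
rewrite (bigD1 j) //= eqxx rmorph1 mul1r big1 ?addr0 // => l /negPf ->.
by rewrite rmorph0 mul0r.
Qed.

Lemma Rm_id c l j : Rm c (gal_id Kb) l j = (l == j)%:R.
Proof.
apply: (uniq2 (zc := fun l => Rm c _ l j) (zc' := fun l => (l == j)%:R)) => m.
by rewrite -RmE chc_id mulr1 (comp_act_id pP) sum_delta.
Qed.

Lemma f_fixed g a : comp_act C g (f a) = f a.
Proof. exact: (E_const_fixed pP p_odd g (E_Zp pP p_odd fO a)). Qed.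

Lemma Rm_comp c g h l j : Rm c (gal_comp g h) l j = \sum_a Rm c g l a * Rm c h a j.
Proof.
apply: (uniq2 (zc := fun l => Rm c _ l j) (zc' := fun l => \sum_a Rm c g l a * Rm c h a j)) => m.
rewrite -RmE chc_comp (comp_act_comp pP) /= mulrCA -rmorphM RmE rmorph_sum mulr_sumr.
transitivity (\sum_a \sum_i f (Rm c g i a) * kp m ^+ i * f (Rm c h a j)).
  apply: eq_bigr => a _; rewrite rmorphM f_fixed mulrCA [chc c g m * _]mulrC RmE mulr_sumr.
  by apply: eq_bigr => i _; rewrite mulrC.
rewrite exchange_big; apply: eq_bigr => i _ /=; rewrite rmorph_sum mulr_suml.
by apply: eq_bigr => a _; rewrite rmorphM mulrAC.
Qed.

Lemma Rm_cont g0 (N : nat) : exists s, forall g, gal_agree s g0 g ->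
  forall c l j, in_pX p N (Rm c g l j - Rm c g0 l j).
Proof.
have [s hs] := charX_cont g0 N; exists (kap :: s) => g hg c l j.
have hgs : gal_agree s g0 g by move=> u us; apply: hg; rewrite in_cons us orbT.
apply: (coord_cong (zc := fun l => Rm c g l j) (zc' := fun l => Rm c g0 l j)).
rewrite -!RmE kp0 !rmorphXn !comp_act_emb hg ?mem_head // -mulrBr -[N%:R]add0r.
apply: (vgeM V); last exact: chc_cont (hs _ hgs).
apply/(vge0P V)/(OX V)/comp_int_emb; apply: (gal_O); by case: (kap_unit pP n0 hkap).
Qed.

Lemma Rm_res c e g (l j : 'I_n) : (c < q)%N -> vgt 0 (charX g 0 - emb kap ^+ e) -> g kap = kap -> (c * e = 0 %[mod q.-1])%N ->
  witt_residue Zp (Rm c g l j) = (l == j)%:R.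
Proof.
move=> cq he gk ce; rewrite -(rmorph_nat (witt_residue Zp) (l == j)).
apply: (coord_cong1 (zc := fun l => Rm c g l j) (zc' := fun l => (l == j)%:R)).
rewrite -RmE sum_delta kp0 rmorphXn comp_act_emb gk -{2}[emb kap ^+ j]mulr1 -mulrBr.
have [Ok _ _] := kap_unit pP n0 hkap.
apply: (vgt_mull V); first by apply/(OX V)/comp_int_emb.
have := chc_cong cq he.
by rewrite -rmorphXn -(prim_expr_mod hkap) ce mod0n expr0 rmorph1.
Qed.

(** The sum of [kap^(c e)] over [c] is [q - 1] or 0, and [q - 1] becomes [-1] in [F_p]. This
    orthogonality is the reason for summing over all [c]. *)
Lemma sum_Rm_res g (e : 'I_q.-1) (l : 'I_n) : vgt 0 (charX g 0 - emb kap ^+ e) -> g kap = kap -> l = 0%N :> nat ->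
  \sum_(c < q.-1) witt_residue Zp (Rm c g l l) = - (e == 0%N :> nat)%:R.
Proof.
move=> he gk l0; rewrite -rmorph_sum.
have [Ok _ _] := kap_unit pP n0 hkap; have Oke : OC (emb kap ^+ e) by apply/(OX V)/comp_int_emb.
pose b : nat := if e == 0%N :> nat then q.-1 else 0%N.
have hb : \sum_(c < q.-1) emb kap ^+ (c * e) = b%:R.
  rewrite /b; case: eqP => [->|/eqP ne]; first by rewrite (eq_bigr (fun=> 1)) => [|c _]; rewrite ?muln0 // sumr_const card_ord.
  have u1 : emb kap ^+ e != 1.
    rewrite -rmorphXn -(rmorph1 emb) (inj_eq (fmorph_inj emb)) -(prim_order_dvd hkap) gtnNdvd //.
    by rewrite lt0n.
  apply: (mulfI (x := emb kap ^+ e - 1)); first by rewrite subr_eq0.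
  rewrite mulr0 (eq_bigr (fun c : 'I__ => (emb kap ^+ e) ^+ c)) => [|c _]; last by rewrite -exprM mulnC.
  have hk : emb kap ^+ q.-1 = 1 by rewrite -rmorphXn prim_expr_order // rmorph1.
  by rewrite -subrX1 exprAC hk expr1n subrr.
have := @coord_cong1 (fun i => \sum_(c < q.-1) Rm c g i l) (fun i => b%:R * (i == l)%:R).
move=> ->; last first.
  have -> : \sum_(j < n) f (b%:R * (j == l)%:R) * kp 0 ^+ j = b%:R.
    rewrite (eq_bigr (fun j => b%:R * (f ((j == l)%:R) * kp 0 ^+ j))) => [|j _]; last by rewrite rmorphM rmorph_nat mulrA.
    by rewrite -mulr_sumr sum_delta l0 expr0 mulr1.
  have -> : \sum_(j < n) f (\sum_(c < q.-1) Rm c g j l) * kp 0 ^+ j = \sum_(c < q.-1) chc c g 0.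
    rewrite (eq_bigr (fun j => \sum_(c < q.-1) f (Rm c g j l) * kp 0 ^+ j)) => [|j _]; last by rewrite rmorph_sum mulr_suml.
    by rewrite exchange_big; apply: eq_bigr => c _ /=; rewrite -RmE l0 expr0 rmorph1 mul1r.
  rewrite -hb -sumrB; apply: (vgt_sum V) => c _; apply: chc_cong => //.
  by apply: leq_trans (ltn_ord c) _; rewrite leq_pred.
rewrite eqxx mulr1 /b rmorph_nat; case: eqP => _; last by rewrite oppr0.
have qp : (q%:R : 'F_p) = 0 by rewrite natrX (_ : p%:R = 0) ?expr0n ?gtn_eqF //; apply/eqP; rewrite -(dvdn_pcharf (pchar_Fp pP)).
by apply: (addIr 1); rewrite natr1 prednK ?expn_gt0 ?prime_gt0 // qp addNr.
Qed.
End Characters.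

End FundamentalCharacters.

(** * Block matrices and the periods of [chc c] in [A] and in [C] *)

Module Periods.
Import separable cyclic cyclotomic Valuations ClosureAndCompletion TateInvariants GhostSequences GhostToAcris CyclotomicSequences PeriodicSequences LubinTate CrystallinePeriods FundamentalCharacters.

Section Blocks.
Variables (T J X : finType).
Local Notation I := (T * (J * X))%type.

Definition blk (R : pzSemiRingType) (D : T -> J -> J -> R) (Q : X -> X -> R) (a b : I) : R :=
  (a.1 == b.1)%:R * D a.1 a.2.1 b.2.1 * Q a.2.2 b.2.2.

Lemma blk_eq (R : pzSemiRingType) D D' Q Q' : (forall c i j, D c i j = D' c i j) -> (forall x y, Q x y = Q' x y) ->
  forall a b, blk D Q a b = blk D' Q' a b :> R.
Proof. by move=> hD hQ a b; rewrite /blk hD hQ. Qed.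

Lemma blk1 (R : pzSemiRingType) a b : blk (fun _ i j => (i == j)%:R) (fun x y => (x == y)%:R) a b = (a == b)%:R :> R.
Proof.
case: a b => a1 [i x] [b1 [j y]]; rewrite /blk /= !xpair_eqE.
by rewrite -!natrM !mulnb andbA.
Qed.

Lemma map_blk (R S : pzSemiRingType) (h : {rmorphism R -> S}) D Q a b :
  h (blk D Q a b) = blk (fun c i j => h (D c i j)) (fun x y => h (Q x y)) a b.
Proof. by rewrite /blk !rmorphM rmorph_nat. Qed.

Lemma blkM (R : comPzRingType) D D' Q Q' a b : \sum_e blk D Q a e * blk D' Q' e b =
  blk (fun c i j => \sum_l D c i l * D' c l j) (fun x y => \sum_w Q x w * Q' w y) a b :> R.
Proof.
case: a b => a1 [i x] [b1 [j y]].
transitivity (\sum_e1 \sum_l \sum_w ((a1 == e1)%:R * D a1 i l * Q x w) * ((e1 == b1)%:R * D' e1 l j * Q' w y)).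
  rewrite -(pair_bigA _ (fun e1 e2 => blk D Q (a1, (i, x)) (e1, e2) * blk D' Q' (e1, e2) (b1, (j, y)))) /=.
  apply: eq_bigr => e1 _.
  by rewrite -(pair_bigA _ (fun l w => blk D Q (a1, (i, x)) (e1, (l, w)) * blk D' Q' (e1, (l, w)) (b1, (j, y)))).
rewrite (bigD1 a1) //= [X in _ + X]big1 ?addr0 => [|e1 ne]; last first.
  by rewrite big1 // => l _; rewrite big1 // => w _; rewrite eq_sym (negPf ne) !mul0r.
rewrite /blk /= eqxx -mulrA big_distrlr mulr_sumr; apply: eq_bigr => l _; rewrite mulr_sumr.
by apply: eq_bigr => w _ /=; ring.
Qed.
End Blocks.

Lemma sum_ind (R : pzSemiRingType) (Tc Tb Te : finType) (b : Tb) (e : Te) (F : (Tc * Tb) * Te -> R) :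
  \sum_a ((a.1.2 == b) && (a.2 == e))%:R * F a = \sum_c F ((c, b), e).
Proof.
rewrite (eq_bigr (fun a => ((a.1.2 == b) && (a.2 == e))%:R * F (a.1, a.2))) => [|[? ?] _] //.
rewrite -(pair_bigA _ (fun u v => ((u.2 == b) && (v == e))%:R * F (u, v))) /=.
rewrite (eq_bigr (fun u => \sum_v ((u.2 == b) && (v == e))%:R * F ((u.1, u.2), v))) => [|[? ?] _] //.
rewrite -(pair_bigA _ (fun c b' => \sum_v ((b' == b) && (v == e))%:R * F ((c, b'), v))) /=.
apply: eq_bigr => c _; rewrite (bigD1 b) //= [X in _ + X]big1 ?addr0 => [|b' /negPf ->]; last first.
  by rewrite big1 // => v _; rewrite mul0r.
rewrite (bigD1 e) //= [X in _ + X]big1 ?addr0 => [|v /negPf ->]; last by rewrite andbF mul0r.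
by rewrite !eqxx mul1r.
Qed.

Lemma prim_root_ex (L : closedFieldType) N : (0 < N)%N -> N%:R != 0 :> L -> exists w : L, N.-primitive_root w.
Proof.
move=> N0 NL; have [r hr] := closed_field_poly_normal ('X^N - 1 : {poly L}).
rewrite lead_coefXnsubC // scale1r in hr.
have ur : uniq r by rewrite -separable_prod_XsubC -hr separable_Xn_sub_1.
have ar : all N.-unity_root r by apply/allP => a ar; rewrite /root_of_unity /= hr root_prod_XsubC.
have sr : (N <= size r)%N.
  have := congr1 (fun P : {poly L} => size P) hr.
  by rewrite size_prod_XsubC size_XnsubC // => -[->].
have /hasP[w _ hw] := has_prim_root N0 ar ur sr; by exists w.
Qed.

Section Weights.
Variables (p : nat) (k : fieldType) (W : witt_vectors p k).
Hypotheses (pP : prime p) (p_odd : odd p).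
Variables (K : fieldExtType {fraction W}) (Kb : alg_closure K) (C : completion Kb) (A : Acris C).
Variable z : nat -> Kb.
Hypothesis hz : compatible_roots z.
Variables (Zp : witt_vectors p 'F_p) (f : {rmorphism Zp -> C}).
Local Notation OC := (@comp_int p k W K Kb C).
Hypothesis fO : forall x, OC (f x).
Local Notation emb := (comp_emb C).
Let V := valuedC pP C.
Local Notation E := (E p OC).
Local Notation compat := (compat p OC).
Local Notation vge := (vge p OC).
Local Notation vl := (vl p OC).
Local Notation fn := (int -> C).
Local Notation ev := (ev pP p_odd A).
Variable n : nat.
Hypothesis n1 : (1 < n)%N.
Local Notation q := (p ^ n)%N.
Local Notation xi := (xi C z).
Let n0 : (0 < n)%N := ltnW n1.
Variables (x y : fn).
Hypotheses (cx : compat x) (Ey : E y) (xy : forall m, vge 1 (y m - x m))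
  (yR : forall m, y (m - n%:Z) = xi m * y m) (x0 : forall m, x m != 0)
  (xq : forall m, vge 1 (x m ^+ q.-1 - xi m)) (xv : forall i : nat, vl (x i.+1%:Z) = ((p ^ i * q.-1)%N%:R)^-1).
Local Notation charX := (charX pP p_odd hz fO n1 cx Ey xy yR x0 xq xv).
Local Notation chc := (chc pP p_odd hz fO n1 cx Ey xy yR x0 xq xv).
Local Notation dig := (dig p).
Local Notation sft i l := ((i + l) %% n)%N.

Lemma per_shift (r : fn) m (i l : nat) : per n r -> r (m - i.+1%:Z - l%:Z) = r (m - (sft i l).+1%:Z).
Proof.
move=> pr; rewrite -(per_iter pP p_odd n0 ((i + l) %/ n)%N (m - i.+1%:Z - l%:Z) pr); congr r.
have := divn_eq (i + l)%N n; rewrite [(n * _)%N]mulnC; move: ((i + l) %/ n * n)%N ((i + l) %% n)%N => a b; lia.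
Qed.

Lemma charX_per g : per n (charX g).
Proof. by case: (charXP pP p_odd hz fO n1 cx Ey xy yR x0 xq xv g). Qed.

Lemma E_charX g : E (charX g).
Proof. by case: (charXP pP p_odd hz fO n1 cx Ey xy yR x0 xq xv g). Qed.

Lemma chc_shift c g m i : chc c g (m - i.+1%:Z) = \prod_(l < n) charX g (m - (sft i l).+1%:Z) ^+ dig c l.
Proof. by apply: eq_bigr => l _; rewrite per_shift //; exact: charX_per. Qed.

Section Crys.
Variable e : A.
Hypothesis he : teichmuller_eps z e.
Local Notation tt := (tt pP p_odd hz he n1 y).
Variable t : A.
Hypothesis ht : forall N, exists M0, forall M', (M0 <= M')%N ->
  in_pX p N (t - \sum_(1 <= i < M'.+1) (-1) ^+ i.-1 * (i.-1)`!%:R * acris_gam i (e - 1)).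

(** A period for [phi^(i+1)] of [chc c]; the indices are reduced modulo [n] by the periodicity of
    [X]. *)
Definition tauB c i : A := \prod_(l < n) tt (sft i l) ^+ dig c l.

Lemma act_tauB g c i : acris_act A g (tauB c i) = ev (sh i.+1 (chc c g)) * tauB c i.
Proof.
have [chi [hchi _]] := cyc_exists pP hz Zp g.
have [hy _ _ _] := charX_chi pP p_odd hz fO n1 cx Ey xy yR x0 xq xv hchi.
have EF l : E (fun m => sh (sft i l).+1 (charX g) m ^+ dig c l).
  by apply: (EX V p_odd); apply: E_sh; exact: E_charX.
have -> : sh i.+1 (chc c g) = fun m => \prod_(l < n) sh (sft i l).+1 (charX g) m ^+ dig c l.
  by apply/funext => m; rewrite /sh chc_shift.
rewrite (@ev_prod _ _ _ pP p_odd _ _ _ A _ _ (fun (l : 'I_n) m => sh (sft i l).+1 (charX g) m ^+ dig c l)) => [|l]; last exact: EF.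
rewrite /tauB rmorph_prod -big_split; apply: eq_bigr => l _ /=.
rewrite (evX pP p_odd A (dig c l) (E_sh _ (E_charX g))) rmorphXn.
by rewrite (act_tt pP p_odd hz fO he n1 Ey _ hchi (E_charX g) hy) exprMn.
Qed.

(** [tt i] divides the product of all of them, which by [tt_prod] is [p t] times a unit. *)
Lemma tt_unit (S : comUnitRingType) (h : {rmorphism A -> S}) i : h (p%:R * t) \is a GRing.unit -> (i < n)%N -> h (tt i) \is a GRing.unit.
Proof.
move=> ut hi; have [c [Ec c0 OcV hc]] := N_mu pP p_odd hz n1 Ey xy yR x0 xv.
have := congr1 h (tt_prod pP p_odd hz he n1 Ey ht Ec hc).
have EcV : E (fun=> c^-1) by apply: (E_inv V p_odd Ec).
have uc : h (ev (fun=> c)) \is a GRing.unit.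
  apply/unitrP; exists (h (ev (fun=> c^-1))); rewrite -!rmorphM -!(evM pP p_odd A) // mulVf // mulfV //.
  by rewrite ev1 rmorph1.
rewrite (bigD1 (Ordinal hi)) //=; move: (tt i) (\prod_(j < n | _) _) => a b e1.
have : h a * h b \is a GRing.unit by rewrite -rmorphM e1 rmorphM GRing.unitrM uc.
by rewrite GRing.unitrM => /andP[].
Qed.

Lemma tauB_unit (S : comUnitRingType) (h : {rmorphism A -> S}) c i : h (p%:R * t) \is a GRing.unit -> h (tauB c i) \is a GRing.unit.
Proof.
move=> ut; rewrite rmorph_prod; apply: rpred_prod => l _; rewrite rmorphXn.
by apply/unitrX/tt_unit; rewrite ?ltn_mod.
Qed.
End Crys.

(* The period y_(1-n) vanishes; the weights come from replacing it by the inverse of the product of the others. *)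
Definition Yo (i : nat) : C := if i == n.-1 then y 0 else y (- i.+1%:Z).
Definition Yc (i : nat) : C := if i == n.-2 then \prod_(j < n | j != n.-2 :> nat) (Yo j)^-1 else Yo i.

Lemma Yo_neq0 i : (i < n)%N -> i != n.-2 -> Yo i != 0.
Proof.
have hy m : 2 - n%:Z <= m -> y m != 0 := fun h => y_neq0 pP p_odd hz n1 xy yR x0 xv h.
move=> hi ni; rewrite /Yo; case: (i =P n.-1) => h; apply: hy; first exact: two_sub_le0.
by move: (n) n1 hi ni h; clear; move=> *; lia.
Qed.

Lemma Yc_neq0 i : (i < n)%N -> Yc i != 0.
Proof.
move=> hi; rewrite /Yc; case: (i =P n.-2) => h; last by apply: Yo_neq0 => //; apply/eqP.
by apply/prodf_neq0 => j nj; rewrite invr_eq0 Yo_neq0.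
Qed.

(** At [i = n - 1] the value [y 0] replaces [y (- n)], which equals [p y 0]; the character is the
    same by periodicity. *)
Lemma act_Yo g i : (i < n)%N -> comp_act C g (Yo i) = charX g (- i.+1%:Z) * Yo i.
Proof.
move=> hi; have [chi [hchi _]] := cyc_exists pP hz Zp g.
have [hy _ _ _] := charX_chi pP p_odd hz fO n1 cx Ey xy yR x0 xq xv hchi.
rewrite /Yo; case: eqP => h; rewrite hy (bg_le0 pP p_odd hz fO hchi n0) // mul1r //.
by rewrite h prednK // -[in LHS](charX_per g 0) sub0r.
Qed.

(** The conjugates of [X] multiply to [chi], so the inverse of the product of the others is the
    missing conjugate divided by [chi]. This twist is the source of the weights. *)
Lemma act_Yc g chi i : cyclotomic_value g chi -> (i < n)%N ->
  comp_act C g (Yc i) = charX g (- i.+1%:Z) * Yc i * (if i == n.-2 then (f chi)^-1 else 1).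
Proof.
move=> hchi hi; rewrite /Yc; case: eqP => h; last by rewrite mulr1 act_Yo.
have [_ uX PX _] := charX_chi pP p_odd hz fO n1 cx Ey xy yR x0 xq xv hchi.
rewrite rmorph_prod (eq_bigr (fun j : 'I_n => (charX g (- j.+1%:Z))^-1 * (Yo j)^-1)) => [|j nj]; last first.
  by rewrite fmorphV act_Yo // invfM.
rewrite big_split /= mulrAC; congr (_ * _).
have hn2 : (n.-2 < n)%N by case: (n) n1 => [|[|]].
have := PX (- 1); rewrite (bigD1 (Ordinal hn2)) //= => <-.
have -> : - 1 - n.-2%:Z = - i.+1%:Z by rewrite h; lia.
have [X0 _] := uX (- i.+1%:Z).
rewrite invfM mulVKf // prodfV; congr (_^-1); apply: eq_bigr => j _; congr (charX g _); lia.
Qed.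

Definition tauC c i : C := \prod_(l < n) Yc (sft i l) ^+ dig c l.

Lemma tauC_neq0 c i : tauC c i != 0.
Proof. by apply/prodf_neq0 => l _; rewrite expf_neq0 // Yc_neq0 // ltn_mod. Qed.

(** Exactly one [l] with [i + l = n - 2] modulo [n] meets the twisted period, and the weight [w] is
    the digit of [c] at this place. *)
Lemma act_tauC c i : (i < n)%N -> exists2 w : nat, (w <= p.-1)%N & forall g chi, cyclotomic_value g chi ->
  comp_act C g (tauC c i) * f chi ^+ w = chc c g (- i.+1%:Z) * tauC c i.
Proof.
move=> hi; have [l0 hl0 l0u] : exists2 l0 : 'I_n, sft i l0 = n.-2 & forall l : 'I_n, sft i l = n.-2 -> l = l0.
  have h : ((n.-2 + (n - i)) %% n < n)%N by rewrite ltn_mod.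
  have hn2 : (n.-2 < n)%N by case: (n) n1 => [|[|]].
  have e0 : ((i + (n.-2 + (n - i)) %% n) %% n = n.-2)%N.
    by rewrite modnDmr addnCA subnKC ?(ltnW hi) // modnDr modn_small.
  exists (Ordinal h) => // l hl; apply: val_inj => /=.
  have : (i + l = i + (n.-2 + (n - i)) %% n %[mod n])%N by rewrite hl e0.
  by move/eqP; rewrite eqn_modDl modn_mod modn_small // => /eqP.
exists (dig c l0).
  by have := ltn_pmod (c %/ p ^ l0) (prime_gt0 pP); rewrite /dig; move: (_ %% p)%N => a; lia.
move=> g chi hchi; have fchi0 : f chi != 0.
  have [_ uX PX _] := charX_chi pP p_odd hz fO n1 cx Ey xy yR x0 xq xv hchi.
  by rewrite -(PX 0); apply/prodf_neq0 => j _; case: (uX (0 - j%:Z)).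
rewrite -[- i.+1%:Z]sub0r chc_shift /tauC rmorph_prod.
rewrite (eq_bigr (fun l : 'I_n => charX g (0 - (sft i l).+1%:Z) ^+ dig c l * Yc (sft i l) ^+ dig c l *
   (if l == l0 then (f chi)^-1 else 1) ^+ dig c l)) => [|l _]; last first.
  rewrite rmorphXn (act_Yc hchi) ?ltn_mod // sub0r !exprMn; congr (_ * _ ^+ _).
  by case: eqP => [/l0u ->|h]; rewrite ?eqxx //; case: eqP => // e; case: h; rewrite e.
rewrite !big_split /= -!mulrA -[X in _ = _ * X]mulr1; congr (_ * (_ * _)).
rewrite (bigD1 l0) //= eqxx big1 ?mulr1 => [|l /negPf ->]; last by rewrite expr1n.
by rewrite exprVn mulVf // expf_neq0.
Qed.
End Weights.

End Periods.

(** * The representation, its weights and its crystalline periods *)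

Module Representation.
Import Valuations ClosureAndCompletion TateInvariants GhostSequences GhostToAcris CyclotomicSequences PeriodicSequences CrystallinePeriods UnramifiedSets InducedQuotients FundamentalCharacters Periods.

Section Construction.
Variables (p : nat) (k : fieldType) (W : witt_vectors p k).
Hypotheses (pP : prime p) (p_odd : odd p).
Variables (K : fieldExtType {fraction W}) (Kb : alg_closure K) (C : completion Kb) (A : Acris C).
Variable z : nat -> Kb.
Hypothesis hz : compatible_roots z.
Variables (Zp : witt_vectors p 'F_p) (B : Bcris A Zp) (f : {rmorphism Zp -> C}).
Hypothesis hf : forall a, f a = acris_theta A (bcris_Zp B a).
Local Notation OC := (@comp_int p k W K Kb C).
Hypothesis fO : forall x, OC (f x).
Local Notation emb := (comp_emb C).
Let V := valuedC pP C.
Local Notation E := (E p OC).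
Local Notation compat := (compat p OC).
Local Notation vge := (vge p OC).
Local Notation vgt := (vgt p OC).
Local Notation vl := (vl p OC).
Local Notation fn := (int -> C).
Local Notation G := (abs_galois Kb).
Local Notation ev := (ev pP p_odd A).
Variable n : nat.
Hypothesis n1 : (1 < n)%N.
Local Notation q := (p ^ n)%N.
Local Notation xi := (xi C z).
Let n0 : (0 < n)%N := ltnW n1.
Variables (x y : fn).
Hypotheses (cx : compat x) (Ey : E y) (xy : forall m, vge 1 (y m - x m))
  (yR : forall m, y (m - n%:Z) = xi m * y m) (x0 : forall m, x m != 0)
  (xq : forall m, vge 1 (x m ^+ q.-1 - xi m)) (xv : forall i : nat, vl (x i.+1%:Z) = ((p ^ i * q.-1)%N%:R)^-1).
Variable kap : Kb.
Hypothesis hkap : (q.-1).-primitive_root kap.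
Local Notation kp := (kp C n kap).
Local Notation charX := (charX pP p_odd hz fO n1 cx Ey xy yR x0 xq xv).
Local Notation chc := (chc pP p_odd hz fO n1 cx Ey xy yR x0 xq xv).
Local Notation Rm := (Rm pP p_odd hz fO n1 cx Ey xy yR x0 xq xv hkap).
Local Notation RmE := (RmE pP p_odd hz fO n1 cx Ey xy yR x0 xq xv hkap).
Variables (X : finType) (act : G -> X -> X) (Z Z' : X -> X -> fn) (xb : X).
Hypothesis hgood : good act Z Z'.
Variable nb : nat.
Local Notation I := (('I_q.-1 * 'I_nb) * ('I_n * X))%type.

Let act_id : forall u, act (gal_id Kb) u = u. Proof. by case: hgood. Qed.
Let act_comp : forall g h u, act (gal_comp g h) u = act g (act h u). Proof. by case: hgood. Qed.
Let EZ : forall u i, E (Z u i). Proof. by case: hgood => _ _ _ []. Qed.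
Let EZ' : forall u i, E (Z' u i). Proof. by case: hgood => _ _ _ []. Qed.
Let actZ : forall g u i m, comp_act C g (Z u i m) = Z (act g u) i m. Proof. by case: hgood => _ _ _ []. Qed.

Lemma good_act_inj g : injective (act g).
Proof.
have [iv [ivl _]] := @gal_inverse K Kb.
by move=> u v e; rewrite -[u]act_id -[v]act_id -(ivl g) !act_comp e.
Qed.

Lemma good_inv u v m : \sum_w Z w u m * Z' v w m = (u == v)%:R.
Proof.
have h : mxI (fun a b => Z a b m) *m mxI (fun a b => Z' a b m) = 1%:M.
  by rewrite mxIM -mxI1; apply: mxI_eq => a b; case: hgood => _ _ _ [_ _ _ ->].
have := mulmx1C h; rewrite mxIM => /matrixP/(_ (enum_rank v) (enum_rank u)).
rewrite !mxE !enum_rankK (inj_eq enum_rank_inj) eq_sym => <-.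
by apply: eq_bigr => w _; rewrite mulrC.
Qed.

(** The tensor product of [Rm c] with the permutation module of [X], summed over [c] and over [nb]
    copies; in the end there is one copy for each vector of a basis of [T]. *)
Definition Rmat (g : G) : 'M[Zp]_#|{: I}| :=
  mxI (blk (fun (c : 'I_q.-1 * 'I_nb) l j => Rm c.1 g l j) (fun u v => (u == act g v)%:R)).

Lemma Rmat_id : Rmat (gal_id Kb) = 1%:M.
Proof.
rewrite -mxI1; apply: mxI_eq => u v; rewrite -blk1; apply: blk_eq => [c i j|s w]; first exact: Rm_id.
by rewrite act_id.
Qed.

Lemma Rmat_comp g h : Rmat (gal_comp g h) = Rmat g *m Rmat h.
Proof.
rewrite mxIM; apply: mxI_eq => u v; rewrite blkM; apply: blk_eq => [c i j|s w]; first exact: Rm_comp.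
rewrite act_comp (bigD1 (act h w)) //= eqxx mulr1 big1 ?addr0 // => t /negPf ->.
by rewrite mulr0.
Qed.

Lemma mul3B (R : comPzRingType) (a b c d : R) : a * b * d - a * c * d = (b - c) * (a * d).
Proof. by ring. Qed.

Lemma Rmat_cont g0 N : exists s, forall g, gal_agree s g0 g -> forall i j, in_pX p N (Rmat g i j - Rmat g0 i j).
Proof.
have [s1 h1] := Rm_cont pP p_odd hz fO n1 cx Ey xy yR x0 xq xv hkap g0 N.
have [s2 h2] : exists s, forall g, gal_agree s g0 g -> forall u, act g u = act g0 u by case: hgood.
exists (s1 ++ s2) => g hg i j.
have hg1 : gal_agree s1 g0 g by move=> u us; apply: hg; rewrite mem_cat us.
have hg2 : gal_agree s2 g0 g by move=> u us; apply: hg; rewrite mem_cat us orbT.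
rewrite !mxE /blk h2 // mul3B; have [w ->] := h1 g hg1 (enum_val i).1.1 (enum_val i).2.1 (enum_val j).2.1.
by rewrite -mulrA; eexists.
Qed.

Section PeriodMatrix.
Variables (S : comNzRingType) (io : {rmorphism Zp -> S}).
Variables (Vv Vv' : 'I_n -> 'I_n -> S) (t t' : nat -> 'I_n -> S) (Zz Zz' : X -> X -> S).
Definition perF : I -> I -> S := blk (fun (c : 'I_q.-1 * 'I_nb) i j => Vv i j * t c.1 i) (fun u v => Zz v u).
Definition perF' : I -> I -> S := blk (fun (c : 'I_q.-1 * 'I_nb) j i => Vv' j i * t' c.1 i) (fun u v => Zz' v u).

(** Serves twice: with [s = 1] in [B] for crystallinity, and with powers of [chi] in [C] for the
    weights. *)
Lemma period_mx (sg : {rmorphism S -> S}) g (s : nat -> 'I_n -> S) :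
  (forall c i j, s c i * sg (Vv i j * t c i) = \sum_l Vv i l * t c i * io (Rm c g l j)) ->
  (forall u v, sg (Zz u v) = Zz (act g u) v) ->
  mxI perF *m map_mx io (Rmat g) = mxI (fun a b : I => s a.1.1 a.2.1 * sg (perF a b)).
Proof.
move=> h1 h2; rewrite map_mxI mxIM; apply: mxI_eq => a b.
under eq_bigr => e _ do rewrite map_blk.
rewrite blkM map_blk /blk -h1 h2 (bigD1 (act g b.2.2)) //= eqxx rmorph1 mulr1 big1 => [|w /negPf ->].
  by rewrite addr0; move: (_ == _)%:R (s _ _) (sg _) (Zz _ _) => r1 r2 r3 r4; ring.
by rewrite rmorph0 mulr0.
Qed.

Lemma period_inv : (forall i i2, \sum_j Vv i j * Vv' j i2 = (i == i2)%:R) -> (forall c i, t c i * t' c i = 1) ->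
  (forall u v, \sum_w Zz w u * Zz' v w = (u == v)%:R) -> mxI perF *m mxI perF' = 1%:M.
Proof.
move=> h1 h2 h3; rewrite mxIM -mxI1; apply: mxI_eq => a b; rewrite blkM -blk1.
apply: blk_eq => [c i j|u v]; last exact: h3.
rewrite (eq_bigr (fun l => t c.1 i * t' c.1 j * (Vv i l * Vv' l j))) => [|l _]; last by ring.
by rewrite -mulr_sumr h1; case: eqP => [->|_]; rewrite ?mulr0 // h2 mul1r.
Qed.
End PeriodMatrix.

Definition Vf (i j : 'I_n) : fn := fun m => kp (m - i.+1%:Z) ^+ j.

Lemma E_Vf i j : E (Vf i j).
Proof. exact: (E_sh i.+1 (E_kpX pP p_odd C n1 hkap j)). Qed.

Lemma Vf_inv : exists V' : 'I_n -> 'I_n -> fn, (forall i j, E (V' i j)) /\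
  forall i i2 m, \sum_j Vf i j m * V' j i2 m = (i == i2)%:R.
Proof.
pose M m := Vm C n kap (m - 1) : 'M[C]_n.
have eM m i j : M m i j = Vf i j m.
  by rewrite /M /Vm mxE /Vf; congr (kp _ ^+ _); rewrite intS; ring.
have EM i j : E (fun m => M m i j).
  have -> : (fun m => M m i j) = Vf i j by apply/funext => m; exact: eM.
  exact: E_Vf.
have [M' [h1 h2]] := E_inv_matrix pP p_odd EM (fun m => det_Vm pP p_odd C n0 hkap (m - 1)).
exists (fun i j m => M' m i j); split=> // i i2 m; have := h2 m => /matrixP/(_ i i2); rewrite !mxE => <-.
by apply: eq_bigr => j _; rewrite eM.
Qed.

Lemma chi_neq0 (g : G) (chi : Zp) : cyclotomic_value g chi -> f chi != 0.
Proof.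
move=> hchi; have [_ uX PX _] := charX_chi pP p_odd hz fO n1 cx Ey xy yR x0 xq xv hchi.
by rewrite -(PX 0); apply/prodf_neq0 => j _; case: (uX (0 - j%:Z)).
Qed.

Lemma ev_Zp a : ev (fun=> f a) = bcris_Zp B a.
Proof.
apply/eqP; rewrite -subr_eq0; apply/eqP; apply: (cA A).1 => N.
have [b [w ew]] := zp_nat_dense a N.
have h1 : in_pX p N (ev (fun=> f a) - b%:R).
  rewrite -(ev_nat pP p_odd A b) -(evB pP p_odd A (E_Zp pP p_odd fO a) (Enat V p_odd b)).
  apply: (ev_small pP p_odd A); first by apply: (EB V p_odd); [exact: E_Zp|exact: (Enat V p_odd)].
  move=> m _; rewrite -(rmorph_nat f b) -rmorphB ew rmorphM rmorphXn rmorph_nat.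
  by apply/(vge_nP V); exists (f w).
have [u hu] := h1; exists (u - bcris_Zp B w).
have -> : ev (fun=> f a) - bcris_Zp B a = (ev (fun=> f a) - b%:R) - (bcris_Zp B a - b%:R) by ring.
by rewrite hu -(rmorph_nat (bcris_Zp B) b) -rmorphB ew rmorphM rmorphXn rmorph_nat mulrBr.
Qed.

Definition rhom (g : G) := map_mx (@tofrac Zp) (Rmat g).

Lemma rhom_rep : matrix_rep rhom.
Proof. by split=> [|g h]; rewrite /rhom ?Rmat_id ?map_mx1 // Rmat_comp map_mxM. Qed.

Lemma rhom_cont : padic_continuous rhom.
Proof.
move=> g0 N; have [s hs] := Rmat_cont g0 N; exists s => g /hs h i j; have [w ew] := h i j.
by exists w; rewrite -ew rmorphB; congr (_ - _); rewrite /rhom mxE.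
Qed.

(** The period matrix over [C] turns an invariant vector into coordinates with
    [g(u s) = chi^(i - ws) (u s)]; by [tate_C] a nonzero coordinate forces [i = ws]. *)
Lemma rhom_weights i : hodge_tate_weight B rhom i -> 0 <= i <= p.-1%:Z.
Proof.
move=> [v v0 hv]; have [V' [_ hV']] := Vf_inv.
have /choice[w hw] (ci : nat * 'I_n) : exists w : nat, (w <= p.-1)%N /\ forall (g : G) (chi : Zp), cyclotomic_value g chi ->
    comp_act C g (tauC n y ci.1 ci.2) * f chi ^+ w = chc ci.1 g (- ci.2.+1%:Z) * tauC n y ci.1 ci.2.
  by have [w h1 h2] := act_tauC pP p_odd hz fO n1 cx Ey xy yR x0 xq xv ci.1 (ltn_ord ci.2); exists w.
pose Vv i j := Vf i j 0; pose tC c (i : 'I_n) := tauC n y c i.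
pose N := mxI (perF Vv tC (fun u v => Z u v 0)).
pose N' := mxI (perF' (fun i j => V' i j 0) (fun c i => (tC c i)^-1) (fun u v => Z' u v 0)).
have NN' : N *m N' = 1%:M.
  apply: period_inv => [i1 i2|c i1|u1 u2]; [exact: hV'| |exact: good_inv].
  by rewrite mulfV //; exact: (tauC_neq0 pP p_odd hz n1 xy yR x0 xv).
pose u := N *m v.
have /cV0Pn[s us] : u != 0.
  by apply: contraNneq v0 => u0; rewrite -[v]mul1mx -(mulmx1C NN') -mulmxA -/u u0 mulmx0.
pose ws := w ((enum_val s).1.1 : nat, (enum_val s).2.1).
have wle : (ws <= p.-1)%N by case: (hw ((enum_val s).1.1 : nat, (enum_val s).2.1)).
have key (g : G) (chi : Zp) : cyclotomic_value g chi -> f chi ^+ ws * comp_act C g (u s 0) = f chi ^ i * u s 0.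
  move=> hchi; have c0 := chi_neq0 hchi.
  have hN : N *m map_mx f (Rmat g) = mxI (fun a b : I => f chi ^+ w (a.1.1 : nat, a.2.1) * comp_act C g (perF Vv tC (fun u v => Z u v 0) a b)).
    apply: (period_mx (io := f) (s := fun c i => f chi ^+ w (c, i))) => [c i1 j|u1 u2]; last exact: actZ.
    have [_ hwc] := hw (c, i1).
    rewrite rmorphM mulrC -mulrA (hwc g chi hchi : comp_act C g (tC c i1) * _ = _).
    rewrite mulrA /Vv /Vf !sub0r RmE mulr_suml; apply: eq_bigr => l _.
    exact: etrans (esym (mulrA _ _ _)) (mulrC _ _).
  have eR : map_mx (comp_Qp B) (rhom g) = map_mx f (Rmat g).
    by apply/matrixP => a b; rewrite !mxE comp_QpP hf.
  have := hv g chi hchi; rewrite eR comp_QpP -hf => e1.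
  have {}e1 : map_mx f (Rmat g) *m map_mx (comp_act C g) v = f chi ^ i *: v.
    by rewrite -[in RHS]e1 scalerA -expfzDr // subrr expr0z scale1r.
  have := congr1 (mulmx N) e1; rewrite mulmxA hN -scalemxAr -/u => /matrixP/(_ s 0).
  move=> e2; have e3 : (f chi ^ i *: u) s 0 = f chi ^ i * u s 0 by rewrite mxE.
  have eu : u s 0 = \sum_b N s b * v b 0 by rewrite /u mxE.
  rewrite -e3 -e2 eu rmorph_sum mulr_sumr [RHS]mxE.
  by apply: eq_bigr => b _; rewrite !mxE rmorphM mulrA.
case: (eqVneq i ws%:Z) => [->|ne]; first by rewrite lez_nat wle.
have ne' : i - ws%:Z != 0 by rewrite subr_eq0.
case: (tate_C pP p_odd hz fO ne' us) => g chi hchi.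
have c0 := chi_neq0 hchi; apply: (mulfI (expf_neq0 ws c0)); rewrite key // mulrA; congr (_ * _).
by rewrite -[f chi ^+ ws]/(f chi ^ ws%:Z) -expfzDr // subrKC.
Qed.

Section Crystalline.
Variable e : A.
Hypothesis he : teichmuller_eps z e.
Hypothesis ht : forall N, exists M0, forall M', (M0 <= M')%N ->
  in_pX p N (bcris_t B - \sum_(1 <= i < M'.+1) (-1) ^+ i.-1 * (i.-1)`!%:R * acris_gam i (e - 1)).
Local Notation loc := (bcris_loc B).

(** [N] is invertible with [N rho(g) = g(N)]. Hence the columns of its inverse are invariant, and
    [N v] has invariant entries for every invariant [v]. *)
Lemma rhom_crystalline : crystalline B rhom.
Proof.
have [V' [EV' hV']] := Vf_inv.
pose Vv i j := loc (ev (Vf i j)); pose tB c (i : 'I_n) := loc (tauB pP p_odd hz n1 y he c i).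
pose Zz u v := loc (ev (Z u v)).
pose N := mxI (perF Vv tB Zz).
pose N' := mxI (perF' (fun i j => loc (ev (V' i j))) (fun c i => (tB c i)^-1) (fun u v => loc (ev (Z' u v)))).
have sumev (T : finType) (F1 F2 : T -> fn) (d : bool) : (forall i, E (F1 i)) -> (forall i, E (F2 i)) ->
    (forall m, \sum_i F1 i m * F2 i m = d%:R) -> \sum_i loc (ev (F1 i)) * loc (ev (F2 i)) = d%:R.
  move=> EF1 EF2 h; transitivity (loc (\sum_i ev (fun m => F1 i m * F2 i m))).
    by rewrite rmorph_sum; apply: eq_bigr => i _; rewrite (evM pP p_odd A) // rmorphM.
  rewrite -(ev_sum pP p_odd A) => [|i]; last exact: (E_M V p_odd).
  have -> : (fun m => \sum_i F1 i m * F2 i m) = fun=> d%:R by apply/funext => m; exact: h.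
  by rewrite ev_nat rmorph_nat.
have NN' : N *m N' = 1%:M.
  apply: period_inv => [i1 i2|c i1|u1 u2].
  - by apply: (sumev _ (fun j => Vf i1 j) (fun j => V' j i2)) => // j; exact: E_Vf.
  - by rewrite mulrV //; exact: (tauB_unit pP p_odd hz n1 Ey xy yR x0 xv he ht _ _ (bcris_unit B)).
  - by apply: (sumev _ (fun w => Z w u1) (fun w => Z' u2 w)) => // m; exact: good_inv.
have N'N := mulmx1C NN'.
pose io : {rmorphism Zp -> B} := bcris_loc B \o bcris_Zp B.
have hN g : N *m map_mx io (Rmat g) = map_mx (bcris_act B g) N.
  transitivity (mxI (fun a b : I => 1 * bcris_act B g (perF Vv tB Zz a b))); last first.
    by rewrite map_mxI; apply: mxI_eq => a b; rewrite mul1r.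
  apply: (period_mx (io := io) (sg := bcris_act B g) (s := fun _ _ => 1)) => [c i1 j|u1 u2].
  - rewrite mul1r -rmorphM bcris_act_loc rmorphM (act_tauB pP p_odd hz fO n1 cx Ey xy yR x0 xq xv) (ev_act pP p_odd A g (E_Vf i1 j)).
    have EaV : E (fun m => comp_act C g (Vf i1 j m)) by apply: E_morph (E_Vf i1 j) => u; exact: comp_act_int.
    have Esc : E (sh i1.+1 (chc c g)) by apply: E_sh; exact: E_chc.
    rewrite mulrA -(evM pP p_odd A EaV Esc).
    have -> : (fun m => comp_act C g (Vf i1 j m) * sh i1.+1 (chc c g) m) = fun m => \sum_l f (Rm c g l j) * Vf i1 l m.
      by apply/funext => m; rewrite /Vf /sh RmE.
    rewrite (@ev_sum _ _ _ pP p_odd _ _ _ A _ _ (fun l m => f (Rm c g l j) * Vf i1 l m)) => [|l]; last first.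
      by apply: (E_M V p_odd); [exact: (E_Zp pP p_odd fO)|exact: E_Vf].
    rewrite mulr_suml rmorph_sum; apply: eq_bigr => l _.
    rewrite (evM pP p_odd A (E_Zp pP p_odd fO _) (E_Vf i1 l)) ev_Zp !rmorphM /Vv /tB /=.
    by rewrite -mulrA mulrC.
  - rewrite bcris_act_loc (ev_act pP p_odd A g (EZ u1 u2)); congr (loc (ev _)).
    by apply/funext => m; exact: actZ.
have eR g : map_mx (bcris_Qp B) (rhom g) = map_mx io (Rmat g).
  by apply/matrixP => a b; rewrite !mxE bcris_QpP.
have hN' g : map_mx io (Rmat g) *m map_mx (bcris_act B g) N' = N'.
  rewrite -[LHS]mul1mx -N'N -mulmxA [N *m _]mulmxA hN -map_mxM NN' map_mx1 mulmx1 //.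
exists N'; split=> [j g|v hv]; first by rewrite eR map_col !colE mulmxA hN'.
exists (N *m v); split; last by move=> c [_ ->]; rewrite mulmxA NN' mul1mx.
split; last by rewrite mulmxA N'N mul1mx.
move=> i g; have := hv g; rewrite eR => e1.
have : map_mx (bcris_act B g) (N *m v) = N *m v by rewrite map_mxM -hN -mulmxA e1.
by move/matrixP/(_ i 0); rewrite mxE.
Qed.
End Crystalline.
End Construction.

End Representation.

(** * The equivariant surjection of the reduction onto [T] *)

Module Quotient.
Import cyclic Valuations ClosureAndCompletion GhostSequences CyclotomicSequences CrystallinePeriods UnramifiedSets InducedQuotients FundamentalCharacters Periods Representation.

Section Quotient.
Variables (p : nat) (k : fieldType) (W : witt_vectors p k).
Hypotheses (pP : prime p) (p_odd : odd p).
Variables (K : fieldExtType {fraction W}) (Kb : alg_closure K) (C : completion Kb).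
Variable z : nat -> Kb.
Hypothesis hz : compatible_roots z.
Variables (Zp : witt_vectors p 'F_p) (f : {rmorphism Zp -> C}).
Local Notation OC := (@comp_int p k W K Kb C).
Hypothesis fO : forall x, OC (f x).
Local Notation emb := (comp_emb C).
Let V := valuedC pP C.
Local Notation E := (E p OC).
Local Notation compat := (compat p OC).
Local Notation vge := (vge p OC).
Local Notation vgt := (vgt p OC).
Local Notation vl := (vl p OC).
Local Notation fn := (int -> C).
Local Notation G := (abs_galois Kb).
Variable n : nat.
Hypothesis n1 : (1 < n)%N.
Local Notation q := (p ^ n)%N.
Local Notation xi := (xi C z).
Let n0 : (0 < n)%N := ltnW n1.
Variables (x y : fn).
Hypotheses (cx : compat x) (Ey : E y) (xy : forall m, vge 1 (y m - x m))
  (yR : forall m, y (m - n%:Z) = xi m * y m) (x0 : forall m, x m != 0)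
  (xq : forall m, vge 1 (x m ^+ q.-1 - xi m)) (xv : forall i : nat, vl (x i.+1%:Z) = ((p ^ i * q.-1)%N%:R)^-1).
Variable kap : Kb.
Hypothesis hkap : (q.-1).-primitive_root kap.
Local Notation charX := (charX pP p_odd hz fO n1 cx Ey xy yR x0 xq xv).
Local Notation Rm := (Rm pP p_odd hz fO n1 cx Ey xy yR x0 xq xv hkap).
Variables (X : finType) (act : G -> X -> X) (Z Z' : X -> X -> fn) (xb : X).
Hypothesis hgood : good act Z Z'.
Variables (T : vectType 'F_p) (tau : G -> 'End(T)).
Hypothesis tau_rep : linear_rep tau.
Hypothesis kapH : forall h, act h xb = xb -> h kap = kap.
Hypothesis tauH : forall h, act h xb = xb -> vgt 0 (charX h 0 - 1) -> tau h = \1%VF.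
Local Notation nb := (\dim {:T}).
Local Notation I := (('I_q.-1 * 'I_nb) * ('I_n * X))%type.
Local Notation Rmat := (Rmat pP p_odd hz fO n1 cx Ey xy yR x0 xq xv hkap act nb).
Local Notation res := (witt_residue Zp).

Let q1 : (0 < q.-1)%N.
Proof. exact: prim_order_gt0 hkap. Qed.

Let bl h : I -> I -> Zp := blk (fun (c : 'I_q.-1 * 'I_nb) l j => Rm c.1 h l j) (fun u v => (u == act h v)%:R).

Lemma residual_quotient : exists L L' : 'cV[{fraction Zp}]_#|{: I}| -> Prop,
  [/\ lattice L /\ lattice L',
    gal_stable (fun g => map_mx (@tofrac Zp) (Rmat g)) L /\ gal_stable (fun g => map_mx (@tofrac Zp) (Rmat g)) L',
    forall v, L' v -> L v & quotient_iso (fun g => map_mx (@tofrac Zp) (Rmat g)) tau L L'].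
Proof.
have act_comp g h u : act (gal_comp g h) u = act g (act h u) by case: hgood.
have ainj g : injective (act g) := @good_act_inj _ _ _ _ _ _ _ _ _ _ hgood g.
have /choice[e he] (g : G) : exists e : 'I_q.-1, vgt 0 (charX g 0 - emb kap ^+ e).
  exact: (char_res pP p_odd hz fO n1 cx Ey xy yR x0 xq xv hkap g).
pose N0 h := act h xb = xb /\ vgt 0 (charX h 0 - 1).
(* [Phi g] records the class of [g] modulo [N0]: the point [g xb] and the exponent of the residue of
   [X], both in finite sets. *)
pose Phi g := (act g xb, e g).
have Xdiff g h : charX (gal_comp g h) 0 - charX g 0 = charX g 0 * comp_act C g (charX h 0 - 1).
  by rewrite (charX_comp pP p_odd hz fO n1 cx Ey xy yR x0 xq xv) rmorphB rmorph1 mulrBr mulr1.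
have dN g h : vgt 0 (charX (gal_comp g h) 0 - charX g 0) <-> vgt 0 (charX h 0 - 1).
  rewrite Xdiff; have [X0 OX OXV] := charX_unit pP p_odd hz fO n1 cx Ey xy yR x0 xq xv g 0.
  split=> hh; last by apply: (vgt_mull V) => //; rewrite (vgt_act pP).
  by rewrite -(vgt_act pP g) -[comp_act C g _](mulKf X0); exact: (vgt_mull V).
have PhiP g h : Phi (gal_comp g h) = Phi g <-> N0 h.
  split=> [[e1 e2]|[e1 e2]].
    split; first by apply: (ainj g); rewrite -act_comp.
    apply/(dN g); apply: (vgt_trans0 V (y := emb kap ^+ e g)); first by rewrite -e2; exact: he.
    by rewrite (vgt_subC V); exact: he.
  rewrite /Phi act_comp e1; congr (_, _); apply: val_inj; apply: (@kap_dist _ _ _ pP p_odd _ _ C _ n1 _ hkap); [exact: ltn_ord|exact: ltn_ord|].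
  apply: (vgt_trans0 V (y := charX (gal_comp g h) 0)); first by rewrite (vgt_subC V); exact: he.
  apply: (vgt_trans0 V (y := charX g 0)); last exact: he.
  exact/dN.
pose j0 := Ordinal n0.
pose ind (b : 'I_nb) (a : I) := (a.1.2 == b) && (a.2 == (j0, xb)).
(* [Lam b] adds over all [c] the coordinates at [j0] and [xb] in the [b]-th copy. The sign in [vv]
   compensates the [-1] of [sum_Rm_res]. *)
pose Lam b : 'rV['F_p]_#|{: I}| := \row_i (ind b (enum_val i))%:R.
pose vv b : 'cV['F_p]_#|{: I}| := \col_i - (ind b (enum_val i))%:R.
pose r g := map_mx res (Rmat g).
have r_rep : matrix_rep r.
  split=> [|g h]; rewrite /r.
    by rewrite (Rmat_id pP p_odd hz fO n1 cx Ey xy yR x0 xq xv hkap hgood nb) map_mx1.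
  by rewrite (Rmat_comp pP p_odd hz fO n1 cx Ey xy yR x0 xq xv hkap hgood nb) map_mxM.
have LamE b h t : (Lam b *m r h) 0 t = \sum_c res (bl h ((c, b), (j0, xb)) (enum_val t)).
  rewrite mxE -(sum_ind b (j0, xb) (fun a => res (bl h a (enum_val t)))).
  rewrite -(sum_enum_val (fun a => ((a.1.2 == b) && (a.2 == (j0, xb)))%:R * res (bl h a (enum_val t)))).
  by apply: eq_bigr => i _; rewrite !mxE.
have cq (c : 'I_q.-1) : (c < q)%N by apply: leq_trans (ltn_ord c) _; rewrite leq_pred.
have Lam_N0 b h : N0 h -> Lam b *m r h = Lam b.
  move=> [h1 h2]; apply/rowP => t; rewrite LamE mxE; case: (enum_val t) => [[c' b'] [j u]]; rewrite /ind /=.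
  have rr c : res (bl h ((c, b), (j0, xb)) ((c', b'), (j, u))) = ((c == c') && ((b == b') && ((j0 == j) && (xb == u))))%:R.
    have ea : (xb == act h u) = (xb == u) by rewrite -{1}h1 (inj_eq (ainj h)).
    have h2' : vgt 0 (charX h 0 - emb kap ^+ 0) by rewrite expr0.
    have ce : (c * 0 = 0 %[mod q.-1])%N by rewrite muln0.
    rewrite /bl /blk /= !rmorphM !rmorph_nat ea (Rm_res hkap j0 j (cq c) h2' (kapH h1) ce).
    by rewrite xpair_eqE -!natrM !mulnb !andbA.
  rewrite (eq_bigr _ (fun c _ => rr c)) (bigD1 c') //= eqxx big1 ?addr0 => [|c /negPf -> //].
  by rewrite xpair_eqE eq_sym [j == _]eq_sym [u == _]eq_sym.
have Lam_v b b' h : (Lam b' *m r h *m vv b) 0 0 = ((b' == b) && `[< N0 h >])%:R.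
  rewrite mxE (eq_bigr (fun t => - ((ind b (enum_val t))%:R * \sum_c res (bl h ((c, b'), (j0, xb)) (enum_val t))))) => [|t _]; last first.
    by rewrite LamE mxE mulrN mulrC.
  rewrite sumrN (sum_enum_val (fun a => (ind b a)%:R * \sum_c res (bl h ((c, b'), (j0, xb)) a))) sum_ind.
  have -> : \sum_c \sum_c0 res (bl h ((c0, b'), (j0, xb)) ((c, b), (j0, xb))) =
     (b' == b)%:R * ((xb == act h xb)%:R * \sum_(c < q.-1) res (Rm c h j0 j0)).
    rewrite !mulr_sumr; apply: eq_bigr => c _; rewrite (bigD1 c) //= big1 ?addr0 => [|c0 nc].
      by rewrite /bl /blk /= !rmorphM !rmorph_nat xpair_eqE eqxx /= -mulrA [res _ * _]mulrC.
    by rewrite /bl /blk /= xpair_eqE (negPf nc) /= !mul0r rmorph0.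
  have [hx|nx] := eqVneq (act h xb) xb; last first.
    rewrite mul0r mulr0 oppr0 (asboolF _) ?andbF //.
    by case=> h1; rewrite h1 eqxx in nx.
  rewrite mul1r (sum_Rm_res hkap (he h) (kapH hx) (erefl : j0 = 0%N :> nat)) mulrN opprK -natrM mulnb.
  congr (_ && _)%:R; apply/eqP/asboolP => [e0|[_ h2]].
    by split=> //; have := he h; rewrite e0 expr0.
  apply: (@kap_dist _ _ _ pP p_odd _ _ C _ n1 _ hkap); [exact: ltn_ord|exact: q1|rewrite expr0].
  by apply: (vgt_trans0 V (y := charX h 0)) => //; rewrite (vgt_subC V); exact: he.
have tau_N0 h : N0 h -> tau h = \1%VF by case; exact: tauH.
have [F [F1 F2 F3 F4]] := induced_quotient tau_rep r_rep PhiP Lam_N0 tau_N0 Lam_v.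
exact: (quotient_lattices F1 F2 F3 F4).
Qed.
End Quotient.

(** Euler's theorem; the factor 2 in front of the totient ensures [n > 1]. *)
Lemma tame_exponent p M : prime p -> coprime p M -> exists2 n, (1 < n)%N & (M %| (p ^ n).-1)%N.
Proof.
move=> pP cM; have M0 : (0 < M)%N.
  by case: M cM => //; rewrite /coprime gcdn0 => /eqP p1; rewrite p1 in pP.
have t0 : (0 < totient M)%N by rewrite totient_gt0.
exists (2 * totient M)%N; first by move: t0; case: (totient M) => // t _; rewrite mulnS.
rewrite -subn1 -eqn_mod_dvd ?expn_gt0 ?prime_gt0 // mulnC expnM -modnXm (Euler_exp_totient cM) modnXm exp1n.
by [].
Qed.

End Quotient.

(** * Choice of [n], [kap] and the unramified set for the given [T] *)

Import cyclic Valuations ClosureAndCompletion GhostSequences TameAction GhostToAcris PeriodicSequences LubinTate CrystallinePeriods UnramifiedSets FundamentalCharacters Periods Representation Quotient.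

Theorem theorem5p7
    (p : nat) (p_prime : prime p) (p_odd : odd p)
    (k : fieldType) (k_char : p \in [pchar k])
    (k_perfect : forall x : k, exists y : k, y ^+ p = x)
    (W : witt_vectors p k)
    (K : fieldExtType {fraction W}) (K_ram : totally_ramified K)
    (Kb : alg_closure K) (C : completion Kb) (A : Acris C)
    (Zp : witt_vectors p 'F_p) (B : Bcris A Zp)
    (T : vectType 'F_p) (tau : abs_galois Kb -> 'End(T))
    (tau_rep : linear_rep tau) (tau_cont : discrete_continuous tau)
    (tau_tame : tamely_ramified tau) :
  exists (d : nat) (rho : abs_galois Kb -> 'M[{fraction Zp}]_d),
    [/\ matrix_rep rho, padic_continuous rho, crystalline B rho,
        forall i : int, hodge_tate_weight B rho i ->
          (0 <= i <= p.-1%:Z)%R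
      & exists L L' : 'cV[{fraction Zp}]_d -> Prop,
          [/\ lattice L /\ lattice L',
              gal_stable rho L /\ gal_stable rho L',
              forall v, L' v -> L v
            & quotient_iso rho tau L L']].
Proof.
have pP := p_prime; pose V := valuedC pP C; pose VK := valuedK pP Kb.
have [z [e [hz he ht]]] := bcris_tP B.
pose f : {rmorphism Zp -> C} := acris_theta A \o bcris_Zp B.
have fO a : @comp_int p k W K Kb C (f a) by exact: theta_O.
have [M [cM hM]] := tame_coprime pP tau_cont tau_tame.
(* As [M] divides [q - 1], elements of valuation [1/(q-1)], like [x 1], can play the role of [w] in
   [tame_coprime]. *)
have [n n1 Mq] := tame_exponent pP cM; have n0 := ltnW n1.
have q0 : (0 < p ^ n)%N by rewrite expn_gt0 prime_gt0.
have q2 : (1 < (p ^ n).-1)%N.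
  have h3 : (3 <= p)%N by have := prime_gt1 pP; move: p_odd; case: (p) => [|[|[|]]].
  have h9 : (p ^ 1 <= p ^ n)%N by rewrite leq_exp2l // prime_gt1.
  by rewrite expn1 in h9; move: (leq_trans h3 h9); case: (p ^ n)%N => [|[|[|]]].
have q1 := ltnW q2.
have [x [y [cx Ey xy [yR x0 xq xv]]]] := y_ex pP p_odd C hz n1.
have [kap hkap] := prim_root_ex q1 (valued_nat0 VK q1).
have [Okap kap0 _] := kap_unit pP n0 hkap.
have v1 : vl p (@comp_int p k W K Kb C) (x 1) = ((p ^ n).-1%:R)^-1 by rewrite (xv 0%N) expn0 mul1n.
have v1le : vl p (@comp_int p k W K Kb C) (x 1) <= 1 by rewrite v1 invf_le1 ?ltr0n // ler1n.
(* [tame_coprime] asks for an element of [Kb]. The precision [p^2] is enough because [x 1] has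
   valuation at most 1, so [w / x 1] is a one-unit. *)
have [w hw] := comp_dense (x 1) 2.
have {}hw : vge p (@comp_int p k W K Kb C) 2%:R (x 1 - comp_emb C w) by apply/(vge_nP V).
have hw' : vge p (@comp_int p k W K Kb C) 2%:R (comp_emb C w - x 1) by rewrite (vge_subC V).
have [vw w0] : vl p (@comp_int p k W K Kb C) (comp_emb C w) = vl p (@comp_int p k W K Kb C) (x 1) /\ comp_emb C w != 0.
  by apply: (vl_sub_lt V (x0 1)); apply: vge_vgt hw'; apply: le_lt_trans v1le _; rewrite ltr1n.
have ow : one_unit p (@comp_int p k W K Kb C) (comp_emb C w / x 1).
  have x1V : vge p (@comp_int p k W K Kb C) (-1) (x 1)^-1 by rewrite /Valuations.vge (vlV V) // lerN2 v1le orbT.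
  have h1 := vgeM V hw' x1V; rewrite mulrBl divff // in h1.
  by apply: vge_vgt h1; rewrite -[2%:R]natr1 addrK.
rewrite fmorph_eq0 in w0; rewrite (vl_emb pP) v1 in vw.
have [zs [Ozs hzs]] := hM _ w q1 Mq w0 vw.
(* Adding [kap] to the list makes the stabiliser of [xb] fix [kap], hence act trivially on Z_q, so
   that [X] is a genuine character there. *)
have [|X [act [Z [Z' [xb [hgood hx]]]]]] := unram_list pP p_odd k_char k_perfect K_ram C (zs := kap :: zs).
  by move=> u; rewrite in_cons => /predU1P[-> //|]; exact: Ozs.
have kapH h : act h xb = xb -> h kap = kap.
  move=> /hx/(_ kap (mem_head _ _)).
  have /(prim_rootP hkap)[i ei] : h kap ^+ (p ^ n).-1 = 1 by rewrite -rmorphXn prim_expr_order // rmorph1.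
  rewrite ei -(vgt_emb pP C) rmorphB rmorphXn -[X in _ - X]expr1 => hi.
  by rewrite (@kap_dist _ _ _ pP p_odd _ _ C _ n1 _ hkap _ _ (ltn_ord i) q2 hi) expr1.
pose chX := charX pP p_odd hz fO n1 cx Ey xy yR x0 xq xv.
(* The congruence at index 0 holds at index 1 by periodicity; by [charX_tame], [h] then fixes [x 1],
   and with it [w], up to one-units. *)
have tauH h : act h xb = xb -> vgt p (@comp_int p k W K Kb C) 0 (chX h 0 - 1) -> tau h = \1%VF.
  move=> hxb h0; apply: hzs => [u us|].
    by apply: (hx _ hxb); rewrite in_cons us orbT.
  have [EX pX _] := charXP pP p_odd hz fO n1 cx Ey xy yR x0 xq xv h.
  have X1 : one_unit p (@comp_int p k W K Kb C) (chX h 1).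
    apply: (vge_vgt ltr01).
    exact: (@E_per_cong _ _ _ pP p_odd _ _ C n n1 _ (fun=> 1) EX pX (E1 V) (fun=> erefl) h0 1).
  have a0 : comp_act C h (x 1) / x 1 != 0 by rewrite mulf_neq0 ?invr_eq0 // fmorph_eq0.
  have X2 : one_unit p (@comp_int p k W K Kb C) (comp_act C h (x 1) / x 1).
    have h1 := charX_tame pP p_odd hz fO n1 cx Ey xy yR x0 xq xv h.
    have [_ _ c0] := one_unit_O V X1.
    have := one_unitM V X1 (one_unitV V h1); rewrite invf_div mulrCA -/chX mulfV // mulr1 //.
  have X3 : one_unit p (@comp_int p k W K Kb C) (comp_act C h (comp_emb C w / x 1)).
    by rewrite /one_unit -(rmorph1 (comp_act C h)) -rmorphB (vgt_act pP).
  have X4 := one_unitM V (one_unitM V X3 X2) (one_unitV V ow).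
  have e4 : comp_act C h (comp_emb C w / x 1) * (comp_act C h (x 1) / x 1) / (comp_emb C w / x 1) = comp_emb C (h w / w).
    have hx0 : comp_act C h (x 1) != 0 by rewrite fmorph_eq0.
    have ew0 : comp_emb C w != 0 by rewrite fmorph_eq0.
    have x10 := x0 1; rewrite !rmorphM !fmorphV comp_act_emb.
    move: (comp_emb C (h w)) (comp_act C h (x 1)) (comp_emb C w) (x 1) hx0 ew0 x10 => a b c d b0 c0 d0.
    by field; rewrite b0 c0 d0.
  by move: X4; rewrite e4 /one_unit -(rmorph1 (comp_emb C)) -rmorphB (vgt_emb pP).
eexists; exists (rhom pP p_odd hz fO n1 cx Ey xy yR x0 xq xv hkap act (\dim {:T})); split.
- exact: (rhom_rep pP p_odd hz fO n1 cx Ey xy yR x0 xq xv hkap hgood).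
- exact: (rhom_cont pP p_odd hz fO n1 cx Ey xy yR x0 xq xv hkap hgood).
- exact: (rhom_crystalline pP p_odd hz fO n1 cx Ey xy yR x0 xq xv hkap hgood _ he ht).
- have hf a : f a = acris_theta A (bcris_Zp B a) by [].
  exact: (fun i hi => rhom_weights hf hgood hi).
- exact: (residual_quotient hkap hgood tau_rep kapH tauH).
Qed.
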